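(* Fix $\tau>0$. Let $\mathbf S\subset\mathbf D$ be a spectral domain. Suppose that $\Sigma$ is diagonal, that $\widehat M=M$ and $T=T^*=\Sigma^{1/2}>0$, that the Basic Assumption (defined in the context) holds, and that $$|1+m(z)\sigma_i|\ge\tau\qquad\text{for all }z\in\mathbf S\text{ and }i\in\{1,\dots,M\}.$$ Moreover, suppose that the equation $z=f(m)$, $\operatorname{Im}m>0$, is stable on $\mathbf S$ in the sense defined in the context. Then the entrywise local law holds with parameters $(X,\Sigma,\mathbf S)$, and the averaged local law holds with parameters $(X,\Sigma,\mathbf S)$.
   Context: Conventions: $N$ is the large parameter; all quantities not called constant may depend on $N$; constants may depend on fixed parameters such as $\tau$ and the $C_p$ below. $A\asymp B$ means $C^{-1}A\le B\le CA$ for some constant $C>0$. $z=E+\mathrm i\eta$ denotes the real and imaginary parts of $z$; $\mathbb C_+$ is the open upper half-plane. Model: $M=M_N$ and $\widehat M=\widehat M_N$ are positive integers, $T$ is a deterministic real $M\times\widehat M$ matrix, $X$ is a random real $\widehat M\times N$ matrix, $\Sigma=TT^*$ has eigenvalues $\sigma_1\ge\dots\ge\sigma_M$, $\phi=M/N$, $\pi=\frac1M\sum_{i=1}^M\delta_{\sigma_i}$. Basic Assumption: $M\asymp\widehat M\asymp N$ (with $\tau\le\phi\le\tau^{-1}$); the entries $X_{i\mu}$ are independent (not necessarily identically distributed) with $\mathbb E X_{i\mu}=0$ and $\mathbb E|X_{i\mu}|^2=1/N$; for every $p\in\mathbb N$ there is a constant $C_p$ with $\mathbb E|\sqrt N X_{i\mu}|^p\le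 C_p$ for all $i,\mu$; $\sigma_1\le\tau^{-1}$; and $\pi([0,\tau])\le1-\tau$. $m$ and $f$: let $s_1>\dots>s_n$ be the distinct nonzero eigenvalues of $\Sigma$ and $f(x)=-\frac1x+\phi\sum_{i=1}^n\frac{\pi(\{s_i\})}{x+s_i^{-1}}$. For $z\in\mathbb C_+$, $m=m(z)$ is the unique solution in $\mathbb C_+$ of $z=f(m)$. Matrices: rows/columns are indexed by $\mathcal I=\{1,\dots,M\}\cup\{M+1,\dots,M+N\}$, and $$G(z)=\begin{pmatrix}-\Sigma^{-1}&X\\ X^*&-z\end{pmatrix}^{-1},\quad \Pi(z)=\begin{pmatrix}-\Sigma(1+m(z)\Sigma)^{-1}&0\\0&m(z)\end{pmatrix},\quad \underline\Sigma=\begin{pmatrix}\Sigma&0\\0&1\end{pmatrix}.$$ $m_N(z)=\frac1N\operatorname{Tr}(X^*\Sigma X-z)^{-1}$, $\Psi(z)=\sqrt{\frac{\operatorname{Im}m(z)}{N\eta}}+\frac1{N\eta}$, $\mathbf D=\{z\in\mathbb C_+:|z|\ge\tau,\ |E|\le\tau^{-1},\ N^{-1+\tau}\le\eta\le\tau^{-1}\}$. A subset $\mathbf S=\mathbf S(N)\subset\mathbf D$ is a spectral domain if for each $z\in\mathbf S$ we have $\{w\in\mathbf D:\operatorname{Re}w=\operatorname{Re}z,\ \operatorname{Im}w\ge\operatorname{Im}z\}\subset\mathbf S$. Stability: the equation $z=f(m)$ is stable on $\mathbf S$ if the following holds for some large enough constant $C>0$. Suppose that $\delta:\mathbf S\to(0,\infty)$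 satisfies $N^{-2}\le\delta(z)\le(\log N)^{-1}$ for $z\in\mathbf S$ and that $\delta$ is Lipschitz continuous with Lipschitz constant $N^2$. Suppose moreover that for each fixed $E$ the function $\eta\mapsto\delta(E+\mathrm i\eta)$ is nonincreasing for $\eta>0$. Suppose that $u:\mathbf S\to\mathbb C$ is the Stieltjes transform of a probability measure supported in $[0,C]$. Let $z\in\mathbf S$ and suppose that $|f(u(z))-z|\le\delta(z)$. If $\operatorname{Im}z<1$ suppose also that $$|u-m|\le\frac{C\delta}{\operatorname{Im}m+\sqrt\delta}\qquad( * )$$ holds at $z+\mathrm iN^{-5}$. Then $( * )$ holds at $z$. Local laws with parameters $(X,\Sigma,\mathbf S)$: the entrywise local law holds if $\bigl(\underline\Sigma^{-1}(G(z)-\Pi(z))\underline\Sigma^{-1}\bigr)_{st}=O_\prec(\Psi(z))$ uniformly in $z\in\mathbf S$ and $s,t\in\mathcal I$; the averaged local law holds if $m_N(z)-m(z)=O_\prec(\frac1{N\eta})$ uniformly in $z\in\mathbf S$. Stochastic domination: for families of nonnegative random variables $\xi^{(N)}(u),\zeta^{(N)}(u)$, $u\in U^{(N)}$, $\xi\prec\zeta$ uniformly in $u$ means: for all $\epsilon,D>0$, $\sup_u\mathbb P[\xi^{(N)}(u)>N^\epsilon\zeta^{(N)}(u)]\le N^{-D}$ for all $N\ge N_0(\epsilon,D)$. $\xi=O_\prec(\zeta)$ means $|\xi|\prec\zeta$. *)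

(* Defs.v *)
From HB Require Import structures.
From mathcomp Require Import all_boot all_order all_algebra.
From mathcomp Require Import complex.
From mathcomp Require Import all_classical all_reals all_analysis.

Set Implicit Arguments.
Unset Strict Implicit.
Unset Printing Implicit Defensive.

Import Order.TTheory GRing.Theory Num.Theory.
Import numFieldNormedType.Exports.

Local Open Scope classical_set_scope.
Local Open Scope complex_scope.
Local Open Scope ring_scope.

Section ComplexMatrices.
Variable R : realType.

(* The norm of [R[i]] takes its values in [R[i]]; this is the same modulus,
   as an element of [R]. *)
Definition cabs (z : R[i]) : R := complex.Re `|z|.

Definition to_mxC m n (A : 'M[R]_(m, n)) : 'M[R[i]]_(m, n) :=
  map_mx (fun x : R => x%:C) A.

End ComplexMatrices.

Section Probability.
Variable R : realType.

Definition mutually_independent d (Omega : measurableType d)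
    (P : probability Omega R) (I : finType) (Y : I -> {RV P >-> R}) : Prop :=
  forall (J : {set I}) (B : I -> set R), (forall i, measurable (B i)) ->
    P (\bigcap_(i in [set` J]) (Y i @^-1` B i))
    = (\prod_(i in J) P (Y i @^-1` B i))%E.

(* [xi] is stochastically dominated by [zeta], uniformly in [u \in A N]. *)
Definition stoch_dom (d : nat -> measure_display)
    (Omega : forall N, measurableType (d N))
    (P : forall N, probability (Omega N) R)
    (U : nat -> Type) (A : forall N, set (U N))
    (xi zeta : forall N, U N -> Omega N -> R) : Prop :=
  forall eps D : R, 0 < eps -> 0 < D ->
    exists N0 : nat, forall N, (N0 <= N)%N ->
      (ereal_sup [set P N [set w | (N%:R `^ eps * zeta N u w < xi N u w)%R]
                 | u in A N]
       <= (N%:R `^ (- D))%:E)%E.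

(* The integrand is bounded as soon as [0 < Im z]. *)
Definition stieltjes_transform (nu : probability (measurableTypeR R) R)
    (z : R[i]) : R[i] :=
  Rintegral nu setT (fun x : R => complex.Re (x%:C - z)^-1)
  +i* Rintegral nu setT (fun x : R => complex.Im (x%:C - z)^-1).

End Probability.

Section Model.
Variables (R : realType) (tau : R).

Definition population_cov M Mh (T : 'M[R]_(M, Mh)) : 'M[R]_M := T *m T^T.

(* [sigma] lists the eigenvalues of the symmetric matrix [Sigma] with
   multiplicity, in nonincreasing order. *)
Definition eigenvalues_of M (Sigma : 'M[R]_M) (sigma : M.-tuple R) : Prop :=
  sorted >=%R sigma /\ char_poly Sigma = \prod_(s <- sigma) ('X - s%:P).

Definition esd M (sigma : M.-tuple R) (A : set R) : R :=
  M%:R^-1 * \sum_(i < M) \1_A (tnth sigma i).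

Definition positive_definite M (A : 'M[R]_M) : Prop :=
  A^T = A /\ forall v : 'rV[R]_M, v != 0 -> 0 < (v *m A *m v^T) 0 0.

Definition ratio (M N : nat) : R := M%:R / N%:R.

(* The comparison constant in "M, Mh and N are of the same order" is taken to
   be [tau] both for [M] and for [Mh]. *)
Definition basic_assumption (Cp : nat -> R) (M Mh N : nat)
    (T : 'M[R]_(M, Mh)) (sigma : M.-tuple R)
    d (Omega : measurableType d) (P : probability Omega R)
    (X : 'I_Mh -> 'I_N -> {RV P >-> R}) : Prop :=
  [/\ [/\ tau <= ratio M N <= tau^-1 & tau <= ratio Mh N <= tau^-1],
      mutually_independent (fun k : 'I_Mh * 'I_N => X k.1 k.2),
      (forall i mu, ('E_P[X i mu] = 0)%E
         /\ ('E_P[(fun w => `|X i mu w| ^+ 2)%R] = (N%:R^-1)%:E)%E),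
      (forall p i mu,
         ('E_P[(fun w => `|Num.sqrt N%:R * X i mu w| ^+ p)%R]
            <= (Cp p)%:E)%E) &
      [/\ eigenvalues_of (population_cov T) sigma,
          (forall i, tnth sigma i <= tau^-1) &
          esd sigma [set` `[0, tau]] <= 1 - tau]].

Definition master_f (M N : nat) (sigma : M.-tuple R) (x : R[i]) : R[i] :=
  - x^-1 + (ratio M N)%:C *
    \sum_(s <- undup [seq t <- sigma | t != 0])
       (esd sigma [set s])%:C / (x + (s^-1)%:C).

(* The values of [m] outside the open upper half-plane are irrelevant. *)
Definition solves_master (M N : nat) (sigma : M.-tuple R)
    (m : R[i] -> R[i]) : Prop :=
  forall z, 0 < complex.Im z ->
    0 < complex.Im (m z) /\ master_f N sigma (m z) = z.

Definition Ddomain (N : nat) : set R[i] :=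
  [set z | [/\ 0 < complex.Im z, tau <= cabs z, `|complex.Re z| <= tau^-1 &
               N%:R `^ (- 1 + tau) <= complex.Im z <= tau^-1]].

Definition spectral_domain (N : nat) (S : set R[i]) : Prop :=
  S `<=` Ddomain N /\
  forall z, S z ->
    [set w | [/\ Ddomain N w, complex.Re w = complex.Re z &
                 complex.Im z <= complex.Im w]] `<=` S.

Definition stability_bound (C : R) (delta : R[i] -> R) (u m : R[i] -> R[i])
    (z : R[i]) : Prop :=
  cabs (u z - m z)
    <= C * delta z / (complex.Im (m z) + Num.sqrt (delta z)).

(* [delta] and [u] live on [S]: they are total functions, constrained only on
   [S]. When [S z] and [Im z < 1], the point [z + i N^-5] is again in [S] for
   [N] large enough depending on [tau]. *)
Definition stable_on (M N : nat) (sigma : M.-tuple R) (m : R[i] -> R[i])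
    (S : set R[i]) (C : R) : Prop :=
  forall (delta : R[i] -> R) (u : R[i] -> R[i]),
    (forall z, S z -> N%:R ^- 2 <= delta z <= (ln N%:R)^-1) ->
    (forall z w, S z -> S w ->
       `|delta z - delta w| <= N%:R ^+ 2 * cabs (z - w)) ->
    (forall z w, S z -> S w -> complex.Re z = complex.Re w ->
       complex.Im z <= complex.Im w -> delta w <= delta z) ->
    (exists nu : probability (measurableTypeR R) R,
       nu [set` `[0, C]] = 1%E /\
       forall z, S z -> u z = stieltjes_transform nu z) ->
    forall z, S z ->
      cabs (master_f N sigma (u z) - z) <= delta z ->
      (complex.Im z < 1 ->
         stability_bound C delta u m (z + Complex 0 (N%:R ^- 5))) ->
      stability_bound C delta u m z.

Definition sample_mx (Mh N : nat) d (Omega : measurableType d)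
    (P : probability Omega R) (X : 'I_Mh -> 'I_N -> {RV P >-> R})
    (w : Omega) : 'M[R]_(Mh, N) := \matrix_(i, mu) X i mu w.

Definition G_mx (M N : nat) (Sigma : 'M[R]_M) (X : 'M[R]_(M, N)) (z : R[i]) :
    'M[R[i]]_(M + N) :=
  invmx (block_mx (- to_mxC (invmx Sigma)) (to_mxC X)
                  (to_mxC X^T) (- z%:M)).

Definition Pi_mx (M N : nat) (Sigma : 'M[R]_M) (mz : R[i]) :
    'M[R[i]]_(M + N) :=
  block_mx (- (to_mxC Sigma *m invmx (1%:M + mz *: to_mxC Sigma))) 0
           0 mz%:M.

Definition under_Sigma (M N : nat) (Sigma : 'M[R]_M) : 'M[R[i]]_(M + N) :=
  block_mx (to_mxC Sigma) 0 0 1%:M.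

Definition m_emp (M N : nat) (Sigma : 'M[R]_M) (X : 'M[R]_(M, N))
    (z : R[i]) : R[i] :=
  N%:R^-1 * \tr (invmx (to_mxC (X^T *m Sigma *m X) - z%:M)).

Definition Psi (N : nat) (m : R[i] -> R[i]) (z : R[i]) : R :=
  Num.sqrt (complex.Im (m z) / (N%:R * complex.Im z))
  + (N%:R * complex.Im z)^-1.

Definition entrywise_local_law (M : nat -> nat)
    (Sigma : forall N, 'M[R]_(M N))
    (d : nat -> measure_display) (Omega : forall N, measurableType (d N))
    (P : forall N, probability (Omega N) R)
    (X : forall N, 'I_(M N) -> 'I_N -> {RV (P N) >-> R})
    (m : forall N : nat, R[i] -> R[i]) (S : forall N : nat, set R[i]) : Prop :=
  stoch_dom P
    (U := fun N => (R[i] * 'I_(M N + N) * 'I_(M N + N))%type)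
    (fun N => [set zst | S N zst.1.1])
    (fun N zst w =>
       let: (z, s, t) := zst in
       let uS := under_Sigma N (Sigma N) in
       cabs ((invmx uS *m
              (G_mx (Sigma N) (sample_mx (X N) w) z
               - Pi_mx N (Sigma N) (m N z)) *m
              invmx uS) s t))
    (fun N zst _ => Psi N (m N) zst.1.1).

Definition averaged_local_law (M : nat -> nat)
    (Sigma : forall N, 'M[R]_(M N))
    (d : nat -> measure_display) (Omega : forall N, measurableType (d N))
    (P : forall N, probability (Omega N) R)
    (X : forall N, 'I_(M N) -> 'I_N -> {RV (P N) >-> R})
    (m : forall N : nat, R[i] -> R[i]) (S : forall N : nat, set R[i]) : Prop :=
  stoch_dom P
    (U := fun _ => R[i])
    S
    (fun N z w => cabs (m_emp (Sigma N) (sample_mx (X N) w) z - m N z))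
    (fun N z _ => (N%:R * complex.Im z)^-1).

End Model.

(* Main.v *)
(* With [Y = Sigma^(1/2) X], the symmetric matrix [h = [[0, Y], [Y^T, 0]]] has
   independent entries, and for [w^2 = z] the entries of [(h - w)^-1] are those
   of [Sigma^-1 G(z) Sigma^-1] up to the scaling of rows and columns.

   The entries of [X] are rounded to a grid and renormalized to the exact mean
   and variance, so that all estimates live on finite product spaces, with
   bounds uniform in the mesh; for fixed [N] the mesh is then sent to 0. On such
   a space linear and quadratic forms are bounded through hypercontractivity.

   By Schur complements and the Ward identity, [m_N] solves [z = f(m)] up to an
   error [delta]. Stability, used with a constant function [delta] while going
   down the grid [z + i k N^-5], gives [|m_N - m| < (N eta)^(-1/4)] up to [N^eps].
   A bound with exponent [a] feeds into fluctuation averaging, which improves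
   [delta] and hence the exponent to [(1 + a) / 2]; finitely many rounds come
   within any [eps] of the exponent 1.

   Stability asks for the spectrum to lie in [[0, C]]. At a large fixed [Re w = a]
   the resolvent stays close to [-1/w], and the averaged estimate at
   [Im w = N^(-9/16)] makes the imaginary part of its trace too small for [h] to
   have an eigenvalue near [a]; rescaling [h] excludes all larger eigenvalues,
   whence [C0 = a^2]. *)
Require Import Defs.
From HB Require Import structures.
From mathcomp Require Import all_boot all_order all_algebra.
From mathcomp Require Import complex.
From mathcomp Require Import all_classical all_reals all_analysis.
From mathcomp Require Import measurable_realfun ring lra zify.

Set Implicit Arguments.
Unset Strict Implicit.
Unset Printing Implicit Defensive.

Import Order.TTheory GRing.Theory Num.Theory.
Import numFieldNormedType.Exports.

Local Open Scope classical_set_scope.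
Local Open Scope complex_scope.
Local Open Scope ring_scope.

Notation Re := complex.Re (only parsing).
Notation Im := complex.Im (only parsing).
Notation leT := le_trans (only parsing).
Notation leMl := ler_wpM2l (only parsing).
Notation leMr := ler_wpM2r (only parsing).
Notation sqrt := Num.sqrt (only parsing).
Notation fs0 := finset.set0 (only parsing).

(** The eigenvalues of [Sigma] have no positive lower bound, while the entrywise law divides by
    [Sigma] on both sides; estimates on entries therefore carry the variance factors [mvar s] and
    [mvar t] of row and column. Uniformity is the second concern: constants may depend only on
    [kap], [cn], [vmax] and [tau]. Probabilistic statements are hence made for families of models
    over an arbitrary index type, and spectral parameters, matrix indices and the mesh all become
    part of the index. On a finite product space a conditional expectation is a finite sum defined
    at every point, so that averaging over several rows in turn raises no question of integrability
    or null sets. Within a deterministic step one letter [x], later [N^e], dominates all constants;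
    fixed powers of [x] may be lost since [e] is arbitrary. Grids have step [N^-5] because stability
    compares [z] with [z + i N^-5], and their polynomial size allows a union bound. The norm bound
    cannot use stability, which presupposes it; it rests on the self-energy being a small
    perturbation of [w] far from the spectrum. *)

Lemma le_mid d (T : porderType d) (y x z : T) : (x <= y)%O -> (y <= z)%O -> (x <= z)%O.
Proof. exact: leT. Qed.
Arguments le_mid {d T} y {x z}.

Lemma eq_ler (R : numDomainType) (x y : R) : x = y -> x <= y.
Proof. by move->. Qed.

Lemma ler_Xn (R : numDomainType) n (x y : R) : 0 <= x -> 0 <= y -> x <= y -> x ^+ n <= y ^+ n.
Proof. by move=> x0 y0; apply: lerXn2r. Qed.

(** * The complex modulus as a real number *)

Section Cabs.
Variable R : realType.
Implicit Types (x y z : R[i]) (a : R).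

Lemma cabsE z : (cabs z)%:C = `|z|.
Proof. by rewrite /cabs normc_def. Qed.

Lemma cabs_sqE z : cabs z ^+ 2 = Re z ^+ 2 + Im z ^+ 2.
Proof. by rewrite /cabs normc_def /= sqr_sqrtr // addr_ge0 ?sqr_ge0. Qed.

Lemma cabs_ge0 z : 0 <= cabs z.
Proof. by rewrite /cabs normc_def sqrtr_ge0. Qed.

Lemma cabsM x y : cabs (x * y) = cabs x * cabs y.
Proof. by apply: complexI; rewrite rmorphM /= !cabsE normrM. Qed.

Lemma cabsD x y : cabs (x + y) <= cabs x + cabs y.
Proof. by rewrite -lecR rmorphD /= !cabsE ler_normD. Qed.

Lemma cabsN x : cabs (- x) = cabs x.
Proof. by apply: complexI; rewrite !cabsE normrN. Qed.

Lemma cabsB x y : cabs (x - y) <= cabs x + cabs y.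
Proof. by rewrite (leT (cabsD _ _)) ?cabsN. Qed.

Lemma cabs_distC x y : cabs (x - y) = cabs (y - x).
Proof. by rewrite -cabsN opprB. Qed.

Lemma cabsV x : cabs x^-1 = (cabs x)^-1.
Proof. by apply: complexI; rewrite fmorphV /= !cabsE normfV. Qed.

Lemma cabsX x n : cabs (x ^+ n) = cabs x ^+ n.
Proof. by apply: complexI; rewrite rmorphXn /= !cabsE normrX. Qed.

Lemma cabs_eq0 x : (cabs x == 0) = (x == 0).
Proof. by rewrite -(inj_eq (@complexI _)) cabsE normr_eq0. Qed.

Lemma cabs_gt0 x : (0 < cabs x) = (x != 0).
Proof. by rewrite lt_def cabs_ge0 andbT cabs_eq0. Qed.

Lemma cabs0 : cabs (0 : R[i]) = 0.
Proof. by apply/eqP; rewrite cabs_eq0. Qed.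

Lemma cabs1 : cabs (1 : R[i]) = 1.
Proof. by apply: complexI; rewrite cabsE normr1. Qed.

Lemma cabsR a : cabs a%:C = `|a|.
Proof. by rewrite /cabs normc_def /= expr0n addr0 sqrtr_sqr. Qed.

Lemma cabsJ x : cabs x^*%C = cabs x.
Proof. by apply: complexI; rewrite !cabsE normcJ. Qed.

Lemma Re_le_cabs z : `|Re z| <= cabs z.
Proof. by rewrite -sqrtr_sqr /cabs normc_def ler_wsqrtr // lerDl sqr_ge0. Qed.

Lemma Im_le_cabs z : `|Im z| <= cabs z.
Proof. by rewrite -sqrtr_sqr /cabs normc_def ler_wsqrtr // lerDr sqr_ge0. Qed.

Lemma cabs_sum (I : Type) (r : seq I) (P : pred I) (F : I -> R[i]) :
 cabs (\sum_(i <- r | P i) F i) <= \sum_(i <- r | P i) cabs (F i).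
Proof.
elim/big_ind2 : _ => [|x a y b Hx Hy|i _]; rewrite ?cabs0 //.
by apply: leT (cabsD _ _) _; apply: lerD.
Qed.

Lemma cabs_prod (I : Type) (r : seq I) (P : pred I) (F : I -> R[i]) :
 cabs (\prod_(i <- r | P i) F i) = \prod_(i <- r | P i) cabs (F i).
Proof.
elim/big_rec2 : _ => [|i x a _ <-]; rewrite ?cabs1 //.
by rewrite cabsM.
Qed.

Lemma ReM x y : Re (x * y) =
 Re x * Re y - Im x * Im y.
Proof. by case: x y => [a b] [c d]. Qed.

Lemma ImM x y : Im (x * y) =
 Re x * Im y + Im x * Re y.
Proof. by case: x y => [a b] [c d]. Qed.

Lemma ReD x y : Re (x + y) = Re x + Re y.
Proof. by case: x y => [a b] [c d]. Qed.

Lemma ImD x y : Im (x + y) = Im x + Im y.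
Proof. by case: x y => [a b] [c d]. Qed.

Lemma ReN x : Re (- x) = - Re x.
Proof. by case: x. Qed.

Lemma ImN x : Im (- x) = - Im x.
Proof. by case: x. Qed.

Lemma ReJ x : Re x^*%C = Re x.
Proof. by case: x. Qed.

Lemma ImJ x : Im x^*%C = - Im x.
Proof. by case: x. Qed.

Lemma Re_sum (I : Type) (r : seq I) (P : pred I) (F : I -> R[i]) :
 Re (\sum_(i <- r | P i) F i) = \sum_(i <- r | P i) Re (F i).
Proof. by elim/big_ind2 : _ => [|x a y b <- <-|i _] //; rewrite ReD. Qed.

Lemma Im_sum (I : Type) (r : seq I) (P : pred I) (F : I -> R[i]) :
 Im (\sum_(i <- r | P i) F i) = \sum_(i <- r | P i) Im (F i).
Proof. by elim/big_ind2 : _ => [|x a y b <- <-|i _] //; rewrite ImD. Qed.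

Lemma eqC x y : Re x = Re y -> Im x = Im y ->
 x = y.
Proof. by case: x y => [a b] [c d] /= -> ->. Qed.

Lemma conjCK x : x^*%C^*%C = x.
Proof. by case: x => a b /=; rewrite opprK. Qed.

Lemma conjC0 : (0 : R[i])^*%C = 0.
Proof. by rewrite /= oppr0. Qed.

Lemma mulCJ x : x * x^*%C = (cabs x ^+ 2)%:C.
Proof. by rewrite rmorphXn /= cabsE sqr_normc. Qed.

Lemma Im_le z : Im z <= cabs z.
Proof. by apply: leT (Im_le_cabs _); rewrite ler_norm. Qed.

Lemma natC n : (n%:R : R)%:C = n%:R.
Proof. exact: rmorph_nat. Qed.

Lemma realC_eq0 a : (a%:C == 0) = (a == 0).
Proof. by rewrite -(rmorph0 (real_complex R)) (inj_eq (fmorph_inj _)). Qed.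

End Cabs.

(** * Tactics for sign conditions and monotone steps *)

Ltac sgn := intros;
 lazymatch goal with
 | |- is_true (_ && _) => apply/andP; split; sgn
 | |- is_true (0 <= _ * _) => first [apply: mulr_ge0; sgn | fin]
 | |- is_true (0 <= _ + _) => first [apply: addr_ge0; sgn | fin]
 | |- is_true (0 <= _ ^+ _) => first [apply: exprn_ge0; sgn | apply: sqr_ge0 | fin]
 | |- is_true (0 <= _^-1) => first [rewrite invr_ge0; sgn | fin]
 | |- is_true (0 < _ * _) => first [apply: mulr_gt0; sgn | fin]
 | |- is_true (0 < _ ^+ _) => first [apply: exprn_gt0; sgn | fin]
 | |- is_true (0 < _^-1) => first [rewrite invr_gt0; sgn | fin]
 | |- is_true (0 < _ + _) => first [apply: addr_gt0; sgn | apply: ltr_wpDl; sgn | apply: ltr_wpDr; sgn | fin]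
 | |- is_true (0 < _ `^ _) => first [apply: powR_gt0; sgn | fin]
 | |- is_true (0 <= _) => fin
 | |- is_true (in_mem _ _) => first [done | rewrite nnegrE; sgn | rewrite posrE; sgn]
 | |- is_true (0 < sqrt _) => rewrite sqrtr_gt0; sgn
 | _ => fin
 end
with fin := first [done | apply: cabs_ge0 | apply: sqrtr_ge0 | apply: powR_ge0 | apply: normr_ge0 | apply: ler0n | by rewrite ltr0n | by apply: ltW | apply: sumr_ge0; sgn ].
Ltac lepM := apply: ler_pM; try sgn.
Ltac leXn := apply: ler_Xn; try sgn.
Ltac mulL := apply: leMl; first sgn.
Ltac mulR := apply: leMr; first sgn.

#[export] Hint Resolve cabs_ge0 : core.

(** * Finite product spaces and conditional expectations *)

Section Prob.
Variables (R : realType) (K V : finType) (p : K -> V -> R).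
Hypotheses (p_ge0 : forall k v, 0 <= p k v) (p_sum1 : forall k, \sum_v p k v = 1).

Notation Om := {ffun K -> V}.

Definition pr (w : Om) : R := \prod_k p k (w k).

Definition merge (A : {set K}) (w' w : Om) : Om :=
 [ffun k => if k \in A then w' k else w k].

(** The conditional expectation given the coordinates outside [A], kept as a function on the whole
    space that ignores the coordinates in [A]. Averages over different sets thus compose as
    operators. *)
Definition Ex (A : {set K}) (F : Om -> R) (w : Om) : R :=
 \sum_w' pr w' * F (merge A w' w).

Definition EE (F : Om -> R) : R := \sum_w pr w * F w.

Definition indep (A : {set K}) (T : Type) (F : Om -> T) : Prop :=
 forall w' w, F (merge A w' w) = F w.

Lemma pr_ge0 w : 0 <= pr w.
Proof. exact: prodr_ge0. Qed.

Lemma pr_sum1 : \sum_w pr w = 1.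
Proof.
rewrite -(@bigA_distr_bigA _ _ _ _ _ K V p) /= big1 // => k _.
Qed.

Lemma pr_merge A w w' :
 pr (merge A w w') * pr (merge A w' w) = pr w * pr w'.
Proof.
rewrite /pr -!big_split /=; apply: eq_bigr => k _; rewrite !ffunE.
by case: ifP => _ //; rewrite mulrC.
Qed.

(** Exchanging the [A]-coordinates of two independent copies is an involution that preserves the
    product weight, so a point assembled from both copies has the original law. This is Fubini
    without splitting the product. *)
Lemma sum_pr_merge A (F : Om -> R) :
 \sum_w \sum_w' pr w * pr w' * F (merge A w w') = EE F.
Proof.
rewrite pair_big /=.
have inv (x : Om * Om) : (merge A (merge A x.1 x.2) (merge A x.2 x.1),
  merge A (merge A x.2 x.1) (merge A x.1 x.2)) = x.
 case: x => x y; congr (_, _); apply/ffunP => k; rewrite !ffunE /=;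
  by case: (k \in A).
rewrite (reindex (fun x : Om * Om => (merge A x.1 x.2, merge A x.2 x.1))) /=;
 last by exists (fun x : Om * Om => (merge A x.1 x.2, merge A x.2 x.1)) => x _ /=; exact: inv.
transitivity (\sum_(x : Om * Om) pr x.1 * pr x.2 * F x.1).
 apply: eq_bigr => -[x y] _ /=; rewrite pr_merge; congr (_ * _ * F _).
 by have [] := inv (x, y).
rewrite -(pair_big xpredT xpredT (fun x y : Om => pr x * pr y * F x)) /=.
apply: eq_bigr => x _; rewrite -big_distrl -big_distrr /=.
by rewrite pr_sum1 mulr1.
Qed.

Lemma EE_Ex A F : EE (Ex A F) = EE F.
Proof.
rewrite -[RHS](sum_pr_merge A) exchange_big /=; apply: eq_bigr => w _.
rewrite big_distrr /=; apply: eq_bigr => w' _.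
by rewrite mulrCA mulrA.
Qed.

Lemma Ex_Ex A B F w : Ex A (Ex B F) w = Ex (A :|: B) F w.
Proof.
rewrite /Ex -[RHS](sum_pr_merge B (fun w' => F (merge (A :|: B) w' w))).
rewrite exchange_big /=; apply: eq_bigr => w' _.
rewrite big_distrr /=; apply: eq_bigr => w'' _.
rewrite mulrCA mulrA; congr (_ * F _); apply/ffunP => k.
by rewrite !ffunE !inE; do !case: (k \in _).
Qed.

Lemma Ex_indep (A B : {set K}) F : B \subset A -> indep B (Ex A F).
Proof.
move=> /fintype.subsetP sBA w' w; apply: eq_bigr => w'' _; congr (_ * F _).
apply/ffunP => k; rewrite !ffunE; case: ifP => // kA; case: ifP => // /sBA.
by rewrite kA.
Qed.

Lemma ExM A F G w : indep A F -> Ex A (fun w => F w * G w) w = F w * Ex A G w.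
Proof.
move=> iF; rewrite /Ex big_distrr /=; apply: eq_bigr => w' _.
by rewrite iF mulrCA.
Qed.

Lemma Ex_id A F w : indep A F -> Ex A F w = F w.
Proof.
move=> iF; rewrite /Ex; under eq_bigr do rewrite iF.
by rewrite -big_distrl /= pr_sum1 mul1r.
Qed.

Lemma ExD A F G w : Ex A (fun w => F w + G w) w = Ex A F w + Ex A G w.
Proof. by rewrite -big_split; apply: eq_bigr => w' _; rewrite mulrDr. Qed.

Lemma ExN A F w : Ex A (fun w => - F w) w = - Ex A F w.
Proof. by rewrite -sumrN; apply: eq_bigr => w' _; rewrite mulrN. Qed.

Lemma ExB A F G w : Ex A (fun w => F w - G w) w = Ex A F w - Ex A G w.
Proof. by rewrite ExD ExN. Qed.

Lemma ExC A c w : Ex A (fun _ => c) w = c.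
Proof. by rewrite Ex_id. Qed.

Lemma eq_Ex A F G : F =1 G -> Ex A F =1 Ex A G.
Proof. by move=> FG w; apply: eq_bigr => w' _; rewrite FG. Qed.

Lemma Ex_sum A (I : Type) (r : seq I) (P : pred I) (F : I -> Om -> R) w :
 Ex A (fun w => \sum_(i <- r | P i) F i w) w = \sum_(i <- r | P i) Ex A (F i) w.
Proof. by rewrite /Ex exchange_big; apply: eq_bigr => w' _; rewrite big_distrr. Qed.

Lemma Ex_EE A F w : Ex A F w = EE (fun w' => F (merge A w' w)).
Proof. by []. Qed.

Lemma EED F G : EE (fun w => F w + G w) = EE F + EE G.
Proof. by rewrite -big_split; apply: eq_bigr => w' _; rewrite mulrDr. Qed.

Lemma EEN F : EE (fun w => - F w) = - EE F.
Proof. by rewrite -sumrN; apply: eq_bigr => w' _; rewrite mulrN. Qed.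

Lemma EEB F G : EE (fun w => F w - G w) = EE F - EE G.
Proof. by rewrite EED EEN. Qed.

Lemma EEZ c F : EE (fun w => c * F w) = c * EE F.
Proof. by rewrite big_distrr; apply: eq_bigr => w' _ /=; rewrite mulrCA. Qed.

Lemma EEC c : EE (fun _ => c) = c.
Proof. by rewrite /EE -big_distrl /= pr_sum1 mul1r. Qed.

Lemma eq_EE F G : F =1 G -> EE F = EE G.
Proof. by move=> FG; apply: eq_bigr => w' _; rewrite FG. Qed.

Lemma le_EE F G : (forall w, F w <= G w) -> EE F <= EE G.
Proof. by move=> FG; apply: ler_sum => w' _; rewrite leMl ?pr_ge0. Qed.

Lemma EE_ge0 F : (forall w, 0 <= F w) -> 0 <= EE F.
Proof. by move=> F0; apply: sumr_ge0 => w _; rewrite mulr_ge0 ?pr_ge0. Qed.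

Lemma EE_sum (I : Type) (r : seq I) (P : pred I) (F : I -> Om -> R) :
 EE (fun w => \sum_(i <- r | P i) F i w) = \sum_(i <- r | P i) EE (F i).
Proof. by rewrite /EE exchange_big; apply: eq_bigr => w' _; rewrite big_distrr. Qed.

Lemma EE_coord k (f : V -> R) : EE (fun w => f (w k)) = \sum_v p k v * f v.
Proof.
rewrite /EE /pr.
(* The test function enters as an extra factor at coordinate [k], so that the sum over all
   configurations factorizes. *)
pose q j v := p j v * (if j == k then f v else 1).
transitivity (\sum_(w : Om) \prod_j q j (w j)).
 apply: eq_bigr => w _; rewrite big_split /=; congr (_ * _).
 by rewrite (bigD1 k) //= eqxx big1 ?mulr1 // => j /negbTE ->.
rewrite -(@bigA_distr_bigA _ _ _ _ _ K V q) (bigD1 k) //= [X in _ * X]big1.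
 by rewrite mulr1; apply: eq_bigr => v _; rewrite /q eqxx.
move=> j /negbTE jk; rewrite -(p_sum1 j); apply: eq_bigr => v _.
by rewrite /q jk mulr1.
Qed.

Lemma EE_indepM (A : {set K}) F G : indep A F ->
 EE (fun w => F w * G w) = EE (fun w => F w * Ex A G w).
Proof.
move=> iF; rewrite -(EE_Ex A); apply: eq_EE => w; exact: ExM.
Qed.

Lemma EE_coordM k (f : V -> R) F : indep [set k] F ->
 EE (fun w => F w * f (w k)) = EE F * EE (fun w => f (w k)).
Proof.
move=> iF; rewrite (EE_indepM _ iF) mulrC -EEZ; apply: eq_EE => w.
rewrite mulrC; congr (_ * _); apply: eq_bigr => w' _.
by rewrite ffunE inE eqxx.
Qed.

End Prob.

(** * Elementary inequalities between powers *)

Section PowerInequalities.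
Variable R : realType.
Implicit Types (x y X q t : R).

Fixpoint quad_const (k : nat) : R :=
 if k is k'.+1 then 1 + 5 * k'.+1%:R + 2 * quad_const k' else 1.

Lemma quad_const_ge0 k : 0 <= quad_const k.
Proof. by elim: k => //= k IH; rewrite !addr_ge0 ?mulr_ge0. Qed.

(* The [X^k t] term is kept exact, as it vanishes in expectation. *)
Lemma exprD_le_quadratic k X q t :
 0 <= X -> 0 <= q -> 0 <= X + t + q -> t ^+ 2 <= 4 * X * q ->
  (X + t + q) ^+ k.+1 <=
  X ^+ k.+1 + k.+1%:R * X ^+ k * t + quad_const k * (q * (X + q) ^+ k).
Proof.
move=> X0 q0 A0 t2; elim: k => [|k IH] /=; first by rewrite !expr1 expr0; lra.
set c := quad_const k in IH *; have c0 : 0 <= c by exact: quad_const_ge0.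
(* AM-GM: [t^2 <= 4 X q <= (X + q)^2]. *)
have tle : `|t| <= X + q.
 rewrite -ler_sqr ?nnegrE ?addr_ge0 // real_normK ?num_real //.
 by apply: (leT t2); have := sqr_ge0 (X - q); rewrite !expr2; lra.
have [t1 t3] : t <= X + q /\ - t <= X + q by move/ler_normlP: tle => [].
have := leMl A0 IH.
rewrite -exprS => /leT; apply.
have Xk : 0 <= X ^+ k by exact: exprn_ge0.
have XXk : X ^+ k <= (X + q) ^+ k by apply: ler_Xn; rewrite //; lra.
set Y := (X + q) ^+ k in XXk *; set W := X ^+ k in Xk XXk *.
have -> : k.+2%:R = k.+1%:R + 1 :> R by rewrite natr1.
rewrite !(exprS X) !(exprS (X + q)) -/W -/Y.
set n := k.+1%:R : R; have n0 : 0 <= n by [].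
have h1 : W * (t ^+ 2) <= W * (4 * X * q) by exact: leMl.
have h2 : W * (t * q) <= (X + q) * q * Y.
 apply: (le_mid (W * ((X + q) * q))).
  by apply: leMl => //; apply: leMr.
 by rewrite mulrC; apply: leMl => //; rewrite mulr_ge0 //; lra.
have h3 : X * W * q <= (X + q) * q * Y.
 rewrite mulrAC; apply: ler_pM => //; first sgn.
 by apply: leMr => //; lra.
have h4 : n * (W * (t ^+ 2)) <= n * (W * (4 * X * q)) by exact: leMl.
have h5 : n * (W * (t * q)) <= n * ((X + q) * q * Y) by exact: leMl.
have h6 : n * (X * W * q) <= n * ((X + q) * q * Y) by exact: leMl.
have h7 : (X + t + q) * (c * (q * Y)) <= 2 * (X + q) * (c * (q * Y)).
 by apply: leMr; rewrite ?mulr_ge0 //; lra.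
rewrite !expr2 in h1 h4; lra.
Qed.

Lemma exprD_le_2exp k x y : 0 <= x -> 0 <= y ->
 (x + y) ^+ k <= 2 ^+ k * (x ^+ k + y ^+ k).
Proof.
move=> x0 y0; wlog xy : x y x0 y0 / x <= y.
 by move=> H; case: (leP x y) => [|/ltW] xy; [|rewrite addrC (addrC (x ^+ k))]; exact: H.
apply: (le_mid ((2 * y) ^+ k)).
 by apply: ler_Xn; lra.
by rewrite exprMn leMl ?exprn_ge0 // lerDr exprn_ge0.
Qed.

Lemma exprM_le_sum k x y : 0 <= x -> 0 <= y ->
 x ^+ k * y <= x ^+ k.+1 + y ^+ k.+1.
Proof.
move=> x0 y0; case: (leP x y) => [|/ltW] xy.
 rewrite -[leLHS]add0r lerD ?exprn_ge0 // exprSr leMr //.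
 by apply: ler_Xn.
by rewrite -[leLHS]addr0 lerD ?exprn_ge0 // exprSr leMl ?exprn_ge0.
Qed.

Lemma exprS_add_ge k x y : 0 <= x -> 0 <= y ->
 x ^+ k.+1 + 2^-1 * (x ^+ k * y + y ^+ k.+1) <= (x + y) ^+ k.+1.
Proof.
move=> x0 y0; rewrite !exprSr.
have h1 : x ^+ k <= (x + y) ^+ k by apply: ler_Xn; lra.
have h2 : y ^+ k <= (x + y) ^+ k by apply: ler_Xn; lra.
have := leMr x0 h1; have := leMr y0 h1; have := leMr y0 h2.
lra.
Qed.

Lemma ler_sum_sub (T : finType) (l l' : seq T) (F : T -> R) :
 uniq l -> uniq l' -> {subset l' <= l} -> (forall i, 0 <= F i) ->
 \sum_(i <- l') F i <= \sum_(i <- l) F i.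
Proof.
move=> ul ul' sl F0; rewrite !big_uniq // big_mkcond [leRHS]big_mkcond /=.
by apply: ler_sum => i _; case: ifP => [/sl ->|_] //; case: ifP.
Qed.

End PowerInequalities.

(** * Moments of linear and quadratic chaoses *)

Section Hypercontractivity.
Variables (R : realType) (K V : finType) (p : K -> V -> R).
Hypotheses (p_ge0 : forall k v, 0 <= p k v) (p_sum1 : forall k, \sum_v p k v = 1).

Notation Om := {ffun K -> V}.
Notation EE := (EE p).

(** Hölder's inequality in a form without roots: both functions are normalized by [al] and [be], and
    then [x^k y <= x^(k+1) + y^(k+1)] is applied pointwise. The factor 2 is the price of this crude
    Young inequality. *)
Lemma EE_mix k (X Y : Om -> R) (al be : R) :
 0 < al -> 0 < be -> (forall w, 0 <= X w) -> (forall w, 0 <= Y w) ->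
 EE (fun w => X w ^+ k.+1) <= al ^+ k.+1 ->
 EE (fun w => Y w ^+ k.+1) <= be ^+ k.+1 ->
 EE (fun w => X w ^+ k * Y w) <= 2 * al ^+ k * be.
Proof.
move=> a0 b0 X0 Y0 EX EY.
have ak0 : 0 < al ^+ k * be by sgn.
rewrite -mulrA -ler_pdivrMr // mulrC -EEZ.
apply: (le_mid (EE (fun w => (al ^- k.+1) * X w ^+ k.+1
  + (be ^- k.+1) * Y w ^+ k.+1))).
 apply: le_EE => // w.
 have -> : (al ^+ k * be)^-1 * (X w ^+ k * Y w) = (X w / al) ^+ k * (Y w / be).
  by rewrite exprMn invfM exprVn; ring.
 apply: (leT (exprM_le_sum _ _ _)); try sgn.
 by rewrite !exprMn !exprVn lerD // mulrC.
rewrite EED !EEZ; apply: (le_mid (1 + 1)); last by lra.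
by apply: lerD; rewrite mulrC ler_pdivrMr ?exprn_gt0 // mul1r.
Qed.

Definition hyper_const (k : nat) : R := locked (4 * (quad_const R k * 2 ^+ k) + 1).

Lemma hyper_const_ge1 k : 1 <= hyper_const k.
Proof. by rewrite /hyper_const -lock lerDr !mulr_ge0 ?exprn_ge0 ?quad_const_ge0. Qed.

(** Adding one centred variable, independent of [g] and [h]. In [|g + zeta h|^2 = X + t + q] the
    part [t] is linear in [zeta], so its first-order contribution to the moment vanishes, and what
    remains is of second order in [zeta]. The coefficient 1 of [al] in the result is essential: it
    lets the step be iterated over many variables with bounds that add instead of multiply. *)
Lemma hypercontract_step k (j : K) (zeta : V -> R) (g h : Om -> R[i])
  (al be kap : R) :
 0 < al -> 0 < be -> 0 <= kap ->
 indep [set j] g -> indep [set j] h ->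
 EE (fun w => zeta (w j)) = 0 ->
 EE (fun w => zeta (w j) ^+ 2) <= kap ->
 EE (fun w => zeta (w j) ^+ (2 * k.+1)) <= kap ^+ k.+1 ->
 EE (fun w => (cabs (g w) ^+ 2) ^+ k.+1) <= al ^+ k.+1 ->
 EE (fun w => (cabs (h w) ^+ 2) ^+ k.+1) <= be ^+ k.+1 ->
 EE (fun w => (cabs (g w + (zeta (w j))%:C * h w) ^+ 2) ^+ k.+1)
  <= (al + hyper_const k * (kap * be)) ^+ k.+1.
Proof.
move=> a0 b0 kap0 ig ih z1 z2 zk Eg Eh; rewrite /hyper_const -lock.
set c := quad_const R k; have c0 : 0 <= c by exact: quad_const_ge0.
pose X w := cabs (g w) ^+ 2; pose Y w := cabs (h w) ^+ 2.
pose t1 w := 2 * (Re (g w) * Re (h w) + Im (g w) * Im (h w)).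
have X0 w : 0 <= X w by exact: sqr_ge0.
have Y0 w : 0 <= Y w by exact: sqr_ge0.
have iX : indep [set j] X by move=> w' w; rewrite /X ig.
have iY : indep [set j] Y by move=> w' w; rewrite /Y ih.
have it1 : indep [set j] t1 by move=> w' w; rewrite /t1 ig ih.
have absE w : cabs (g w + (zeta (w j))%:C * h w) ^+ 2 =
  X w + t1 w * zeta (w j) + Y w * zeta (w j) ^+ 2.
 rewrite /X /Y /t1 !cabs_sqE ReD ImD ReM ImM /=; ring.
apply: (le_mid (EE (fun w => X w ^+ k.+1 +
  (k.+1%:R * X w ^+ k * t1 w) * zeta (w j) +
  c * 2 ^+ k * ((X w ^+ k * Y w) * zeta (w j) ^+ 2 +
  Y w ^+ k.+1 * zeta (w j) ^+ (2 * k.+1))))).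
 apply: le_EE => // w; rewrite absE.
 have q0 : 0 <= Y w * zeta (w j) ^+ 2 by sgn.
 apply: (leT (exprD_le_quadratic _ _ _ _ _)) => //.
 - by rewrite -absE sqr_ge0.
 - have -> : 4 * X w * (Y w * zeta (w j) ^+ 2) = 4 * (X w * Y w) * zeta (w j) ^+ 2 by ring.
  rewrite exprMn leMr ?sqr_ge0 // /t1 /X /Y !cabs_sqE.
  have := sqr_ge0 (Re (g w) * Im (h w) - Im (g w) * Re (h w)).
  by rewrite !expr2; lra.
 - rewrite mulrA lerD // -(mulrA c) leMl //.
  apply: (le_mid (Y w * zeta (w j) ^+ 2 * (2 ^+ k * (X w ^+ k + (Y w * zeta (w j) ^+ 2) ^+ k)))).
  by rewrite leMl // exprD_le_2exp.
  have -> : Y w ^+ k.+1 * zeta (w j) ^+ (2 * k.+1) =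
  Y w * zeta (w j) ^+ 2 * (Y w * zeta (w j) ^+ 2) ^+ k.
  by rewrite exprM -exprMn exprS.
  set q := Y w * _; apply: eq_ler; rewrite /q; ring.
rewrite !EED EEZ EED (EE_coordM p_sum1 zeta); last by move=> w' w; rewrite iX it1.
rewrite (EE_coordM p_sum1 (fun v => zeta v ^+ 2)); last by move=> w' w; rewrite iX iY.
rewrite (EE_coordM p_sum1 (fun v => zeta v ^+ (2 * k.+1))); last by move=> w' w; rewrite iY.
rewrite z1 mulr0 addr0.
have mixle : EE (fun w => X w ^+ k * Y w) <= 2 * al ^+ k * be by exact: EE_mix.
have mix0 : 0 <= EE (fun w => X w ^+ k * Y w).
 by apply: EE_ge0 => // w; apply: mulr_ge0; [apply: exprn_ge0; exact: X0|exact: Y0].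
have h1 : EE (fun w => X w ^+ k * Y w) * EE (fun w => zeta (w j) ^+ 2)
  <= 2 * al ^+ k * be * kap.
 by apply: ler_pM => //; apply: EE_ge0 => // w; rewrite sqr_ge0.
have h2 : EE (fun w => Y w ^+ k.+1) * EE (fun w => zeta (w j) ^+ (2 * k.+1))
  <= be ^+ k.+1 * kap ^+ k.+1.
 apply: ler_pM => //; apply: EE_ge0 => // w; first by apply: exprn_ge0; exact: Y0.
 by rewrite exprM; sgn.
set c' := c * 2 ^+ k; have c'0 : 0 <= c' by rewrite mulr_ge0 ?exprn_ge0.
set b := kap * be; have bb0 : 0 <= b by rewrite mulr_ge0 // ltW.
have C0 : 1 <= 4 * c' + 1 by lra.
apply: leT (exprS_add_ge k (ltW a0) _); last by rewrite mulr_ge0 //; lra.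
apply: (le_mid (al ^+ k.+1 + c' * (2 * al ^+ k * be * kap + be ^+ k.+1 * kap ^+ k.+1))).
 by apply: lerD => //; apply: leMl => //; apply: lerD.
rewrite lerD2l -exprMn (mulrC be kap) -/b (exprMn _ _ b).
have e1 : 4 * c' + 1 <= (4 * c' + 1) ^+ k.+1 by rewrite -[leLHS]expr1 ler_weXn2l.
have e2 := leMr (exprn_ge0 k.+1 bb0) e1.
have e3 : 0 <= al ^+ k * b by sgn.
have e4 : 0 <= b ^+ k.+1 by sgn.
have e5 : 0 <= c' * b ^+ k.+1 by sgn.
have -> : 2 * al ^+ k * be * kap = 2 * (al ^+ k * b) by rewrite /b; ring.
have -> : al ^+ k * ((4 * c' + 1) * b) = (4 * c' + 1) * (al ^+ k * b) by ring.
lra.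
Qed.

(** The one-variable step iterated along [l]. The parameter [t] keeps the two bounds strictly
    positive, as that step asks, although coefficients may vanish. *)
Lemma linear_chaos k (zeta : K -> V -> R) (kap : K -> R) (l : seq K)
  (a : K -> R[i]) (t : R) :
 (forall j, 0 <= kap j) ->
 (forall j, EE (fun w => zeta j (w j)) = 0) ->
 (forall j, EE (fun w => zeta j (w j) ^+ 2) <= kap j) ->
 (forall j, EE (fun w => zeta j (w j) ^+ (2 * k.+1)) <= kap j ^+ k.+1) ->
 uniq l -> 0 < t ->
 EE (fun w => (cabs (\sum_(j <- l) (zeta j (w j))%:C * a j) ^+ 2) ^+ k.+1)
  <= (t + hyper_const k * (\sum_(j <- l) kap j * (cabs (a j) ^+ 2 + t))) ^+ k.+1.
Proof.
move=> kap0 z1 z2 zk; have c1 := hyper_const_ge1 k.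
have c0 : 0 <= hyper_const k by lra.
move=> + t0; elim: l => [_|j l IH /andP[jl ul]].
 rewrite big_nil mulr0 addr0.
 under eq_EE do rewrite big_nil cabs0 expr0n /= expr0n /=.
 by rewrite (EEC p_sum1) exprn_ge0 // ltW.
rewrite big_cons mulrDr addrCA addrC.
under eq_EE do rewrite big_cons addrC.
apply: (hypercontract_step (zeta := zeta j)) => //.
- rewrite ltr_pwDl // mulr_ge0 ?sumr_ge0 // => i _; rewrite mulr_ge0 //.
 sgn.
- by rewrite ltr_wpDl ?sqr_ge0.
- move=> w' w; apply: eq_big_seq => i il; rewrite ffunE inE.
 by case: eqP => // ij; rewrite -ij il in jl.
- exact: IH.
- rewrite (EEC p_sum1); leXn.
 by rewrite lerDl ltW.
Qed.

(** Summation over unordered pairs in the order of the list: the head variable multiplies a linear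
    form in the later ones, which is the shape needed for an induction adding one variable at a
    time. *)
Fixpoint pair_sum (U : nmodType) (l : seq K) (F : K -> K -> U) : U :=
 if l is j :: l' then pair_sum l' F + \sum_(i <- l') F j i else 0.

(** The coefficient of each new variable is a linear chaos in the variables already treated, so
    [linear_chaos] supplies the bound [be] of the one-variable step. *)
Lemma quadratic_chaos k (zeta : K -> V -> R) (kap : K -> R) (l : seq K)
  (a : K -> K -> R[i]) (t : R) :
 (forall j, 0 <= kap j) ->
 (forall j, EE (fun w => zeta j (w j)) = 0) ->
 (forall j, EE (fun w => zeta j (w j) ^+ 2) <= kap j) ->
 (forall j, EE (fun w => zeta j (w j) ^+ (2 * k.+1)) <= kap j ^+ k.+1) ->
 uniq l -> 0 < t ->
 EE (fun w => (cabs (pair_sum l (fun j i =>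
  (zeta j (w j))%:C * ((zeta i (w i))%:C * a j i))) ^+ 2) ^+ k.+1)
  <= (t + \sum_(j <- l) hyper_const k * (kap j *
  (t + hyper_const k * \sum_(i <- l) kap i * (cabs (a j i) ^+ 2 + t)))) ^+ k.+1.
Proof.
move=> kap0 z1 z2 zk ul t0; have c_ge := hyper_const_ge1 k.
set c := hyper_const k in c_ge *.
have term0 i j (b : R) : 0 <= b -> 0 <= b * (kap i * (cabs (a j i) ^+ 2 + t)).
 by move=> b0; rewrite !mulr_ge0 // addr_ge0 ?sqr_ge0 // ltW.
pose Bd (l' : seq K) := t + \sum_(j <- l') c * (kap j *
  (t + c * \sum_(i <- l) kap i * (cabs (a j i) ^+ 2 + t))).
have in0 b j (l' : seq K) : 0 <= b ->
  0 < t + b * \sum_(i <- l') kap i * (cabs (a j i) ^+ 2 + t).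
 move=> b0; rewrite ltr_pwDl // mulr_ge0 // sumr_ge0 // => i _.
 by rewrite -[X in 0 <= X]mul1r term0.
have Bd_gt0 l' : 0 < Bd l'.
 rewrite /Bd ltr_pwDl // sumr_ge0 // => j _; rewrite !mulr_ge0 //; first by lra.
 by rewrite ltW // in0 //; lra.
(* The induction runs over sublists while the inner sums stay over all of [l]; the bound then grows
   by one fixed summand per variable. *)
suff H : forall l', uniq l' -> {subset l' <= l} ->
 EE (fun w => (cabs (pair_sum l' (fun j i =>
  (zeta j (w j))%:C * ((zeta i (w i))%:C * a j i))) ^+ 2) ^+ k.+1)
  <= Bd l' ^+ k.+1.
 exact: H.
elim=> [_ _|j l' IH /andP[jl ul'] sl].
 under eq_EE do rewrite /= cabs0 expr0n /= expr0n /=.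
 by rewrite (EEC p_sum1) exprn_ge0 // ltW.
have sl' : {subset l' <= l} by move=> i il; apply: sl; rewrite inE il orbT.
rewrite /Bd big_cons addrCA addrC -/(Bd l') => /=.
under eq_EE do rewrite /= -mulr_sumr.
have notj i : i \in l' -> i != j.
 by move=> il; apply: contraNneq jl => <-.
apply: (hypercontract_step (zeta := zeta j)) => //.
- by apply: in0; lra.
- move=> w' w; elim: l' jl notj {IH ul' sl sl'} => [//|i l' IHl].
 rewrite inE negb_or => /andP[ij jl] notj /=; rewrite IHl //; last first.
  by move=> i' i'l; apply: notj; rewrite inE i'l orbT.
 have E i' : i' \in i :: l' -> merge [set j] w' w i' = w i'.
  by move=> /notj /negbTE i'j; rewrite ffunE inE i'j.
 congr (_ + _); rewrite E ?mem_head //; apply: eq_big_seq => i' i'l.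
 by rewrite E // inE i'l orbT.
- move=> w' w; apply: eq_big_seq => i /notj/negbTE ij.
 by rewrite ffunE inE ij.
- exact: IH.
- apply: (leT (@linear_chaos k zeta kap l' (a j) t _ _ _ _ _ _)) => //.
 have c0 : 0 <= c by lra.
 leXn.
 rewrite lerD2l; apply: leMl => //.
 apply: ler_sum_sub => //.
 by move=> i; rewrite -[X in 0 <= X]mul1r term0.
Qed.

End Hypercontractivity.

(** * Resolvents of symmetric matrices and of their minors *)

Section Resolvent.
Variables (R : realType) (n : nat).
Implicit Types (h : 'I_n -> 'I_n -> R) (B : {set 'I_n}) (w : R[i]).

(* Minors keep their full size: the rows and columns in [B] are set to zero. *)
Definition Hm h B : 'M[R[i]]_n :=
 \matrix_(s, t) (if (s \in B) || (t \in B) then 0 else (h s t)%:C).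

Definition Gm h w B : 'M[R[i]]_n := invmx (Hm h B - w%:M).

Definition hsym h := (forall s t, h s t = h t s) /\ (forall s, h s s = 0).

Lemma Hm_tr h B : hsym h -> (Hm h B)^T = Hm h B.
Proof. by move=> [hs _]; apply/matrixP => s t; rewrite !mxE orbC hs. Qed.

(** For a kernel vector [v] the quadratic form of the real symmetric matrix is real, while the
    kernel equation makes it [|v|^2] times the conjugate of [w]; hence [v = 0]. *)
Lemma Hm_unit h B w : hsym h -> 0 < Im w -> Hm h B - w%:M \in unitmx.
Proof.
move=> hh w0; rewrite -row_free_unit -kermx_eq0; apply/eqP/row_matrixP => i.
rewrite row0; set v := row i _.
have vL : v *m (Hm h B - w%:M) = 0.
 by apply/sub_kermxP; rewrite /v; exact: row_sub.
have key : \sum_t v 0 t * (\sum_s v 0 s * Hm h B s t - w * v 0 t)^*%C = 0.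
 rewrite big1 // => t _.
 have <- : (v *m (Hm h B - w%:M)) 0 t = \sum_s v 0 s * Hm h B s t - w * v 0 t.
  by rewrite mulmxBr mul_mx_scalar mxE; congr (_ + _); [exact: mxE|rewrite !mxE].
 by rewrite vL [X in X^*%C]mxE conjC0 mulr0.
have dbl : \sum_t v 0 t * (\sum_s v 0 s * Hm h B s t)^*%C =
  (\sum_t v 0 t * (\sum_s v 0 s * Hm h B s t)^*%C)^*%C.
 rewrite raddf_sum /= (eq_bigr (fun t => \sum_s v 0 t * (v 0 s)^*%C * Hm h B s t)); last first.
  move=> t _; rewrite raddf_sum big_distrr /=; apply: eq_bigr => s _.
  rewrite rmorphM /= mulrA; congr (_ * _); rewrite !mxE.
  by case: ifP => _; rewrite ?conjc0 // conjc_real.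
 rewrite exchange_big /=; apply: eq_bigr => s _.
 rewrite rmorphM /= conjCK big_distrr /=; apply: eq_bigr => t _.
 have -> : Hm h B s t = Hm h B t s by rewrite -[in LHS](Hm_tr B hh) mxE.
 by ring.
have key2 : \sum_t v 0 t * (\sum_s v 0 s * Hm h B s t)^*%C =
  (\sum_t cabs (v 0 t) ^+ 2)%:C * w^*%C.
 apply/eqP; rewrite -subr_eq0; apply/eqP; rewrite -[RHS]key rmorph_sum big_distrl /=.
 rewrite -sumrB; apply: eq_bigr => t _; rewrite rmorphB /= mulrBr; congr (_ - _).
 by rewrite -mulCJ [in RHS]rmorphM /=; ring.
have S0 : \sum_t cabs (v 0 t) ^+ 2 = 0.
 have := congr1 (@Im R) dbl; rewrite ImJ key2 ImM /= mul0r addr0 ImJ.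
 move=> /eqP; rewrite -addr_eq0 mulrN -opprD oppr_eq0 -mulrDl mulf_eq0 -mulr2n mulrn_eq0 /=.
 by rewrite (gt_eqF w0) orbF => /eqP.
apply/rowP => t; rewrite [RHS]mxE; apply/eqP; rewrite -cabs_eq0 -sqrf_eq0.
by move/eqP: S0; rewrite psumr_eq0 => [/allP/(_ t (mem_index_enum _))|s _]; try sgn.
Qed.

Section Fixed.
Variables (h : 'I_n -> 'I_n -> R) (w : R[i]).
Hypotheses (hh : hsym h) (w_gt0 : 0 < Im w).
Notation H := (Hm h).
Notation G := (Gm h w).

Let w_neq0 : w != 0.
Proof. by apply: contraTneq w_gt0 => ->; rewrite ltxx. Qed.

Lemma Gm_sym B s t : G B s t = G B t s.
Proof.
have /matrixP/(_ t s) : (G B)^T = G B.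
 by rewrite /Gm trmx_inv linearB /= Hm_tr // tr_scalar_mx.
by rewrite mxE.
Qed.

Lemma Gm_eq B s t : \sum_k H B s k * G B k t - w * G B s t = (s == t)%:R.
Proof.
have /matrixP/(_ s t) := mulmxV (Hm_unit B hh w_gt0).
by rewrite mulmxBl mul_scalar_mx !mxE.
Qed.

Lemma Gm_out B s t : s \in B -> G B s t = - (s == t)%:R / w.
Proof.
move=> sB; rewrite -(Gm_eq B) big1 ?sub0r ?opprK => [|k _].
 by rewrite mulrC mulKf.
by rewrite mxE sB mul0r.
Qed.

Lemma Gm_out0 B s t : s \in B -> s != t -> G B s t = 0.
Proof. by move=> sB /negbTE st; rewrite Gm_out // st oppr0 mul0r. Qed.

(** Ward's identity. The resolvent equation is paired with the conjugate column; the quadratic form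
    of the symmetric matrix is real and drops out of the imaginary part. *)
Lemma Gm_ward B s : Im (G B s s) = Im w * \sum_t cabs (G B s t) ^+ 2.
Proof.
pose Gs k := (G B k s)^*%C.
have e1 : \sum_k Gs k * (\sum_l H B k l * G B l s - w * G B k s) = Gs s.
 rewrite (bigD1 s) //= Gm_eq eqxx mulr1 big1 ?addr0 // => k /negbTE ks.
 by rewrite Gm_eq ks mulr0.
pose Q := \sum_k Gs k * \sum_l H B k l * G B l s.
have QJ : Q^*%C = Q.
 rewrite /Q raddf_sum (eq_bigr (fun k => \sum_l Gs l * H B k l * G B k s)) /=.
  rewrite exchange_big; apply: eq_bigr => l _; rewrite big_distrr /=.
  by apply: eq_bigr => k _; rewrite -mulrA -[in LHS](Hm_tr B hh) [X in _ * (X * _)]mxE.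
 move=> k _; rewrite /Gs rmorphM /= conjCK raddf_sum big_distrr /=.
 apply: eq_bigr => l _; rewrite rmorphM /=.
 have -> : (H B k l)^*%C = H B k l.
  by rewrite mxE; case: ifP => _; rewrite ?conjC0 // conjc_real.
 by rewrite /Gs; ring.
have e2 : Q - w * (\sum_t cabs (G B s t) ^+ 2)%:C = Gs s.
 rewrite -e1 rmorph_sum big_distrr -sumrB; apply: eq_bigr => k _ /=.
 rewrite mulrBr; congr (_ - _).
 by rewrite -mulCJ (Gm_sym B s k) /Gs; ring.
have ImQ : Im Q = 0.
 have := congr1 (@Im R) QJ; rewrite ImJ => /eqP.
 by rewrite eq_sym -addr_eq0 -mulr2n mulrn_eq0 /= => /eqP.
have := congr1 (@Im R) e2; rewrite ImD ImN ImQ ImM /= mulr0 !add0r ImJ.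
by move/oppr_inj.
Qed.

Lemma Gm_Im_ge0 B s : 0 <= Im (G B s s).
Proof.
by rewrite Gm_ward mulr_ge0 ?(ltW w_gt0) // sumr_ge0 // => t _; rewrite sqr_ge0.
Qed.

Lemma Gm_row_le B s t : cabs (G B s t) ^+ 2 <= Im (G B s s) / Im w.
Proof.
rewrite Gm_ward mulrC mulKf ?gt_eqF // (bigD1 t) //= lerDl.
by rewrite sumr_ge0 // => k _; rewrite sqr_ge0.
Qed.

Lemma Gm_le B s t : cabs (G B s t) <= (Im w)^-1.
Proof.
have diag : cabs (G B s s) <= (Im w)^-1.
 have := Gm_row_le B s s; set x := cabs _ => H.
 have : x ^+ 2 <= x / Im w.
  apply: (leT H); rewrite leMr; try sgn.
  exact: Im_le.
 have : 0 <= x by exact: cabs_ge0.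
 rewrite le_eqVlt => /predU1P[<- _|x0]; first sgn.
 by rewrite expr2 ler_pM2l.
rewrite -ler_sqr; try sgn.
apply: (leT (Gm_row_le _ _ _)); rewrite expr2 leMr; try sgn.
by apply: leT diag; exact: Im_le.
Qed.

Lemma Gm_minor_raw B u s t : s != u ->
 G B s t = G (u |: B) s t - (\sum_k G (u |: B) s k * H B k u) * G B u t.
Proof.
move=> su; set B' := u |: B.
have E : G B - G B' = - (G B' *m (H B - H B') *m G B).
 rewrite -mulNmx -mulmxN opprB.
 have -> : H B' - H B = (H B' - w%:M) - (H B - w%:M).
  by rewrite opprB addrA subrK.
 rewrite mulmxBr mulmxBl mulVmx ?Hm_unit // mul1mx -mulmxA mulmxV ?Hm_unit //.
 by rewrite mulmx1.
have /matrixP/(_ s t) := E; rewrite [LHS]mxE [in LHS]mxE [X in _ = X -> _]mxE => e.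
transitivity (G B' s t + (G B s t - G B' s t)); first by rewrite addrC subrK.
rewrite e; congr (_ - _); rewrite mxE (bigD1 u) //= [X in _ + X]big1 ?addr0 => [|l lu].
 congr (_ * _); rewrite mxE; apply: eq_bigr => k _; rewrite !mxE.
 by rewrite !inE eqxx orbT subr0.
rewrite mxE big1 ?mul0r // => k _; rewrite !mxE !inE (negbTE lu) /=.
case: eqP => [->|_] /=; last by rewrite subrr mulr0.
by rewrite Gm_sym (Gm_out0 (t := s)) ?mul0r // ?inE ?eqxx // eq_sym.
Qed.

Lemma Gm_off B u s : s != u ->
 G B s u = - (\sum_k G (u |: B) s k * H B k u) * G B u u.
Proof.
move=> su; rewrite (Gm_minor_raw B u su) (Gm_sym _ s u).
by rewrite (Gm_out0 (t := s)) ?inE ?eqxx // 1?eq_sym // sub0r mulNr.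
Qed.

(** Schur's complement formula, obtained by inserting [Gm_off] in the diagonal resolvent
    equation. *)
Lemma Gm_diag B u :
 G B u u * (- w - \sum_k \sum_l H B u k * G (u |: B) k l * H B l u) = 1.
Proof.
have e : \sum_k H B u k * G B k u - w * G B u u = 1 by rewrite Gm_eq eqxx.
rewrite -[RHS]e.
rewrite mulrDr addrC; congr (_ + _); last by rewrite mulrN mulrC.
rewrite mulrN mulr_sumr -sumrN; apply: eq_bigr => k _.
case: (eqVneq k u) => [->|ku].
 rewrite [H B u u]mxE [in RHS]hh.2 if_same mul0r big1 ?mulr0 ?oppr0 // => l _.
 by rewrite hh.2 if_same !mul0r.
rewrite (Gm_off B ku) mulNr mulrN; congr (- _).
rewrite mulr_suml !mulr_sumr; apply: eq_bigr => l _; ring.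
Qed.

Lemma Gm_diag_neq0 B u : G B u u != 0.
Proof.
apply/eqP => G0; have := Gm_diag B u; rewrite G0 mul0r => /esym/eqP.
by rewrite oner_eq0.
Qed.

Lemma Gm_diagV B u :
 (G B u u)^-1 = - w - \sum_k \sum_l H B u k * G (u |: B) k l * H B l u.
Proof. by rewrite -[LHS]mulr1 -(Gm_diag B u) mulKf // Gm_diag_neq0. Qed.

Lemma Gm_minor B u s t : s != u ->
 G B s t = G (u |: B) s t + G B s u * G B u t / G B u u.
Proof.
move=> su; rewrite (Gm_minor_raw _ t su) (Gm_off B su); congr (_ + _).
by field; exact: Gm_diag_neq0.
Qed.

End Fixed.

Lemma Gm_diff h w w' B s t : hsym h -> 0 < Im w -> 0 < Im w' ->
 cabs (Gm h w B s t - Gm h w' B s t) <=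
  cabs (w - w') * (n%:R / (Im w * Im w')).
Proof.
move=> hh w0 w'0.
have E : Gm h w B - Gm h w' B = (w - w') *: (Gm h w B *m Gm h w' B).
 have -> : (w - w') *: (Gm h w B *m Gm h w' B) =
  Gm h w B *m ((Hm h B - w'%:M) - (Hm h B - w%:M)) *m Gm h w' B.
  have -> : Hm h B - w'%:M - (Hm h B - w%:M) = (w - w')%:M.
  by rewrite opprB addrC addrA subrK raddfB.
  by rewrite mul_mx_scalar scalemxAl.
 rewrite mulmxBr mulmxBl mulVmx ?Hm_unit // mul1mx -mulmxA mulmxV ?Hm_unit //.
 by rewrite mulmx1.
have /matrixP/(_ s t) := E; rewrite [LHS]mxE [in LHS]mxE => ->.
rewrite [in leLHS]mxE cabsM leMl ?cabs_ge0 // mxE.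
apply: (leT (cabs_sum _ _ _)).
rewrite mulr_natl -[n in leRHS]card_ord -sumr_const; apply: ler_sum => k _.
by rewrite cabsM invfM ler_pM ?cabs_ge0 ?Gm_le.
Qed.

(** Serves only for continuity in the matrix entries at fixed dimension, so that the crude factor
    [n^2] does no harm. *)
Lemma Gm_diff_h h h' w B s t (e : R) : hsym h -> hsym h' -> 0 < Im w ->
 (forall s t, `|h s t - h' s t| <= e) ->
 cabs (Gm h w B s t - Gm h' w B s t) <= n%:R ^+ 2 * e / Im w ^+ 2.
Proof.
move=> hh hh' w0 he.
have E : Gm h w B - Gm h' w B = Gm h w B *m (Hm h' B - Hm h B) *m Gm h' w B.
 have -> : Hm h' B - Hm h B = (Hm h' B - w%:M) - (Hm h B - w%:M).
  by rewrite opprB addrA subrK.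
 rewrite mulmxBr mulmxBl mulVmx ?Hm_unit // mul1mx -mulmxA mulmxV ?Hm_unit //.
 by rewrite mulmx1.
have /matrixP/(_ s t) := E; rewrite [LHS]mxE [in LHS]mxE => ->; rewrite mxE.
apply: (leT (cabs_sum _ _ _)).
have -> : n%:R ^+ 2 * e / Im w ^+ 2 = \sum_(k < n) (n%:R * (e / Im w)) / Im w.
 by rewrite sumr_const card_ord -mulr_natl; field; rewrite gt_eqF.
apply: ler_sum => k _; rewrite cabsM; apply: ler_pM; rewrite ?cabs_ge0 ?Gm_le //.
rewrite mxE; apply: (leT (cabs_sum _ _ _)).
rewrite mulr_natl -[n in leRHS]card_ord -sumr_const; apply: ler_sum => l _.
rewrite cabsM mulrC; apply: ler_pM; rewrite ?cabs_ge0 ?Gm_le //.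
have e0 : 0 <= e by apply: leT (he l k); exact: normr_ge0.
rewrite !mxE; case: ifP => _; first by rewrite subrr cabs0.
by rewrite -rmorphB /= cabsR distrC.
Qed.

End Resolvent.

(** * Random matrix models and events of overwhelming probability *)

Section Models.
Variable R : realType.

(* A symmetric matrix with independent entries on a finite product space; the
   coordinate carrying the entry [(s, t)] is the unordered pair [{s, t}]. *)
Record model := Model {
 msize : nat;
 mdim : nat;
 mval : finType;
 mlaw : {set 'I_mdim} -> mval -> R;
 mxi : {set 'I_mdim} -> mval -> R;
 mvar : 'I_mdim -> R;
 mlaw_ge0 : forall k v, 0 <= mlaw k v;
 mlaw_sum1 : forall k, \sum_v mlaw k v = 1;
 mxi_mean : forall k, \sum_v mlaw k v * mxi k v = 0 }.

Definition mOm (mu : model) := {ffun {set 'I_(mdim mu)} -> mval mu}.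
Definition mE (mu : model) (F : mOm mu -> R) : R := EE (@mlaw mu) F.
Definition mh (mu : model) (w : mOm mu) (s t : 'I_(mdim mu)) : R :=
 if s == t then 0 else mxi [set s; t]%SET (w [set s; t]%SET).
Definition mS (mu : model) (s t : 'I_(mdim mu)) : R :=
 mE (fun w => mh w s t ^+ 2).
Definition mrow (mu : model) (s : 'I_(mdim mu)) : {set {set 'I_(mdim mu)}} :=
 [set k : {set 'I_(mdim mu)} | s \in k]%SET.

(** The entry [(s, t)] has size [sqrt (mvar s * mvar t / N)]. Keeping the two factors apart, instead
    of bounding them by [vmax], is what later survives the division by [Sigma]. *)
Definition good_model (kap : nat -> R) (cn vmax : R) (mu : model) : Prop :=
 [/\ (0 < msize mu <= mdim mu)%N, (mdim mu)%:R <= cn * (msize mu)%:R,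
  (forall s, 0 < @mvar mu s <= vmax) &
  forall s t q, mE (fun w : mOm mu => ((msize mu)%:R * mh w s t ^+ 2) ^+ q)
  <= kap q * (mvar s * mvar t) ^+ q].

Lemma mh_sym mu (w : mOm mu) : hsym (mh w).
Proof.
split=> [s t|s]; rewrite /mh ?eqxx // eq_sym; case: ifP => // _.
by rewrite finset.setUC.
Qed.

Definition mpr (mu : model) (A : mOm mu -> Prop) : R :=
 mE (fun w => (`[< A w >])%:R).

Lemma mE_ge0 mu (F : mOm mu -> R) : (forall w, 0 <= F w) -> 0 <= mE F.
Proof. by move=> F0; apply: EE_ge0 => //; exact: mlaw_ge0. Qed.

Lemma le_mE mu (F G : mOm mu -> R) : (forall w, F w <= G w) -> mE F <= mE G.
Proof. by move=> FG; apply: le_EE => //; exact: mlaw_ge0. Qed.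

Lemma mpr_le mu (A B : mOm mu -> Prop) : (forall w, A w -> B w) -> mpr A <= mpr B.
Proof.
move=> AB; apply: le_mE => w; case: asboolP => [/AB Bw|_]; last exact: ler0n.
by rewrite asboolT.
Qed.

Lemma mpr_or mu (A B : mOm mu -> Prop) : mpr (fun w => A w \/ B w) <= mpr A + mpr B.
Proof.
rewrite -EED; apply: le_mE => w.
rewrite -natrD ler_nat.
by case: (asboolP (A w)) => a; case: (asboolP (B w)) => b; case: asboolP => // -[].
Qed.

Lemma mpr_exists mu (I : finType) (A : I -> mOm mu -> Prop) :
 mpr (fun w => exists i, A i w) <= \sum_i mpr (A i).
Proof.
rewrite -(EE_sum _ _ _ (fun i w => (`[< A i w >])%:R)); apply: le_mE => w.
case: asboolP => [[i Ai]|_]; last exact: sumr_ge0.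
by rewrite (bigD1 i) //= (asboolT Ai) lerDl sumr_ge0.
Qed.

Lemma mpr_markov mu (F : mOm mu -> R) (c : R) : 0 < c -> (forall w, 0 <= F w) ->
 mpr (fun w => ~ (F w <= c)) <= mE F / c.
Proof.
move=> c0 F0; rewrite ler_pdivlMr // mulrC -EEZ; apply: le_mE => w.
case: asboolP => [/negP|_]; last by rewrite mulr0.
by rewrite mulr1 -ltNge => /ltW.
Qed.

(** The threshold depends on [D] but not on [u]. Uniformity in any parameter is obtained by making
    that parameter part of [U]. *)
Definition whp (U : Type) (mu : U -> model) (A : forall u, mOm (mu u) -> Prop) : Prop :=
 forall D : nat, exists N0 : nat, forall u, (N0 <= msize (mu u))%N ->
  mpr (fun w => ~ A u w) <= (msize (mu u))%:R ^- D.

Section Whp.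
Variables (U : Type) (mu : U -> model).
Notation Nu u := ((msize (mu u))%:R : R).

Lemma whp_ev (A B : forall u, mOm (mu u) -> Prop) :
 (exists N0 : nat, forall u, (N0 <= msize (mu u))%N -> forall w, A u w -> B u w) ->
 whp A -> whp B.
Proof.
move=> [N1 AB] wA D; have [N0 H] := wA D; exists (maxn N0 N1) => u.
rewrite geq_max => /andP[h0 h1]; apply: leT (H u h0); apply: mpr_le => w nB Aw.
by apply: nB; exact: AB.
Qed.

Lemma whp_mono (A B : forall u, mOm (mu u) -> Prop) :
 (forall u w, A u w -> B u w) -> whp A -> whp B.
Proof. by move=> AB; apply: whp_ev; exists 0%N => u _; exact: AB. Qed.

Lemma natr_pow_ge (C : R) (k : nat) : (0 < k)%N -> exists N0 : nat, forall N : nat,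
 (N0 <= N)%N -> C <= N%:R ^+ k.
Proof.
move=> k0; exists (Num.Def.archi_bound `|C|).+1 => N hN.
have N1 : (1 <= N)%N by apply: leq_trans hN.
apply: (le_mid (N%:R)).
 apply: (le_mid `|C|); first exact: ler_norm.
 rewrite ltW // (lt_le_trans (archi_boundP (normr_ge0 C))) // ler_nat.
 exact: ltnW.
by rewrite -[leLHS]expr1 ler_weXn2l // ler1n.
Qed.

Lemma whp_and (A B : forall u, mOm (mu u) -> Prop) :
 whp A -> whp B -> whp (fun u w => A u w /\ B u w).
Proof.
move=> wA wB D; have [N0 HA] := wA D.+1; have [N1 HB] := wB D.+1.
have [N2 H2] := @natr_pow_ge 2 1 isT.
exists (maxn (maxn N0 N1) (maxn N2 1)) => u; rewrite !geq_max -!andbA => /and4P[h0 h1 h2 h3].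
apply: (le_mid (mpr (fun w => ~ A u w \/ ~ B u w))).
 by apply: mpr_le => w /not_andP.
apply: (leT (mpr_or _ _)); apply: (leT (lerD (HA u h0) (HB u h1))).
have N0' : 0 < Nu u by sgn.
rewrite exprSr invfM -mulrDr ler_piMr; try sgn.
have := H2 _ h2; rewrite expr1 => N2'.
by rewrite -mulr2n -[_ *+ 2]mulr_natl ler_pdivrMr ?mul1r.
Qed.

(** Union bound: the events are taken with exponent [D + m + 1], of which [m] powers pay for the
    number of events and one for [c]. *)
Lemma whp_forall (I : U -> finType) (m : nat) (c : R) (A : forall u, I u -> mOm (mu u) -> Prop) :
 (forall u, (#|I u|)%:R <= c * Nu u ^+ m) ->
 @whp {u : U & I u} (fun x => mu (projT1 x)) (fun x => A (projT1 x) (projT2 x)) ->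
 whp (fun u w => forall i, A u i w).
Proof.
move=> cI H D; have [N0 HN0] := H (D + m).+1.
have [N1 HN1] := @natr_pow_ge c 1 isT.
exists (maxn N0 (maxn N1 1)) => u; rewrite !geq_max => /and3P[h0 h1 h2].
have N0' : 0 < Nu u by sgn.
apply: (le_mid (mpr (fun w => exists i, ~ A u i w))).
 by apply: mpr_le => w /existsNP.
apply: (leT (mpr_exists _)).
apply: (le_mid (\sum_(i : I u) Nu u ^- (D + m).+1)).
 by apply: ler_sum => i _; exact: (HN0 (existT _ u i)).
rewrite sumr_const -[leLHS]mulr_natl.
apply: (le_mid (Nu u ^+ m.+1 * Nu u ^- (D + m).+1)).
 rewrite leMr ?invr_ge0 ?exprn_ge0 //; apply: (leT (cI u)).
 by rewrite exprS leMr ?exprn_ge0 //; have := HN1 _ h1; rewrite expr1.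
by rewrite -addnS exprD invfM mulrCA divff ?mulr1 // expf_neq0 // gt_eqF.
Qed.

Lemma powR_nat_ge (e : R) (D : nat) : 0 < e -> exists k : nat, (0 < k)%N /\
 forall N : nat, (0 < N)%N -> N%:R ^+ D <= (N%:R `^ e) ^+ k :> R.
Proof.
move=> e0; exists (Num.Def.archi_bound (D%:R / e)).+1; split=> // N N0.
rewrite -!powR_mulrn ?powR_ge0 // -powRrM ler_powR ?ler1n // mulrC -ler_pdivrMr //.
by rewrite ltW // (lt_le_trans (archi_boundP _)) ?divr_ge0 ?(ltW e0) // ler_nat.
Qed.

Lemma powR_ge_ev (C e : R) : 0 < e -> exists N0 : nat, forall N : nat,
 (N0 <= N)%N -> C <= N%:R `^ e.
Proof.
move=> e0; have [k [k0 Hk]] := powR_nat_ge 1 e0.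
have [N0 HN0] := @natr_pow_ge (`|C| ^+ k + 1) 1 isT.
exists (maxn N0 1) => N; rewrite geq_max => /andP[h0 h1].
apply: (leT (ler_norm C)).
rewrite -(@ler_pXn2r _ k); try sgn.
apply: leT (Hk N h1); apply: leT (HN0 N h0).
by rewrite lerDl.
Qed.

(** Markov's inequality for a power so high that [N^(e k) >= N^(D+1)]; the additional factor [N]
    absorbs the moment constant. *)
Lemma whp_moments (X : forall u, mOm (mu u) -> R) :
 (forall u w, 0 <= X u w) ->
 (forall k : nat, exists C : R, forall u, mE (fun w => X u w ^+ k.+1) <= C) ->
 forall e : R, 0 < e -> whp (fun u w => X u w <= Nu u `^ e).
Proof.
move=> X0 HX e e0 D; have [k [k0 Hk]] := powR_nat_ge D.+1 e0.
case: k k0 Hk => // k _ Hk; have [C HC] := HX k.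
have [N0 HN0] := @natr_pow_ge C 1 isT.
exists (maxn N0 1) => u; rewrite geq_max => /andP[h0 h1].
have N0' : 0 < Nu u by rewrite ltr0n.
have P0 : 0 < Nu u `^ e by rewrite powR_gt0.
apply: (le_mid (mpr (fun w => ~ (X u w ^+ k.+1 <= (Nu u `^ e) ^+ k.+1)))).
 by apply: mpr_le => w; apply: contra_not; rewrite ler_pXn2r // nnegrE ?(ltW P0).
apply: (leT (mpr_markov _ _)); rewrite ?exprn_gt0 //.
 by move=> w; rewrite exprn_ge0.
rewrite ler_pdivrMr ?exprn_gt0 //; apply: (leT (HC u)).
apply: (leT (HN0 _ h0)); rewrite expr1.
rewrite mulrC ler_pdivlMr ?exprn_gt0 // -exprS; exact: Hk.
Qed.

End Whp.
End Models.

Notation "''J_' mu" := 'I_(mdim mu) (at level 0, mu at level 2, only parsing).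
Notation mSG G s := (\sum_t (mS s t)%:C * G t t) (only parsing).

(** * Large deviation bounds for linear and quadratic forms in one row *)

Section LargeDeviationMoments.
Variables (R : realType) (kap : nat -> R) (cn vmax : R).
Notation good := (good_model kap cn vmax).

Section Row.
Variables (mu : model R) (s : 'J_mu).
Hypothesis gmu : good mu.
Notation n := (mdim mu).
Notation Nr := ((msize mu)%:R : R).

Definition row_seq : seq {set 'I_n} :=
 [seq [set s; t]%SET | t <- enum 'I_n & t != s].

Definition oth (k : {set 'I_n}) : 'I_n :=
 odflt s [pick t | (t != s) && (k == [set s; t]%SET)].

(** Cut off outside the row, so that the moment hypotheses of the chaos bounds hold at every
    coordinate and not only at those carrying an entry of row [s]. *)
Definition rzeta (k : {set 'I_n}) (v : mval mu) : R :=
 if k \in row_seq then mxi k v else 0.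

Lemma pair_inj (t t' : 'I_n) : t != s -> t' != s ->
 [set s; t]%SET = [set s; t']%SET -> t = t'.
Proof.
move=> ts t's /setP/(_ t); rewrite !inE eqxx (negbTE ts) /= => /esym.
by move/eqP.
Qed.

Lemma oth_pair t : t != s -> oth [set s; t]%SET = t.
Proof.
move=> ts; rewrite /oth; case: pickP => [t' /andP[t's /eqP/pair_inj ->] //|/(_ t)].
by rewrite ts eqxx.
Qed.

Lemma row_seq_uniq : uniq row_seq.
Proof.
rewrite map_inj_in_uniq ?filter_uniq //; first by rewrite -enumT; exact: enum_uniq.
move=> t t'.
by rewrite !mem_filter => /andP[ts _] /andP[t's _]; exact: pair_inj.
Qed.

Lemma row_seqP k : reflect (exists2 t, t != s & k = [set s; t]%SET) (k \in row_seq).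
Proof.
apply: (iffP mapP) => [[t]|[t ts ->]].
 by rewrite mem_filter => /andP[ts _] ->; exists t.
by exists t => //; rewrite mem_filter ts mem_enum.
Qed.

Lemma sum_row_seq (U : nmodType) (f : {set 'I_n} -> U) :
 \sum_(k <- row_seq) f k = \sum_(t | t != s) f [set s; t]%SET.
Proof. by rewrite big_map big_filter big_enum_cond. Qed.

Lemma rzeta_pair (w : mOm mu) t : t != s ->
 rzeta [set s; t]%SET (w [set s; t]%SET) = mh w s t.
Proof.
move=> ts; rewrite /rzeta ifT; last by apply/row_seqP; exists t.
by rewrite /mh eq_sym (negbTE ts).
Qed.

Lemma rzeta_mean k : EE (mlaw (m:=mu)) (fun w => rzeta k (w k)) = 0.
Proof.
rewrite (EE_coord (mlaw_sum1 (m:=mu)) k (rzeta k)) /rzeta.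
case: (k \in row_seq); first exact: mxi_mean.
by rewrite big1 // => v _; rewrite mulr0.
Qed.

Let v0 (t : 'I_n) : 0 < mvar t. Proof. by have [_ _ /(_ t)/andP[]] := gmu. Qed.
Let N0 : 0 < Nr. Proof. by have [/andP[N0 _] _ _ _] := gmu; rewrite ltr0n. Qed.

Lemma kap_ge0 t q : t != s -> 0 <= kap q.
Proof.
move=> ts; have [_ _ _ /(_ s t q) H] := gmu.
have : 0 <= kap q * (mvar s * mvar t) ^+ q.
 by apply: leT H; apply: mE_ge0 => w; rewrite exprn_ge0 // mulr_ge0 ?sqr_ge0 ?ler0n.
by rewrite pmulr_lge0; sgn.
Qed.

Definition vv k : R := mvar s * mvar (oth k) / Nr.

Lemma vv_ge0 k : 0 <= vv k.
Proof. by rewrite /vv; sgn. Qed.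

Lemma rzeta_mom k q : (0 < q)%N ->
 EE (mlaw (m:=mu)) (fun w => rzeta k (w k) ^+ (2 * q)) <= `|kap q| * vv k ^+ q.
Proof.
move=> q0; case: (boolP (k \in row_seq)) => [/row_seqP[t ts ->]|kr]; last first.
 under eq_EE do rewrite /rzeta (negbTE kr) expr0n muln_eq0 /= eqn0Ngt q0 /=.
 by rewrite (EEC (mlaw_sum1 (m:=mu))) mulr_ge0 ?exprn_ge0 // vv_ge0.
under eq_EE do rewrite rzeta_pair //.
have [_ _ _ /(_ s t q)] := gmu; rewrite /vv oth_pair // (ger0_norm (kap_ge0 _ ts)).
rewrite expr_div_n mulrA ler_pdivlMr; try sgn.
move=> H; apply: leT H; apply: eq_ler.
by rewrite /mE mulrC -EEZ; apply: eq_EE => w; rewrite exprMn exprM.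
Qed.

Lemma lin_row (w : mOm mu) (a : 'I_n -> R[i]) :
 \sum_t (mh w s t)%:C * a t =
 \sum_(k <- row_seq) (rzeta k (w k))%:C * a (oth k).
Proof.
rewrite sum_row_seq (bigD1 s) //= /mh eqxx mul0r add0r.
by apply: eq_bigr => t ts; rewrite rzeta_pair // oth_pair // /mh.
Qed.

End Row.

Lemma le_scale_expr (c x : R) q : 0 <= c -> 0 <= x -> (0 < q)%N ->
 c * x ^+ q <= ((1 + c) * x) ^+ q.
Proof.
move=> c0 x0; case: q => // q _; rewrite exprMn leMr; try sgn.
apply: (le_mid ((1 + c) ^+ 1)); first by rewrite expr1; lra.
by rewrite ler_weXn2l //; lra.
Qed.

Lemma exprD_ge (x y : R) q : 0 <= x -> 0 <= y -> x ^+ q.+1 + y ^+ q.+1 <= (x + y) ^+ q.+1.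
Proof.
move=> x0 y0; rewrite 3!exprSr mulrDr lerD // leMr //; apply: ler_Xn; lra.
Qed.

Section Chaos.
Variables (k : nat) (mu : model R) (s : 'J_mu).
Hypothesis gmu : good mu.
Notation Nr := ((msize mu)%:R : R).
Notation h := mh.

(** The chaos bounds ask for one variance proxy controlling the second and the [2(k+1)]-th moment;
    this constant dominates both. *)
Definition lin_const : R := locked (1 + (`|kap 1| + `|kap k.+1|)).

Let rk (j : {set 'J_mu}) : R := lin_const * vv s j.
Let lin_const_ge1 : 1 <= lin_const.
Proof. by rewrite /lin_const -lock lerDl addr_ge0. Qed.
Let vv0 := vv_ge0 s gmu.
Let rk_ge0 j : 0 <= rk j.
Proof. by rewrite mulr_ge0 //; apply: leT lin_const_ge1. Qed.
Let rk_mom1 j : EE (mlaw (m:=mu)) (fun w => rzeta s j (w j) ^+ 2) <= rk j.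
Proof.
have := rzeta_mom s gmu j (q := 1) isT; rewrite muln1 expr1 => /leT; apply.
by rewrite leMr // /lin_const -lock; have := normr_ge0 (kap k.+1); lra.
Qed.

Let rk_momk j : EE (mlaw (m:=mu)) (fun w => rzeta s j (w j) ^+ (2 * k.+1)) <= rk j ^+ k.+1.
Proof.
apply: (leT (rzeta_mom s gmu j (q := k.+1) isT)).
apply: (leT (le_scale_expr _ _ _)) => //.
apply: ler_Xn; rewrite //; first by apply: mulr_ge0; try sgn.
by rewrite leMr // /lin_const -lock; have := normr_ge0 (kap 1); lra.
Qed.

Lemma lde_lin_moment (a : 'J_mu -> R[i]) (A : R) : 0 < A ->
  mvar s / Nr * (\sum_t mvar t * cabs (a t) ^+ 2) <= A ->
  mE (fun w : mOm mu => (cabs (\sum_t (mh w s t)%:C * a t) ^+ 2) ^+ k.+1)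
  <= ((1 + hyper_const R k * lin_const) * A) ^+ k.+1.
Proof.
move=> A0 hA; have hc := hyper_const_ge1 R k; set c := hyper_const R k in hc *.
have Sk0 : 0 <= \sum_(j <- row_seq s) rk j by sgn.
(* Chosen so that all contributions of the regularization add up to exactly [A]. *)
pose t := A / (1 + c * \sum_(j <- row_seq s) rk j).
have D0 : 0 < 1 + c * \sum_(j <- row_seq s) rk j by rewrite ltr_pwDl // mulr_ge0 //; lra.
have t0 : 0 < t by rewrite divr_gt0.
rewrite /mE; under eq_EE do rewrite lin_row.
apply: (leT (linear_chaos (mlaw_ge0 (m:=mu)) (mlaw_sum1 (m:=mu))
 (fun j => a (oth s j)) rk_ge0 (rzeta_mean s) rk_mom1 rk_momk (row_seq_uniq s) t0)).
have c0 : 0 <= c by lra.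
apply: ler_Xn.
- rewrite addr_ge0 ?(ltW t0) // mulr_ge0 // sumr_ge0 // => j _.
 sgn.
- by rewrite mulr_ge0 ?(ltW A0) // addr_ge0 // mulr_ge0 // ltW // (lt_le_trans ltr01).
- rewrite (eq_bigr (fun j => rk j * cabs (a (oth s j)) ^+ 2 + t * rk j)); last first.
  by move=> j _; rewrite mulrDr (mulrC t).
 rewrite big_split -mulr_sumr mulrDr addrCA mulrDl addrC /=.
 have -> : t + c * (t * \sum_(i <- row_seq s) rk i) = A.
  by rewrite mulrCA -[X in X + _]mulr1 -mulrDr /t mulfVK // gt_eqF.
 rewrite mul1r lerD2l -mulrA leMl // /rk.
 under eq_bigr do rewrite -mulrA.
 rewrite -mulr_sumr leMl //; first by apply: leT lin_const_ge1.
 apply: leT hA; rewrite sum_row_seq mulr_sumr [leRHS](bigD1 s) //=.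
 rewrite -[leLHS]add0r lerD //; last first.
  apply: ler_sum => i is'; rewrite /vv oth_pair //.
  by apply: eq_ler; ring.
 have [_ _ vs _] := gmu; have /andP[vs0 _] := vs s.
 sgn.
Qed.

Lemma sym_pair_sum (T : finType) (l : seq T) (F : T -> T -> R[i]) :
 (forall i j, F i j = F j i) ->
 \sum_(i <- l) \sum_(j <- l) F i j = \sum_(i <- l) F i i + (pair_sum l F) *+ 2.
Proof.
move=> Fs; elim: l => [|x l IH] /=; first by rewrite !big_nil mul0rn addr0.
have E : \sum_(i <- l) \sum_(j <- x :: l) F i j =
  \sum_(i <- l) F x i + \sum_(i <- l) \sum_(j <- l) F i j.
 by rewrite -big_split; apply: eq_bigr => i _; rewrite big_cons Fs.
rewrite big_cons E IH !big_cons.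
by rewrite mulrnDl [_ *+ 2 in RHS]mulr2n; ring.
Qed.

Lemma lde_pair_moment (a : 'J_mu -> 'J_mu -> R[i]) (A : R) : 0 < A ->
 (mvar s / Nr) ^+ 2 * (\sum_t \sum_r mvar t * mvar r * cabs (a t r) ^+ 2) <= A ->
 mE (fun w : mOm mu => (cabs (pair_sum (row_seq s) (fun j i =>
  (rzeta s j (w j))%:C * ((rzeta s i (w i))%:C * a (oth s j) (oth s i)))) ^+ 2) ^+ k.+1)
  <= ((1 + (hyper_const R k * lin_const) ^+ 2) * A) ^+ k.+1.
Proof.
move=> A0 hA; have hc := hyper_const_ge1 R k; set c := hyper_const R k in hc *.
have c0 : 0 <= c by lra.
pose K := \sum_(j <- row_seq s) rk j; have K0 : 0 <= K by sgn.
(* As for the linear form: the terms containing [t] now sum to [t (1 + c K + (c K)^2) = A]. *)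
pose t := A / (1 + c * K + (c * K) ^+ 2).
have cK : 0 <= c * K by sgn.
have D0 : 0 < 1 + c * K + (c * K) ^+ 2 by rewrite -addrA ltr_pwDl; sgn.
have t0 : 0 < t by rewrite divr_gt0.
apply: (leT (quadratic_chaos (mlaw_ge0 (m:=mu)) (mlaw_sum1 (m:=mu))
 (fun j i => a (oth s j) (oth s i)) rk_ge0 (rzeta_mean s) rk_mom1 rk_momk (row_seq_uniq s) t0)).
rewrite -/c; apply: ler_Xn.
- rewrite addr_ge0 ?(ltW t0) // sumr_ge0 // => j _.
 apply: mulr_ge0 => //; apply: mulr_ge0 => //; rewrite addr_ge0 ?(ltW t0) // mulr_ge0 // sumr_ge0 // => i _.
 sgn.
- sgn.
- have -> : t + \sum_(j <- row_seq s) c * (rk j * (t + c * \sum_(i <- row_seq s)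
  rk i * (cabs (a (oth s j) (oth s i)) ^+ 2 + t))) =
  t * (1 + c * K + (c * K) ^+ 2) + c ^+ 2 * \sum_(j <- row_seq s) \sum_(i <- row_seq s)
  rk j * rk i * cabs (a (oth s j) (oth s i)) ^+ 2.
  rewrite (eq_bigr (fun j => (c * t + c ^+ 2 * t * K) * rk j + c ^+ 2 * \sum_(i <- row_seq s)
  rk j * rk i * cabs (a (oth s j) (oth s i)) ^+ 2)); last first.
  move=> j _; rewrite (eq_bigr (fun i => rk i * cabs (a (oth s j) (oth s i)) ^+ 2 + t * rk i)); last first.
  by move=> i _; rewrite mulrDr (mulrC t).
  rewrite big_split -mulr_sumr /= -/K.
  rewrite [X in _ = _ + c ^+ 2 * X](eq_bigr (fun i => rk j * (rk i * cabs (a (oth s j) (oth s i)) ^+ 2))); last first.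
  by move=> i _; rewrite mulrA.
  by rewrite -mulr_sumr; ring.
  rewrite big_split /= -[X in t + (X + _)]mulr_sumr -[X in t + (_ + X)]mulr_sumr -/K.
  by ring.
 have tE : t * (1 + c * K + (c * K) ^+ 2) = A by rewrite /t mulfVK // gt_eqF.
 rewrite tE mulrDl mul1r lerD2l [(c * lin_const) ^+ 2]exprMn -[leRHS]mulrA leMl ?sqr_ge0 //.
 have -> : \sum_(j <- row_seq s) \sum_(i <- row_seq s) rk j * rk i * cabs (a (oth s j) (oth s i)) ^+ 2 =
  lin_const ^+ 2 * \sum_(j <- row_seq s) \sum_(i <- row_seq s) vv s j * vv s i * cabs (a (oth s j) (oth s i)) ^+ 2.
  rewrite mulr_sumr; apply: eq_bigr => j _; rewrite mulr_sumr; apply: eq_bigr => i _.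
  by rewrite /rk; ring.
 rewrite leMl ?sqr_ge0 //; apply: leT hA.
 have [_ _ vs _] := gmu; have v0 (r : 'J_mu) : 0 <= mvar r by have /andP[/ltW] := vs r.
 rewrite sum_row_seq mulr_sumr [leRHS](bigD1 s) //= -[leLHS]add0r lerD //.
  sgn.
 apply: ler_sum => i is'; rewrite sum_row_seq mulr_sumr [leRHS](bigD1 s) //= -[leLHS]add0r lerD //.
  sgn.
 apply: ler_sum => r rs; rewrite /vv !oth_pair //.
 by apply: eq_ler; ring.
Qed.

Definition diag_const : R := locked (1 + `|kap 2| +
 4 ^+ k.+1 * (`|kap (2 * k.+1)| + `|kap 1| ^+ (2 * k.+1))).

Let dk (j : {set 'J_mu}) : R := diag_const * vv s j ^+ 2.
Let dz (j : {set 'J_mu}) (v : mval mu) : R :=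
 rzeta s j v ^+ 2 - EE (mlaw (m:=mu)) (fun w => rzeta s j (w j) ^+ 2).

Let var_le j : 0 <= EE (mlaw (m:=mu)) (fun w => rzeta s j (w j) ^+ 2) <= `|kap 1| * vv s j.
Proof.
apply/andP; split; first by apply: EE_ge0 => [|w]; [exact: mlaw_ge0|exact: sqr_ge0].
by have := rzeta_mom s gmu j (q := 1) isT; rewrite muln1 expr1.
Qed.

Let diag_const_ge1 : 1 <= diag_const.
Proof. by rewrite /diag_const -lock -addrA lerDl; sgn. Qed.
Let dz_mean j : EE (mlaw (m:=mu)) (fun w => dz j (w j)) = 0.
Proof. by rewrite /dz EEB (EEC (mlaw_sum1 (m:=mu))) subrr. Qed.
Let dz_mom1 j : EE (mlaw (m:=mu)) (fun w => dz j (w j) ^+ 2) <= dk j.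
Proof.
have /andP[] := var_le j; rewrite /dz; set m := EE _ _ => m0 _.
rewrite (@eq_EE _ _ _ _ _ (fun w => rzeta s j (w j) ^+ (2 * 2) - (2 * m) * rzeta s j (w j) ^+ 2 + m ^+ 2)); last first.
 by move=> w; rewrite exprM; ring.
rewrite EED EEB EEZ (EEC (mlaw_sum1 (m:=mu))) -/m.
have := rzeta_mom s gmu j (q := 2) isT; set x := EE _ _; set y := _ ^+ 2 => h.
have y0 : 0 <= y by exact: sqr_ge0.
apply: (le_mid (`|kap 2| * y)).
 by apply: leT h; have := sqr_ge0 m; rewrite expr2; lra.
by rewrite leMr // /diag_const -lock [leRHS]addrAC lerDr; sgn.
Qed.

Let dz_momk j : EE (mlaw (m:=mu)) (fun w => dz j (w j) ^+ (2 * k.+1)) <= dk j ^+ k.+1.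
Proof.
have /andP[] := var_le j; rewrite /dz; set m := EE _ _ => m0 m1.
set q := (2 * k.+1)%N.
have vj : 0 <= vv s j by [].
apply: (le_mid (EE (mlaw (m:=mu)) (fun w => 2 ^+ q * (rzeta s j (w j) ^+ (2 * q) + m ^+ q)))).
 apply: le_EE => [|w]; first exact: mlaw_ge0.
 have z0 := sqr_ge0 (rzeta s j (w j)).
 rewrite (exprM _ 2 q); apply: leT (exprD_le_2exp q z0 m0).
 rewrite /q !(exprM _ 2); leXn.
 by have := mulr_ge0 z0 m0; rewrite sqrrB sqrrD; lra.
rewrite EEZ EED (EEC (mlaw_sum1 (m:=mu))).
apply: (le_mid (2 ^+ q * (`|kap q| + `|kap 1| ^+ q) * vv s j ^+ q)).
 rewrite -mulrA leMl ?exprn_ge0 // mulrDl lerD //; first exact: rzeta_mom.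
 by rewrite -exprMn; apply: ler_Xn; rewrite // mulr_ge0.
have -> : 2 ^+ q = 4 ^+ k.+1 :> R by rewrite exprM -natrX.
rewrite /q (exprM (vv s j)); apply: (leT (le_scale_expr _ _ _)) => //.
 sgn.
apply: ler_Xn; rewrite //.
- by apply: mulr_ge0; try sgn.
- by apply: mulr_ge0; rewrite ?sqr_ge0 // (leT _ diag_const_ge1).
- by rewrite leMr ?sqr_ge0 // /diag_const -lock lerD2r lerDl.
Qed.

(** The diagonal of a quadratic form is a linear chaos in the centred squares [dz] of the
    entries. *)
Lemma lde_diag_moment (a : 'J_mu -> R[i]) (A : R) : 0 < A ->
 (mvar s / Nr) ^+ 2 * (\sum_t mvar t ^+ 2 * cabs (a t) ^+ 2) <= A ->
 mE (fun w : mOm mu => (cabs (\sum_t ((mh w s t ^+ 2 - mS s t))%:C * a t) ^+ 2) ^+ k.+1)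
  <= ((1 + hyper_const R k * diag_const) * A) ^+ k.+1.
Proof.
move=> A0 hA; have hc := hyper_const_ge1 R k; set c := hyper_const R k in hc *.
have dk0 j : 0 <= dk j by rewrite mulr_ge0 ?sqr_ge0 // (leT _ diag_const_ge1).
have Sk0 : 0 <= \sum_(j <- row_seq s) dk j by sgn.
pose t := A / (1 + c * \sum_(j <- row_seq s) dk j).
have D0 : 0 < 1 + c * \sum_(j <- row_seq s) dk j by rewrite ltr_pwDl // mulr_ge0 //; lra.
have t0 : 0 < t by rewrite divr_gt0.
have E w : \sum_t (mh w s t ^+ 2 - mS s t)%:C * a t =
  \sum_(j <- row_seq s) (dz j (w j))%:C * a (oth s j).
 rewrite sum_row_seq (bigD1 s) //= /mS {1}/mh eqxx expr0n /=.
 rewrite [mE _](_ : _ = 0) ?subrr ?mul0r ?add0r; last first.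
  rewrite /mE -(EEC (mlaw_sum1 (m:=mu)) 0); apply: eq_EE => w'.
  by rewrite /mh eqxx expr0n.
 apply: eq_bigr => i is'; rewrite oth_pair // /dz rzeta_pair //.
 by congr ((_ - _)%:C * _); apply: eq_EE => w'; rewrite rzeta_pair.
rewrite /mE; under eq_EE do rewrite E.
apply: (leT (linear_chaos (mlaw_ge0 (m:=mu)) (mlaw_sum1 (m:=mu))
 (fun j => a (oth s j)) dk0 dz_mean dz_mom1 dz_momk (row_seq_uniq s) t0)).
have c0 : 0 <= c by lra.
have d0 : 0 <= diag_const by apply: leT diag_const_ge1.
apply: ler_Xn.
- rewrite addr_ge0 ?(ltW t0) // mulr_ge0 // sumr_ge0 // => j _.
 sgn.
- sgn.
- rewrite (eq_bigr (fun j => dk j * cabs (a (oth s j)) ^+ 2 + t * dk j)); last first.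
  by move=> j _; rewrite mulrDr (mulrC t).
 rewrite big_split -mulr_sumr mulrDr addrCA mulrDl addrC /=.
 have -> : t + c * (t * \sum_(i <- row_seq s) dk i) = A.
  by rewrite mulrCA -[X in X + _]mulr1 -mulrDr /t mulfVK // gt_eqF.
 rewrite mul1r lerD2l -mulrA leMl // /dk.
 under eq_bigr do rewrite -mulrA.
 rewrite -mulr_sumr leMl //.
 apply: leT hA; rewrite sum_row_seq mulr_sumr [leRHS](bigD1 s) //=.
 rewrite -[leLHS]add0r lerD //; last first.
  apply: ler_sum => i is'; rewrite /vv oth_pair //.
  by apply: eq_ler; ring.
 sgn.
Qed.

Definition quad_form_const : R :=
 2 * (2 * (1 + hyper_const R k * diag_const) + 8 * (1 + (hyper_const R k * lin_const) ^+ 2)).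

(** By symmetry of [a], the centred form is its centred diagonal plus twice a sum over unordered
    pairs, and the two chaos bounds apply separately. *)
Lemma lde_quad_moment (a : 'J_mu -> 'J_mu -> R[i]) (A : R) : 0 < A ->
 (forall t r, a t r = a r t) ->
 (mvar s / Nr) ^+ 2 * (\sum_t \sum_r mvar t * mvar r * cabs (a t r) ^+ 2) <= A ->
 mE (fun w : mOm mu => (cabs (\sum_t \sum_r (mh w s t)%:C * a t r * (mh w r s)%:C
  - \sum_t (mS s t)%:C * a t t) ^+ 2) ^+ k.+1)
  <= (quad_form_const * A) ^+ k.+1.
Proof.
move=> A0 asym hA.
pose P w := pair_sum (row_seq s) (fun j i =>
  (rzeta s j (w j))%:C * ((rzeta s i (w i))%:C * a (oth s j) (oth s i))).
pose Q w := \sum_t ((mh w s t ^+ 2 - mS s t))%:C * a t t.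
have [_ _ vs _] := gmu.
have v0 (r : 'J_mu) : 0 <= mvar r by have /andP[/ltW] := vs r.
have E (w : mOm mu) : \sum_t \sum_r (mh w s t)%:C * a t r * (mh w r s)%:C
  - \sum_t (mS s t)%:C * a t t = Q w + (P w) *+ 2.
 have -> : \sum_t \sum_r (mh w s t)%:C * a t r * (mh w r s)%:C =
  \sum_(j <- row_seq s) \sum_(i <- row_seq s)
  (rzeta s j (w j))%:C * ((rzeta s i (w i))%:C * a (oth s j) (oth s i)).
  rewrite (eq_bigr (fun t => (mh w s t)%:C * \sum_(i <- row_seq s) ((rzeta s i (w i))%:C * a t (oth s i)))).
  by rewrite lin_row; apply: eq_bigr => j _; rewrite mulr_sumr.
  move=> t _; rewrite -lin_row mulr_sumr; apply: eq_bigr => r _.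
  by rewrite [mh w r s](mh_sym w).1; ring.
 rewrite sym_pair_sum; last first.
  by move=> i j; rewrite [a (oth s j) _]asym; ring.
 rewrite /P addrAC; congr (_ + _); rewrite /Q.
 under [RHS]eq_bigr do rewrite rmorphB mulrBl.
 rewrite sumrB; congr (_ - _).
 rewrite (eq_bigr (fun t => (mh w s t)%:C * ((mh w s t)%:C * a t t))); last first.
  by move=> t _; rewrite rmorphXn /=; ring.
 rewrite sum_row_seq [RHS](bigD1 s) //= {1}/mh eqxx mul0r add0r.
 by apply: eq_bigr => t ts; rewrite oth_pair // rzeta_pair.
rewrite /mE; under eq_EE do rewrite E.
set C1 := 1 + hyper_const R k * diag_const; set C2 := 1 + (hyper_const R k * lin_const) ^+ 2.
have hc := hyper_const_ge1 R k.
have C10 : 0 <= C1.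
 by rewrite addr_ge0 // mulr_ge0 //; [lra | apply: leT diag_const_ge1].
have C20 : 0 <= C2 by rewrite addr_ge0 ?sqr_ge0.
have hQ : EE (mlaw (m:=mu)) (fun w => (cabs (Q w) ^+ 2) ^+ k.+1) <= (C1 * A) ^+ k.+1.
 apply: lde_diag_moment => //; apply: leT hA; rewrite leMl ?sqr_ge0 //.
 apply: ler_sum => t _; rewrite (bigD1 t) //= -expr2 lerDl.
 sgn.
have hP : EE (mlaw (m:=mu)) (fun w => (cabs (P w) ^+ 2) ^+ k.+1) <= (C2 * A) ^+ k.+1.
 exact: lde_pair_moment.
apply: (le_mid (EE (mlaw (m:=mu)) (fun w => 2 ^+ k.+1 * (2 ^+ k.+1 * (cabs (Q w) ^+ 2) ^+ k.+1
  + 8 ^+ k.+1 * (cabs (P w) ^+ 2) ^+ k.+1)))).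
 apply: le_EE => [|w]; first exact: mlaw_ge0.
 rewrite -!exprMn; apply: (le_mid ((2 * cabs (Q w) ^+ 2 + 8 * cabs (P w) ^+ 2) ^+ k.+1)); last first.
  by apply: exprD_le_2exp; sgn.
 apply: ler_Xn; [sgn|sgn|].
 have := cabsD (Q w) (P w *+ 2); have -> : cabs (P w *+ 2) = 2 * cabs (P w).
  by rewrite -[P w *+ 2]mulr_natl cabsM -natC cabsR ger0_norm.
 have := cabs_ge0 (Q w); have := cabs_ge0 (P w); have := cabs_ge0 (Q w + P w *+ 2).
 set x := cabs _; set y := cabs (P w); set z := cabs (Q w) => x0 y0 z0 xyz.
 apply: (le_mid ((z + 2 * y) ^+ 2)).
  by apply: ler_Xn; rewrite //; lra.
 by have := sqr_ge0 (z - 2 * y); rewrite !expr2; lra.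
rewrite EEZ EED !EEZ.
apply: (le_mid (2 ^+ k.+1 * (2 ^+ k.+1 * (C1 * A) ^+ k.+1 + 8 ^+ k.+1 * (C2 * A) ^+ k.+1))).
 by rewrite leMl ?exprn_ge0 // lerD // leMl ?exprn_ge0.
rewrite -!exprMn.
have -> : quad_form_const * A = 2 * (2 * (C1 * A) + 8 * (C2 * A)).
 by rewrite /quad_form_const -/C1 -/C2; ring.
rewrite [leRHS]exprMn leMl; try sgn.
have x0 : 0 <= 2 * (C1 * A) by sgn.
have y0 : 0 <= 8 * (C2 * A) by sgn.
exact: exprD_ge.
Qed.

Lemma mh_merge (w' w0 : mOm mu) t : mh (merge (mrow s) w' w0) s t = mh w' s t.
Proof. by rewrite /mh ffunE !inE eqxx. Qed.

Lemma mh_merge_r (w' w0 : mOm mu) t : mh (merge (mrow s) w' w0) t s = mh w' t s.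
Proof. by rewrite ![mh _ t s](mh_sym _).1 mh_merge. Qed.

(** Coefficients and normalization that do not involve row [s] are frozen by conditioning on the
    other rows. This is why the size [al] may itself be random. *)
Lemma lde_lin_cond (a : 'J_mu -> mOm mu -> R[i]) (al : mOm mu -> R) :
 (forall t, indep (mrow s) (a t)) -> indep (mrow s) al -> (forall w, 0 < al w) ->
 (forall w, mvar s / Nr * (\sum_t mvar t * cabs (a t w) ^+ 2) <= al w) ->
 mE (fun w : mOm mu => (cabs (\sum_t (mh w s t)%:C * a t w) ^+ 2 / al w) ^+ k.+1)
  <= (1 + hyper_const R k * lin_const) ^+ k.+1.
Proof.
move=> ia ial al0 ha; rewrite /mE -(EE_Ex (mlaw_sum1 (m:=mu)) (mrow s)).
rewrite -[leRHS](EEC (mlaw_sum1 (m:=mu))).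
apply: le_EE => [|w0]; first exact: mlaw_ge0.
rewrite Ex_EE; under eq_EE => w'.
 under eq_bigr do rewrite mh_merge ia.
 rewrite ial exprMn mulrC; over.
rewrite EEZ exprVn ler_pdivrMl ?exprn_gt0 // -exprMn mulrC.
exact: lde_lin_moment.
Qed.

Lemma lde_quad_cond (a : 'J_mu -> 'J_mu -> mOm mu -> R[i]) (al : mOm mu -> R) :
 (forall t r, indep (mrow s) (a t r)) -> indep (mrow s) al -> (forall w, 0 < al w) ->
 (forall t r w, a t r w = a r t w) ->
 (forall w, (mvar s / Nr) ^+ 2 *
  (\sum_t \sum_r mvar t * mvar r * cabs (a t r w) ^+ 2) <= al w) ->
 mE (fun w : mOm mu => (cabs (\sum_t \sum_r (mh w s t)%:C * a t r w * (mh w r s)%:C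
  - \sum_t (mS s t)%:C * a t t w) ^+ 2 / al w) ^+ k.+1)
  <= quad_form_const ^+ k.+1.
Proof.
move=> ia ial al0 asym ha; rewrite /mE -(EE_Ex (mlaw_sum1 (m:=mu)) (mrow s)).
rewrite -[leRHS](EEC (mlaw_sum1 (m:=mu))).
apply: le_EE => [|w0]; first exact: mlaw_ge0.
rewrite Ex_EE; under eq_EE => w'.
 under eq_bigr => t _.
  under eq_bigr => r _ do rewrite mh_merge ia mh_merge_r.
  over.
 under [X in _ - X]eq_bigr do rewrite ia.
 rewrite ial exprMn mulrC; over.
rewrite EEZ exprVn ler_pdivrMl ?exprn_gt0 // -exprMn mulrC.
by apply: lde_quad_moment.
Qed.
End Chaos.

Section Families.
Variables (U : Type) (mu : U -> model R) (s : forall u, 'J_(mu u)).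
Hypothesis gmu : forall u, good (mu u).
Notation Nr u := ((msize (mu u))%:R : R).

Lemma whp_sqr (L al : forall u, mOm (mu u) -> R) :
 (forall u w, 0 <= L u w) -> (forall u w, 0 < al u w) ->
 (forall e, 0 < e -> whp (fun u w => L u w ^+ 2 / al u w <= Nr u `^ e)) ->
 forall e, 0 < e -> whp (fun u w => L u w <= Nr u `^ e * sqrt (al u w)).
Proof.
move=> L0 al0 H e e0; apply: (whp_mono _ (H (e + e) _)); last sgn.
move=> u w; rewrite ler_pdivrMr // => h.
rewrite -ler_sqr; try sgn.
rewrite exprMn sqr_sqrtr ?(ltW (al0 u w)) //; apply: (leT h).
rewrite leMr ?(ltW (al0 u w)) // powRD ?expr2 //.
by apply/implyP => _; have [/andP[N0 _] _ _ _] := gmu u; rewrite pnatr_eq0 -lt0n.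
Qed.

Lemma lde_lin (a : forall u, 'J_(mu u) -> mOm (mu u) -> R[i])
  (al : forall u, mOm (mu u) -> R) :
 (forall u t, indep (mrow (s u)) (a u t)) -> (forall u, indep (mrow (s u)) (al u)) ->
 (forall u w, 0 < al u w) ->
 (forall u w, mvar (s u) / Nr u * (\sum_t mvar t * cabs (a u t w) ^+ 2) <= al u w) ->
 forall e, 0 < e -> whp (fun u w =>
  cabs (\sum_t (mh w (s u) t)%:C * a u t w) <= Nr u `^ e * sqrt (al u w)).
Proof.
move=> ia ial al0 ha; apply: whp_sqr => //; apply: whp_moments => [u w|k].
 by apply: divr_ge0; [exact: sqr_ge0 | exact: ltW].
exists ((1 + hyper_const R k * lin_const k) ^+ k.+1) => u.
exact: lde_lin_cond.
Qed.

Lemma lde_quad (a : forall u, 'J_(mu u) -> 'J_(mu u) -> mOm (mu u) -> R[i])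
  (al : forall u, mOm (mu u) -> R) :
 (forall u t r, indep (mrow (s u)) (a u t r)) -> (forall u, indep (mrow (s u)) (al u)) ->
 (forall u w, 0 < al u w) -> (forall u t r w, a u t r w = a u r t w) ->
 (forall u w, (mvar (s u) / Nr u) ^+ 2 *
  (\sum_t \sum_r mvar t * mvar r * cabs (a u t r w) ^+ 2) <= al u w) ->
 forall e, 0 < e -> whp (fun u w =>
  cabs (\sum_t \sum_r (mh w (s u) t)%:C * a u t r w * (mh w r (s u))%:C
  - \sum_t (mS (s u) t)%:C * a u t t w) <= Nr u `^ e * sqrt (al u w)).
Proof.
move=> ia ial al0 asym ha; apply: whp_sqr => //; apply: whp_moments => [u w|k].
 by apply: divr_ge0; [exact: sqr_ge0 | exact: ltW].
exists (quad_form_const k ^+ k.+1) => u.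
exact: lde_quad_cond.
Qed.

(** The way back from probability to moments: on the exceptional event a polynomial bound on moments
    is enough, because the probability beats every power of [N]. *)
Lemma moments_of_whp (X : forall u, mOm (mu u) -> R) :
 (forall u w, 0 <= X u w) ->
 (forall e, 0 < e -> whp (fun u w => X u w <= Nr u `^ e)) ->
 (forall k : nat, exists C : R, exists m : nat, forall u, mE (fun w => X u w ^+ k) <= C * Nr u ^+ m) ->
 forall (k : nat) (e : R), 0 < e -> exists N0 : nat, forall u, (N0 <= msize (mu u))%N ->
  mE (fun w => X u w ^+ k.+1) <= Nr u `^ e.
Proof.
move=> X0 HX Hm k e e0; pose e' := e / (2 * k.+1%:R).
have e'0 : 0 < e' by rewrite divr_gt0 ?mulr_gt0.
have [C [m HC]] := Hm (k.+1 * 2)%N.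
have [N1 HN1] := HX _ e'0 (m + m)%N.
have e20 : 0 < e / 2 by sgn.
have [N2 HN2] := @powR_ge_ev R (2 + `|C|) (e / 2) e20.
exists (maxn N1 (maxn N2 1)) => u; rewrite !geq_max => /and3P[h1 h2 h3].
have N0 : 0 < Nr u by sgn.
pose B w : R := (`[< ~ (X u w <= Nr u `^ e') >])%:R.
(* On the exceptional event [x <= N^-m x^2 + N^m]: the first term is paid by the polynomial moment,
   the second by the probability [N^(-2m)]. *)
apply: (le_mid (mE (fun w => Nr u `^ (e / 2) +
  (Nr u ^- m * X u w ^+ (k.+1 * 2) + Nr u ^+ m * B w)))).
 apply: le_mE => w; rewrite /B; case: asboolP => [_|/contrapT Xle].
  rewrite mulr1; set x := X u w ^+ k.+1; rewrite exprM -/x.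
  have P0 : 0 < Nr u ^+ m by sgn.
  have : 0 <= Nr u `^ (e / 2) by exact: powR_ge0.
  have : x <= (Nr u ^+ m)^-1 * x ^+ 2 + Nr u ^+ m.
  rewrite -(ler_pM2l P0) mulrDr mulVKf ?gt_eqF //.
  by have := sqr_ge0 (x - Nr u ^+ m); have := sqr_ge0 x; have := sqr_ge0 (Nr u ^+ m); rewrite !expr2; nra.
  by lra.
 rewrite mulr0 addr0 -[leLHS]addr0 lerD //; last first.
  sgn.
 apply: (le_mid ((Nr u `^ e') ^+ k.+1)).
  by leXn.
 rewrite -powR_mulrn ?powR_ge0 // -powRrM /e'.
 by rewrite (_ : _ / _ * _ = e / 2) //; field; rewrite addrC natr1 pnatr_eq0.
rewrite /mE !EED !EEZ (EEC (mlaw_sum1 (m:=mu u))).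
apply: (le_mid (Nr u `^ (e / 2) + (`|C| + 1))).
 rewrite lerD2l; apply: lerD.
  rewrite mulrC ler_pdivrMr ?exprn_gt0 //; apply: (leT (HC u)).
  by apply: leMr; [exact/exprn_ge0/ltW | exact: ler_norm].
 rewrite mulrC -ler_pdivlMr ?exprn_gt0 // mul1r; apply: (leT (HN1 u h1)).
 rewrite lef_pV2 ?posrE ?exprn_gt0 // exprD -[leLHS]mul1r.
 apply: leMr; first by apply: exprn_ge0; exact: ltW.
 by apply: exprn_ege1; rewrite ?ler1n // ltW.
have := HN2 _ h2; set y := Nr u `^ (e / 2) => y2.
have -> : Nr u `^ e = y ^+ 2.
 by rewrite expr2 -powRD -?splitr //; apply/implyP; rewrite gt_eqF.
have := normr_ge0 C; rewrite expr2 => c0.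
by nra.
Qed.

End Families.
End LargeDeviationMoments.

(** * Complex expectations, Jensen and Hölder inequalities *)

Section ComplexExpectation.
Variables (R : realType) (K V : finType) (p : K -> V -> R).
Hypotheses (p_ge0 : forall k v, 0 <= p k v) (p_sum1 : forall k, \sum_v p k v = 1).
Notation Om := {ffun K -> V}.
Notation EE := (EE p).
Implicit Types (A B : {set K}) (F G : Om -> R[i]).

Definition cEx A F : Om -> R[i] := fun w =>
 (Ex p A (fun w => Re (F w)) w) +i* (Ex p A (fun w => Im (F w)) w).

Definition cEE F : R[i] :=
 (EE (fun w => Re (F w))) +i* (EE (fun w => Im (F w))).

Lemma cEx_cEx A B F : cEx A (cEx B F) = cEx (A :|: B)%SET F.
Proof. by apply: funext => w; congr (_ +i* _); exact: Ex_Ex. Qed.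

Lemma cEx_comm A B F : cEx A (cEx B F) = cEx B (cEx A F).
Proof. by rewrite !cEx_cEx finset.setUC. Qed.

Lemma cEE_cEx A F : cEE (cEx A F) = cEE F.
Proof. by congr (_ +i* _); exact: EE_Ex. Qed.

Lemma cEx_id A F : indep A F -> cEx A F = F.
Proof.
move=> iF; apply: funext => w; rewrite /cEx !(Ex_id p_sum1); first by case: (F w).
 by move=> w' w0; rewrite iF.
by move=> w' w0; rewrite iF.
Qed.

Lemma cEx_indep A B F : B \subset A -> indep B (cEx A F).
Proof. by move=> sBA w' w; rewrite /cEx !(Ex_indep _ _ sBA). Qed.

Lemma cExD A F G : cEx A (fun w => F w + G w) = (fun w => cEx A F w + cEx A G w).
Proof.
apply: funext => w; apply: eqC; rewrite ?ReD ?ImD /cEx /= -ExD; apply: eq_Ex => w'.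
 by rewrite ReD.
by rewrite ImD.
Qed.

Lemma cExM A F G : indep A F -> cEx A (fun w => F w * G w) = (fun w => F w * cEx A G w).
Proof.
move=> iF; apply: funext => w; apply: eqC; rewrite ?ReM ?ImM /cEx /=.
 have iR : indep A (fun w => Re (F w)) by move=> w' w0; rewrite iF.
 have iI : indep A (fun w => Im (F w)) by move=> w' w0; rewrite iF.
 by rewrite -(ExM p _ _ iR) -(ExM p _ _ iI) -ExB; apply: eq_Ex => w'; rewrite ReM.
have iR : indep A (fun w => Re (F w)) by move=> w' w0; rewrite iF.
have iI : indep A (fun w => Im (F w)) by move=> w' w0; rewrite iF.
by rewrite -(ExM p _ _ iR) -(ExM p _ _ iI) -ExD; apply: eq_Ex => w'; rewrite ImM.
Qed.

Lemma cExZ A c F : cEx A (fun w => c * F w) = (fun w => c * cEx A F w).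
Proof. by apply: (cExM (F := fun=> c)). Qed.

Lemma cExN A F : cEx A (fun w => - F w) = (fun w => - cEx A F w).
Proof.
transitivity (cEx A (fun w => (-1) * F w)).
 by congr cEx; apply: funext => w; rewrite mulN1r.
by rewrite cExZ; apply: funext => w; rewrite mulN1r.
Qed.

Lemma cExB A F G : cEx A (fun w => F w - G w) = (fun w => cEx A F w - cEx A G w).
Proof. by rewrite cExD cExN. Qed.

Lemma cExJ A F : cEx A (fun w => (F w)^*%C) = (fun w => (cEx A F w)^*%C).
Proof.
apply: funext => w; apply: eqC; rewrite ?ReJ ?ImJ /cEx /=.
 by apply: eq_Ex => w'; rewrite ReJ.
by rewrite -ExN; apply: eq_Ex => w'; rewrite ImJ.
Qed.

Lemma cEED F G : cEE (fun w => F w + G w) = cEE F + cEE G.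
Proof.
apply: eqC; rewrite ?ReD ?ImD /cEE /= -EED; apply: eq_EE => w'.
 by rewrite ReD.
by rewrite ImD.
Qed.

Lemma cEEZ c F : cEE (fun w => c * F w) = c * cEE F.
Proof.
apply: eqC; rewrite ?ReM ?ImM /cEE /= -!EEZ.
 by rewrite -EEB; apply: eq_EE => w; rewrite ReM.
by rewrite -EED; apply: eq_EE => w; rewrite ImM.
Qed.

Lemma cEE0 : cEE (fun _ => 0) = 0.
Proof. by apply: eqC; rewrite /cEE /= (EEC p_sum1). Qed.

Lemma cEE_sum (I : Type) (r : seq I) (P : pred I) (F : I -> Om -> R[i]) :
 cEE (fun w => \sum_(i <- r | P i) F i w) = \sum_(i <- r | P i) cEE (F i).
Proof.
apply: eqC; rewrite ?Re_sum ?Im_sum /cEE /= -EE_sum; apply: eq_EE => w.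
 by rewrite Re_sum.
by rewrite Im_sum.
Qed.

(** Multiplication by the conjugate of the mean turns the claim into the real inequality
    [Re <= cabs]. *)
Lemma cabs_cEE_le F : cabs (cEE F) <= EE (fun w => cabs (F w)).
Proof.
set z := cEE F; have E0 : 0 <= EE (fun w => cabs (F w)).
 by apply: EE_ge0 => // w.
have [z0|z0] := eqVneq z 0; first by rewrite z0 cabs0.
have zp : 0 < cabs z by rewrite cabs_gt0.
rewrite -(ler_pM2l zp) -EEZ -expr2.
have -> : cabs z ^+ 2 = EE (fun w => Re (z^*%C * F w)).
 rewrite -[LHS]/(Re (cabs z ^+ 2)%:C) -mulCJ mulrC.
 by rewrite {2}/z -cEEZ.
apply: le_EE => // w; apply: (leT (ler_norm _)); apply: (leT (Re_le_cabs _)).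
by rewrite cabsM cabsJ.
Qed.

Lemma cabs_cEx_le A F w : cabs (cEx A F w) <= Ex p A (fun w => cabs (F w)) w.
Proof. exact: (cabs_cEE_le (fun w' => F (merge A w' w))). Qed.

(** The tangent of the power at [a] lies below its graph; with [a] the mean, Jensen's inequality
    follows by integration. *)
Lemma expr_tangent (m : nat) (x a : R) : 0 <= x -> 0 <= a ->
 a ^+ m.+1 + m.+1%:R * a ^+ m * (x - a) <= x ^+ m.+1.
Proof.
move=> x0 a0; elim: m => [|m IH]; first by rewrite !expr1 expr0; lra.
have := leMl x0 IH; rewrite -exprS => /(leT _); apply.
have -> : m.+2%:R = m.+1%:R + 1 :> R by rewrite natr1.
have H : 0 <= m.+1%:R * a ^+ m * (x - a) ^+ 2 by sgn.
rewrite -subr_ge0; apply: leT H _; rewrite le_eqVlt; apply/orP; left.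
by apply/eqP; rewrite !(exprS a); ring.
Qed.

Lemma jensen_EE m (F : Om -> R) : (forall w, 0 <= F w) ->
 EE F ^+ m <= EE (fun w => F w ^+ m).
Proof.
move=> F0; case: m => [|m]; first by rewrite expr0 (EEC p_sum1).
have E0 : 0 <= EE F by exact: EE_ge0.
apply: (le_mid (EE (fun w => EE F ^+ m.+1 + m.+1%:R * EE F ^+ m * (F w - EE F)))).
 by rewrite EED (EEC p_sum1) EEZ EEB (EEC p_sum1) subrr mulr0 addr0.
by apply: le_EE => // w; exact: expr_tangent.
Qed.

Lemma cEx_contract A F m : EE (fun w => cabs (cEx A F w) ^+ m) <= EE (fun w => cabs (F w) ^+ m).
Proof.
rewrite -[leRHS](EE_Ex p_sum1 A); apply: le_EE => // w.
apply: (le_mid (Ex p A (fun w => cabs (F w)) w ^+ m)).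
 apply: ler_Xn; [exact: cabs_ge0| |exact: cabs_cEx_le].
 by apply: sumr_ge0 => w' _; apply: mulr_ge0; [exact: (pr_ge0 p_ge0)|exact: cabs_ge0].
exact: (jensen_EE m (F := fun w' => cabs (F (merge A w' w)))).
Qed.

Lemma sub_contract F G m : EE (fun w => cabs (F w - G w) ^+ m) <=
 2 ^+ m * (EE (fun w => cabs (F w) ^+ m) + EE (fun w => cabs (G w) ^+ m)).
Proof.
rewrite -EED -EEZ; apply: le_EE => // w.
have F0 := cabs_ge0 (F w); have G0 := cabs_ge0 (G w).
apply: (le_mid ((cabs (F w) + cabs (G w)) ^+ m)).
 by apply: ler_Xn; [exact: cabs_ge0|exact: addr_ge0|exact: cabsB].
wlog xy : F G F0 G0 / cabs (F w) <= cabs (G w).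
 move=> H; case: (leP (cabs (F w)) (cabs (G w))) => [|/ltW] xy; first exact: H.
 by rewrite addrC [X in _ * X]addrC; exact: H.
apply: (le_mid ((2 * cabs (G w)) ^+ m)).
 by apply: ler_Xn; lra.
by rewrite exprMn leMl ?exprn_ge0 // lerDr exprn_ge0.
Qed.

(** Hölder's inequality for [m] factors, from the inequality of arithmetic and geometric means
    applied pointwise to the normalized factors. *)
Lemma holder_prod (m : nat) (Y : 'I_m -> Om -> R[i]) (be : 'I_m -> R) :
 (forall j, 0 < be j) ->
 (forall j, EE (fun w => cabs (Y j w) ^+ m) <= be j ^+ m) ->
 EE (fun w => \prod_j cabs (Y j w)) <= \prod_j be j.
Proof.
move=> be0 HY; case: m Y be be0 HY => [|m] Y be be0 HY.
 by under eq_EE do rewrite big_ord0; rewrite (EEC p_sum1) big_ord0.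
have P0 : 0 < \prod_j be j by exact: prodr_gt0.
rewrite (@eq_EE _ _ _ _ _ (fun w => (\prod_j be j) * \prod_j ((be j)^-1 * cabs (Y j w)))); last first.
 by move=> w; rewrite -big_split /=; apply: eq_bigr => j _; rewrite mulVKf // gt_eqF.
rewrite EEZ -[leRHS]mulr1 ler_pM2l //.
apply: (le_mid (EE (fun w => m.+1%:R^-1 * \sum_j (be j)^-1 ^+ m.+1 * cabs (Y j w) ^+ m.+1))).
 apply: le_EE => // w; pose x j := (be j)^-1 * cabs (Y j w).
 have x0 j : 0 <= x j by apply: mulr_ge0; [rewrite invr_ge0; exact: ltW (be0 j)|exact: cabs_ge0].
 have [] := @leif_AGM R 'I_m.+1 predT (fun j => x j ^+ m.+1) _.
  by move=> j _; rewrite exprn_ge0.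
 rewrite prodrXl cardT size_enum_ord ler_pXn2r ?nnegrE ?prodr_ge0 //; last first.
  by rewrite divr_ge0 // sumr_ge0 // => j _; rewrite exprn_ge0.
 move=> + _ => /leT; apply; rewrite mulrC leMl ?invr_ge0 //.
 by apply: ler_sum => j _; rewrite exprMn.
rewrite EEZ EE_sum ler_pdivrMl ?ltr0n // mulr1.
apply: (le_mid (\sum_(j < m.+1) 1)).
 apply: ler_sum => j _; rewrite EEZ exprVn ler_pdivrMl ?exprn_gt0 // mulr1; exact: HY.
by rewrite sumr_const card_ord.
Qed.

(** * Fluctuation averaging: expansion and counting *)

Section FluctuationAveraging.
Variables (n : nat) (row : 'I_n -> {set K}).
Notation QQ b F := (fun w => F w - cEx (row b) F w).

Fixpoint QA (A : seq 'I_n) (F : Om -> R[i]) : Om -> R[i] :=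
 if A is a :: A' then QQ a (QA A' F) else F.

Lemma cEx_QQ X b F : cEx X (QQ b F) = QQ b (cEx X F).
Proof. by rewrite cExB cEx_comm. Qed.

Lemma QQ_QQ a b F : QQ a (QQ b F) = QQ b (QQ a F).
Proof.
apply: funext => w; rewrite !cExB (cEx_comm (row a) (row b)); ring.
Qed.

Lemma QA_QQ (A : seq 'I_n) b F : QA A (QQ b F) = QQ b (QA A F).
Proof. by elim: A => //= a A ->; rewrite QQ_QQ. Qed.

Lemma cEx_QA X (A : seq 'I_n) F : cEx X (QA A F) = QA A (cEx X F).
Proof. by elim: A => //= a A IH; rewrite cEx_QQ IH. Qed.

Lemma QAJ (A : seq 'I_n) F : QA A (fun w => (F w)^*%C) = (fun w => (QA A F w)^*%C).
Proof.
elim: A => //= a A ->; rewrite cExJ; apply: funext => w.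
by rewrite rmorphB.
Qed.

Lemma cEx_QQ0 b F : cEx (row b) (QQ b F) = fun _ => 0.
Proof.
by rewrite cExB cEx_cEx finset.setUid; apply: funext => w; rewrite subrr.
Qed.

Lemma QA0 (A : seq 'I_n) : QA A (fun _ => 0) = fun _ => 0.
Proof.
elim: A => //= a A ->; rewrite cEx_id; last by move=> ? ?.
by apply: funext => w; rewrite subrr.
Qed.

Lemma QA_contract (A : seq 'I_n) F (m : nat) : EE (fun w => cabs (QA A F w) ^+ m) <=
 (2 ^+ m * 2) ^+ size A * EE (fun w => cabs (F w) ^+ m).
Proof.
elim: A => [|a A IH] /=; first by rewrite expr0 mul1r.
apply: (leT (sub_contract _ _ _)).
rewrite exprS -mulrA -[X in _ <= X]mulrA leMl; try sgn.
apply: (le_mid (EE (fun w => cabs (QA A F w) ^+ m) + EE (fun w => cabs (QA A F w) ^+ m))).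
 by rewrite lerD2l cEx_contract.
by rewrite [leRHS]mulr_natl mulr2n lerD.
Qed.

Variables (m : nat) (F : 'I_m -> 'I_n -> Om -> R[i]) (B : R).
Hypotheses (B_gt0 : 0 < B) (F_cent : forall j s, cEx (row s) (F j s) = fun _ => 0).
Hypothesis F_mom : forall j s (A : seq 'I_n), uniq A -> s \notin A -> (size A <= m)%N ->
 EE (fun w => cabs (QA A (F j s) w) ^+ m) <= (B ^+ (size A).+1) ^+ m.

Definition lone (sg : 'I_m -> 'I_n) (b : 'I_n) : Prop :=
 exists2 j0, sg j0 = b & forall j, j != j0 -> sg j != b.

Lemma prod_telescope (Y Y' : 'I_m -> R[i]) :
 \prod_(j < m) Y j = \prod_(j < m) Y' j + \sum_(k < m) \prod_(j < m)
  (if (j < k)%N then Y' j else if j == k then Y j - Y' j else Y j).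
Proof.
pose Hy k := \prod_(j < m) (if (j < k)%N then Y' j else Y j).
have -> : \prod_j Y j = Hy 0%N by rewrite /Hy; apply: eq_bigr => j _.
have -> : \prod_j Y' j = Hy m by rewrite /Hy; apply: eq_bigr => j _; rewrite ltn_ord.
rewrite (eq_bigr (fun k : 'I_m => Hy k - Hy k.+1)); last first.
 move=> k _; rewrite (bigD1 k) //= ltnn eqxx mulrBl; congr (_ - _).
  rewrite /Hy [RHS](bigD1 k) //= ltnn; congr (_ * _).
  by apply: eq_bigr => j /negbTE jk; rewrite jk; case: ifP.
 rewrite /Hy [RHS](bigD1 k) //= ltnSn; congr (_ * _).
 by apply: eq_bigr => j /negbTE jk; rewrite jk (_ : (j < k.+1)%N = (j < k)%N) // ltnS leq_eqVlt val_eqE jk.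
rewrite -(big_mkord xpredT (fun k => Hy k - Hy k.+1)).
rewrite (eq_bigr (fun k => - (Hy k.+1 - Hy k))) => [|k _]; last by rewrite opprB.
by rewrite sumrN telescope_sumr // opprB addrC subrK.
Qed.

(** Each lone index [b] yields one more factor [B]. In the other factors the identity is split into
    averaging over row [b] and its complement [QQ b]. If all of them are averaged, the expectation
    vanishes because the factor at [b] is centred. Otherwise some factor has acquired a [QQ b],
    which [F_mom] rewards by one power of [B]. Telescoping produces at most [m] such terms per lone
    index. *)
Lemma cEE_prod_lone (sg : 'I_m -> 'I_n) (l : seq 'I_n) (C : 'I_m -> {set K})
  (A : 'I_m -> seq 'I_n) :
 uniq l -> (forall b, b \in l -> lone sg b) ->
 (forall j, uniq (A j)) -> (forall j, sg j \notin A j) ->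
 (forall j b, b \in l -> b \notin A j) ->
 (forall j, (size (A j) + size l <= m)%N) ->
 cabs (cEE (fun w => \prod_j cEx (C j) (QA (A j) (F j (sg j))) w)) <=
  m%:R ^+ size l * B ^+ (m + \sum_j size (A j) + size l).
Proof.
elim: l C A => [|b l IH] C A ul ll uA sA lA szA.
 rewrite mul1r addn0; apply: (leT (cabs_cEE_le _)).
 under eq_EE do rewrite cabs_prod.
 apply: (leT (@holder_prod m _ (fun j => B ^+ (size (A j)).+1) _ _)).
 - by move=> j; rewrite exprn_gt0.
 - move=> j; apply: (leT (cEx_contract _ _ _)); apply: F_mom => //.
  by have := szA j; rewrite addn0.
 - rewrite -expr_sum (eq_bigr (fun j => 1 + size (A j))%N) => [|j _]; last by rewrite add1n.
  by rewrite big_split /= sum_nat_const card_ord muln1.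
have [j0 sj0 lj0] := ll b (mem_head _ _).
pose Y j := cEx (C j) (QA (A j) (F j (sg j))).
pose Y' j := if j == j0 then Y j else cEx (row b) (Y j).
have -> : (fun w => \prod_j cEx (C j) (QA (A j) (F j (sg j))) w) =
 (fun w => \prod_j Y' j w + \sum_(k < m) \prod_(j < m)
  (if (j < k)%N then Y' j w else if j == k then Y j w - Y' j w else Y j w)).
 by apply: funext => w; rewrite -(prod_telescope (fun j => Y j w) (fun j => Y' j w)).
rewrite cEED cEE_sum.
have -> : cEE (fun w => \prod_j Y' j w) = 0.
 have -> : (fun w => \prod_j Y' j w) = (fun w => \prod_(j | j != j0) Y' j w * Y j0 w).
  by apply: funext => w; rewrite (bigD1 j0) //= mulrC {2}/Y' eqxx.
 rewrite -(cEE_cEx (row b)) cExM; last first.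
  move=> w' w; apply: eq_bigr => j /negbTE jj0; rewrite /Y' jj0.
  exact: (cEx_indep _ (subxx _)).
 rewrite /Y cEx_comm cEx_QA -sj0 F_cent QA0 cEx_id; last by move=> ? ?.
 rewrite -[RHS]cEE0; congr cEE; apply: funext => w; by rewrite mulr0.
rewrite add0r; apply: (leT (cabs_sum _ _ _)).
have -> : m%:R ^+ size (b :: l) * B ^+ (m + \sum_j size (A j) + size (b :: l)) =
  \sum_(k < m) m%:R ^+ size l * B ^+ (m + \sum_j size (A j) + (size l).+1).
 by rewrite sumr_const card_ord -[RHS]mulr_natl /= exprS mulrA.
(* The factor carrying [b] itself is left unchanged, so its term of the telescoping sum is zero. *)
apply: ler_sum => k _; have [kj0|kj0] := eqVneq k j0.
 have -> : (fun w => \prod_(j < m) (if (j < k)%N then Y' j w else if j == k then Y j w - Y' j w else Y j w)) = fun _ => 0.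
  apply: funext => w; rewrite (bigD1 k) //= ltnn eqxx /Y' kj0 eqxx subrr mul0r //.
 by rewrite cEE0 cabs0; sgn.
(* Factors before [k] have been averaged over row [b], the [k]-th receives [QQ b], the later ones
   are as before. *)
pose C' (j : 'I_m) := if (j < k)%N && (j != j0) then (row b :|: C j)%SET else C j.
pose A' (j : 'I_m) := if j == k then b :: A j else A j.
have -> : (fun w => \prod_(j < m) (if (j < k)%N then Y' j w else if j == k then Y j w - Y' j w else Y j w)) =
  (fun w => \prod_j cEx (C' j) (QA (A' j) (F j (sg j))) w).
 apply: funext => w; apply: eq_bigr => j _; rewrite /C' /A' /Y' /Y.
 have [->|jk] := eqVneq j k; first by rewrite ltnn (negbTE kj0) /= cEx_QQ.
 case: ltnP => //= _; have [//|jj0] := eqVneq j j0.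
 by rewrite cEx_cEx.
have lb : b \notin l by case/andP: ul.
have AE : (\sum_j size (A' j) = (\sum_j size (A j)).+1)%N.
 rewrite (bigD1 k) //= [in RHS](bigD1 k) //= /A' eqxx /= addSn; congr (_ + _).+1.
 by apply: eq_bigr => j /negbTE ->.
apply: (leT (IH C' A' _ _ _ _ _ _)).
- by case/andP: ul.
- by move=> b' b'l; apply: ll; rewrite inE b'l orbT.
- move=> j; rewrite /A'; case: eqP => // _ /=; rewrite uA andbT.
 by apply: lA; rewrite mem_head.
- move=> j; rewrite /A'; case: (eqVneq j k) => [jk|] //; rewrite inE negb_or sA andbT.
 by apply: lj0; rewrite jk.
- move=> j b' b'l; have b'bl : b' \in b :: l by rewrite inE b'l orbT.
 rewrite /A'; case: eqP => [_|_]; last exact: lA.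
 rewrite inE negb_or lA // andbT; by apply: contraNneq lb => <-.
- move=> j; rewrite /A'; have := szA j; rewrite /= addnS; case: eqP => _ //=.
 by move/ltnW.
by rewrite AE addnS addSn -addnS.
Qed.

Section Counting.
Hypotheses (n_gt0 : (0 < n)%N) (B_le1 : B <= 1) (B_ge : n%:R^-1 <= B ^+ 2).

(** The coincidence pattern of an index tuple, encoded by sending each slot to the first slot with
    the same index. Fixed points represent the classes. *)
Let first (sg : {ffun 'I_m -> 'I_n}) : {ffun 'I_m -> 'I_m} :=
 [ffun j => [arg min_(i < j | sg i == sg j) i]].

Let Lo (sg : {ffun 'I_m -> 'I_n}) : {set 'I_m} :=
 [set j | [forall i, (i != j) ==> (sg i != sg j)]]%SET.

Let Fx (pi : {ffun 'I_m -> 'I_m}) : {set 'I_m} := [set j | pi j == j]%SET.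
Let firstP (sg : {ffun 'I_m -> 'I_n}) (j : 'I_m) : sg (first sg j) = sg j /\ forall i : 'I_m, sg i = sg j -> (first sg j <= i)%N.
Proof.
rewrite /first ffunE; case: arg_minnP => // i /eqP ij H; split=> // i' /eqP; exact: H.
Qed.

Let Lo_sub sg : Lo sg \subset Fx (first sg).
Proof.
apply/fintype.subsetP => j; rewrite !inE => /forallP H; have [e _] := firstP sg j.
by apply: contraLR (H (first sg j)) => ne; rewrite ne e eqxx.
Qed.

(** A tuple is determined by its pattern and its values at the representatives. *)
Let card_first_le (pi : {ffun 'I_m -> 'I_m}) :
 (#|[set sg | first sg == pi]%SET| <= n ^ #|Fx pi|)%N.
Proof.
pose y : 'I_n := Ordinal n_gt0.
pose g (sg : {ffun 'I_m -> 'I_n}) : {ffun 'I_m -> 'I_n} :=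
 [ffun j => if j \in Fx pi then sg j else y].
have <- : #|pffun_on y (Fx pi) predT : {pred {ffun 'I_m -> 'I_n}}| = (n ^ #|Fx pi|)%N.
 by rewrite card_pffun_on [#|predT|]card_ord.
rewrite -(card_in_imset (f := g)).
 apply: subset_leq_card; apply/fintype.subsetP => _ /imsetP[sg _ ->].
 apply/pffun_onP; split=> [|//]; apply/supportP => j jF.
 by rewrite ffunE (negbTE jF).
move=> s1 s2; rewrite !inE => /eqP f1 /eqP f2 /ffunP g12; apply/ffunP => j.
have [e1 H1] := firstP s1 j; have [e2 H2] := firstP s2 j.
rewrite f1 in e1 H1; rewrite f2 in e2 H2; rewrite -e1 -e2.
have [e3 H3] := firstP s1 (pi j); rewrite f1 in e3 H3.
have ppi : pi (pi j) == pi j.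
 rewrite -val_eqE eqn_leq; apply/andP; split; first exact: H3.
 by apply: H1; rewrite e3.
by have := g12 (pi j); rewrite !ffunE inE ppi.
Qed.

(** Every class that is not lone has a second member, which is not a representative; choosing one
    injects these classes into the complement of [Fx]. *)
Let card_Fx_le sg : (2 * #|Fx (first sg)| <= m + #|Lo sg|)%N.
Proof.
set D := Fx (first sg); have sD : (#|D :\: Lo sg| <= #|~: D|)%N.
 pose g j := odflt j [pick i | (i != j) && (sg i == sg j)].
 have gP j : j \in D :\: Lo sg -> g j != j /\ sg (g j) = sg j.
  rewrite inE => /andP[jL _]; rewrite /g; case: pickP => [i /andP[ij /eqP]//|H].
  case/negP: jL; rewrite inE; apply/forallP => i; apply/implyP => ij.
  by have := H i; rewrite ij /= => ->.
 rewrite -(card_in_imset (f := g)).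
  apply: subset_leq_card; apply/fintype.subsetP => _ /imsetP[j jD ->].
  have [gj sgj] := gP j jD; rewrite !inE; move: jD; rewrite !inE => /andP[_ /eqP fj].
  apply: contra gj => /eqP fg; rewrite -val_eqE eqn_leq.
  have [_ H1] := firstP sg j; have [_ H2] := firstP sg (g j).
  by rewrite -{1}fg (H2 j) // -{1}fj (H1 (g j)).
 move=> i j iD jD gij; have [_ si] := gP i iD; have [_ sj] := gP j jD.
 have sij : sg i = sg j by rewrite -si gij sj.
 move: iD jD; rewrite !inE => /andP[_ /eqP fi] /andP[_ /eqP fj].
 apply/eqP; rewrite -val_eqE eqn_leq.
 have [_ H1] := firstP sg i; have [_ H2] := firstP sg j.
 by rewrite -{1}fi (H1 j) // -{1}fj (H2 i).
have cD : (#|D| + #|~: D| = m)%N by rewrite cardsC card_ord.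
have cD2 : (#|Lo sg| + #|D :\: Lo sg| = #|D|)%N.
 by rewrite -[RHS](cardsID (Lo sg)) (finset.setIidPr (Lo_sub sg)).
by move: cD2 cD sD; lia.
Qed.

(** Each slot that is not a representative leaves a factor [1/n <= B^2]; together with one [B] per
    lone slot this makes up at least [B^m], by [card_Fx_le]. *)
Let lone_weight sg : B ^+ #|Lo sg| / n%:R ^+ m <= B ^+ m / n%:R ^+ #|Fx (first sg)|.
Proof.
set d := #|Fx _|; set l := #|Lo sg|.
have dm : (d <= m)%N by rewrite -[X in (_ <= X)%N]card_ord max_card.
have n0 : 0 < n%:R :> R by sgn.
have -> : n%:R ^+ m = n%:R ^+ (m - d) * n%:R ^+ d :> R by rewrite -exprD subnK.
rewrite invfM mulrA leMr; try sgn.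
apply: (le_mid (B ^+ l * (B ^+ 2) ^+ (m - d))).
 rewrite leMl ?exprn_ge0 ?(ltW B_gt0) // -exprVn.
 by leXn.
rewrite -exprM -exprD; apply: ler_wiXn2l; try sgn.
have := card_Fx_le sg; rewrite -/d -/l; move: dm; clearbody d l; lia.
Qed.

(** The product is expanded over index tuples and these are grouped by pattern. Every slot
    contributes [B] by size, and lone slots and coincidences together contribute [B^m] again, whence
    [B^(2m)]. One factor [m^m] counts patterns, the other bounds the telescoping terms. *)
Lemma fluct_avg_abs :
 cabs (cEE (fun w => \prod_j (n%:R^-1 * \sum_s F j s w))) <=
  (m ^ m)%:R ^+ 2 * B ^+ (2 * m).
Proof.
have -> : (fun w => \prod_j (n%:R^-1 * \sum_s F j s w)) =
 (fun w => \sum_(sg : {ffun 'I_m -> 'I_n}) (n%:R^-1) ^+ m * \prod_j F j (sg j) w).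
 apply: funext => w; rewrite big_split /= prodr_const card_ord.
 by rewrite bigA_distr_bigA mulr_sumr.
rewrite cEE_sum; apply: (leT (cabs_sum _ _ _)).
pose P0 (sg : {ffun 'I_m -> 'I_n}) := (m ^ m)%:R * (B ^+ (2 * m) / n%:R ^+ #|Fx (first sg)|).
apply: (le_mid (\sum_sg P0 sg)).
 apply: ler_sum => sg _; rewrite cEEZ cabsM cabsX cabsV.
 have -> : cabs (n%:R : R[i]) = n%:R by rewrite -natC cabsR ger0_norm.
 pose l := [seq sg j | j <- enum (Lo sg)].
 have szl : size l = #|Lo sg| by rewrite size_map -cardE.
 have Lom : (#|Lo sg| <= m)%N by rewrite -[X in (_ <= X)%N]card_ord max_card.
 have loP j : j \in Lo sg -> forall i, i != j -> sg i != sg j.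
  by rewrite inE => /forallP H i ij; have := H i; rewrite ij.
 have := @cEE_prod_lone sg l (fun=> fs0) (fun=> [::]) _ _ _ _ _ _.
 have -> : (fun w => \prod_j cEx fs0 (QA [::] (F j (sg j))) w) = (fun w => \prod_j F j (sg j) w).
  apply: funext => w; apply: eq_bigr => j _; rewrite /= cEx_id // => w' w0.
  by congr F; apply/ffunP => k; rewrite ffunE inE.
 move=> H; apply: (le_mid (n%:R^-1 ^+ m * (m%:R ^+ size l * B ^+ (m + \sum_(j < m) 0 + size l)))).
  rewrite leMl ?exprn_ge0 ?invr_ge0 //; apply: H => //.
  - rewrite map_inj_in_uniq ?enum_uniq // => i j; rewrite !mem_enum => iL jL ij.
  by apply/eqP; apply: contraT => ne; have := loP j jL i ne; rewrite ij eqxx.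
  - move=> b /mapP[j]; rewrite mem_enum => jL ->; exists j => // i; exact: loP.
  - by rewrite szl.
 rewrite big1 // addn0 szl exprD /P0 mul2n -addnn exprD.
 rewrite mulrC -!mulrA; lepM.
  have le_expnn x k : (x <= k)%N -> (k ^ x <= k ^ k)%N.
  by case: k => [|k]; [rewrite leqn0 => /eqP ->|exact: leq_pexp2l].
  by rewrite -natrX ler_nat le_expnn.
 rewrite leMl ?exprn_ge0 ?(ltW B_gt0) // exprVn; exact: lone_weight.
rewrite /P0 -mulr_sumr expr2 -mulrA leMl // -mulr_sumr mulrC leMr; try sgn.
rewrite (partition_big first predT) //=.
apply: (le_mid (\sum_(pi : {ffun 'I_m -> 'I_m}) 1)); last first.
 by rewrite sumr_const card_ffun !card_ord.
apply: ler_sum => pi _.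
rewrite (eq_bigr (fun=> (n%:R ^+ #|Fx pi|)^-1)) => [|sg /eqP <- //].
rewrite sumr_const -[_ *+ _]mulr_natl ler_pdivrMr ?exprn_gt0 ?ltr0n // mul1r -natrX ler_nat.
have := card_first_le pi; rewrite cardsE; exact.
Qed.

End Counting.
End FluctuationAveraging.

Lemma fluct_avg_moment (n : nat) (row : 'I_n -> {set K}) (q : nat) (f : 'I_n -> Om -> R[i]) (B : R) :
 (0 < n)%N -> 0 < B -> B <= 1 -> n%:R^-1 <= B ^+ 2 ->
 (forall s, cEx (row s) (f s) = fun _ => 0) ->
 (forall s (A : seq 'I_n), uniq A -> s \notin A -> (size A <= q + q)%N ->
  EE (fun w => cabs (QA row A (f s) w) ^+ (q + q)) <= (B ^+ (size A).+1) ^+ (q + q)) ->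
 EE (fun w => cabs (n%:R^-1 * \sum_s f s w) ^+ (q + q)) <=
  ((q + q) ^ (q + q))%:R ^+ 2 * B ^+ (2 * (q + q)).
Proof.
move=> n0 B0 B1 Bn fc fm.
(* Half of the factors are conjugated, so that the product is an even power of the modulus. *)
pose F (j : 'I_(q + q)) s : Om -> R[i] := if (j < q)%N then f s else fun w => (f s w)^*%C.
have := @fluct_avg_abs n row (q + q) F B B0 _ _ n0 B1 Bn.
have -> : (fun w => \prod_j (n%:R^-1 * \sum_s F j s w)) =
  (fun w => (cabs (n%:R^-1 * \sum_s f s w) ^+ (q + q))%:C).
 apply: funext => w; set S := n%:R^-1 * _.
 rewrite big_split_ord /= (eq_bigr (fun=> S)); last first.
  by move=> j _; rewrite /F /= ltn_ord.
 rewrite [X in _ * X](eq_bigr (fun=> S^*%C)); last first.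
  move=> j _; rewrite /F /= ltnNge leq_addr /= /S rmorphM /= fmorphV /= rmorph_nat.
  by rewrite rmorph_sum.
 by rewrite !prodr_const card_ord -exprMn mulCJ -rmorphXn /= -exprM mul2n addnn.
have -> : cEE (fun w => (cabs (n%:R^-1 * \sum_s f s w) ^+ (q + q))%:C) =
 (EE (fun w => cabs (n%:R^-1 * \sum_s f s w) ^+ (q + q)))%:C.
 by apply: eqC => //=; rewrite (EEC p_sum1).
rewrite cabsR ger0_norm; last by apply: EE_ge0 => // w; rewrite exprn_ge0 // cabs_ge0.
apply=> [j s|j s A uA sA szA]; rewrite /F; case: ifP => _ //.
- by rewrite cExJ fc; apply: funext => w; rewrite conjC0.
- exact: fm.
- rewrite QAJ; under eq_EE do rewrite cabsJ; exact: fm.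
Qed.

End ComplexExpectation.

(** * Differences with respect to the removed indices *)

Section MinorDifferences.
Variables (R : realType) (n : nat).
Implicit Types (f g : {set 'I_n} -> R[i]) (B X : {set 'I_n}) (A : seq 'I_n).

(** What is lost when row [a] is removed as well. For resolvent entries the subtracted term does not
    depend on row [a]. *)
Definition Dl (a : 'I_n) f : {set 'I_n} -> R[i] := fun B => f B - f (a |: B)%SET.
Fixpoint DA A f : {set 'I_n} -> R[i] := if A is a :: A' then DA A' (Dl a f) else f.

Definition shiftf (a : 'I_n) f : {set 'I_n} -> R[i] := fun B => f (a |: B)%SET.

Lemma DAD A f g : DA A (fun B => f B + g B) = (fun B => DA A f B + DA A g B).
Proof.
elim: A f g => //= a A IH f g; rewrite -IH; congr DA.
by apply: funext => B; rewrite /Dl opprD addrACA.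
Qed.

Lemma DA_shift A a f : DA A (shiftf a f) = shiftf a (DA A f).
Proof.
elim: A f => //= b A IH f; rewrite -IH; congr DA.
by apply: funext => B; rewrite /Dl /shiftf finset.setUCA.
Qed.

Definition dsj B X := [forall x, ~~ ((x \in B) && (x \in X))].

Lemma dsjC B X : dsj B X = dsj X B.
Proof. by apply: eq_forallb => x; rewrite andbC. Qed.

Lemma dsjU1r a B X : dsj B (a |: X)%SET = (a \notin B) && dsj B X.
Proof.
apply/forallP/andP => [H|[aB /forallP H] x].
 split; first by have := H a; rewrite !inE eqxx andbT.
 apply/forallP => x; apply: contra (H x); rewrite !inE => /andP[-> ->].
 by rewrite orbT.
by rewrite !inE; case: eqP => [->|_]; [rewrite (negbTE aB)|exact: H].
Qed.

Lemma dsjU1l a B X : dsj (a |: B)%SET X = (a \notin X) && dsj B X.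
Proof. by rewrite dsjC dsjU1r dsjC. Qed.

(** [B] lists indices already removed, [A] those about to be removed, and [X] the indices of the
    entry under study, which must remain. *)
Definition avoids X A B :=
 [&& uniq A, all (fun a => (a \notin B) && (a \notin X)) A & dsj B X].

Lemma avoids_cons X a A B : avoids X (a :: A) B =
 [&& a \notin B, a \notin X & avoids (a |: X)%SET A B].
Proof.
rewrite /avoids /= dsjU1r.
have E : all (fun x => (x \notin B) && (x \notin (a |: X)%SET)) A =
  (a \notin A) && all (fun x => (x \notin B) && (x \notin X)) A.
 elim: A => //= x A ->; rewrite !inE !negb_or (eq_sym x a).
 by case: (x \in B); case: (a == x); case: (x \in X); case: (a \in A).
rewrite E; case: (a \in A); rewrite ?andbF //=.
by case: (a \in B); case: (a \in X); case: (uniq A); case: all.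
Qed.

Lemma eq_DA X A B f g : (forall B' : {set 'I_n}, dsj B' X -> f B' = g B') ->
 avoids X A B -> DA A f B = DA A g B.
Proof.
elim: A f g B X => [|a A IH] f g B X fg; first by case/and3P=> _ _ /fg.
rewrite avoids_cons => /and3P[aB aX av] /=; apply: IH av => B'.
rewrite dsjU1r => /andP[aB' BX]; by rewrite /Dl !fg ?dsjU1l ?aX.
Qed.

(* Functions of the minor set whose [j]-th differences are [O(Psi^(r+j))]. *)
Definition ordp (Psi : R) (m k r : nat) X (C : R) f : Prop := forall A B,
 avoids X A B -> (size A <= k)%N -> (#|B| + size A <= m)%N ->
 cabs (DA A f B) <= C * Psi ^+ (r + size A).

Section Class.
Variable Psi : R.
Hypotheses (Psi_ge0 : 0 <= Psi) (Psi_le1 : Psi <= 1).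
Notation ordp := (ordp Psi).

Lemma avoidsW X a A B : avoids (a |: X)%SET A B -> avoids X A B.
Proof.
case/and3P=> uA aA; rewrite dsjU1r => /andP[aB BX].
rewrite /avoids uA BX andbT /=; apply: sub_all aA => x.
by rewrite !inE negb_or => /andP[-> /andP[_ ->]].
Qed.

Lemma ordpW m k r X a C f : ordp m k r X C f -> ordp m k r (a |: X)%SET C f.
Proof. by move=> H A B /avoidsW; exact: H. Qed.

Lemma ordp_sub m k r X X' C f : X \subset X' -> ordp m k r X C f -> ordp m k r X' C f.
Proof.
move=> /fintype.subsetP XX H A B /and3P[uA aA /forallP BX]; apply: H; apply/and3P; split=> //.
 apply: sub_all aA => x /andP[-> xX]; exact: contra (XX x) xX.
by apply/forallP => x; apply: contra (BX x) => /andP[-> /XX].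
Qed.

Lemma ordpN m k r X C f : ordp m k r X C f -> ordp m k r X C (fun B => - f B).
Proof.
move=> H A B av sA sB.
have -> : DA A (fun B => - f B) = (fun B => - DA A f B).
 elim: A f {H av sA sB} => //= a A IH f; rewrite -IH; congr DA.
 by apply: funext => B'; rewrite /Dl opprB opprK addrC.
by rewrite cabsN; exact: H.
Qed.

Lemma ordp_le m m' k k' r X (C C' : R) f : (m' <= m)%N -> (k' <= k)%N -> C <= C' ->
 ordp m k r X C f -> ordp m' k' r X C' f.
Proof.
move=> mm kk CC H A B av sA sB; apply: (leT (H A B av _ _)).
- exact: leq_trans kk.
- exact: leq_trans mm.
- by rewrite leMr ?exprn_ge0.
Qed.

Lemma ordp_Dl m k r X a C f : a \notin X -> ordp m.+1 k.+1 r X C f ->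
 ordp m k r.+1 (a |: X)%SET C (Dl a f).
Proof.
move=> aX H A B av sA sB.
rewrite addSnnS; apply: (H (a :: A) B) => //=.
- case/and3P: (av) => _ _; rewrite dsjU1r => /andP[aB _].
 by rewrite avoids_cons aB aX.
- by rewrite addnS.
Qed.

Lemma ordp_shift m k r X a C f : a \notin X -> ordp m.+1 k r X C f ->
 ordp m k r (a |: X)%SET C (shiftf a f).
Proof.
move=> aX H A B av sA sB; rewrite DA_shift; apply: H => //.
- case/and3P: (av) => uA aA dBX; rewrite /avoids uA dsjU1l aX /=.
 have := dBX; rewrite dsjU1r => /andP[_ ->].
 rewrite andbT; apply: sub_all aA => x; rewrite !inE !negb_or.
 by move=> /andP[-> /andP[-> ->]].
- by rewrite cardsU1; apply: leq_trans (leq_add (leq_add (leq_b1 _) (leqnn _)) (leqnn _)) _.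
Qed.

(** A discrete Leibniz rule. Each difference of a product gives two terms, hence [2^k], and orders
    in [Psi] add. *)
Lemma ordpM m k r r' X C C' f g : 0 <= C -> 0 <= C' ->
 ordp m k r X C f -> ordp m k r' X C' g ->
 ordp m k (r + r') X (2 ^+ k * (C * C')) (fun B => f B * g B).
Proof.
move=> C0 C'0; elim: k m r r' X f g => [|k IH] m r r' X f g Hf Hg [|a A] B av sA sB //.
- rewrite /= addn0 expr0 mul1r cabsM exprD mulrACA.
 have := Hf [::] B av isT sB; have := Hg [::] B av isT sB; rewrite /= !addn0 => h1 h2.
 by apply: ler_pM => //; exact: cabs_ge0.
- rewrite /= addn0 cabsM exprD.
 have := Hf [::] B av isT sB; have := Hg [::] B av isT sB; rewrite /= !addn0 => h1 h2.
 apply: (le_mid ((C * Psi ^+ r) * (C' * Psi ^+ r'))).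
  by apply: ler_pM => //; exact: cabs_ge0.
 rewrite mulrACA leMr ?mulr_ge0 ?exprn_ge0 // -[leLHS]mul1r leMr; try sgn.
 by rewrite exprn_ege1 // ler1n.
- case: m Hf Hg sB => [|m] Hf Hg sB; first by rewrite /= addnS in sB.
 move: av; rewrite avoids_cons => /and3P[aB aX av].
 have -> : DA (a :: A) (fun B => f B * g B) =
  (fun B => DA A (fun B => Dl a f B * g B) B + DA A (fun B => shiftf a f B * Dl a g B) B).
  rewrite -DAD /=; congr DA; apply: funext => B'; rewrite /Dl /shiftf; ring.
 have sB' : (#|B| + size A <= m)%N by rewrite /= addnS in sB.
 apply: (leT (cabsD _ _)).
 have fD := ordp_Dl aX Hf; have gD := ordp_Dl aX Hg.
 have g1 : ordp m k r' (a |: X)%SET C' g.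
  by apply: ordpW; apply: ordp_le Hg.
 have f1 : ordp m k r (a |: X)%SET C (shiftf a f).
  by apply: ordp_shift => //; apply: ordp_le Hf.
 have h1 := IH _ _ _ _ _ _ fD g1 A B av sA sB'.
 have h2 := IH _ _ _ _ _ _ f1 gD A B av sA sB'.
 apply: (leT (lerD h1 h2)).
 by rewrite exprS -mulrA mulr_natl mulr2n mulrDl /= !addSn !addnS.
Qed.

End Class.
End MinorDifferences.

(** * Size of iterated minor differences of resolvent entries *)

Section ResolventDifferences.
Variables (R : realType) (n : nat) (h : 'I_n -> 'I_n -> R) (w : R[i]).
Hypotheses (hh : hsym h) (w_gt0 : 0 < Im w).
Notation G := (Gm h w).
Implicit Types (B : {set 'I_n}).

Definition minor_bounds (m : nat) (Psi K : R) : Prop := forall B, (#|B| <= m)%N ->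
 [/\ forall s t, s != t -> s \notin B -> t \notin B -> cabs (G B s t) <= Psi,
  forall s, s \notin B -> cabs (G B s s) <= K &
  forall s, s \notin B -> cabs (G B s s)^-1 <= K].

(** Removing one index changes an entry by two off-diagonal entries over a diagonal one. This is so
    small that the bounds at most double; [K^2 Psi] then grows by 8 per removal, which explains the
    smallness condition. *)
Lemma minor_boundsP m (Psi K : R) : 0 <= Psi -> 1 <= K ->
 minor_bounds 0 Psi K -> 8 ^+ m.+1 * (K ^+ 2 * Psi) <= 1 ->
 minor_bounds m (2 ^+ m * Psi) (2 ^+ m * K).
Proof.
move=> P0 K1 H0; elim: m => [|m IH] cond; first by rewrite expr0 !mul1r.
have K0 : 0 <= K by lra.
have KP : 0 <= K ^+ 2 * Psi by sgn.
have e8 : 1 <= 8 ^+ m.+1 :> R by apply: exprn_ege1; lra.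
have cond' : 8 ^+ m.+1 * (K ^+ 2 * Psi) <= 1.
 apply: leT cond; rewrite leMr // [leRHS]exprS; lra.
move=> B cB; case: (set_0Vmem B) => [B0|[u uB]].
 have := H0 B; rewrite B0 cards0 => /(_ isT) [h1 h2 h3].
 have e1 : 1 <= 2 ^+ m.+1 :> R.
  by apply: exprn_ege1; lra.
 split=> [s t st sB tB|s sB|s sB].
 - by apply: (leT (h1 s t st sB tB)); rewrite ler_peMl.
 - by apply: (leT (h2 s sB)); rewrite ler_peMl.
 - by apply: (leT (h3 s sB)); rewrite ler_peMl.
pose B' := (B :\ u)%SET.
have BE : B = (u |: B')%SET by rewrite finset.setD1K.
have uB' : u \notin B' by rewrite !inE eqxx.
have cB' : (#|B'| <= m)%N by move: cB; rewrite (cardsD1 u) uB.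
have [h1 h2 h3] := IH cond' B' cB'.
have LPE : 8 * ((2 ^+ m * K) ^+ 2 * (2 ^+ m * Psi)) = 8 ^+ m.+1 * (K ^+ 2 * Psi).
 have E8 : 8 ^+ m = (2 ^+ m) ^+ 3 :> R.
  by rewrite -exprM mulnC exprM (_ : 2 ^+ 3 = 8 :> R) // -natrX.
 by rewrite [8 ^+ m.+1]exprS E8; ring.
rewrite !exprS -!(mulrA 2).
set P := 2 ^+ m * Psi in h1 LPE *; set L := 2 ^+ m * K in h2 h3 LPE *.
have P0' : 0 <= P by rewrite mulr_ge0 ?exprn_ge0.
have m1 : 1 <= 2 ^+ m :> R.
 by apply: exprn_ege1; lra.
have L1 : 1 <= L by rewrite -[1]mulr1 ler_pM.
have LP : 8 * (L ^+ 2 * P) <= 1 by rewrite LPE.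
have PL : P * L <= 8^-1.
 have : 0 <= P * L * (L - 1) by rewrite !mulr_ge0 //; lra.
 by rewrite expr2 in LP; lra.
have L10 : 0 <= L - 1 by lra.
have PP : P <= 8^-1 by have := mulr_ge0 P0' L10; lra.
have nB x : x \notin B -> x != u /\ x \notin B'.
 by rewrite BE !inE !negb_or => /andP[xu ->]; rewrite xu; case: eqP xu.
have corr s t : s \notin B -> t \notin B -> cabs (G B' s t - G B s t) <= P * (P * L).
 move=> sB tB; have [su sB'] := nB s sB; have [tu tB'] := nB t tB.
 rewrite (Gm_minor hh w_gt0 B' t su) -BE addrC addKr !cabsM -mulrA.
 by apply: ler_pM; [exact: cabs_ge0|apply: mulr_ge0; exact: cabs_ge0|exact: h1|
  apply: ler_pM; [exact: cabs_ge0|exact: cabs_ge0| |exact: h3]];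
  apply: h1; rewrite // eq_sym.
have bnd s t (x : R) : s \notin B -> t \notin B -> cabs (G B' s t) <= x -> cabs (G B s t) <= x + P * (P * L).
 move=> sB tB hx; rewrite -(subKr (G B' s t) (G B s t)).
 by apply: (leT (cabsB _ _)); apply: lerD => //; exact: corr.
have PPL : P * (P * L) <= P * 8^-1 by rewrite leMl.
split=> [s t st sB tB|s sB|s sB].
- have [_ sB'] := nB s sB; have [_ tB'] := nB t tB.
 by apply: (leT (bnd s t _ sB tB (h1 s t st sB' tB'))); lra.
- have [_ sB'] := nB s sB.
 by apply: (leT (bnd s s _ sB sB (h2 s sB'))); lra.
- have [_ sB'] := nB s sB; have := h3 s sB'; rewrite !cabsV.
 have x0 : 0 < cabs (G B' s s) by rewrite cabs_gt0 (Gm_diag_neq0 hh w_gt0).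
 have y0 : 0 < cabs (G B s s) by rewrite cabs_gt0 (Gm_diag_neq0 hh w_gt0).
 have := corr s s sB sB.
 have := cabsD (G B' s s - G B s s) (G B s s); rewrite subrK.
 move=> h4 h5 h6; have xy : cabs (G B' s s) <= cabs (G B s s) + P * (P * L) by lra.
 have Lx : 1 <= L * cabs (G B' s s) by rewrite -ler_pdivrMr // mul1r.
 have Lpos : 0 <= L by lra.
 rewrite -[leLHS]mul1r ler_pdivrMr //.
 have : L * cabs (G B' s s) <= L * cabs (G B s s) + L * (P * (P * L)).
  by rewrite -mulrDr leMl.
 have : L * (P * (P * L)) <= 8^-1 * 8^-1.
  by rewrite mulrA (mulrC L); apply: ler_pM => //; rewrite mulr_ge0.
 lra.
Qed.

Lemma Dl_offdiag a s t B : a != s -> a != t -> dsj B [set s; t; a]%SET ->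
 Dl a (fun B => G B s t) B = G B s a * G B a t * (G B a a)^-1.
Proof.
move=> as' at' _; rewrite /Dl (Gm_minor hh w_gt0 B t (s := s) (u := a)); last by rewrite eq_sym.
by rewrite addrC addKr.
Qed.

Lemma Dl_inv a s B : a != s ->
 Dl a (fun B => (G B s s)^-1) B =
  - ((G B s a * G B a s * (G B a a)^-1) * (G B s s)^-1) * (G (a |: B)%SET s s)^-1.
Proof.
move=> as'; have g1 := Gm_diag_neq0 hh w_gt0 B s; have g2 := Gm_diag_neq0 hh w_gt0 (a |: B)%SET s.
have sa : s != a by rewrite eq_sym.
rewrite /Dl; have -> : G B s a * G B a s * (G B a a)^-1 = G B s s - G (a |: B)%SET s s.
 by rewrite (Gm_minor hh w_gt0 B s sa) addrC addKr.
by field; rewrite g1 g2.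
Qed.

(** The recursion follows [Dl_inv]: a product of five entries, with a factor from [ordpM] for each
    of the four multiplications. The summand [c] makes the sequence nondecreasing. *)
Fixpoint dconst (K : R) (k : nat) : R :=
 if k is k'.+1 then let c := dconst K k' in
  c + 2 ^+ k' * (2 ^+ k' * (2 ^+ k' * (2 ^+ k' * (c * c) * c) * c) * c) else K.

Lemma dconst_ge1 K k : 1 <= K -> 1 <= dconst K k.
Proof.
move=> K1; elim: k => //= k IH; apply: (leT IH); rewrite lerDl.
have c0 : 0 <= dconst K k by apply: leT IH.
sgn.
Qed.

(** Induction on the number of differences. The first difference of an entry is a product of entries
    containing two off-diagonal ones; further differences are handled by the Leibniz rule and the
    induction hypothesis. A diagonal entry is of order 0 but its first difference is already of
    order 2. *)
Lemma resolvent_ordp m (Psi K : R) : 0 <= Psi -> Psi <= 1 -> 1 <= K ->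
 minor_bounds m Psi K -> forall k,
 [/\ forall s t, s != t -> ordp Psi m k 1 [set s; t]%SET (dconst K k) (fun B => G B s t),
  forall s, ordp Psi m k 0 [set s]%SET (dconst K k) (fun B => (G B s s)^-1) &
  forall s a, a != s -> ordp Psi m.-1 k.-1 2 [set a; s]%SET (dconst K k)
  (Dl a (fun B => G B s s))].
Proof.
move=> P0 P1 K1 mb; have K0 : 0 <= K by lra.
have base1 s t B : s != t -> dsj B [set s; t]%SET -> (#|B| <= m)%N -> cabs (G B s t) <= Psi.
 move=> st; rewrite dsjU1r -(finset.setU0 [set t]%SET) dsjU1r => /and3P[sB tB _] cB.
 by have [h1 _ _] := mb B cB; exact: h1.
have base2 s B : s \notin B -> (#|B| <= m)%N -> cabs (G B s s)^-1 <= K.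
 by move=> sB cB; have [_ _ h3] := mb B cB; exact: h3.
have prodP k c : 0 <= c ->
  (forall s t, s != t -> ordp Psi m k 1 [set s; t]%SET c (fun B => G B s t)) ->
  (forall s, ordp Psi m k 0 [set s]%SET c (fun B => (G B s s)^-1)) ->
  forall s t a, a != s -> a != t ->
  ordp Psi m k 2 (a |: [set s; t])%SET (2 ^+ k * (2 ^+ k * (c * c) * c))
  (fun B => G B s a * G B a t * (G B a a)^-1).
 move=> c0 H1 H2 s t a as' at'; rewrite -[2%N]/(1 + 1 + 0)%N; apply: ordpM => //.
 - sgn.
 - apply: ordpM => //.
  + apply: ordp_sub (H1 s a _); last by rewrite eq_sym.
  by apply/fintype.subsetP => x; rewrite !inE => /orP[] ->; rewrite ?orbT.
  + apply: ordp_sub (H1 a t _) => //.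
  by apply/fintype.subsetP => x; rewrite !inE => /orP[] ->; rewrite ?orbT.
 - apply: ordp_sub (H2 a).
  by apply/fintype.subsetP => x; rewrite !inE => ->.
elim=> [|k [IH1 IH2 _]].
 split=> [s t st|s|s a as'] [|//] B /and3P[_ _ dB] _ /=; rewrite addn0 => cB.
 - by rewrite expr1 (leT (base1 s t B st dB cB)) // ler_peMl.
 - rewrite mulr1; apply: base2 => //.
  by move: dB; rewrite -(finset.setU0 [set s]%SET) dsjU1r => /andP[].
 - have cB' : (#|B| <= m)%N by apply: leq_trans cB (leq_pred _).
  have sa : s != a by rewrite eq_sym.
  have dB' : dsj B [set s; a]%SET by rewrite finset.setUC.
  have aB : a \notin B by move: dB; rewrite dsjU1r => /andP[].
  rewrite Dl_offdiag //; last by rewrite (finset.setUC [set s; s]%SET) finset.setUid.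
  rewrite !cabsM mulrC expr2; apply: ler_pM; rewrite ?mulr_ge0 ?cabs_ge0 ?base2 //.
  by apply: ler_pM; rewrite ?cabs_ge0 ?base1.
set c := dconst K k in IH1 IH2 *; have c1 : 1 <= c by exact: dconst_ge1.
have c0 : 0 <= c by lra.
set p := 2 ^+ k * (2 ^+ k * (c * c) * c).
have e1 : 1 <= 2 ^+ k :> R by apply: exprn_ege1; lra.
have e0 : 0 <= 2 ^+ k :> R by lra.
have p0 : 0 <= p by rewrite /p; sgn.
have pP := prodP k c c0 IH1 IH2.
have e2 (x : R) : 0 <= x -> x <= 2 ^+ k * (x * c).
 move=> x0; rewrite mulrCA ler_peMr //; apply: leT c1 _; rewrite ler_peMl //.
have dE : dconst K k.+1 = c + 2 ^+ k * (2 ^+ k * (p * c) * c) by [].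
have dp : p <= dconst K k.+1.
 rewrite dE; apply: (leT (e2 _ p0)); apply: (leT (e2 _ _)); first sgn.
 by rewrite lerDr.
have dK : K <= dconst K k.+1.
 rewrite dE; have : K <= c.
  rewrite /c; elim: (k) => //= k' IHk; apply: (leT IHk); rewrite lerDl.
  have x0 : 0 <= dconst K k' by apply: leT (dconst_ge1 k' K1).
  sgn.
 by move=> Kc; rewrite -[leLHS]addr0 lerD //; sgn.
have d0 : 0 <= dconst K k.+1 by apply: leT dK.
split=> [s t st|s|s a as'].
- move=> [|a A] B av sA sB.
  have /and3P[_ _ dB] := av; rewrite /= addn0 expr1.
  rewrite /= addn0 in sB; apply: (leT (base1 s t B st dB sB)).
  by rewrite ler_peMl // (leT K1).
 move: av; rewrite avoids_cons => /and3P[aB]; rewrite !inE negb_or => /andP[as' at'] av.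
 rewrite /= (eq_DA (X := (a |: [set s; t])%SET) (g := fun B => G B s a * G B a t * (G B a a)^-1)) //; last first.
  by move=> B' dB'; rewrite Dl_offdiag // finset.setUC.
 rewrite -[(1 + _)%N]/(2 + size A)%N; apply: (leT (pP s t a as' at' A B av _ _)) => //.
  by apply: leq_trans sB; rewrite leq_add2l.
 by rewrite leMr ?exprn_ge0.
- move=> [|a A] B av sA sB.
  have /and3P[_ _ dB] := av; rewrite /= mulr1.
  rewrite /= addn0 in sB; apply: leT dK; apply: base2 => //.
  by move: dB; rewrite -(finset.setU0 [set s]%SET) dsjU1r => /andP[].
 move: av; rewrite avoids_cons => /and3P[aB]; rewrite inE => as' av.
 rewrite /= (eq_DA (X := (a |: [set s])%SET) (g := fun B => - ((G B s a * G B a s * (G B a a)^-1) * (G B s s)^-1) *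
  shiftf a (fun B => (G B s s)^-1) B)) //; last first.
  by move=> B' dB'; rewrite Dl_inv // mulNr.
 have [m' mE] : exists m', m = m'.+1 by case: (m) sB => [|m'] sB; [rewrite /= addnS in sB|exists m'].
 have S1 : ordp Psi m' k 0 (a |: [set s])%SET c (shiftf a (fun B => (G B s s)^-1)).
  by apply: ordp_shift; rewrite ?inE // -mE.
 have S2 : ordp Psi m' k 2 (a |: [set s])%SET (2 ^+ k * (p * c)) (fun B => - (G B s a * G B a s * (G B a a)^-1 * (G B s s)^-1)).
  apply: ordpN; rewrite -[2%N]/(2 + 0)%N; apply: ordpM => //.
  apply: (ordp_le P0 (m := m) (k := k) (C := p)) => //; first by rewrite mE.
  by have := pP s s a as' as'; rewrite finset.setUid.
  apply: (ordp_le P0 (m := m) (k := k) (C := c)) => //; first by rewrite mE.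
  exact: ordpW.
 have sB' : (#|B| + size A <= m')%N by move: sB; rewrite mE /= addnS.
 have pc0 : 0 <= 2 ^+ k * (p * c) by sgn.
 have := ordpM P0 pc0 c0 S2 S1 av _ sB'; rewrite -ltnS => /(_ sA) /leT; apply.
 rewrite addn0 add0n add2n; apply: ler_pM; rewrite ?exprn_ge0 //; first sgn.
  by rewrite -[leRHS]/(c + 2 ^+ k * (2 ^+ k * (p * c) * c)) lerDr.
 by rewrite /= [leLHS]exprS ler_piMl; sgn.
- have sa : s != a by rewrite eq_sym.
 move=> A B av sA sB /=.
 rewrite (eq_DA (X := (a |: [set s; s])%SET) (g := fun B => G B s a * G B a s * (G B a a)^-1)); last first.
 + by rewrite finset.setUid.
 + by move=> B' dB'; rewrite Dl_offdiag // finset.setUC.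
 apply: (leT (pP s s a as' as' A B _ _ _)) => //.
 + by rewrite finset.setUid.
 + by apply: leq_trans sB (leq_pred _).
 + by rewrite leMr ?exprn_ge0.
Qed.

(* Each minor removed from a resolvent entry gains one factor [Psi]. *)
Lemma DA_diag_le m (Psi K : R) : 0 <= Psi -> Psi <= 1 -> 1 <= K ->
 minor_bounds 0 Psi K -> 8 ^+ m.+2 * (K ^+ 2 * Psi) <= 1 ->
 forall s A, uniq A -> s \notin A -> A != [::] -> (size A <= m)%N ->
 cabs (DA A (fun B => G B s s) fs0) <=
  dconst (2 ^+ m * K) m * (2 ^+ m * Psi) ^+ (size A).+1.
Proof.
move=> P0 P1 K1 mb cond s A uA sA A0 szA.
have K0 : 0 <= K by lra.
have KP : 0 <= K ^+ 2 * Psi by sgn.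
have e8 k : 1 <= 8 ^+ k :> R by apply: exprn_ege1; lra.
have e2 : 1 <= 2 ^+ m :> R by apply: exprn_ege1; lra.
have cond' : 8 ^+ m.+1 * (K ^+ 2 * Psi) <= 1.
 apply: leT cond; rewrite leMr // [leRHS]exprS; have := e8 m.+1; lra.
have mb' := minor_boundsP P0 K1 mb cond'.
have P0' : 0 <= 2 ^+ m * Psi by rewrite mulr_ge0 // (leT _ e2).
have P1' : 2 ^+ m * Psi <= 1.
 apply: leT cond'; apply: ler_pM => //.
  apply: (le_mid (8 ^+ m)); first by apply: ler_Xn; lra.
  by rewrite [leRHS]exprS; have := e8 m; lra.
 by rewrite ler_peMl //; apply: exprn_ege1.
have K1' : 1 <= 2 ^+ m * K by rewrite -[leLHS]mulr1 ler_pM.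
have [_ _ H] := resolvent_ordp P0' P1' K1' mb' m.
case: A uA sA A0 szA => // a A /= /andP[aA uA]; rewrite inE negb_or => /andP[sa sA] _ szA.
have as' : a != s by rewrite eq_sym.
have := H s a as' A fs0; rewrite add2n; apply.
- rewrite /avoids uA /=; apply/andP; split.
  apply/allP => x xA; rewrite !inE /= negb_or; apply/andP; split.
  by apply: contraNneq aA => <-.
  by apply: contraNneq sA => <-.
 by apply/forallP => x; rewrite inE.
- by case: (m) szA.
- by rewrite cards0 add0n; case: (m) szA.
Qed.

End ResolventDifferences.

(** * From averaging operators to minor differences *)

Section QADifferences.
Variables (R : realType) (K V : finType) (p : K -> V -> R).
Hypotheses (p_ge0 : forall k v, 0 <= p k v) (p_sum1 : forall k, \sum_v p k v = 1).
Variables (n : nat) (row : 'I_n -> {set K}).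
Notation Om := {ffun K -> V}.

Lemma QAB (A : seq 'I_n) (F G : Om -> R[i]) :
 QA p row A (fun w => F w - G w) = (fun w => QA p row A F w - QA p row A G w).
Proof.
elim: A => //= a A ->; rewrite cExB; apply: funext => w; ring.
Qed.

Lemma QAZ (A : seq 'I_n) c (F : Om -> R[i]) :
 QA p row A (fun w => c * F w) = (fun w => c * QA p row A F w).
Proof. by elim: A => //= a A ->; rewrite cExZ; apply: funext => w; rewrite mulrBr. Qed.

(** [F (a |: B)] does not depend on row [a], so the operator [1 - E_a] annihilates it and [F B] may
    be replaced by its difference in direction [a]. Probabilistic fluctuations are thereby
    controlled by algebra. *)
Lemma QA_DA (F : {set 'I_n} -> Om -> R[i]) :
 (forall (B : {set 'I_n}) a, a \in B -> indep (row a) (F B)) ->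
 forall A B, QA p row A (F B) = QA p row A (fun w => DA A (fun B' => F B' w) B).
Proof.
move=> iF A; elim: A F iF => //= a A IH F iF B.
pose F' B w := F B w - F (a |: B)%SET w.
have iF' (B' : {set 'I_n}) c : c \in B' -> indep (row c) (F' B').
 by move=> cB w' w; rewrite /F' !iF // inE cB orbT.
rewrite -(IH F' iF' B) /F' QAB.
have Q0 : (fun w => QA p row A (F (a |: B)%SET) w - cEx p (row a) (QA p row A (F (a |: B)%SET)) w) = fun _ => 0.
 rewrite -(QA_QQ p_sum1) cEx_id //; last by apply: iF; rewrite !inE eqxx.
 rewrite -[RHS](QA0 p_sum1 row A); congr QA; apply: funext => w; by rewrite subrr.
apply: funext => w; have := congr1 (fun f => f w) Q0; rewrite /= cExB => q0.
by rewrite -[LHS]subr0 -q0; ring.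
Qed.

End QADifferences.

Lemma DA_le (R : realType) n (A : seq 'I_n) (f : {set 'I_n} -> R[i]) B (C : R) :
 (forall B', cabs (f B') <= C) -> cabs (DA A f B) <= 2 ^+ size A * C.
Proof.
elim: A f B C => [|a A IH] f B C fC /=; first by rewrite expr0 mul1r.
rewrite exprSr -mulrA; apply: IH => B'; apply: (leT (cabsB _ _)).
by have := fC B'; have := fC (a |: B')%SET; lra.
Qed.

(** * Row averages of resolvent entries of a model *)

Section ResolventModel.
Variables (R : realType) (mu : model R) (w : R[i]).
Notation n := (mdim mu).
Notation G om B := (Gm (mh om) w B).

Lemma Gm_indep (B : {set 'I_n}) a s t : a \in B ->
 indep (mrow a) (fun om : mOm mu => G om B s t).
Proof.
move=> aB om' om; congr (invmx (_ - _) _ _); apply/matrixP => i j; rewrite !mxE.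
case: ifP => // /negbT; rewrite negb_or => /andP[iB jB]; congr (_%:C).
rewrite /mh; case: eqP => // _; rewrite ffunE !inE.
have ai : (a == i) = false by apply: contraNF iB => /eqP <-.
have aj : (a == j) = false by apply: contraNF jB => /eqP <-.
by rewrite ai aj.
Qed.

(** The mean over row [s] of the inverse diagonal entry given by Schur's formula; the fluctuation
    caused by row [s] is collected in [Zq]. *)
Definition av (om : mOm mu) s : R[i] :=
 - w - \sum_t (mS s t)%:C * G om [set s]%SET t t.

Definition Zq (om : mOm mu) s : R[i] :=
 \sum_t \sum_r (mh om s t)%:C * G om [set s]%SET t r * (mh om r s)%:C
 - \sum_t (mS s t)%:C * G om [set s]%SET t t.

Lemma Gm_diagV_av (om : mOm mu) s : 0 < Im w ->
 (G om fs0 s s)^-1 = av om s - Zq om s.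
Proof.
move=> w0; rewrite (Gm_diagV (mh_sym om) w0) finset.setU0 /av /Zq.
have -> : \sum_k \sum_l Hm (mh om) fs0 s k * G om [set s]%SET k l * Hm (mh om) fs0 l s =
  \sum_t \sum_r (mh om s t)%:C * G om [set s]%SET t r * (mh om r s)%:C.
 by apply: eq_bigr => k _; apply: eq_bigr => l _; rewrite !mxE !inE.
by ring.
Qed.

Lemma av_indep s : indep (mrow s) (fun om => av om s).
Proof.
move=> om' om; rewrite /av; congr (_ - _); apply: eq_bigr => t _.
by rewrite (Gm_indep t t (set11 s)).
Qed.

Lemma mS_ge0 s t : 0 <= @mS _ mu s t.
Proof. by apply: mE_ge0 => om; exact: sqr_ge0. Qed.

Lemma mS_diag s : @mS _ mu s s = 0.
Proof.
rewrite /mS /mE -(EEC (mlaw_sum1 (m:=mu)) 0); apply: eq_EE => om.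
by rewrite /mh eqxx expr0n.
Qed.

Lemma av_Im (om : mOm mu) s : 0 < Im w -> Im w <= - Im (av om s).
Proof.
move=> w0; rewrite /av ImD !ImN opprD !opprK lerDl Im_sum sumr_ge0 // => t _.
by rewrite ImM /= mul0r addr0 mulr_ge0 ?mS_ge0 // Gm_Im_ge0 //; exact: mh_sym.
Qed.

Lemma av_neq0 (om : mOm mu) s : 0 < Im w -> av om s != 0.
Proof.
move=> w0; apply: contraTneq (av_Im om s w0) => ->.
by rewrite /= oppr0 -ltNge.
Qed.

Lemma avV_le (om : mOm mu) s : 0 < Im w -> cabs (av om s)^-1 <= (Im w)^-1.
Proof.
move=> w0; rewrite cabsV lef_pV2 ?posrE ?cabs_gt0 ?av_neq0 //.
apply: (leT (av_Im om s w0)); apply: leT (Im_le_cabs _).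
by rewrite -normrN ler_norm.
Qed.

Lemma mh_cross s t r : EE (mlaw (m:=mu)) (fun om => mh om s t * mh om r s) =
 if t == r then mS s t else 0.
Proof.
case: eqP => [->|/eqP tr].
 by rewrite /mS /mE; apply: eq_EE => om; rewrite (mh_sym om).1 -expr2.
have [->|rs] := eqVneq r s.
 by rewrite -(EEC (mlaw_sum1 (m:=mu)) 0); apply: eq_EE => om; rewrite {2}/mh eqxx mulr0.
rewrite (@eq_EE _ _ _ _ _ (fun om => mh om s t * mxi [set r; s]%SET (om [set r; s]%SET))); last first.
 by move=> om; rewrite {2}/mh (negbTE rs).
rewrite (EE_coordM (mlaw_sum1 (m:=mu)) (mxi [set r; s]%SET)); last first.
 move=> om' om; rewrite /mh; case: eqP => // /eqP st; rewrite ffunE inE.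
 case: eqP => // /setP/(_ r); rewrite !inE eqxx (negbTE rs) /= => /eqP rt.
 by rewrite rt eqxx in tr.
by rewrite (EE_coord (mlaw_sum1 (m:=mu))) mxi_mean mulr0.
Qed.

Lemma cEx_real (A : {set {set 'I_n}}) (f : mOm mu -> R) :
 cEx (mlaw (m:=mu)) A (fun om => (f om)%:C) = (fun om => (Ex (mlaw (m:=mu)) A f om)%:C).
Proof.
by apply: funext => om; apply: eqC => //=; rewrite (ExC (mlaw_sum1 (m:=mu))).
Qed.

Lemma cEx_row_hh s t r : cEx (mlaw (m:=mu)) (mrow s)
  (fun om => (mh om s t)%:C * (mh om r s)%:C) =
 fun _ => (if t == r then mS s t else 0)%:C.
Proof.
rewrite (_ : (fun om => _) = (fun om : mOm mu => (mh om s t * mh om r s)%:C)); last first.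
 by apply: funext => om; rewrite rmorphM.
rewrite cEx_real; apply: funext => om; congr (_%:C); rewrite Ex_EE -mh_cross.
by apply: eq_EE => om'; rewrite mh_merge mh_merge_r.
Qed.

Lemma cEx_sum (K V : finType) (p : K -> V -> R) (A : {set K}) (I : finType) (F : I -> {ffun K -> V} -> R[i]) :
 cEx p A (fun om => \sum_i F i om) = (fun om => \sum_i cEx p A (F i) om).
Proof.
apply: funext => om; apply: eqC; rewrite ?Re_sum ?Im_sum /cEx /= -Ex_sum.
 by apply: eq_Ex => om'; rewrite Re_sum.
by apply: eq_Ex => om'; rewrite Im_sum.
Qed.

Lemma cEx_Zq s : cEx (mlaw (m:=mu)) (mrow s) (fun om => Zq om s) = fun _ => 0.
Proof.
rewrite /Zq cExB cEx_sum; apply: funext => om.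
rewrite [X in _ - X om]cEx_id; first last.
- by move=> om' om0; apply: eq_bigr => t _; rewrite (Gm_indep t t (set11 s)).
- exact: mlaw_sum1.
apply/eqP; rewrite subr_eq0; apply/eqP; apply: eq_bigr => t _; rewrite cEx_sum (bigD1 t) //=.
have E r : cEx (mlaw (m:=mu)) (mrow s) (fun om => (mh om s t)%:C * G om [set s]%SET t r * (mh om r s)%:C) om
  = G om [set s]%SET t r * (if t == r then mS s t else 0)%:C.
  have -> : (fun om : mOm mu => (mh om s t)%:C * G om [set s]%SET t r * (mh om r s)%:C) =
  (fun om => G om [set s]%SET t r * ((mh om s t)%:C * (mh om r s)%:C)).
  by apply: funext => om'; ring.
  by rewrite (cExM _ _ (Gm_indep t r (set11 s))) cEx_row_hh.
rewrite E eqxx mulrC big1 ?addr0 // => r rt.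
by rewrite E eq_sym (negbTE rt) mulr0.
Qed.

End ResolventModel.

(** * Thresholds and powers of the matrix size *)

Section WhpMore.
Variables (R : realType) (U : Type) (mu : U -> model R).
Notation Nr u := ((msize (mu u))%:R : R).

Lemma powR_ge1 u (e : R) : (0 < msize (mu u))%N -> 0 <= e -> 1 <= Nr u `^ e.
Proof. by move=> N0 e0; rewrite -[leLHS](powRr0 (Nr u)) ler_powR ?ler1n. Qed.

Lemma whp_moments_ev (X : forall u, mOm (mu u) -> R) :
 (forall u w, 0 <= X u w) ->
 (forall (q : nat) (e : R), (0 < q)%N -> 0 < e -> exists N0 : nat, forall u,
  (N0 <= msize (mu u))%N -> mE (fun w => X u w ^+ (q + q)) <= Nr u `^ e) ->
 forall e : R, 0 < e -> whp (fun u w => X u w <= Nr u `^ e).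
Proof.
move=> X0 HX e e0 D; have [k [k0 Hk]] := powR_nat_ge D.+1 e0.
have [N0 HN0] := HX k 1 k0 ltr01.
exists (maxn N0 1) => u; rewrite geq_max => /andP[h0 h1].
have N0' : 0 < Nr u by rewrite ltr0n.
have P0 : 0 < Nr u `^ e by rewrite powR_gt0.
have kk : (0 < k + k)%N by rewrite addn_gt0 k0.
apply: (le_mid (mpr (fun w => ~ (X u w ^+ (k + k) <= (Nr u `^ e) ^+ (k + k))))).
 apply: mpr_le => w; apply: contra_not; rewrite ler_pXn2r // nnegrE ?(ltW P0) //.
apply: (leT (mpr_markov _ _)); rewrite ?exprn_gt0 //.
 by move=> w; rewrite exprn_ge0.
rewrite ler_pdivrMr ?exprn_gt0 //; apply: (leT (HN0 u h0)).
rewrite powRr1 ?(ltW N0') // mulrC ler_pdivlMr ?exprn_gt0 // -exprS exprD.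
apply: (leT (Hk _ h1)); rewrite ler_peMr ?exprn_ge0 ?(ltW P0) //.
rewrite -[leLHS](expr1n _ k); apply: ler_Xn; rewrite ?(ltW P0) //.
by apply: powR_ge1 => //; exact: ltW.
Qed.

Definition evt (P : U -> Prop) : Prop :=
 exists N0 : nat, forall u, (N0 <= msize (mu u))%N -> P u.

Lemma evt_and P Q : evt P -> evt Q -> evt (fun u => P u /\ Q u).
Proof.
move=> [N0 H0] [N1 H1]; exists (maxn N0 N1) => u; rewrite geq_max => /andP[h0 h1].
by split; [exact: H0|exact: H1].
Qed.

Lemma evt_mono (P Q : U -> Prop) : (forall u, P u -> Q u) -> evt P -> evt Q.
Proof. by move=> PQ [N0 H]; exists N0 => u /H /PQ. Qed.

Lemma evt_pos : evt (fun u => 0 < msize (mu u))%N.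
Proof. by exists 1%N. Qed.

Lemma evt_powR (C e : R) : 0 < e -> evt (fun u => C <= Nr u `^ e).
Proof. by move=> e0; have [N0 H] := powR_ge_ev C e0; exists N0 => u /H. Qed.

Lemma powR_exp (x e : R) k : (x `^ e) ^+ k = x `^ (e * k%:R).
Proof. by rewrite -powR_mulrn ?powR_ge0 // -powRrM. Qed.

Lemma powRDp (x a b : R) : 0 < x -> x `^ (a + b) = x `^ a * x `^ b.
Proof. by move=> x0; rewrite powRD //; apply/implyP => _; rewrite gt_eqF. Qed.

End WhpMore.

Arguments evt {R U} mu P.

(** * Fluctuation averaging for families of models *)

Section FluctuationAveragingFamily.
Variables (R : realType) (kap : nat -> R) (cn vmax : R).
Variables (U : Type) (mu : U -> model R) (w : U -> R[i]) (Psi : U -> R) (c K : R).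
Notation Nr u := ((msize (mu u))%:R : R).
Notation GG u om := (Gm (@mh _ (mu u) om) (w u)).
Notation G0 u om s t := (GG u om fs0 s t).
Hypotheses (gmu : forall u, good_model kap cn vmax (mu u)) (w_gt0 : forall u, 0 < Im (w u))
 (w_big : forall u, (Im (w u))^-1 <= Nr u) (c_gt0 : 0 < c) (K_ge1 : 1 <= K) (Psi_gt0 : forall u, 0 < Psi u)
 (Psi_ge : forall u, (Nr u)^-1 <= Psi u ^+ 2) (Psi_le : forall u, Psi u <= Nr u `^ (- c)).
Hypothesis Hoff : forall e, 0 < e -> whp (fun u (om : mOm (mu u)) =>
 forall s t, s != t -> cabs (G0 u om s t) <= Nr u `^ e * Psi u).
Hypothesis Hdiag : whp (fun u (om : mOm (mu u)) =>
 forall s, cabs (G0 u om s s) <= K /\ cabs (G0 u om s s)^-1 <= K).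
Hypothesis HZ : forall e, 0 < e -> whp (fun u (om : mOm (mu u)) =>
 forall s, cabs (Zq (w u) om s) <= Nr u `^ e * Psi u).

Let N_gt0 u : 0 < Nr u.
Proof. by have [/andP[N0 _] _ _ _] := gmu u; rewrite ltr0n. Qed.
Let N_ge1 u : 1 <= Nr u.
Proof. by have [/andP[N0 _] _ _ _] := gmu u; rewrite ler1n. Qed.
Let PsiV_le u : (Psi u)^-1 <= Nr u.
Proof.
have P0 := Psi_gt0 u; have N0 := N_gt0 u.
rewrite -[leRHS]invrK lef_pV2; try sgn.
rewrite -(@ler_pXn2r _ 2); try sgn.
apply: leT (Psi_ge u); rewrite expr2 ger_pMl ?invr_gt0 // invf_le1 //.
Qed.

Let Psi_le1 u : Psi u <= 1.
Proof.
apply: (leT (Psi_le u)); rewrite powRN invf_le1; try sgn.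
by apply: powR_ge1; [have [/andP[]] := gmu u|exact: ltW].
Qed.

Let Gle u om B s t : cabs (GG u om B s t) <= Nr u.
Proof. by apply: leT (w_big u); apply: Gm_le => //; exact: mh_sym. Qed.
Let base_minor u om e : (forall s t, s != t -> cabs (G0 u om s t) <= Nr u `^ e * Psi u) ->
 (forall s, cabs (G0 u om s s) <= K /\ cabs (G0 u om s s)^-1 <= K) ->
 minor_bounds (@mh _ (mu u) om) (w u) 0 (Nr u `^ e * Psi u) K.
Proof.
move=> h1 h2 B; rewrite leqn0 cards_eq0 => /eqP ->.
by split=> [s t st _ _|s _|s _]; [exact: h1|exact: (h2 s).1|exact: (h2 s).2].
Qed.

Section Differences.
Variable m : nat.
Definition dcond u (p : 'J_(mu u) * seq 'J_(mu u)) : bool :=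
 [&& uniq p.2, p.1 \notin p.2, p.2 != [::] & (size p.2 <= m)%N].
Definition U1 := {u : U & {p : 'J_(mu u) * seq 'J_(mu u) | dcond p}}.
Let mu1 (x : U1) := mu (projT1 x).
Definition X1 (x : U1) (om : mOm (mu1 x)) : R :=
 cabs (DA (sval (projT2 x)).2 (fun B => GG (projT1 x) om B (sval (projT2 x)).1 (sval (projT2 x)).1)
  fs0) / Psi (projT1 x) ^+ (size (sval (projT2 x)).2).+1.

Lemma whp_X1 e : 0 < e -> @whp R U1 mu1 (fun x om => X1 om <= Nr (projT1 x) `^ e).
Proof.
(* The first bound keeps [N^e' Psi] small; the second makes [m + 1] powers of [N^e'] cost at most
   [N^(e/2)], which leaves as much for the constants. *)
move=> e0; pose e' := Num.min (c / 2) (e / (2 * m.+1%:R)).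
have m1 : 0 < m.+1%:R :> R by sgn.
have e'0 : 0 < e' by rewrite lt_min; sgn.
have e'c : e' <= c / 2 by rewrite /e' ge_min lexx.
have e'e : e' * m.+1%:R <= e / 2.
 apply: (le_mid (e / (2 * m.+1%:R) * m.+1%:R)).
  by rewrite leMr ?(ltW m1) // /e' ge_min lexx orbT.
 by apply: eq_ler; field; rewrite addrC natr1 gt_eqF.
pose D := dconst (2 ^+ m * K) m.
have e2 : 1 <= 2 ^+ m :> R by apply: exprn_ege1; lra.
have D0 : 0 <= D by apply: (le_mid 1) => //; apply: dconst_ge1; rewrite -[leLHS]mulr1 ler_pM.
have wU : whp (fun u (om : mOm (mu u)) => forall s (A : seq 'J_(mu u)), dcond (s, A) ->
  cabs (DA A (fun B => GG u om B s s) fs0) / Psi u ^+ (size A).+1 <= Nr u `^ e); last first.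
 move=> DD; have [N0 H] := wU DD; exists N0 => x hx; apply: leT (H _ hx).
 move: x hx => [u [[s A] cA]] hx; apply: mpr_le => om; apply: contra_not => H'.
 exact: H' cA.
apply: whp_ev (whp_and (Hoff e'0) Hdiag).
have [N1 HN1] := @powR_ge_ev R (D * 2 ^+ m ^+ m.+1) (e / 2) (divr_gt0 e0 (ltr0Sn _ 1)).
have [N2 HN2] := @powR_ge_ev R (8 ^+ m.+2 * K ^+ 2) (c / 2) (divr_gt0 c_gt0 (ltr0Sn _ 1)).
exists (maxn N1 N2) => u; rewrite geq_max => /andP[h1 h2] om [off diag] s A /and4P[/= uA sA A0 szA].
have N0 := N_gt0 u; have P0 := Psi_gt0 u.
set x := Nr u `^ e'; have x1 : 1 <= x by apply: powR_ge1; [rewrite -(@ltr0n R)|exact: ltW].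
have x0 : 0 <= x by lra.
have xP : x * Psi u <= Nr u `^ (- (c / 2)).
 apply: (le_mid (Nr u `^ (c / 2) * Nr u `^ (- c))).
  by apply: ler_pM => //; [exact: ltW|rewrite ler_powR].
 by rewrite -powRDp // (_ : c / 2 + - c = - (c / 2)) //; lra.
have P1 : x * Psi u <= 1.
 apply: (leT xP); rewrite powRN invf_le1; try sgn.
 by apply: powR_ge1; [rewrite -(@ltr0n R)|rewrite divr_ge0 // ltW].
have cond : 8 ^+ m.+2 * (K ^+ 2 * (x * Psi u)) <= 1.
 rewrite mulrA; apply: (le_mid (8 ^+ m.+2 * K ^+ 2 * Nr u `^ (- (c / 2)))).
  have K0 : 0 <= K := leT ler01 K_ge1.
  by apply: leMl; [sgn|exact: xP].
 by rewrite powRN ler_pdivrMr ?powR_gt0 // mul1r; exact: HN2.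
have xP0 : 0 <= x * Psi u by sgn.
have := DA_diag_le (mh_sym om) (w_gt0 u) xP0 P1 K_ge1 (base_minor off diag) cond uA sA A0 szA.
rewrite -/D mulrA exprMn => H; rewrite ler_pdivrMr ?exprn_gt0 //; apply: (leT H).
rewrite mulrA leMr; try sgn.
apply: (le_mid (D * (2 ^+ m * x) ^+ m.+1)).
 apply: leMl => //; apply: ler_weXn2l; last by [].
 by rewrite -[leLHS]mulr1; apply: ler_pM.
rewrite exprMn mulrA.
have -> : Nr u `^ e = Nr u `^ (e / 2) * Nr u `^ (e / 2) by rewrite -powRDp // -splitr.
lepM; first by rewrite -[leLHS]/(D * 2 ^+ m ^+ m.+1); exact: HN1.
by rewrite powR_exp ler_powR.
Qed.

Lemma X1_mom k e : 0 < e -> exists N0 : nat, forall x : U1, (N0 <= msize (mu1 x))%N ->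
 mE (fun om => X1 (x := x) om ^+ k.+1) <= Nr (projT1 x) `^ e.
Proof.
move=> e0; apply: (moments_of_whp (mu := mu1) (X := X1)) => //.
- by move=> x om; rewrite divr_ge0 ?cabs_ge0 // exprn_ge0 // ltW.
- exact: whp_X1.
- move=> k'; exists ((2 ^+ m) ^+ k'), ((m.+2) * k')%N => -[u [[s A] /= cA]].
 have N0 := N_gt0 u; have N1 := N_ge1 u; have P0 := Psi_gt0 u.
 have szA : (size A <= m)%N by case/and4P: cA.
 apply: (le_mid (mE (fun _ : mOm (mu u) => (2 ^+ m) ^+ k' * Nr u ^+ (m.+2 * k')))).
  apply: le_mE => om; rewrite exprM -exprMn; apply: ler_Xn.
  - by rewrite divr_ge0 ?cabs_ge0 // exprn_ge0 // ltW.
  - sgn.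
  rewrite /X1 /= [Nr u ^+ m.+2]exprS mulrA -exprVn; apply: ler_pM; rewrite ?cabs_ge0 //.
  + by rewrite exprn_ge0 // invr_ge0 ltW.
  + apply: (le_mid (2 ^+ size A * Nr u)); first exact: DA_le.
  rewrite leMr ?(ltW N0) // ler_weXn2l //; lra.
  + apply: (le_mid (Nr u ^+ (size A).+1)).
  by apply: ler_Xn; rewrite ?invr_ge0 ?(ltW P0) ?(ltW N0).
  by rewrite ler_weXn2l.
 by rewrite /mE (EEC (mlaw_sum1 (m:=mu u))).
Qed.

End Differences.

Definition U0 := {u : U & 'J_(mu u)}.
Let mu0 (x : U0) := mu (projT1 x).
Definition X0 (x : U0) (om : mOm (mu0 x)) : R :=
 cabs (G0 (projT1 x) om (projT2 x) (projT2 x) - (av (w (projT1 x)) om (projT2 x))^-1) / Psi (projT1 x).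
(** The remainder of [1/(av - Zq)] after its first-order term. That term has mean zero over row [s],
    and the remainder is of order [Psi^2]. *)
Definition X2 (x : U0) (om : mOm (mu0 x)) : R :=
 cabs (G0 (projT1 x) om (projT2 x) (projT2 x) - (av (w (projT1 x)) om (projT2 x))^-1
  - Zq (w (projT1 x)) om (projT2 x) / av (w (projT1 x)) om (projT2 x) ^+ 2) / Psi (projT1 x) ^+ 2.

Let diffE u om s : G0 u om s s - (av (w u) om s)^-1 = Zq (w u) om s * G0 u om s s / av (w u) om s.
Proof.
have a0 := av_neq0 om s (w_gt0 u).
have g0 := Gm_diag_neq0 (mh_sym om) (w_gt0 u) fs0 s.
have := Gm_diagV_av om s (w_gt0 u) => gV.
have -> : Zq (w u) om s = av (w u) om s - (G0 u om s s)^-1 by rewrite gV; ring.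
by field; rewrite a0 g0.
Qed.

Let diffE2 u om s : G0 u om s s - (av (w u) om s)^-1 - Zq (w u) om s / av (w u) om s ^+ 2 =
 Zq (w u) om s ^+ 2 * G0 u om s s / av (w u) om s ^+ 2.
Proof.
have a0 := av_neq0 om s (w_gt0 u).
have -> : Zq (w u) om s / av (w u) om s ^+ 2 = Zq (w u) om s / av (w u) om s * (av (w u) om s)^-1.
 by field.
rewrite diffE.
have -> : Zq (w u) om s * G0 u om s s / av (w u) om s - Zq (w u) om s / av (w u) om s * (av (w u) om s)^-1
 = Zq (w u) om s / av (w u) om s * (G0 u om s s - (av (w u) om s)^-1) by ring.
by rewrite diffE; field.
Qed.

Lemma whp_X02 e : 0 < e -> @whp R U0 mu0 (fun x om => X0 om <= Nr (projT1 x) `^ e /\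
  X2 om <= Nr (projT1 x) `^ e).
Proof.
move=> e0; pose e' := Num.min (c / 2) (e / 4).
have e'0 : 0 < e' by rewrite lt_min !divr_gt0.
have e'c : e' <= c / 2 by rewrite /e' ge_min lexx.
have e'e : e' <= e / 4 by rewrite /e' ge_min lexx orbT.
have wU : whp (fun u (om : mOm (mu u)) => forall s,
  cabs (G0 u om s s - (av (w u) om s)^-1) <= Nr u `^ e * Psi u /\
  cabs (G0 u om s s - (av (w u) om s)^-1 - Zq (w u) om s / av (w u) om s ^+ 2) <= Nr u `^ e * Psi u ^+ 2); last first.
 move=> DD; have [N0 H] := wU DD; exists N0 => x hx; apply: leT (H _ hx).
 move: x hx => [u s] hx; apply: mpr_le => om; apply: contra_not => H'.
 by have [h1 h2] := H' s; rewrite /X0 /X2 /= !ler_pdivrMr ?exprn_gt0.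
apply: whp_ev (whp_and (HZ e'0) Hdiag).
have e20 : 0 < e / 2 by sgn.
have c20 : 0 < c / 2 by sgn.
have [N1 HN1] := @powR_ge_ev R (4 * K ^+ 3) (e / 2) e20.
have [N2 HN2] := @powR_ge_ev R (2 * K) (c / 2) c20.
exists (maxn N1 N2) => u; rewrite geq_max => /andP[h1 h2] om [hZ diag] s.
have N0 := N_gt0 u; have P0 := Psi_gt0 u; have [gK gVK] := diag s; have zx := hZ s.
set x := Nr u `^ e' in zx; have x1 : 1 <= x by apply: powR_ge1; [rewrite -(@ltr0n R)|exact: ltW].
have x0 : 0 <= x by lra.
have xP0 : 0 <= x * Psi u by sgn.
have xP : x * Psi u <= Nr u `^ (- (c / 2)).
 apply: (le_mid (Nr u `^ (c / 2) * Nr u `^ (- c))).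
  by apply: ler_pM => //; [exact: ltW|rewrite ler_powR].
 by rewrite -powRDp // (_ : c / 2 + - c = - (c / 2)) //; lra.
have xPK : 2 * K * (x * Psi u) <= 1.
 apply: (le_mid (2 * K * Nr u `^ (- (c / 2)))).
  have K0' : 0 <= K := leT ler01 K_ge1.
  by apply: leMl; [sgn|exact: xP].
 by rewrite powRN ler_pdivrMr ?powR_gt0 // mul1r; exact: HN2.
have a0 := av_neq0 om s (w_gt0 u).
have aK : cabs (av (w u) om s)^-1 <= 2 * K.
 have aE : (G0 u om s s)^-1 = av (w u) om s - Zq (w u) om s by exact: Gm_diagV_av.
 have g0 : 0 < cabs (G0 u om s s) by rewrite cabs_gt0; exact: Gm_diag_neq0 (mh_sym om) (w_gt0 u) _ _.
 have hle : (cabs (G0 u om s s))^-1 <= cabs (av (w u) om s) + x * Psi u.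
  rewrite -cabsV aE; apply: (leT (cabsB _ _)); by rewrite lerD2l.
 have gi : K^-1 <= (cabs (G0 u om s s))^-1 by rewrite lef_pV2 ?posrE //; lra.
 have Kp : 0 < K by lra.
 have ap : 0 < cabs (av (w u) om s) by rewrite cabs_gt0.
 have h3 : 1 <= K * cabs (av (w u) om s) + K * (x * Psi u).
  by rewrite -mulrDr -ler_pdivrMl // mulr1; exact: leT hle.
 rewrite cabsV -[leLHS]mul1r ler_pdivrMr //; lra.
have NE : Nr u `^ e = Nr u `^ (e / 2) * Nr u `^ (e / 2) by rewrite -powRDp // -splitr.
have xe : x ^+ 2 <= Nr u `^ (e / 2) by rewrite powR_exp ler_powR //; lra.
have C1 : 4 * K ^+ 3 <= Nr u `^ (e / 2) by exact: HN1.
have K0 : 0 <= K := leT ler01 K_ge1.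
have bnd : 4 * K ^+ 3 * x ^+ 2 <= Nr u `^ e by rewrite NE; apply: ler_pM => //; sgn.
split.
 rewrite diffE !cabsM; apply: (le_mid (x * Psi u * K * (2 * K))).
  by apply: ler_pM => //; [sgn|exact: cabs_ge0|apply: ler_pM => //; exact: cabs_ge0].
 rewrite (_ : x * Psi u * K * (2 * K) = 2 * K ^+ 2 * x * Psi u); last by ring.
 rewrite leMr ?(ltW P0) //; apply: leT bnd; apply: ler_pM => //; first sgn.
  have : K ^+ 2 * 1 <= K ^+ 2 * K by rewrite leMl ?sqr_ge0.
  by rewrite -exprSr; have := sqr_ge0 K; lra.
 by rewrite expr2 ler_peMl.
rewrite diffE2 cabsM cabsM cabsV !cabsX -exprVn -cabsV.
apply: (le_mid ((x * Psi u) ^+ 2 * K * (2 * K) ^+ 2)).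
 apply: ler_pM => //; first sgn.
 - sgn.
 - by apply: ler_pM => //; [exact: sqr_ge0|exact: cabs_ge0|leXn].
 - by leXn.
rewrite (_ : (x * Psi u) ^+ 2 * K * (2 * K) ^+ 2 = 4 * K ^+ 3 * x ^+ 2 * Psi u ^+ 2); last by ring.
by rewrite leMr ?sqr_ge0.
Qed.

Let gvar u s : 0 < @mvar _ (mu u) s <= vmax.
Proof. by have [_ _ H _] := gmu u. Qed.

(** A polynomial bound from [|G| <= N]; it is meant for exceptional events only. *)
Lemma Zq_mom k : exists C : R, exists m : nat, forall x : U0,
 mE (fun om : mOm (mu0 x) => (cabs (Zq (w (projT1 x)) om (projT2 x)) ^+ 2) ^+ k.+1) <= C * Nr (projT1 x) ^+ m.
Proof.
exists ((quad_form_const kap k * (vmax ^+ 4 * cn ^+ 2 + 1)) ^+ k.+1), (2 * k.+1)%N => -[u s] /=.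
have N0 := N_gt0 u; have N1 := N_ge1 u.
pose al : R := (vmax ^+ 4 * cn ^+ 2 + 1) * Nr u ^+ 2.
have al0 : 0 < al.
 rewrite mulr_gt0 ?exprn_gt0 // ltr_wpDl // mulr_ge0 ?sqr_ge0 //.
 by rewrite -[4%N]/(2 * 2)%N exprM sqr_ge0.
have := @lde_quad_cond R kap cn vmax k (mu u) s (gmu u) (fun t r om => GG u om [set s]%SET t r)
  (fun=> al) _ _ _ _ _.
rewrite exprM -exprMn -mulrA -/al => H.
have {H} H : mE (fun om : mOm (mu u) => (cabs (Zq (w u) om s) ^+ 2 / al) ^+ k.+1) <= quad_form_const kap k ^+ k.+1.
 apply: H => //.
 - by move=> t r; exact: (Gm_indep (w u) t r (set11 s)).
 - by move=> t r om; apply: Gm_sym; exact: mh_sym.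
 - move=> om; have [_ hn _ _] := gmu u.
  have v0 t : 0 <= @mvar _ (mu u) t by have /andP[/ltW] := gvar t.
  have v1 t : @mvar _ (mu u) t <= vmax by have /andP[] := gvar t.
  have vm0 : 0 <= vmax by apply: leT (v1 s).
  apply: (le_mid ((vmax / Nr u) ^+ 2 * \sum_(t < mdim (mu u)) \sum_(r < mdim (mu u)) vmax * vmax * Nr u ^+ 2)).
  apply: ler_pM; first sgn.
  - sgn.
  - leXn.
  by rewrite leMr ?invr_ge0.
  apply: ler_sum => t _; apply: ler_sum => r _; apply: ler_pM; [sgn|sgn|by apply: ler_pM|].
  by apply: ler_Xn; rewrite ?cabs_ge0 //; exact: Gle.
  rewrite !sumr_const card_ord -!mulrnA -[_ *+ (_ * _)]mulr_natl natrM.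
  rewrite (_ : _ * _ = vmax ^+ 4 * (mdim (mu u))%:R ^+ 2); last by field; rewrite gt_eqF.
  rewrite /al mulrDl mul1r -[leLHS]addr0 lerD ?sqr_ge0 // -mulrA -exprMn.
  rewrite leMl //; first by rewrite -[4%N]/(2 * 2)%N exprM sqr_ge0.
  by apply: ler_Xn; rewrite //; apply: leT hn.
rewrite exprMn mulrC -ler_pdivrMl ?exprn_gt0 //; apply: leT H.
rewrite /mE -EEZ; apply: eq_ler; apply: eq_EE => om.
by rewrite [RHS]exprMn exprVn mulrC.
Qed.

Lemma X0_mom k e : 0 < e -> exists N0 : nat, forall x : U0, (N0 <= msize (mu0 x))%N ->
 mE (fun om => X0 (x := x) om ^+ k.+1) <= Nr (projT1 x) `^ e.
Proof.
move=> e0; apply: (moments_of_whp (mu := mu0) (X := X0)) => //.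
- by move=> x om; rewrite divr_ge0 ?cabs_ge0 // ltW.
- by move=> e1 e10; apply: whp_mono (whp_X02 e10) => x om [].
- move=> k'; exists (2 ^+ k'), (2 * k')%N => -[u s].
 have N0 := N_gt0 u; have P0 := Psi_gt0 u.
 apply: (le_mid (mE (fun _ : mOm (mu u) => 2 ^+ k' * Nr u ^+ (2 * k')))); last first.
  by rewrite /mE (EEC (mlaw_sum1 (m:=mu u))).
 apply: le_mE => om; rewrite exprM -exprMn; apply: ler_Xn; [|sgn|].
  by rewrite divr_ge0 ?cabs_ge0 // ltW.
 rewrite /X0 /= expr2 mulrA; apply: ler_pM => //; first sgn.
  sgn.
 have h1 := Gle om fs0 s s; have h2 := leT (avV_le om s (w_gt0 u)) (w_big u).
 by apply: (leT (cabsB _ _)); lra.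
Qed.

Lemma X2_mom k e : 0 < e -> exists N0 : nat, forall x : U0, (N0 <= msize (mu0 x))%N ->
 mE (fun om => X2 (x := x) om ^+ k.+1) <= Nr (projT1 x) `^ e.
Proof.
move=> e0; apply: (moments_of_whp (mu := mu0) (X := X2)) => //.
- by move=> x om; rewrite divr_ge0 ?cabs_ge0 // sqr_ge0.
- by move=> e1 e10; apply: whp_mono (whp_X02 e10) => x om [].
- case=> [|k'].
  exists 1, 0%N => x; rewrite mulr1 /mE; under eq_EE do rewrite expr0.
  by rewrite (EEC (mlaw_sum1 (m:=mu0 x))).
 have [C [m HC]] := Zq_mom k'.
 exists (2 ^+ k'.+1 * (3 ^+ k'.+1 + `|C|)), (4 * k'.+1 + m)%N => -[u s].
 have N0 := N_gt0 u; have N1 := N_ge1 u; have P0 := Psi_gt0 u.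
 apply: (le_mid (mE (fun om : mOm (mu u) => Nr u ^+ (4 * k'.+1) * (2 ^+ k'.+1 *
  (3 ^+ k'.+1 + (cabs (Zq (w u) om s) ^+ 2) ^+ k'.+1))))).
  apply: le_mE => om.
  apply: (le_mid (Nr u ^+ (4 * k'.+1) * (3 + cabs (Zq (w u) om s) ^+ 2) ^+ k'.+1)); last first.
  by rewrite leMl ?exprn_ge0 ?(ltW N0) // exprD_le_2exp // sqr_ge0.
  rewrite exprM -exprMn; apply: ler_Xn.
  - by rewrite divr_ge0 ?cabs_ge0 // sqr_ge0.
  - sgn.
  have PN : Psi u ^- 2 <= Nr u ^+ 2.
  by rewrite -exprVn; leXn.
  rewrite /X2 /= (_ : 4 = 2 + 2)%N // exprD mulrAC.
  apply: ler_pM => //; [exact: cabs_ge0|sgn|].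
  have aN := leT (avV_le om s (w_gt0 u)) (w_big u).
  have NN : Nr u <= Nr u ^+ 2 by rewrite -[leLHS]expr1 ler_weXn2l.
  have N2 : 1 <= Nr u ^+ 2 by apply: leT NN.
  have gN := Gle om fs0 s s.
  set Z := Zq (w u) om s.
  have Z0 : 0 <= cabs Z := cabs_ge0 _.
  have ZaN : cabs (Z / av (w u) om s ^+ 2) <= Nr u ^+ 2 * (1 + cabs Z ^+ 2).
  rewrite cabsM -exprVn cabsX mulrC; apply: ler_pM => //.
  - sgn.
  - by leXn.
  - by have := sqr_ge0 (cabs Z - 1); rewrite sqrrB; lra.
  apply: (leT (cabsB _ _)); have := cabsB (G0 u om s s) (av (w u) om s)^-1.
  lra.
 rewrite /mE EEZ EEZ EED (EEC (mlaw_sum1 (m:=mu u))).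
 have H1 := HC (existT _ u s).
 have H2 : mE (fun om : mOm (mu u) => (cabs (Zq (w u) om s) ^+ 2) ^+ k'.+1) <= `|C| * Nr u ^+ m.
  by apply: (leT H1); rewrite leMr ?exprn_ge0 // ler_norm.
 rewrite [leRHS](_ : _ = Nr u ^+ (4 * k'.+1) * (2 ^+ k'.+1 * (3 ^+ k'.+1 * Nr u ^+ m + `|C| * Nr u ^+ m))); last first.
  by rewrite exprD; ring.
 mulL.
 mulL.
 apply: lerD => //; apply: ler_peMr; first sgn.
 by apply: exprn_ege1; rewrite //; lra.
Qed.

Section T1.
Variable W : forall u, 'J_(mu u) -> R[i].
Arguments W : clear implicits.
Hypothesis W_le : forall u s, cabs (W u s) <= 1.
Notation QQ u s F := (fun om : mOm (mu u) => F om - cEx (mlaw (m:=mu u)) (mrow s) F om).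

Lemma mdim_gt0 u : (0 < mdim (mu u))%N.
Proof. by have [/andP[h1 h2] _ _ _] := gmu u; apply: leq_trans h2. Qed.

(** The hypothesis of the counting argument. With [A] empty, subtracting [1/av], which is constant
    over row [s], leaves a quantity of order [Psi]. Otherwise [QA_DA] passes to minor differences,
    where each index of [A] gains a factor [Psi]. *)
Lemma mom_F q e1 : (0 < q)%N -> 0 < e1 -> evt mu (fun u =>
 forall s (A : seq 'J_(mu u)), uniq A -> s \notin A -> (size A <= q + q)%N ->
 mE (fun om => cabs (QA (mlaw (m:=mu u)) (@mrow _ _) A (QQ u s (fun om => G0 u om s s)) om) ^+ (q + q)) <=
  ((Nr u `^ e1 * Psi u) ^+ (size A).+1) ^+ (q + q)).
Proof.
move=> q0 e10.
have qq : (q + q = (q + q).-1.+1)%N by rewrite prednK // addn_gt0 q0.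
pose Cq : R := 2 ^+ (q + q) * 2.
have [N1 HN1] := X1_mom (q + q) (q + q).-1 (e10).
have [N2 HN2] := X0_mom (q + q).-1 (e10).
have [N3 HN3] := evt_powR mu (Cq ^+ (q + q).+1) e10.
exists (maxn 1 (maxn N1 (maxn N2 N3))) => u; rewrite !geq_max => /and4P[h0 h1 h2 h3] s A uA sA szA.
have P0 := Psi_gt0 u; have N0 := N_gt0 u.
have Cq1 : 1 <= Cq.
 have : 1 <= 2 ^+ (q + q) :> R by rewrite -[leLHS](expr1n _ (q + q)); apply: ler_Xn; lra.
 by rewrite /Cq; lra.
have Cq0 : 0 <= Cq by lra.
have NE1 : 1 <= Nr u `^ e1 by apply: powR_ge1 => //; exact: ltW.
have NE0 : 0 <= Nr u `^ e1 by lra.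
rewrite -exprM exprMn.
have step (F : mOm (mu u) -> R[i]) (k : nat) : (k <= q + q)%N ->
  mE (fun om => (cabs (F om) / Psi u ^+ (size A).+1) ^+ (q + q)) <= Nr u `^ e1 ->
  Cq ^+ k.+1 * mE (fun om => cabs (F om) ^+ (q + q)) <=
  Nr u `^ e1 ^+ ((size A).+1 * (q + q)) * Psi u ^+ ((size A).+1 * (q + q)).
 move=> kq; rewrite /mE; under eq_EE do rewrite expr_div_n mulrC.
 rewrite EEZ -exprM ler_pdivrMl ?exprn_gt0 // => H.
 apply: (le_mid (Cq ^+ (q + q).+1 * (Psi u ^+ ((size A).+1 * (q + q)) * Nr u `^ e1))).
  apply: ler_pM => //; [sgn| |by rewrite ler_weXn2l].
  by apply: mE_ge0 => om; rewrite exprn_ge0 ?cabs_ge0.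
 rewrite mulrC -mulrA mulrC leMr; try sgn.
 apply: (le_mid (Nr u `^ e1 ^+ 2)).
  by rewrite expr2; apply: leMl => //; exact: HN3.
 apply: ler_weXn2l => //.
 by rewrite mulSn (leq_trans _ (leq_addr _ _)) // addnn -[2%N]/(1.*2)%N leq_double.
have [A0|A0] := eqVneq A [::].
 subst A; rewrite /=.
 apply: leT (step (fun om => G0 u om s s - (av (w u) om s)^-1) 0%N _ _); first last.
 - by have := HN2 (existT _ u s) h2; rewrite -qq expr1.
 - by [].
 rewrite expr1.
 apply: (le_mid (mE (fun om => cabs (QQ u s (fun om => G0 u om s s - (av (w u) om s)^-1) om) ^+ (q + q)))).
  apply: eq_ler; apply: eq_EE => om; congr (cabs _ ^+ _).
  rewrite cExB [cEx _ _ (fun om => (av _ _ _)^-1)]cEx_id; first by ring.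
  - exact: mlaw_sum1.
  - by move=> om' om0; rewrite av_indep.
 apply: leT (QA_contract (@mlaw_ge0 _ (mu u)) (@mlaw_sum1 _ (mu u)) (@mrow _ (mu u)) [:: s] _ _) _.
 by rewrite expr1.
have szA0 : (0 < size A)%N by case: A A0 {uA sA szA step}.
have cA : dcond (q + q) (s, A) by rewrite /dcond /= uA sA A0 szA.
apply: leT (step (fun om => DA A (fun B => GG u om B s s) fs0) (size A) szA _); last first.
 by have := HN1 (existT _ u (exist _ (s, A) cA)) h1; rewrite -qq.
rewrite (QA_QQ (mlaw_sum1 (m:=mu u))).
have QE := QA_DA (mlaw_sum1 (m:=mu u)) (F := fun B om => GG u om B s s)
 (fun B a aB => Gm_indep (w u) s s aB) A fs0.
rewrite /= in QE; rewrite QE.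
exact: (QA_contract (@mlaw_ge0 _ (mu u)) (@mlaw_sum1 _ (mu u)) (@mrow _ (mu u)) (s :: A)).
Qed.

Lemma avg_Q e : 0 < e -> whp (fun u (om : mOm (mu u)) =>
 cabs ((mdim (mu u))%:R^-1 * \sum_s W u s * (G0 u om s s - cEx (mlaw (m:=mu u)) (mrow s) (fun om => G0 u om s s) om))
  <= Nr u `^ e * Psi u ^+ 2).
Proof.
move=> e0.
pose Y u om : R := cabs ((mdim (mu u))%:R^-1 * \sum_s W u s * (G0 u om s s - cEx (mlaw (m:=mu u)) (mrow s) (fun om => G0 u om s s) om)) / Psi u ^+ 2.
have Y0 u om : 0 <= Y u om by rewrite /Y; sgn.
suff H : whp (fun u om => Y u om <= Nr u `^ e).
 by apply: whp_mono H => u om; rewrite /Y ler_pdivrMr // exprn_gt0.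
apply: whp_moments_ev e0 => // q e1 q0 e10.
pose e2 := Num.min (c / 2) (e1 / (8 * q%:R)).
have q1 : 0 < q%:R :> R by sgn.
have e20 : 0 < e2 by rewrite lt_min; sgn.
have e2c : e2 <= c / 2 by rewrite /e2 ge_min lexx.
have e2e : e2 * (2 * (q + q))%N%:R <= e1 / 2.
 apply: (le_mid (e1 / (8 * q%:R) * (2 * (q + q))%N%:R)).
  by rewrite leMr // /e2 ge_min lexx orbT.
 by rewrite natrM natrD; apply: eq_ler; field; rewrite gt_eqF.
have [N1 HN1] := mom_F q0 e20.
have e12 : 0 < e1 / 2 by sgn.
have [N2 HN2] := evt_powR mu (((q + q) ^ (q + q))%:R ^+ 2) e12.
exists (maxn 1 (maxn N1 N2)) => u; rewrite !geq_max => /and3P[h0 h1 h2].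
have P0 := Psi_gt0 u; have N0 := N_gt0 u.
set B := Nr u `^ e2 * Psi u.
have NE1 : 1 <= Nr u `^ e2 by apply: powR_ge1 => //; exact: ltW.
have NE0 : 0 < Nr u `^ e2 by sgn.
have B0 : 0 < B by rewrite mulr_gt0.
have B1 : B <= 1.
 apply: (le_mid (Nr u `^ c * Nr u `^ (- c))); last first.
  by rewrite -powRDp // subrr powRr0.
 lepM.
 by rewrite ler_powR ?N_ge1 //; lra.
have Bn : (mdim (mu u))%:R^-1 <= B ^+ 2.
 apply: (le_mid (Nr u)^-1).
  rewrite lef_pV2 ?posrE ?ltr0n ?mdim_gt0 // ler_nat.
  by have [/andP[]] := gmu u.
 apply: (leT (Psi_ge u)); leXn.
 by rewrite /B ler_peMl // ltW.
have H := @fluct_avg_moment R _ _ (mlaw (m:=mu u)) (@mlaw_ge0 _ (mu u)) (@mlaw_sum1 _ (mu u)) (mdim (mu u)) (@mrow _ (mu u)) q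
 (fun s om => W u s * (G0 u om s s - cEx (mlaw (m:=mu u)) (mrow s) (fun om => G0 u om s s) om)) B (mdim_gt0 u) B0 B1 Bn.
have {}H := H _ _.
apply: (le_mid (((q + q) ^ (q + q))%:R ^+ 2 * B ^+ (2 * (q + q)) / Psi u ^+ (2 * (q + q)))); last first.
 rewrite ler_pdivrMr ?exprn_gt0 // /B exprMn mulrA leMr; try sgn.
 have -> : Nr u `^ e1 = Nr u `^ (e1 / 2) * Nr u `^ (e1 / 2) by rewrite -powRDp // -splitr.
 lepM; first exact: HN2.
 by rewrite powR_exp ler_powR ?N_ge1.
rewrite /Y /mE; under eq_EE do rewrite expr_div_n mulrC.
rewrite EEZ -exprM mulrC leMr; try sgn.
apply: H => [s|s A uA sA szA].
 rewrite cExZ; apply: funext => om; rewrite cEx_QQ0 ?mulr0 //; exact: mlaw_sum1.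
apply: leT (HN1 u h1 s A uA sA szA).
apply: le_mE => om; leXn.
by rewrite QAZ cabsM ler_piMl ?cabs_ge0.
Qed.

End T1.

(** Averaging over row [s] removes the term linear in [Zq], so the error is of second order for each
    [s] separately. *)
Lemma cEx_diag_av e : 0 < e -> whp (fun u (om : mOm (mu u)) => forall s,
 cabs (cEx (mlaw (m:=mu u)) (mrow s) (fun om => G0 u om s s) om - (av (w u) om s)^-1) <= Nr u `^ e * Psi u ^+ 2).
Proof.
move=> e0.
pose Y (x : U0) (om : mOm (mu0 x)) : R := cabs (cEx (mlaw (m:=mu0 x)) (mrow (projT2 x)) (fun om => G0 (projT1 x) om (projT2 x) (projT2 x)) om
  - (av (w (projT1 x)) om (projT2 x))^-1) / Psi (projT1 x) ^+ 2.
have YE x om : Y x om = cabs (cEx (mlaw (m:=mu0 x)) (mrow (projT2 x)) (fun om =>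
  G0 (projT1 x) om (projT2 x) (projT2 x) - (av (w (projT1 x)) om (projT2 x))^-1
  - Zq (w (projT1 x)) om (projT2 x) / av (w (projT1 x)) om (projT2 x) ^+ 2) om) / Psi (projT1 x) ^+ 2.
 case: x om => u s om; rewrite /Y /=; congr (cabs _ / _).
 rewrite !cExB [cEx _ _ (fun om => (av _ _ _)^-1)]cEx_id; first last.
 - by move=> om' om0; rewrite av_indep.
 - exact: mlaw_sum1.
 have -> : (fun om : mOm (mu u) => Zq (w u) om s / av (w u) om s ^+ 2) = (fun om => (av (w u) om s ^+ 2)^-1 * Zq (w u) om s).
  by apply: funext => om'; rewrite mulrC.
 rewrite cExM; last by move=> om' om0; rewrite av_indep.
 by rewrite cEx_Zq mulr0 subr0.
have H : whp (fun x om => Y x om <= Nr (projT1 x) `^ e).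
 apply: (whp_moments_ev (mu := mu0)) e0 => [x om|q e1 q0 e10].
  by rewrite divr_ge0 ?cabs_ge0 ?sqr_ge0.
 have qq : (q + q = (q + q).-1.+1)%N by rewrite prednK // addn_gt0 q0.
 have [N2 HN2] := X2_mom (q + q).-1 e10.
 exists N2 => x hx; apply: leT (HN2 x hx); rewrite -qq /mE.
 under eq_EE do rewrite YE expr_div_n mulrC.
 rewrite EEZ.
 apply: (le_mid (((Psi (projT1 x) ^+ 2) ^+ (q + q))^-1 * mE (fun om : mOm (mu0 x) => cabs (
  G0 (projT1 x) om (projT2 x) (projT2 x) - (av (w (projT1 x)) om (projT2 x))^-1
  - Zq (w (projT1 x)) om (projT2 x) / av (w (projT1 x)) om (projT2 x) ^+ 2) ^+ (q + q)))).
  mulL.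
  exact: (cEx_contract (@mlaw_ge0 _ (mu0 x)) (@mlaw_sum1 _ (mu0 x))).
 rewrite /mE -EEZ; apply: le_mE => om; by rewrite /X2 expr_div_n mulrC.
have HH := @whp_forall R U mu (fun u => 'J_(mu u)) 1 cn
  (fun u s om => Y (existT _ u s) om <= Nr u `^ e) _ _.
apply: whp_mono (HH _ _) => [u om h s| u |].
- by have := h s; rewrite /Y /= ler_pdivrMr // exprn_gt0.
- by rewrite card_ord expr1; have [_ ? _ _] := gmu u.
- by apply: whp_mono H => -[u s] om.
Qed.

(** The entry minus [1/av] is its fluctuation over row [s], which needs cancellation between
    different [s], plus a row average that is already accurate to order [Psi^2]. *)
Theorem fluctuation_averaging (W : forall u, 'J_(mu u) -> R[i]) :
 (forall u s, cabs (W u s) <= 1) -> forall e, 0 < e -> whp (fun u (om : mOm (mu u)) =>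
 cabs ((mdim (mu u))%:R^-1 * \sum_s W u s * (G0 u om s s - (av (w u) om s)^-1)) <= Nr u `^ e * Psi u ^+ 2).
Proof.
move=> W1 e e0; have e20 : 0 < e / 2 by sgn.
apply: whp_ev (whp_and (avg_Q W1 e20) (cEx_diag_av e20)).
have [N0 HN0] := evt_powR mu 2 e20.
exists N0 => u /HN0 {}HN0 om [h1 h2].
have P0 := Psi_gt0 u.
have n0 : 0 < (mdim (mu u))%:R :> R by rewrite ltr0n mdim_gt0.
pose cE s := cEx (mlaw (m:=mu u)) (mrow s) (fun om => G0 u om s s) om.
have -> : \sum_s W u s * (G0 u om s s - (av (w u) om s)^-1) =
 \sum_s W u s * (G0 u om s s - cE s) + \sum_s W u s * (cE s - (av (w u) om s)^-1).
 by rewrite -big_split /=; apply: eq_bigr => s _; ring.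
rewrite mulrDr; apply: (leT (cabsD _ _)).
have h3 : cabs ((mdim (mu u))%:R^-1 * \sum_s W u s * (cE s - (av (w u) om s)^-1)) <= Nr u `^ (e / 2) * Psi u ^+ 2.
 rewrite cabsM cabsV (_ : cabs _ = (mdim (mu u))%:R :> R); last first.
  by rewrite -[X in cabs X]natC cabsR ger0_norm.
 rewrite mulrC ler_pdivrMr //; apply: (leT (cabs_sum _ _ _)).
 apply: (le_mid (\sum_(s < mdim (mu u)) Nr u `^ (e / 2) * Psi u ^+ 2)).
  apply: ler_sum => s _; rewrite cabsM; apply: leT (h2 s).
  by rewrite ler_piMl ?cabs_ge0.
 by rewrite sumr_const card_ord -[leLHS]mulr_natr.
apply: (leT (lerD h1 h3)); rewrite -mulrDl; mulR.
have -> : Nr u `^ e = Nr u `^ (e / 2) * Nr u `^ (e / 2) by rewrite -powRDp ?N_gt0 // -splitr.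
have : 0 <= Nr u `^ (e / 2) by exact: powR_ge0.
by move: HN0; nra.
Qed.

End FluctuationAveragingFamily.

Lemma Gm_Im_gt0 (R : realType) n (h : 'I_n -> 'I_n -> R) (w : R[i]) B s :
 hsym h -> 0 < Im w -> 0 < Im (Gm h w B s s).
Proof.
move=> hh w0; rewrite Gm_ward // mulr_gt0 // (bigD1 s) //=.
rewrite ltr_pwDl ?sumr_ge0 // ?exprn_gt0 // ?cabs_gt0 ?Gm_diag_neq0 //.
by move=> i _; rewrite sqr_ge0.
Qed.

(** * The large deviation event for one spectral parameter *)

Section LargeDeviationEvent.
Variables (R : realType).

(** All later estimates on one sample are deterministic consequences of this event. By Ward's
    identity the sums of squared resolvent entries appear as imaginary parts divided by [Im w]. *)
Definition lde_ev (mu : model R) (w : R[i]) (x : R) (om : mOm mu) : Prop :=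
 let G B := Gm (mh om) w B in let N := (msize mu)%:R in let b := Im w in
 [/\ forall s, cabs (Zq w om s) <= x * (mvar s * sqrt ((\sum_t Im (G [set s]%SET t t)) / (N ^+ 2 * b))),
  forall s t, cabs (\sum_k (mh om s k)%:C * G [set s]%SET k t) <=
  x * sqrt (mvar s * (Im (G [set s]%SET t t) / (N * b))),
  forall s t, s != t -> cabs (\sum_k \sum_l (mh om s k)%:C * G [set s; t]%SET k l * (mh om l t)%:C) <=
  x * sqrt (mvar s * mvar t * ((\sum_k Im (G [set s; t]%SET k k)) / (N ^+ 2 * b))) &
  forall s t, `|mh om s t| <= x * sqrt (mvar s * mvar t / N)].

Variables (kap : nat -> R) (cn vmax : R) (U : Type) (mu : U -> model R) (w : U -> R[i]).
Notation Nr u := ((msize (mu u))%:R : R).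
Notation GG u om := (Gm (@mh _ (mu u) om) (w u)).
Hypotheses (gmu : forall u, good_model kap cn vmax (mu u)) (w_gt0 : forall u, 0 < Im (w u)).

Let N_gt0 u : 0 < Nr u.
Proof. by have [/andP[N0 _] _ _ _] := gmu u; rewrite ltr0n. Qed.
Let v_gt0 u s : 0 < @mvar _ (mu u) s.
Proof. by have [_ _ /(_ s)/andP[]] := gmu u. Qed.
Let v_le u s : @mvar _ (mu u) s <= vmax.
Proof. by have [_ _ /(_ s)/andP[]] := gmu u. Qed.
Let G_gt0 u om B s : 0 < Im (GG u om B s s).
Proof. by apply: Gm_Im_gt0 => //; exact: mh_sym. Qed.
Let vm_ge0 u (s : 'J_(mu u)) : 0 <= vmax.
Proof. exact: leT (ltW (v_gt0 s)) (v_le s). Qed.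
Let ward u om B t : \sum_k cabs (GG u om B k t) ^+ 2 = Im (GG u om B t t) / Im (w u).
Proof.
have hs := mh_sym om; rewrite (Gm_ward hs (w_gt0 u)) [_ * (\sum__ _)]mulrC mulfK ?gt_eqF //.
by apply: eq_bigr => k _; rewrite (Gm_sym _ hs).
Qed.

Let vward u om B t (P : pred 'J_(mu u)) : \sum_(k | P k) mvar k * cabs (GG u om B k t) ^+ 2
  <= vmax * (Im (GG u om B t t) / Im (w u)).
Proof.
rewrite -ward mulr_sumr big_mkcond; apply: ler_sum => k _.
have := vm_ge0 k; have := v_gt0 k; have := sqr_ge0 (cabs (GG u om B k t)) => h1 h2 h3.
case: ifP => _; last exact: mulr_ge0.
by rewrite leMr.
Qed.

Let absorb e : 0 < e -> evt mu (fun u => Nr u `^ (e / 2) * vmax <= Nr u `^ e).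
Proof.
move=> e0; have e20 : 0 < e / 2 by sgn.
apply: evt_mono (evt_and (evt_pos mu) (evt_powR mu vmax e20)) => u [N0 h].
rewrite [e in leRHS]splitr powRDp ?N_gt0 //; apply: leMl => //; exact: powR_ge0.
Qed.

Let absorb' e : 0 < e -> evt mu (fun u => Nr u `^ (e / 2) * sqrt vmax <= Nr u `^ e).
Proof.
move=> e0; have e20 : 0 < e / 2 by sgn.
apply: evt_mono (evt_and (evt_pos mu) (evt_powR mu (sqrt vmax) e20)) => u [N0 h].
rewrite [e in leRHS]splitr powRDp ?N_gt0 //; apply: leMl => //; exact: powR_ge0.
Qed.

Lemma whp_index (I : U -> finType) (m : nat) (c : R) (A : forall u, I u -> mOm (mu u) -> Prop) :
 (forall u, (#|I u|)%:R <= c * Nr u ^+ m) ->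
 @whp _ {u : U & I u} (fun x => mu (projT1 x)) (fun x => A (projT1 x) (projT2 x)) ->
 whp (fun u om => forall i, A u i om).
Proof. exact: whp_forall. Qed.

Let dim_le u : (mdim (mu u))%:R <= cn * Nr u.
Proof. by have [_ ? _ _] := gmu u. Qed.
Let card1 u : (#|'J_(mu u)|)%:R <= cn * Nr u ^+ 1.
Proof. by rewrite card_ord expr1. Qed.
Let card2 u : (#|{: 'J_(mu u) * 'J_(mu u)}|)%:R <= cn ^+ 2 * Nr u ^+ 2.
Proof. by rewrite card_prod card_ord natrM -exprMn expr2; apply: ler_pM. Qed.
Let card3 u : (#|{: 'J_(mu u) * 'J_(mu u) * 'J_(mu u)}|)%:R <= cn ^+ 3 * Nr u ^+ 3.
Proof. by rewrite !card_prod card_ord !natrM -exprMn exprSr expr2; do 2 (apply: ler_pM => //). Qed.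

Lemma whp_Zq e : 0 < e -> whp (fun u (om : mOm (mu u)) => forall s,
 cabs (Zq (w u) om s) <= Nr u `^ e * (mvar s * sqrt ((\sum_t Im (GG u om [set s]%SET t t)) / (Nr u ^+ 2 * Im (w u))))).
Proof.
move=> e0; have e20 : 0 < e / 2 by sgn.
apply: (@whp_index (fun u => 'J_(mu u)) 1 cn _ card1).
pose U1 := {u : U & 'J_(mu u)}.
pose al (x : U1) (om : mOm (mu (projT1 x))) : R := (mvar (projT2 x) / Nr (projT1 x)) ^+ 2 *
 (vmax ^+ 2 * \sum_t (Im (GG (projT1 x) om [set projT2 x]%SET t t) / Im (w (projT1 x)))).
have sum0 u om (s : 'J_(mu u)) : 0 < \sum_t Im (GG u om [set s]%SET t t).
 by rewrite (bigD1 s) //= ltr_pwDl // sumr_ge0 // => t _; exact: ltW.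
have := @lde_quad R kap cn vmax U1 (fun x => mu (projT1 x)) (fun x => projT2 x) (fun x => gmu (projT1 x))
 (fun x t r om => GG (projT1 x) om [set projT2 x]%SET t r) al _ _ _ _ _ _ e20.
move=> /(_ _ _ _ _ _)/whp_ev; apply.
- have [N0 H] := absorb e0; exists N0 => -[u s] /= /H {}H om /leT; apply.
 rewrite /al /= -mulr_suml.
 rewrite (_ : _ ^+ 2 * (vmax ^+ 2 * _) = (mvar s * vmax) ^+ 2 * ((\sum_t Im (GG u om [set s]%SET t t)) / (Nr u ^+ 2 * Im (w u)))); last first.
  by field; rewrite (gt_eqF (N_gt0 u)) (gt_eqF (w_gt0 u)).
 rewrite sqrtrM ?sqr_ge0 // sqrtr_sqr ger0_norm ?mulr_ge0 ?(ltW (v_gt0 s)) ?(vm_ge0 s) //.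
 rewrite [mvar s * vmax]mulrC !mulrA; apply: leMr; first exact: sqrtr_ge0.
 by apply: leMr => //; exact: ltW.
- by move=> [u s] t r om' om /=; rewrite (Gm_indep _ _ _ (set11 s)).
- move=> [u s] om' om; rewrite /al /=; congr (_ * (_ * _)); apply: eq_bigr => t _.
 by rewrite (Gm_indep _ _ _ (set11 s)).
- move=> [u s] om; rewrite /al /= mulr_gt0 ?exprn_gt0 ?divr_gt0 // -mulr_suml.
 apply: mulr_gt0; last by rewrite divr_gt0 ?sum0.
 by rewrite exprn_gt0 // (lt_le_trans (v_gt0 s)).
- by move=> [u s] t r om; apply: Gm_sym => //; exact: mh_sym.
- move=> [u s] om; rewrite /al /=; apply: leMl; first exact: sqr_ge0.
 rewrite exchange_big /= expr2 -mulrA [X in _ * X]mulr_sumr mulr_sumr; apply: ler_sum => r _.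
 under eq_bigr do rewrite mulrAC mulrC.
 rewrite -mulr_sumr; apply: ler_pM => //; first sgn.
  by rewrite sumr_ge0 // => t _; rewrite mulr_ge0 ?sqr_ge0 // ltW.
 exact: vward.
Qed.

Lemma whp_lin e : 0 < e -> whp (fun u (om : mOm (mu u)) => forall s t,
 cabs (\sum_k (mh om s k)%:C * GG u om [set s]%SET k t) <=
  Nr u `^ e * sqrt (mvar s * (Im (GG u om [set s]%SET t t) / (Nr u * Im (w u))))).
Proof.
move=> e0; have e20 : 0 < e / 2 by sgn.
suff : whp (fun u (om : mOm (mu u)) => forall p : 'J_(mu u) * 'J_(mu u),
 cabs (\sum_k (mh om p.1 k)%:C * GG u om [set p.1]%SET k p.2) <=
  Nr u `^ e * sqrt (mvar p.1 * (Im (GG u om [set p.1]%SET p.2 p.2) / (Nr u * Im (w u))))).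
 by apply: whp_mono => u om H s t; exact: (H (s, t)).
apply: (@whp_index _ 2 (cn ^+ 2) _ card2).
pose U1 := {u : U & 'J_(mu u) * 'J_(mu u)}%type.
pose al (x : U1) (om : mOm (mu (projT1 x))) : R := mvar (projT2 x).1 / Nr (projT1 x) *
 (vmax * (Im (GG (projT1 x) om [set (projT2 x).1]%SET (projT2 x).2 (projT2 x).2) / Im (w (projT1 x)))).
have := @lde_lin R kap cn vmax U1 (fun x => mu (projT1 x)) (fun x => (projT2 x).1) (fun x => gmu (projT1 x))
 (fun x k om => GG (projT1 x) om [set (projT2 x).1]%SET k (projT2 x).2) al _ _ _ _ _ e20.
move=> /(_ _ _ _ _)/whp_ev; apply.
- have [N0 H] := absorb' e0; exists N0 => -[u [s t]] /= /H {}H om /leT; apply.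
 rewrite /al /=.
 rewrite (_ : _ / _ * (vmax * _) = vmax * (mvar s * (Im (GG u om [set s]%SET t t) / (Nr u * Im (w u))))); last first.
  by field; rewrite (gt_eqF (N_gt0 u)) (gt_eqF (w_gt0 u)).
 by rewrite (sqrtrM _ (vm_ge0 s)) [leLHS]mulrA; apply: leMr; first exact: sqrtr_ge0.
- by move=> [u [s t]] k om' om /=; rewrite (Gm_indep _ _ _ (set11 s)).
- by move=> [u [s t]] om' om; rewrite /al /= (Gm_indep _ _ _ (set11 s)).
- move=> [u [s t]] om; rewrite /al /=; do 2 (rewrite mulr_gt0 ?divr_gt0 //).
 by rewrite (lt_le_trans (v_gt0 s)).
- move=> [u [s t]] om; rewrite /al /=; apply: leMl; last exact: vward.
 sgn.
Qed.

Lemma whp_h e : 0 < e -> whp (fun u (om : mOm (mu u)) => forall s t,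
 `|mh om s t| <= Nr u `^ e * sqrt (mvar s * mvar t / Nr u)).
Proof.
move=> e0.
suff : whp (fun u (om : mOm (mu u)) => forall p : 'J_(mu u) * 'J_(mu u),
 `|mh om p.1 p.2| <= Nr u `^ e * sqrt (mvar p.1 * mvar p.2 / Nr u)).
 by apply: whp_mono => u om H s t; exact: (H (s, t)).
apply: (@whp_index _ 2 (cn ^+ 2) _ card2).
pose U1 := {u : U & 'J_(mu u) * 'J_(mu u)}%type.
have := (@whp_sqr R kap cn vmax U1 (fun x => mu (projT1 x)) (fun x => gmu (projT1 x)) (fun x om => `|mh om (projT2 x).1 (projT2 x).2|)
  (fun x om => mvar (projT2 x).1 * mvar (projT2 x).2 / Nr (projT1 x)) _ _ _ e e0).
move=> /(_ _ _ _); apply.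
- by move=> x om; exact: normr_ge0.
- by move=> x om; rewrite divr_gt0 ?mulr_gt0.
move=> e' e'0; apply: whp_moments e'0 => [x om|k].
 sgn.
exists (kap k.+1) => -[u [s t]] /=; have [_ _ _ /(_ s t k.+1)] := gmu u.
rewrite mulrC -ler_pdivrMl ?exprn_gt0 ?mulr_gt0 //; apply: leT.
rewrite /mE -EEZ; apply: eq_ler; apply: eq_EE => om.
rewrite -exprVn -exprMn; congr (_ ^+ _); rewrite real_normK ?num_real //.
by field; rewrite !gt_eqF.
Qed.

(** Two linear bounds in succession: over row [t] with coefficients from the double minor, then over
    row [s] with the resulting [v] as coefficients. The shared entry [h s t] is cut out of [v] so
    that [v] does not involve row [s]; the double minor vanishes at the corresponding place. *)
Lemma whp_double e : 0 < e -> whp (fun u (om : mOm (mu u)) => forall s t, s != t ->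
 cabs (\sum_k \sum_l (mh om s k)%:C * GG u om [set s; t]%SET k l * (mh om l t)%:C) <=
  Nr u `^ e * sqrt (mvar s * mvar t * ((\sum_k Im (GG u om [set s; t]%SET k k)) / (Nr u ^+ 2 * Im (w u))))).
Proof.
move=> e0; have e40 : 0 < e / 4 by rewrite divr_gt0.
have e20 : 0 < e / 2 by rewrite divr_gt0.
pose v u (s t k : 'J_(mu u)) (om : mOm (mu u)) : R[i] :=
 if (s == t) || (k == s) then 0 else
  \sum_l (mh om t l)%:C * (if l == s then 0 else GG u om [set s; t]%SET k l).
have tin u (s t : 'J_(mu u)) : t \in [set s; t]%SET by rewrite !inE eqxx orbT.
have sin u (s t : 'J_(mu u)) : s \in [set s; t]%SET by rewrite !inE eqxx.
have W1 : whp (fun u (om : mOm (mu u)) => forall s t k, cabs (v u s t k om) <=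
  Nr u `^ (e / 4) * sqrt (mvar t / Nr u * (vmax * (Im (GG u om [set s; t]%SET k k) / Im (w u))))).
 suff : whp (fun u (om : mOm (mu u)) => forall p : 'J_(mu u) * 'J_(mu u) * 'J_(mu u),
  cabs (\sum_l (mh om p.1.2 l)%:C * (if (l == p.1.1) then 0 else GG u om [set p.1.1; p.1.2]%SET p.2 l)) <=
  Nr u `^ (e / 4) * sqrt (mvar p.1.2 / Nr u * (vmax * (Im (GG u om [set p.1.1; p.1.2]%SET p.2 p.2) / Im (w u))))).
  apply: whp_mono => u om H s t k; rewrite /v; case: ifP => _; last exact: (H (s, t, k)).
  by rewrite cabs0 mulr_ge0 ?powR_ge0 ?sqrtr_ge0.
 apply: (@whp_index _ 3 (cn ^+ 3) _ card3).
 pose U1 := {u : U & 'J_(mu u) * 'J_(mu u) * 'J_(mu u)}%type.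
 have := @lde_lin R kap cn vmax U1 (fun x => mu (projT1 x)) (fun x => (projT2 x).1.2) (fun x => gmu (projT1 x))
  (fun x l om => if l == (projT2 x).1.1 then 0 else GG (projT1 x) om [set (projT2 x).1.1; (projT2 x).1.2]%SET (projT2 x).2 l)
  (fun x om => mvar (projT2 x).1.2 / Nr (projT1 x) * (vmax * (Im (GG (projT1 x) om [set (projT2 x).1.1; (projT2 x).1.2]%SET (projT2 x).2 (projT2 x).2) / Im (w (projT1 x)))))
  _ _ _ _ _ e40.
 move=> /(_ _ _ _ _); apply.
 - by move=> [u [[s t] k]] l om' om /=; rewrite (Gm_indep _ _ _ (tin u s t)).
 - by move=> [u [[s t] k]] om' om /=; rewrite (Gm_indep _ _ _ (tin u s t)).
 - move=> [u [[s t] k]] om /=; do 2 (rewrite mulr_gt0 ?divr_gt0 //).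
  by rewrite (lt_le_trans (v_gt0 s)).
 - move=> [u [[s t] k]] om /=; apply: leMl; first by rewrite divr_ge0 // ltW.
  apply: leT (vward om [set s; t]%SET k xpredT); apply: ler_sum => l _.
  rewrite (Gm_sym (w u) (mh_sym om) [set s; t]%SET k l); apply: leMl; first exact: ltW.
  by case: ifP => _ //; rewrite cabs0 expr0n sqr_ge0.
(* The second summand is the target size; it keeps [al] positive even if every [v] vanishes. *)
pose al u (s t : 'J_(mu u)) (om : mOm (mu u)) : R := mvar s / Nr u * (\sum_k mvar k * cabs (v u s t k om) ^+ 2)
  + mvar s * mvar t * ((\sum_k Im (GG u om [set s; t]%SET k k)) / (Nr u ^+ 2 * Im (w u))).
have sum0 u om (s t : 'J_(mu u)) : 0 < \sum_k Im (GG u om [set s; t]%SET k k).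
 by rewrite (bigD1 s) //= ltr_pwDl // sumr_ge0 // => k _; exact: ltW.
have tail0 u om (s t : 'J_(mu u)) : 0 < mvar s * mvar t * ((\sum_k Im (GG u om [set s; t]%SET k k)) / (Nr u ^+ 2 * Im (w u))).
 apply: mulr_gt0; first exact: mulr_gt0.
 by apply: divr_gt0; [exact: sum0|rewrite mulr_gt0 ?exprn_gt0].
have vind u (s t k : 'J_(mu u)) : indep (mrow s) (v u s t k).
 move=> om' om; rewrite /v; have [//|st /=] := eqVneq s t; case: eqP => // /eqP ks.
 apply: eq_bigr => l _; have [->|ls] := eqVneq l s; first by rewrite !mulr0.
 rewrite (Gm_indep _ _ _ (sin u s t)); congr (_%:C * _).
 rewrite /mh; case: eqP => // /eqP tl; rewrite ffunE !inE.
 by rewrite (negbTE st) eq_sym (negbTE ls).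
have W2 : whp (fun u (om : mOm (mu u)) => forall s t, cabs (\sum_k (mh om s k)%:C * v u s t k om) <=
  Nr u `^ (e / 4) * sqrt (al u s t om)).
 suff : whp (fun u (om : mOm (mu u)) => forall p : 'J_(mu u) * 'J_(mu u),
  cabs (\sum_k (mh om p.1 k)%:C * v u p.1 p.2 k om) <= Nr u `^ (e / 4) * sqrt (al u p.1 p.2 om)).
  by apply: whp_mono => u om H s t; exact: (H (s, t)).
 apply: (@whp_index _ 2 (cn ^+ 2) _ card2).
 pose U1 := {u : U & 'J_(mu u) * 'J_(mu u)}%type.
 have := @lde_lin R kap cn vmax U1 (fun x => mu (projT1 x)) (fun x => (projT2 x).1) (fun x => gmu (projT1 x))
  (fun x k om => v (projT1 x) (projT2 x).1 (projT2 x).2 k om)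
  (fun x om => al (projT1 x) (projT2 x).1 (projT2 x).2 om)
  _ _ _ _ _ e40.
 move=> /(_ _ _ _ _); apply.
 - by move=> [u [s t]] k; exact: vind.
 - move=> [u [s t]] om' om /=; rewrite /al; congr (_ * _ + _ * (_ / _)).
  by apply: eq_bigr => k _; rewrite vind.
  by apply: eq_bigr => k _; rewrite (Gm_indep _ _ _ (sin u s t)).
 - move=> [u [s t]] om /=; rewrite ltr_wpDl // mulr_ge0 ?divr_ge0 ?(ltW (v_gt0 _)) // sumr_ge0 // => k _.
  by rewrite mulr_ge0 ?sqr_ge0 // ltW.
 - by move=> [u [s t]] om; rewrite /al /= lerDl ltW.
apply: whp_ev (whp_and W1 W2).
have [N0 H] := evt_and (evt_pos mu) (evt_powR mu (sqrt (vmax ^+ 2 + 1)) e20).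
exists N0 => u /H [N1 {}H] om [h1 h2] s t st.
have hs := mh_sym om.
rewrite (_ : \sum_k _ = \sum_k (mh om s k)%:C * v u s t k om); last first.
 apply: eq_bigr => k _; rewrite /v (negbTE st) /=; have [->|ks] := eqVneq k s.
  by rewrite hs.2 mul0r big1 // => l _; rewrite !mul0r.
 rewrite mulr_sumr; apply: eq_bigr => l _; rewrite (hs.1 l t) -mulrA; congr (_ * _).
 rewrite mulrC; congr (_ * _); have [->|//] := eqVneq l s.
 rewrite (Gm_sym (w u) hs _ k s); apply: Gm_out0 => //; [exact: sin|by rewrite eq_sym].
apply: (leT (h2 s t)).
set T := \sum_k Im (GG u om [set s; t]%SET k k).
set x := Nr u `^ (e / 4); have x1 : 1 <= x by apply: powR_ge1 => //; exact: ltW.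
have vm0 := vm_ge0 s.
have alle : al u s t om <= x ^+ 2 * (vmax ^+ 2 + 1) * (mvar s * mvar t * (T / (Nr u ^+ 2 * Im (w u)))).
 have t0 := tail0 u om s t; rewrite -/T in t0.
 rewrite /al -/T mulrDr mulr1 mulrDl; apply: lerD; last first.
  by rewrite ler_peMl ?(ltW t0) // -[leLHS](expr1n _ 2); apply: ler_Xn; lra.
 apply: (le_mid (mvar s / Nr u * (\sum_k vmax * (x ^+ 2 * (mvar t / Nr u * (vmax * (Im (GG u om [set s; t]%SET k k) / Im (w u)))))))).
  apply: leMl; first by rewrite divr_ge0 // ltW.
  apply: ler_sum => k _; apply: ler_pM => //; [exact: ltW|exact: sqr_ge0|].
  have r0 : 0 <= mvar t / Nr u * (vmax * (Im (GG u om [set s; t]%SET k k) / Im (w u))).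
  by rewrite mulr_ge0 ?divr_ge0 ?mulr_ge0 ?invr_ge0 // ltW.
  rewrite -[X in x ^+ 2 * X]sqr_sqrtr // -exprMn; apply: ler_Xn; rewrite ?cabs_ge0 //.
  by rewrite mulr_ge0 ?sqrtr_ge0 //; lra.
 rewrite -!mulr_sumr -mulr_suml -/T; apply: eq_ler.
 by field; rewrite (gt_eqF (N_gt0 u)) (gt_eqF (w_gt0 u)).
apply: (le_mid (x * sqrt (x ^+ 2 * (vmax ^+ 2 + 1) * (mvar s * mvar t * (T / (Nr u ^+ 2 * Im (w u))))))).
 by apply: leMl; [lra|exact: ler_wsqrtr].
rewrite sqrtrM; last by rewrite mulr_ge0 ?sqr_ge0 // addr_ge0 ?sqr_ge0.
rewrite sqrtrM ?sqr_ge0 // sqrtr_sqr ger0_norm; last by lra.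
rewrite !mulrA; apply: leMr; first exact: sqrtr_ge0.
have -> : Nr u `^ e = x * x * Nr u `^ (e / 2).
 by rewrite /x -!powRDp ?N_gt0 //; congr (_ `^ _); field.
by rewrite leMl // mulr_ge0; lra.
Qed.

Lemma lde_whp e : 0 < e -> whp (fun u (om : mOm (mu u)) => lde_ev (w u) (Nr u `^ e) om).
Proof.
move=> e0; apply: whp_mono (whp_and (whp_and (whp_Zq e0) (whp_lin e0)) (whp_and (whp_double e0) (whp_h e0))).
by move=> u om [[h1 h2] [h3 h4]].
Qed.

End LargeDeviationEvent.

Lemma ImV (R : realType) (z : R[i]) : Im z^-1 = - Im z / cabs z ^+ 2.
Proof. by rewrite cabs_sqE; case: z => a b /=; rewrite mulNr. Qed.

(** * Deterministic estimates at one spectral parameter *)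

Section OneStep.
Variables (R : realType) (kap : nat -> R) (cn vmax : R) (mu : model R) (w : R[i]) (x g : R) (om : mOm mu).
Notation N := ((msize mu)%:R : R).
Notation n := (mdim mu).
Notation b := (Im w).
Notation G B := (Gm (mh om) w B).
Notation G0 := (Gm (mh om) w fs0).
Notation Phi := (sqrt (g / (N * b))).
Hypotheses (gmu : good_model kap cn vmax mu) (b_gt0 : 0 < b) (x_ge : 4 <= x) (cn_le : cn <= x)
 (vmax_le : vmax <= x) (kap_le : `|kap 1| <= x) (wV_le : (cabs w)^-1 <= x)
 (Gd : forall s, cabs (G0 s s) <= x /\ cabs (G0 s s)^-1 <= x) (gI : forall s, Im (G0 s s) <= g)
 (g_le : g <= x) (Nb : x ^+ 20 <= N * b) (lde : lde_ev w x om).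

Let hs := mh_sym om.
Let x_gt0 : 0 < x. Proof. exact: lt_le_trans (ltr0Sn _ 3) x_ge. Qed.
Let x_ge0 : 0 <= x. Proof. exact: ltW. Qed.
Let N_ge1 : 1 <= N.
Proof. by have [/andP[N0 _] _ _ _] := gmu; rewrite ler1n. Qed.
Let N_gt0 : 0 < N. Proof. exact: lt_le_trans N_ge1. Qed.
Let v_gt0 (s : 'I_n) : 0 < mvar s.
Proof. by have [_ _ /(_ s)/andP[]] := gmu. Qed.
Let v_le (s : 'I_n) : mvar s <= x.
Proof. by have [_ _ /(_ s)/andP[_ h] _] := gmu; apply: (leT h). Qed.
Let Nb_gt0 : 0 < N * b. Proof. exact: mulr_gt0. Qed.
Let n_le : n%:R <= x * N.
Proof. by have [_ h _ _] := gmu; apply: (leT h); rewrite leMr // ltW. Qed.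
(** Ward's identity bounds [Im G_ss] from below by [Im w |G_ss|^2], so that [g] is at least of order
    [Im w]. *)
Let g_ge (s : 'I_n) : b <= x ^+ 2 * g.
Proof.
apply: (le_mid (x ^+ 2 * Im (G0 s s))); last first.
 by apply: leMl; [exact: sqr_ge0|exact: gI].
rewrite (Gm_ward hs b_gt0) mulrCA ler_peMr ?(ltW b_gt0) // (bigD1 s) //= mulrDr.
apply: (le_mid (x ^+ 2 * cabs (G0 s s) ^+ 2)); last first.
 by rewrite lerDl mulr_ge0 ?sqr_ge0 // sumr_ge0 // => t _; exact: sqr_ge0.
have [_] := Gd s; rewrite cabsV => h; have g0 : 0 < cabs (G0 s s).
 by rewrite cabs_gt0; exact: Gm_diag_neq0.
rewrite -exprMn -[leLHS](expr1n _ 2); leXn.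
by rewrite -ler_pdivrMr // mul1r.
Qed.

Let s0 : 'I_n.
Proof. by have [/andP[h1 h2] _ _ _] := gmu; exact: Ordinal (leq_trans h1 h2). Qed.
Let g_gt0 : 0 < g.
Proof. have := g_ge s0; rewrite -(pmulr_rgt0 g (exprn_gt0 2 x_gt0)); exact: lt_le_trans. Qed.

Lemma Phi_sqr : Phi ^+ 2 = g / (N * b).
Proof. by rewrite sqr_sqrtr; sgn. Qed.

Let Phi0 : 0 <= Phi. Proof. exact: sqrtr_ge0. Qed.

Lemma Phi_small : x ^+ 9 * Phi <= 1.
Proof.
have x0 := ltW x_gt0.
rewrite -ler_sqr; try sgn.
rewrite exprMn Phi_sqr -exprM expr1n mulrA ler_pdivrMr // mul1r; apply: leT Nb.
rewrite (_ : 20 = 18 + 2)%N // exprD leMl ?exprn_ge0 // expr2.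
by apply: (leT g_le); rewrite ler_peMl //; move: x_ge; lra.
Qed.

Lemma Phi_ge : N^-1 <= (x * Phi) ^+ 2.
Proof.
rewrite exprMn Phi_sqr invfM mulrA mulrCA -[leLHS]mulr1 leMl; try sgn.
by rewrite ler_pdivlMr // mul1r; exact: (g_ge s0).
Qed.

Let gPhi : g = N * b * Phi ^+ 2.
Proof. by rewrite Phi_sqr mulrC divfK // gt_eqF. Qed.
Let xpow k l : (k <= l)%N -> x ^+ k <= x ^+ l.
Proof. by move=> kl; apply: ler_weXn2l => //; move: x_ge; lra. Qed.
Let off_sum s t : s != t -> cabs (G0 s t) <=
 x * cabs (\sum_k (mh om s k)%:C * G [set s]%SET k t).
Proof.
move=> st; rewrite (Gm_sym w hs) (Gm_off hs b_gt0); last by rewrite eq_sym.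
rewrite cabsM cabsN mulrC; lepM; first by have [] := Gd s.
rewrite finset.setU0; apply: eq_ler; congr cabs; apply: eq_bigr => k _.
by rewrite /Hm !mxE !inE /= mulrC (Gm_sym w hs) (hs.1 k s).
Qed.

Let minor_eq s t : s != t -> G [set s]%SET t t = G0 t t - G0 s t ^+ 2 / G0 s s.
Proof.
move=> st; have := Gm_minor hs b_gt0 fs0 (u := s) (s := t) t; rewrite eq_sym => /(_ st) ->.
by rewrite finset.setU0 (Gm_sym w hs _ t s); ring.
Qed.

Let half_step s t : s != t ->
 cabs (G0 s t) ^+ 2 <= mvar s * (x ^+ 4 * Im (G [set s]%SET t t) / (N * b)).
Proof.
move=> st; have [_ h2 _ _] := lde; have I0 := Gm_Im_gt0 [set s]%SET t hs b_gt0.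
have al0 : 0 <= mvar s * (Im (G [set s]%SET t t) / (N * b)).
 sgn.
rewrite (_ : mvar s * _ = (x ^+ 2 * sqrt (mvar s * (Im (G [set s]%SET t t) / (N * b)))) ^+ 2); last first.
 by rewrite exprMn sqr_sqrtr //; ring.
leXn.
apply: (leT (off_sum st)); rewrite expr2 -mulrA; apply: leMl => //.
Qed.

(** A self-improving bound: the minor differs from the full entry by [x |G_st|^2], and [half_step]
    bounds this by a small multiple of the minor's own imaginary part, which is absorbed on the
    left. *)
Lemma minor_Im s t : s != t -> Im (G [set s]%SET t t) <= 2 * g.
Proof.
move=> st; have I0 := Gm_Im_gt0 [set s]%SET t hs b_gt0.
set I := Im (G [set s]%SET t t) in I0 *.
have h : I <= g + x * cabs (G0 s t) ^+ 2.
 rewrite /I minor_eq // ImD ImN lerD //.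
 apply: (le_mid (cabs (G0 s t ^+ 2 / G0 s s))).
  by apply: leT (Im_le_cabs _); rewrite -normrN ler_norm.
 rewrite cabsM cabsX mulrC leMr ?sqr_ge0 //; by have [] := Gd s.
have h1 : x * cabs (G0 s t) ^+ 2 <= I / 2.
 apply: (le_mid (x * (x * (x ^+ 4 * I / (N * b))))).
  rewrite leMl ?x_ge0 //; apply: (leT (half_step st)); apply: leMr => //.
  sgn.
 rewrite (_ : x * _ = x ^+ 6 / (N * b) * I); last by ring.
 rewrite [leRHS]mulrC leMr ?(ltW I0) // ler_pdivrMr // mulrC ler_pdivlMr //.
 apply: leT Nb; rewrite (_ : 20 = 6 + 14)%N // exprD leMl; try sgn.
 by have := xpow (isT : (1 <= 14)%N); rewrite expr1; move: x_ge; lra.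
by lra.
Qed.

Lemma offdiag_le s t : s != t -> cabs (G0 s t) <= x ^+ 3 * (sqrt (mvar s) * Phi).
Proof.
move=> st; have v0 := v_gt0 s.
rewrite -ler_sqr; try sgn.
apply: (leT (half_step st)).
have -> : (x ^+ 3 * (sqrt (mvar s) * Phi)) ^+ 2 = mvar s * (x ^+ 6 * g / (N * b)).
 rewrite (_ : (x ^+ 3 * (sqrt (mvar s) * Phi)) ^+ 2 = x ^+ 6 * (sqrt (mvar s) ^+ 2 * Phi ^+ 2)); last by ring.
 rewrite Phi_sqr sqr_sqrtr ?(ltW v0) //; ring.
rewrite leMl ?(ltW v0) // leMr; try sgn.
rewrite (_ : 6 = 4 + 2)%N // exprD -mulrA leMl; try sgn.
apply: (leT (minor_Im st)); rewrite leMr; try sgn.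
by rewrite expr2; move: x_ge; nra.
Qed.

Lemma offdiag_le4 s t : s != t -> cabs (G0 s t) <= x ^+ 4 * Phi.
Proof.
move=> st; apply: (leT (offdiag_le st)).
rewrite (_ : x ^+ 4 * Phi = x ^+ 3 * (x * Phi)); last by ring.
apply: leMl; first exact: exprn_ge0.
apply: leMr => //; rewrite -ler_sqr ?nnegrE ?sqrtr_ge0 // sqr_sqrtr; try sgn.
apply: (leT (v_le s)); rewrite expr2 ler_peMl //; move: x_ge; lra.
Qed.

Lemma Zq_le s : cabs (Zq w om s) <= x ^+ 4 * (mvar s * Phi).
Proof.
have [h1 _ _ _] := lde; apply: (leT (h1 s)).
rewrite (_ : x ^+ 4 * (mvar s * Phi) = x * (mvar s * (x ^+ 3 * Phi))); last by ring.
apply: leMl => //; mulL.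
rewrite -ler_sqr; try sgn.
have I0 t := Gm_Im_gt0 [set s]%SET t hs b_gt0.
have T0 : 0 <= \sum_t Im (G [set s]%SET t t) by rewrite sumr_ge0 // => t _; exact: ltW.
rewrite sqr_sqrtr; last sgn.
rewrite (_ : (x ^+ 3 * Phi) ^+ 2 = x ^+ 6 * Phi ^+ 2); last by ring.
rewrite Phi_sqr ler_pdivrMr; last sgn.
rewrite (_ : x ^+ 6 * (g / (N * b)) * (N ^+ 2 * b) = x ^+ 6 * N * g); last by field; rewrite !gt_eqF.
have Is : Im (G [set s]%SET s s) <= x ^+ 4 * g.
 apply: (le_mid (x ^+ 2 * b)); last first.
  rewrite (_ : 4 = 2 + 2)%N // exprD -mulrA leMl ?sqr_ge0 //; exact: (g_ge s).
 rewrite Gm_out ?set11 // eqxx mulN1r ImN.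
 have wi := cabs_sqE w; have w0 : 0 < cabs w.
  rewrite cabs_gt0; apply: contraTneq b_gt0 => ->; by rewrite ltxx.
 rewrite -(@ler_pM2l _ (cabs w ^+ 2)); try sgn.
 rewrite (_ : cabs w ^+ 2 * - Im w^-1 = b); last first.
  by rewrite ImV; field; rewrite gt_eqF.
 rewrite -[leLHS]mul1r mulrA leMr ?(ltW b_gt0) // -exprMn -[leLHS](expr1n _ 2).
 leXn.
 by rewrite mulrC -ler_pdivrMr // mul1r.
rewrite (bigD1 s) //=.
have H2 : \sum_(t | t != s) Im (G [set s]%SET t t) <= (x * N) * (2 * g).
 apply: (le_mid (\sum_(t < n) 2 * g)).
  rewrite big_mkcond; apply: ler_sum => t _; case: ifP => [ts|_]; last sgn.
  by apply: minor_Im; rewrite eq_sym.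
 by rewrite sumr_const card_ord -[leLHS]mulr_natl leMr; sgn.
apply: (leT (lerD Is H2)).
rewrite (_ : x * N * (2 * g) = 2 * x * N * g); last by ring.
rewrite -mulrDl leMr; try sgn.
apply: (le_mid (x ^+ 4 * N + 2 * x * N)).
 by rewrite lerD2r ler_peMr ?exprn_ge0.
rewrite -mulrDl leMr; try sgn.
have x14 := xpow (isT : (1 <= 4)%N); rewrite expr1 in x14.
rewrite (_ : x ^+ 6 = x ^+ 4 * x ^+ 2); last by rewrite -exprD.
have : 16 <= x ^+ 2 by rewrite expr2; move: x_ge; nra.
by have x40 : 0 <= x ^+ 4 := exprn_ge0 4 x_ge0; nra.
Qed.

Lemma mS_le s t : @mS _ mu s t <= x ^+ 2 * mvar s / N.
Proof.
have [_ _ _ /(_ s t 1%N)] := gmu; rewrite /mS /mE.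
under eq_EE do rewrite expr1; rewrite EEZ expr1 => h.
rewrite ler_pdivlMr // mulrC; apply: (leT h).
apply: (le_mid (`|kap 1| * (mvar s * mvar t))).
 by rewrite leMr ?ler_norm; sgn.
rewrite expr2 -mulrA; apply: ler_pM => //; first sgn.
by rewrite mulrC; apply: leMr => //; exact: ltW.
Qed.

Lemma minor_sum_le s : cabs (\sum_t (mS s t)%:C * G [set s]%SET t t - mSG G0 s)
 <= x ^+ 12 * (mvar s * Phi ^+ 2).
Proof.
rewrite -sumrB; apply: (leT (cabs_sum _ _ _)).
apply: (le_mid (\sum_(t < n) x ^+ 11 * (mvar s * Phi ^+ 2) / N)); last first.
 rewrite sumr_const card_ord -[leLHS]mulr_natl.
 apply: (le_mid ((x * N) * (x ^+ 11 * (mvar s * Phi ^+ 2) / N))).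
  rewrite leMr // divr_ge0 ?(ltW N_gt0) // !mulr_ge0; try sgn.
 by apply: eq_ler; field; rewrite gt_eqF.
apply: ler_sum => t _; have [<-|st] := eqVneq s t.
 rewrite mS_diag !mul0r subrr cabs0 divr_ge0 ?(ltW N_gt0) // !mulr_ge0; try sgn.
rewrite -mulrBr cabsM cabsR ger0_norm ?mS_ge0 // minor_eq // addrC addKr cabsN cabsM cabsX.
apply: (le_mid ((x ^+ 2 * mvar s / N) * ((x ^+ 4 * Phi) ^+ 2 * x))).
 apply: ler_pM; rewrite ?mS_ge0 ?mulr_ge0 ?sqr_ge0 ?cabs_ge0 //; first exact: mS_le.
 lepM; last by have [] := Gd s.
 by apply: ler_Xn; rewrite ?cabs_ge0 ?mulr_ge0 ?exprn_ge0 //; exact: offdiag_le4.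
by apply: eq_ler; ring.
Qed.

Lemma av_approx s : cabs (av w om s + w + mSG G0 s) <= x ^+ 12 * (mvar s * Phi ^+ 2).
Proof.
rewrite (_ : _ + _ = - (\sum_t (mS s t)%:C * G [set s]%SET t t - mSG G0 s)).
 by rewrite cabsN minor_sum_le.
by rewrite /av; ring.
Qed.

Lemma diagV_approx s : cabs ((G0 s s)^-1 + w + mSG G0 s) <= x ^+ 5 * (mvar s * Phi).
Proof.
rewrite (Gm_diagV_av om s b_gt0).
rewrite [X in cabs X](_ : _ = (av w om s + w + mSG G0 s) - Zq w om s); last by ring.
apply: (leT (cabsB _ _)); apply: (leT (lerD (av_approx s) (Zq_le s))).
have vP : 0 <= mvar s * Phi by sgn.
apply: (le_mid (x ^+ 3 * (mvar s * Phi) + x ^+ 4 * (mvar s * Phi))).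
 rewrite lerD2r (_ : x ^+ 12 * _ = x ^+ 9 * Phi * (x ^+ 3 * (mvar s * Phi))); last by ring.
 by rewrite ler_piMl ?Phi_small; sgn.
rewrite -mulrDl leMr // [x ^+ 5]exprSr.
have h34 := xpow (isT : (3 <= 4)%N); have x40 : 0 <= x ^+ 4 by exact: exprn_ge0.
by move: x_ge; nra.
Qed.

Lemma minor_out_Im (s : 'I_n) (B : {set 'I_n}) : s \in B -> Im (G B s s) <= x ^+ 4 * g.
Proof.
move=> sB; apply: (le_mid (x ^+ 2 * b)); last first.
 rewrite (_ : x ^+ 4 * g = x ^+ 2 * (x ^+ 2 * g)); last by ring.
 apply: leMl; [exact: sqr_ge0|exact: (g_ge s)].
rewrite Gm_out // eqxx mulN1r ImN.
have w0 : 0 < cabs w by rewrite cabs_gt0; apply: contraTneq b_gt0 => ->; rewrite ltxx.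
rewrite -(@ler_pM2l _ (cabs w ^+ 2)); try sgn.
rewrite (_ : cabs w ^+ 2 * - Im w^-1 = b); last by rewrite ImV; field; rewrite gt_eqF.
rewrite -[leLHS]mul1r mulrA leMr ?(ltW b_gt0) // -exprMn -[leLHS](expr1n _ 2).
leXn.
by rewrite mulrC -ler_pdivrMr // mul1r.
Qed.

Let small_pair : 2 * x ^+ 2 * (x ^+ 4 * Phi) ^+ 2 <= 1.
Proof.
have h := Phi_small; have P1 : x ^+ 5 * Phi <= 1.
 by apply: leT h; apply: leMr => //; exact: xpow.
rewrite (_ : 2 * x ^+ 2 * (x ^+ 4 * Phi) ^+ 2 = 2 * (x ^+ 5 * Phi) ^+ 2); last by ring.
have P2 : x ^+ 5 * Phi <= 1 / 4.
 have h5 : x ^+ 6 * Phi <= 1 by apply: leT h; apply: leMr => //; exact: xpow.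
 have h4 : 4 * (x ^+ 5 * Phi) <= x ^+ 6 * Phi.
  rewrite (_ : x ^+ 6 * Phi = x * (x ^+ 5 * Phi)); last by ring.
  by apply: leMr => //; rewrite mulr_ge0 ?exprn_ge0.
 lra.
have := mulr_ge0 (exprn_ge0 5 x_ge0) Phi0; move: P2; nra.
Qed.

Lemma minor_diagV_le s t : s != t -> cabs (G [set t]%SET s s) <= 2 * x /\ cabs (G [set t]%SET s s)^-1 <= 2 * x.
Proof.
move=> st; have ts : t != s by rewrite eq_sym.
have [d1 d2] := Gd s; have [_ d3] := Gd t.
have M0 := offdiag_le4 ts.
have A0 : cabs (G0 t s ^+ 2 / G0 t t) <= (x ^+ 4 * Phi) ^+ 2 * x.
 rewrite cabsM cabsX; lepM.
 by leXn.
have E := minor_eq ts; rewrite E.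
have x1 : (x ^+ 4 * Phi) ^+ 2 * x <= (2 * x)^-1.
 rewrite -[leRHS]mul1r ler_pdivlMr ?mulr_gt0 // (_ : _ * x * (2 * x) = 2 * x ^+ 2 * (x ^+ 4 * Phi) ^+ 2); last by ring.
 exact: small_pair.
have Gs : x^-1 <= cabs (G0 s s).
 by rewrite cabsV in d2; rewrite -[leRHS]invrK lef_pV2 ?posrE // invr_gt0 cabs_gt0; exact: Gm_diag_neq0.
have x2 : (2 * x)^-1 = x^-1 / 2 by rewrite invfM mulrC.
rewrite x2 in x1; have xi : x^-1 <= 1 by rewrite invf_le1 //; move: x_ge; lra.
have h1 := cabsB (G0 s s) (G0 t s ^+ 2 / G0 t t).
have h2 : cabs (G0 s s) <= cabs (G0 s s - G0 t s ^+ 2 / G0 t t) + cabs (G0 t s ^+ 2 / G0 t t).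
 by rewrite {1}(_ : G0 s s = (G0 s s - G0 t s ^+ 2 / G0 t t) + G0 t s ^+ 2 / G0 t t); [exact: cabsD|ring].
split; first by move: h1 A0 x1 xi d1 x_ge; lra.
rewrite cabsV -[leRHS]invrK lef_pV2 ?posrE ?invr_gt0 ?mulr_gt0 //.
 by rewrite x2; move: h2 A0 x1 Gs; lra.
have : 0 < x^-1 by sgn.
move: h2 A0 x1 Gs; lra.
Qed.

Lemma minor2_Im s t k : s != t -> k != s -> k != t -> Im (G [set s; t]%SET k k) <= 3 * g.
Proof.
move=> st ks kt; have tk : t != k by rewrite eq_sym.
have -> : G [set s; t]%SET k k = G [set t]%SET k k - G [set t]%SET k s ^+ 2 / G [set t]%SET s s.
 have := Gm_minor hs b_gt0 [set t]%SET (u := s) (s := k) k ks => ->.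
 by rewrite (Gm_sym w hs _ s k); ring.
have [_ h1] := minor_diagV_le st; have h2 := minor_Im tk.
have h3 : cabs (G [set t]%SET k s) <= 2 * (x ^+ 4 * Phi).
 have := Gm_minor hs b_gt0 fs0 (u := t) (s := k) s kt; rewrite finset.setU0 => e.
 have {e}-> : G [set t]%SET k s = G0 k s - G0 k t * G0 t s / G0 t t by rewrite e; ring.
 apply: (leT (cabsB _ _)); rewrite (_ : 2 * _ = x ^+ 4 * Phi + x ^+ 4 * Phi); last by ring.
 apply: lerD; first exact: offdiag_le4.
 have [_ d3] := Gd t; rewrite eq_sym in st; have P := mulr_ge0 (exprn_ge0 4 x_ge0) Phi0.
 rewrite cabsM cabsM; apply: (le_mid ((x ^+ 4 * Phi) * (x ^+ 4 * Phi) * x)).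
  apply: ler_pM; rewrite ?mulr_ge0 ?cabs_ge0 //; apply: ler_pM; rewrite ?cabs_ge0 //; exact: offdiag_le4.
 rewrite -mulrA ler_piMr // (_ : x ^+ 4 * Phi * x = x ^+ 5 * Phi); last by ring.
 by apply: leT Phi_small; apply: leMr => //; exact: xpow.
rewrite ImD ImN (_ : 3 * g = 2 * g + g); last by ring.
apply: lerD => //; apply: (le_mid (cabs (G [set t]%SET k s ^+ 2 / G [set t]%SET s s))).
 by apply: leT (Im_le_cabs _); rewrite -normrN ler_norm.
rewrite cabsM cabsX; apply: (le_mid ((2 * (x ^+ 4 * Phi)) ^+ 2 * (2 * x))).
 apply: ler_pM; rewrite ?sqr_ge0 ?cabs_ge0 //; leXn.
rewrite (_ : (2 * _) ^+ 2 * _ = 8 * x ^+ 9 * Phi ^+ 2); last by ring.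
rewrite Phi_sqr mulrA ler_pdivrMr // mulrC; mulL.
apply: leT Nb; apply: (le_mid (x ^+ 2 * x ^+ 9)).
 by apply: leMr; rewrite ?exprn_ge0 // expr2; move: x_ge; nra.
by rewrite -exprD; exact: xpow.
Qed.

(** Schur's formula applied to row [t] and then to row [s] in the minor. Both rows then face a minor
    independent of them. *)
Lemma offdiag_expand s t : s != t -> G0 s t = - (G0 t t * (G [set t]%SET s s *
 ((mh om s t)%:C - \sum_k \sum_l (mh om t k)%:C * G [set t; s]%SET k l * (mh om l s)%:C))).
Proof.
move=> st; have ts : t != s by rewrite eq_sym.
have U : [set t; s]%SET = (s |: [set t])%SET by rewrite finset.setUC.
rewrite (Gm_off hs b_gt0) // finset.setU0.
rewrite (eq_bigr (fun k => G [set t]%SET s k * (mh om k t)%:C)); last by move=> k _; rewrite /Hm mxE !inE.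
rewrite (bigD1 s) //= (eq_bigr (fun k => - (G [set t]%SET s s *
  (\sum_l (mh om t k)%:C * G [set t; s]%SET k l * (mh om l s)%:C)))); last first.
 move=> k ks; rewrite (Gm_sym w hs _ s k) (Gm_off hs b_gt0) // -U.
 set S1 := \sum_k0 _; set S2 := \sum_l _.
 suff -> : S2 = S1 * (mh om k t)%:C by ring.
 rewrite /S1 mulr_suml /S2.
 apply: eq_bigr => l _; rewrite (hs.1 k t); have [->|kt] := eqVneq k t.
  by rewrite hs.2 !(mul0r, mulr0).
 have [->|lt] := eqVneq l t.
  by rewrite (Gm_sym w hs) Gm_out0 ?set21 ?(mul0r, mulr0) // eq_sym.
 rewrite /Hm mxE !inE (negbTE lt) (negbTE st) /=; ring.
have z0 : \sum_l (mh om t s)%:C * G [set t; s]%SET s l * (mh om l s)%:C = 0.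
 apply: big1 => l _; have [->|ls] := eqVneq l s; first by rewrite hs.2 mulr0.
 by rewrite Gm_out0 ?set22 ?(mul0r, mulr0) // eq_sym.
rewrite [in RHS](bigD1 s) //= z0 add0r sumrN -mulr_sumr; ring.
Qed.

(** Sharper than [offdiag_le], which shows only the variance of one index. The variances of both are
    needed for the division by [Sigma] on each side. *)
Lemma offdiag_le2 s t : s != t -> cabs (G0 s t) <= x ^+ 8 * (sqrt (mvar s * mvar t) * Phi).
Proof.
move=> st; have ts : t != s by rewrite eq_sym.
have [_ _ /(_ t s ts) l3 /(_ s t) l4] := lde.
set q := sqrt (mvar s * mvar t); have q0 : 0 <= q by exact: sqrtr_ge0.
have vv : 0 <= mvar s * mvar t by sgn.
rewrite (offdiag_expand st) cabsN cabsM (cabsM (G [set t]%SET s s)).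
have [d1 _] := Gd t; have [d2 _] := minor_diagV_le st.
have qP : 0 <= q * Phi by exact: mulr_ge0.
have H1 : `|mh om s t| <= x ^+ 2 * (q * Phi).
 apply: (leT l4); rewrite (_ : x ^+ 2 * (q * Phi) = x * (x * (q * Phi))); last by ring.
 apply: leMl => //.
 rewrite sqrtrM // mulrCA; apply: leMl => //.
 rewrite -ler_sqr ?nnegrE ?sqrtr_ge0 ?mulr_ge0 // sqr_sqrtr ?invr_ge0 ?(ltW N_gt0) //; exact: Phi_ge.
have U : [set t; s]%SET = [set s; t]%SET by rewrite finset.setUC.
have H2 : cabs (\sum_k \sum_l (mh om t k)%:C * G [set t; s]%SET k l * (mh om l s)%:C) <= x ^+ 4 * (q * Phi).
 apply: (leT l3); rewrite [mvar t * _]mulrC sqrtrM // -/q.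
 rewrite (_ : x ^+ 4 * (q * Phi) = x * (q * (x ^+ 3 * Phi))); last by ring.
 apply: leMl => //; apply: leMl => //.
 have T0 : 0 <= \sum_k Im (G [set t; s]%SET k k).
  by rewrite sumr_ge0 // => k _; apply: ltW; exact: Gm_Im_gt0.
 rewrite -ler_sqr; try sgn.
 rewrite sqr_sqrtr; last sgn.
 rewrite (_ : (x ^+ 3 * Phi) ^+ 2 = x ^+ 6 * Phi ^+ 2); last by ring.
 rewrite Phi_sqr ler_pdivrMr; last sgn.
 rewrite (_ : x ^+ 6 * (g / (N * b)) * (N ^+ 2 * b) = x ^+ 6 * N * g); last by field; rewrite !gt_eqF.
 rewrite (bigD1 t) //= (bigD1 s) //=.
 have Is : Im (G [set t; s]%SET s s) <= x ^+ 4 * g by apply: minor_out_Im; rewrite set22.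
 have It : Im (G [set t; s]%SET t t) <= x ^+ 4 * g by apply: minor_out_Im; rewrite set21.
 have Ir : \sum_(k | (k != t) && (k != s)) Im (G [set t; s]%SET k k) <= (x * N) * (3 * g).
  apply: (le_mid (\sum_(k < n) 3 * g)).
  rewrite big_mkcond; apply: ler_sum => k _; case: ifP => [/andP[kt ks]|_]; last sgn.
  by rewrite U; apply: minor2_Im.
  by rewrite sumr_const card_ord -[leLHS]mulr_natl leMr; sgn.
 have x2 : 16 <= x ^+ 2 by rewrite expr2; move: x_ge; nra.
 have x41 : x <= x ^+ 4 by rewrite -[leLHS]expr1; exact: xpow.
 have x64 : 16 * x ^+ 4 <= x ^+ 6.
  by rewrite (_ : x ^+ 6 = x ^+ 2 * x ^+ 4); [apply: leMr; try sgn|rewrite -exprD].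
 have NG : g <= N * g by rewrite ler_peMl // ltW.
 have NG0 : 0 <= N * g by sgn.
 have k1 : x ^+ 4 * g <= x ^+ 4 * (N * g) by apply: leMl; try sgn.
 have k2 : x * N * (3 * g) <= 3 * (x ^+ 4 * (N * g)).
  by rewrite (_ : x * N * (3 * g) = 3 * (x * (N * g))); [apply: leMl => //; apply: leMr|ring].
 have k3 : 16 * (x ^+ 4 * (N * g)) <= x ^+ 6 * N * g.
  by rewrite -[x ^+ 6 * N * g]mulrA mulrA; apply: leMr.
 have k4 : 0 <= x ^+ 4 * (N * g) by sgn.
 move: Is It Ir k1 k2 k3 k4; lra.
apply: (le_mid (x * (2 * x * (2 * (x ^+ 4 * (q * Phi)))))).
 apply: ler_pM; rewrite ?mulr_ge0 ?cabs_ge0 //; lepM.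
 apply: (leT (cabsB _ _)); rewrite cabsR.
 have : x ^+ 2 * (q * Phi) <= x ^+ 4 * (q * Phi) by apply: leMr => //; exact: xpow.
 move: H1 H2; lra.
rewrite (_ : x * _ = (4 * x ^+ 6) * (q * Phi)); last by ring.
apply: leMr => //; rewrite (_ : x ^+ 8 = x ^+ 2 * x ^+ 6); last by rewrite -exprD.
by apply: leMr; rewrite ?exprn_ge0 // expr2; move: x_ge; nra.
Qed.

End OneStep.

Lemma cabs_inv_diff (R : realType) (x d : R) (G G' : R[i]) : 1 <= x -> G != 0 ->
 cabs G^-1 <= x -> cabs (G - G') <= d -> 2 * x * d <= 1 ->
 cabs (G'^-1 - G^-1) <= 2 * x ^+ 2 * d.
Proof.
move=> x1 G0 Gx GG d1.
have g0 : 0 < cabs G by rewrite cabs_gt0.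
have d0 : 0 <= d := leT (cabs_ge0 _) GG.
have gx : 1 <= x * cabs G by rewrite -ler_pdivrMr // mul1r -cabsV.
have h1 : cabs G <= cabs G' + d.
 by rewrite {1}(_ : G = G' + (G - G')); [apply: (leT (cabsD _ _)); rewrite lerD2l|ring].
have gx' : 1 <= 2 * x * cabs G' by nra.
have g'0 : 0 < cabs G' by rewrite ltNge; apply/negP => h; have := cabs_ge0 G'; nra.
have G'0 : G' != 0 by rewrite -cabs_gt0.
have -> : G'^-1 - G^-1 = (G - G') / (G' * G) by field; rewrite G0 G'0.
rewrite cabsM cabsV cabsM ler_pdivrMr ?mulr_gt0 //; apply: (leT GG).
have : 1 <= (2 * x * cabs G') * (x * cabs G) by rewrite -[leLHS]mulr1; apply: ler_pM.
move=> h; rewrite -[leLHS]mul1r.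
rewrite (_ : 2 * x ^+ 2 * d * (cabs G' * cabs G) = 2 * x * cabs G' * (x * cabs G) * d); last by ring.
exact: leMr.
Qed.

(** * Spectral parameters with large real part *)

Section FarOneStep.
Variables (R : realType) (kap : nat -> R) (cn vmax : R) (mu : model R) (a b x s0 : R) (om : mOm mu).
Notation N := ((msize mu)%:R : R).
Notation n := (mdim mu).
Notation w := (a +i* b).
Notation G B := (Gm (mh om) w B).
Notation G0 := (Gm (mh om) w fs0).
Hypotheses (gmu : good_model kap cn vmax mu) (b_gt0 : 0 < b) (a_ge1 : 1 <= a) (b_le : b <= 2 * a)
 (x_ge : 4 <= x) (a_le : 8 * a <= x) (cn_le : cn <= x) (vmax_le : vmax <= x) (kap_le : `|kap 1| <= x)
 (Nb : x ^+ 20 <= N * b) (lde : lde_ev w x om) (S_le : forall s : 'I_n, \sum_t mS s t <= s0)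
 (s0_le : 32 * s0 <= a ^+ 2).

Let hs := mh_sym om.
Let wI : 0 < Im w. Proof. exact: b_gt0. Qed.
Let w_ge : a <= cabs w.
Proof. by apply: leT (Re_le_cabs _); rewrite /= ler_norm. Qed.
Let w_le : cabs w <= 3 * a.
Proof.
have a0 : 0 <= a by apply: leT a_ge1.
rewrite -ler_sqr ?nnegrE ?cabs_ge0 ?mulr_ge0 // cabs_sqE /= exprMn.
move: b_le b_gt0 a_ge1; nra.
Qed.
Let w0 : 0 < cabs w. Proof. exact: lt_le_trans (lt_le_trans ltr01 a_ge1) w_ge. Qed.
Let v_gt0 (s : 'I_n) : 0 < mvar s.
Proof. by have [_ _ /(_ s)/andP[]] := gmu. Qed.
Let v_le (s : 'I_n) : mvar s <= x.
Proof. by have [_ _ /(_ s)/andP[_ h] _] := gmu; apply: (leT h). Qed.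

(** The regime where the self-energy is a small perturbation and [G_ss] is close to [-1/w]. It is
    assumed with [1/4] and recovered with [1/8]; the gap absorbs a move of [Im w] by one grid
    step. *)
Definition near_free (c : R) := forall s, cabs ((G0 s s)^-1 + w) <= c * cabs w.

Let SG_le (s : 'I_n) (K : R) (F : 'I_n -> R[i]) : (forall t, cabs (F t) <= K) ->
 cabs (\sum_t (mS s t)%:C * F t) <= s0 * K.
Proof.
move=> FK; apply: (leT (cabs_sum _ _ _)).
have K0 : 0 <= K := leT (cabs_ge0 _) (FK s).
apply: (le_mid ((\sum_t mS s t) * K)); last by rewrite leMr.
rewrite mulr_suml; apply: ler_sum => t _; rewrite cabsM cabsR ger0_norm ?mS_ge0 //.
by rewrite leMl ?mS_ge0.
Qed.

Let s0_ge0 (s : 'I_n) : 0 <= s0.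
Proof. by apply: leT (S_le s); apply: sumr_ge0 => t _; exact: mS_ge0. Qed.

(** At height at least [a] the trivial bound [|G| <= 1/Im w <= 1/a] already makes the self-energy
    small. *)
Lemma near_free_start : a <= b -> near_free (1/8).
Proof.
move=> ab s; rewrite (Gm_diagV_av om s) //.
have [h1 _ _ _] := lde.
have bV B t : cabs (G B t t) <= a^-1.
 apply: (le_mid b^-1); first exact: (Gm_le hs wI B t t).
 by rewrite lef_pV2 ?posrE // (lt_le_trans ltr01).
rewrite (_ : av w om s - Zq w om s + w = - (\sum_t (mS s t)%:C * G [set s]%SET t t) - Zq w om s); last first.
 by rewrite /av; ring.
apply: (leT (cabsB _ _)); rewrite cabsN.
have H1 := SG_le s (bV [set s]%SET).
have H1' : s0 * a^-1 <= a / 32.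
 rewrite ler_pdivrMr ?(lt_le_trans ltr01) //; move: s0_le; rewrite expr2; lra.
have Nge : x ^+ 19 <= N.
 have x0 : 0 < x by apply: lt_le_trans x_ge.
 rewrite -(@ler_pM2l _ x) // -exprS; apply: (leT Nb).
 have a0 : 0 < a by apply: lt_le_trans a_ge1.
 by rewrite mulrC leMr ?ler0n //; move: b_le a_le; lra.
have H2 : cabs (Zq w om s) <= a / 16.
 apply: (leT (h1 s)).
 have x0 : 0 < x by apply: lt_le_trans x_ge.
 have N0 : 0 < N by apply: lt_le_trans Nge; rewrite exprn_gt0.
 apply: (le_mid (x * (x * (x ^+ 9)^-1))).
  mulL.
  apply: ler_pM; [exact: ltW|exact: sqrtr_ge0|exact: v_le|].
  rewrite -ler_sqr; try sgn.
  have T0 : 0 <= \sum_t Im (G [set s]%SET t t).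
  by rewrite sumr_ge0 // => t _; exact: Gm_Im_ge0.
  rewrite sqr_sqrtr; last sgn.
  rewrite ler_pdivrMr /=; last sgn.
  apply: (le_mid (x * N * 1)).
  apply: (le_mid (\sum_(t < n) 1)).
  apply: ler_sum => t _; apply: (le_mid (cabs (G [set s]%SET t t))).
  exact: Im_le.
  by apply: (leT (bV _ t)); rewrite invf_le1 // (lt_le_trans ltr01).
  rewrite sumr_const card_ord -[leLHS]mulr_natl leMr //.
  by have [_ h _ _] := gmu; apply: (leT h); rewrite leMr // ltW.
  rewrite mulr1 (_ : x ^- 9 ^+ 2 * (N ^+ 2 * b) = N * b * N / x ^+ 18); last by field; rewrite gt_eqF.
  rewrite ler_pdivlMr; try sgn.
  rewrite (_ : x * N * x ^+ 18 = x ^+ 19 * N); last by ring.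
  mulR.
  by apply: (leT Nge); rewrite ler_peMr ?(ltW N0) // (leT a_ge1).
 rewrite (_ : x * (x / x ^+ 9) = (x ^+ 7)^-1); last by field; rewrite gt_eqF.
 apply: (le_mid (16^-1)); last by move: a_ge1; lra.
 rewrite lef_pV2; try sgn.
 apply: (le_mid (4 ^+ 7)); first by lra.
 by leXn.
move: w_ge a_ge1 H1 H1' H2; lra.
Qed.

Section Weak.
Hypothesis weak : near_free (1/4).

Let GV_le s : cabs (G0 s s)^-1 <= (5/4) * cabs w.
Proof.
rewrite (_ : (G0 s s)^-1 = ((G0 s s)^-1 + w) - w); last by ring.
by apply: (leT (cabsB _ _)); have := weak s; lra.
Qed.

Let G_le s : cabs (G0 s s) <= (4/3) / cabs w.
Proof.
have g0 : 0 < cabs (G0 s s) by rewrite cabs_gt0; exact: Gm_diag_neq0.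
have : (3/4) * cabs w <= cabs (G0 s s)^-1.
 have : cabs w <= cabs ((G0 s s)^-1 + w) + cabs (G0 s s)^-1.
  rewrite {1}(_ : w = ((G0 s s)^-1 + w) - (G0 s s)^-1); last by ring.
  exact: cabsB.
 by have := weak s; lra.
rewrite cabsV => h; rewrite ler_pdivlMr //.
have : (3/4) * cabs w * cabs (G0 s s) <= 1 by rewrite -ler_pdivlMr // mul1r.
lra.
Qed.

Lemma far_diag s : cabs (G0 s s) <= x /\ cabs (G0 s s)^-1 <= x.
Proof.
split; last by apply: (leT (GV_le s)); move: a_ge1 a_le w_le; lra.
apply: (leT (G_le s)); rewrite ler_pdivrMr //; move: w_ge a_ge1 x_ge; nra.
Qed.

Let wVx : (cabs w)^-1 <= x.
Proof. by rewrite invf_ple ?posrE //; [apply: leT w_ge; apply: leT a_ge1; rewrite invf_le1; move: x_ge; lra|apply: lt_le_trans x_ge]. Qed.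
Let Im_le s : Im (G0 s s) <= 4.
Proof.
apply: (le_mid (cabs (G0 s s))); first exact: Im_le.
by apply: (leT (G_le s)); rewrite ler_pdivrMr //; move: w_ge a_ge1; nra.
Qed.

Lemma near_free_step : near_free (1/8).
Proof.
move=> s.
have H := diagV_approx gmu wI x_ge cn_le vmax_le kap_le wVx far_diag Im_le x_ge Nb lde s.
have P1 := Phi_small gmu wI x_ge far_diag Im_le x_ge Nb; rewrite /= in P1.
have P0 : 0 <= sqrt (4 / (N * b)) by exact: sqrtr_ge0.
have H1 : s0 * ((4/3) / cabs w) <= cabs w / 24.
 rewrite mulrA ler_pdivrMr //; move: s0_le w_ge a_ge1; nra.
have H2 := SG_le s G_le.
rewrite (_ : _ + w = ((G0 s s)^-1 + w + mSG G0 s) - mSG G0 s); last by ring.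
apply: (leT (cabsB _ _)).
have H3 : x ^+ 5 * (mvar s * sqrt (4 / (N * b))) <= 1 / 64.
 apply: (le_mid (x ^+ 6 * sqrt (4 / (N * b)))).
  rewrite (_ : x ^+ 6 * _ = x ^+ 5 * (x * sqrt (4 / (N * b)))); last by ring.
  by apply: leMl; [rewrite exprn_ge0 //; move: x_ge; lra|apply: leMr].
 have x3 : 64 <= x ^+ 3.
  apply: (le_mid (4 ^+ 3)); first by lra.
  by apply: ler_Xn; rewrite //; move: x_ge; lra.
 have x60 : 0 <= x ^+ 6 * sqrt (4 / (N * b)) by rewrite mulr_ge0 ?exprn_ge0 //; move: x_ge; lra.
 have : x ^+ 3 * (x ^+ 6 * sqrt (4 / (N * b))) <= 1 by rewrite mulrA -exprD.
 move=> h; nra.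
move: H H2 H1 H3 w_ge a_ge1 => /= H H2 H1 H3; lra.
Qed.

(** Let [g] be the largest [Im G_ss]. Since [s0 |G|^2] is at most [1/18], the self-energy term is
    absorbed and leaves [g <= 2 (b + x^6 Phi)] with [Phi^2 = g/(N b)]. Solving this quadratic
    inequality for [Phi] gives a bound without a contribution from a spectral density. *)
Lemma far_Phi : exists g, [/\ forall s, Im (G0 s s) <= g, g <= x &
 g / (N * b) <= x ^+ 13 * (N^-1 + (N * b) ^- 2)].
Proof.
have n0 : (0 < n)%N by have [/andP[h1 h2] _ _ _] := gmu; exact: leq_trans h2.
case: (@arg_maxP _ _ _ (Ordinal n0) xpredT (fun s => Im (G0 s s)) isT) => s1 _ s1P.
have {}s1P s : Im (G0 s s) <= Im (G0 s1 s1) := s1P s isT.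
set g := Im (G0 s1 s1) in s1P *.
have x0 : 0 < x by apply: lt_le_trans x_ge.
have g4 : g <= 4 by exact: Im_le.
have gx : g <= x by apply: leT x_ge.
have g0 : 0 <= g by exact: Gm_Im_ge0.
exists g; split=> //.
have H := diagV_approx gmu wI x_ge cn_le vmax_le kap_le wVx far_diag s1P gx Nb lde s1.
have P0 : 0 <= sqrt (g / (N * b)) by exact: sqrtr_ge0.
rewrite /= in H; set Phi := sqrt (g / (N * b)) in H P0.
have NB0 : 0 < N * b by apply: lt_le_trans Nb; rewrite exprn_gt0.
have N0 : 0 < N by move: NB0; rewrite pmulr_lgt0.
have PE : Phi ^+ 2 = g / (N * b) by rewrite sqr_sqrtr; sgn.
rewrite -PE.
have g6 : Im (G0 s1 s1) / cabs (G0 s1 s1) ^+ 2 <= b + s0 * g + x ^+ 6 * Phi.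
 have : - Im ((G0 s1 s1)^-1 + w + \sum_t (mS s1 t)%:C * G0 t t) <= x ^+ 6 * Phi.
  apply: (le_mid (cabs ((G0 s1 s1)^-1 + w + \sum_t (mS s1 t)%:C * G0 t t))).
  by apply: leT (Im_le_cabs _); rewrite -normrN ler_norm.
  apply: (leT H); rewrite (_ : x ^+ 6 * _ = x ^+ 5 * (x * Phi)); last by ring.
  by apply: leMl; [exact: exprn_ge0 (ltW x0)|apply: leMr].
 rewrite !ImD ImV Im_sum /= => h.
 have : \sum_t Im ((mS s1 t)%:C * G0 t t) <= s0 * g.
  apply: (le_mid ((\sum_t mS s1 t) * g)); last by rewrite leMr.
  by rewrite mulr_suml; apply: ler_sum => t _; rewrite ImM /= mul0r addr0 leMl ?mS_ge0.
 move: h; lra.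
have G0p : 0 < cabs (G0 s1 s1) by rewrite cabs_gt0; exact: Gm_diag_neq0.
have gle : g <= 2 * (b + x ^+ 6 * Phi).
 have G43 := G_le s1.
 have w2 : cabs (G0 s1 s1) ^+ 2 <= (16/9) / cabs w ^+ 2.
  rewrite (_ : (16/9) / cabs w ^+ 2 = ((4/3) / cabs w) ^+ 2); last by field; rewrite gt_eqF.
  by leXn.
 have w1 : 1 <= cabs w ^+ 2 by apply: exprn_ege1; rewrite ?cabs_ge0 //; move: w_ge a_ge1; lra.
 have h1 : cabs (G0 s1 s1) ^+ 2 <= 16/9.
  by apply: (leT w2); rewrite ler_pdivrMr ?exprn_gt0 //; lra.
 have h2 : s0 * cabs (G0 s1 s1) ^+ 2 <= 1/18.
  apply: (le_mid (s0 * ((16/9) / cabs w ^+ 2))); first by rewrite leMl // (s0_ge0 s1).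
  rewrite mulrA ler_pdivrMr; try sgn.
  have : a ^+ 2 <= cabs w ^+ 2 by apply: ler_Xn; rewrite ?cabs_ge0 //; move: a_ge1; lra.
  move: s0_le; lra.
 have h3 : g <= cabs (G0 s1 s1) ^+ 2 * (b + x ^+ 6 * Phi) + s0 * cabs (G0 s1 s1) ^+ 2 * g.
  move: g6; rewrite ler_pdivrMr ?exprn_gt0 // -/g => /leT; apply; apply: eq_ler; ring.
 have y0 : 0 <= b + x ^+ 6 * Phi by sgn.
 have h4 : cabs (G0 s1 s1) ^+ 2 * (b + x ^+ 6 * Phi) <= 16/9 * (b + x ^+ 6 * Phi) by rewrite leMr.
 have h5 : s0 * cabs (G0 s1 s1) ^+ 2 * g <= 1/18 * g by rewrite leMr.
 lra.
have PP : Phi ^+ 2 <= 2 / N + 2 * (x ^+ 6 / (N * b) * Phi).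
 rewrite PE ler_pdivrMr //; apply: (leT gle); apply: eq_ler.
 by field; rewrite !gt_eqF.
set y := x ^+ 6 / (N * b) in PP.
have PP2 : Phi ^+ 2 <= 4 * (N^-1 + y ^+ 2).
 have := sqr_ge0 (Phi - 2 * y); rewrite sqrrB exprMn; move: PP; lra.
apply: (leT PP2).
have -> : x ^+ 13 * (N^-1 + (N * b) ^- 2) = x * (x ^+ 12 / N + y ^+ 2).
 by rewrite /y; field; rewrite !gt_eqF.
have h12 : N^-1 <= x ^+ 12 / N.
 by rewrite ler_peMl ?invr_ge0 ?(ltW N0) // -[leLHS](expr1n _ 12); apply: ler_Xn; rewrite ?(ltW x0) //; move: x_ge; lra.
apply: ler_pM => //; first sgn.
by rewrite lerD2r.
Qed.

Notation Psi := (sqrt (N^-1 + (N * b) ^- 2)).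

Lemma far_bounds : [/\ forall s t, s != t -> cabs (G0 s t) <= x ^+ 11 * Psi,
 forall s, cabs (Zq w om s) <= x ^+ 12 * Psi &
 forall s, cabs (av w om s + w + mSG G0 s) <= x ^+ 26 * Psi ^+ 2].
Proof.
have [g [gI gx gP]] := far_Phi.
have x0 : 0 < x by apply: lt_le_trans x_ge.
have NB0 : 0 < N * b by apply: lt_le_trans Nb; rewrite exprn_gt0.
have N0 : 0 < N by move: NB0; rewrite pmulr_lgt0.
have p0 : 0 <= N^-1 + (N * b) ^- 2 by sgn.
have Psi0 : 0 <= Psi by exact: sqrtr_ge0.
have Phile : sqrt (g / (N * b)) <= x ^+ 7 * Psi.
 apply: (le_mid (sqrt (x ^+ 14 * (N^-1 + (N * b) ^- 2)))).
  apply: ler_wsqrtr; apply: (leT gP); apply: leMr => //.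
  apply: ler_weXn2l => //; move: x_ge; lra.
 rewrite sqrtrM ?exprn_ge0 ?(ltW x0) // (_ : x ^+ 14 = (x ^+ 7) ^+ 2); last by rewrite -exprM.
 by rewrite sqrtr_sqr ger0_norm; sgn.
have P0 := sqrtr_ge0 (g / (N * b)).
split.
- move=> s t st; apply: (leT (offdiag_le4 gmu wI x_ge vmax_le far_diag gI Nb lde st)).
 rewrite (_ : x ^+ 11 * Psi = x ^+ 4 * (x ^+ 7 * Psi)); last by ring.
 by rewrite leMl; sgn.
- move=> s; apply: (leT (Zq_le gmu wI x_ge cn_le vmax_le wVx far_diag gI Nb lde s)).
 rewrite (_ : x ^+ 12 * Psi = x ^+ 4 * (x * (x ^+ 7 * Psi))); last by ring.
 mulL.
 by apply: ler_pM => //; exact: ltW.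
- move=> s; apply: (leT (av_approx gmu wI x_ge cn_le vmax_le kap_le far_diag gI Nb lde s)).
 rewrite /= sqr_sqrtr ?divr_ge0 ?(ltW NB0) //; last exact: leT (Gm_Im_ge0 hs wI fs0 s) (gI s).
 rewrite sqr_sqrtr // (_ : x ^+ 26 * _ = x ^+ 12 * (x * (x ^+ 13 * (N^-1 + (N * b) ^- 2)))); last by ring.
 mulL.
 apply: ler_pM => //; first sgn.
 by rewrite divr_ge0 ?(ltW NB0) //; exact: leT (Gm_Im_ge0 hs wI fs0 s) (gI s).
Qed.

(** Taking imaginary parts in the averaged equation, the symmetry of the variance profile bounds the
    averaged self-energy by [s0] times the average itself, with a total coefficient of at most
    [1/18], which is absorbed. *)
Lemma far_avg : cabs (n%:R^-1 * \sum_s (G0 s s - (av w om s)^-1)) <= x * Psi ^+ 2 ->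
 n%:R^-1 * (\sum_s Im (G0 s s)) <= 8 * (b + x ^+ 27 * Psi ^+ 2).
Proof.
move=> H; have [_ _ hav] := far_bounds.
have x0 : 0 < x by apply: lt_le_trans x_ge.
have NB0 : 0 < N * b by apply: lt_le_trans Nb; rewrite exprn_gt0.
have n0 : 0 < n%:R :> R.
 by rewrite ltr0n; have [/andP[h1 h2] _ _ _] := gmu; exact: leq_trans h2.
have P0 : 0 <= Psi ^+ 2 by exact: sqr_ge0.
set y := x ^+ 26 * Psi ^+ 2 in hav.
have y0 : 0 <= y by rewrite mulr_ge0 ?exprn_ge0 // ltW.
set A := n%:R^-1 * (\sum_s Im (G0 s s)).
have A0 : 0 <= A by rewrite mulr_ge0 ?invr_ge0 ?(ltW n0) // sumr_ge0 // => s _; exact: Gm_Im_ge0.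
have w1 : 1 <= cabs w ^+ 2 by apply: exprn_ege1; rewrite ?cabs_ge0 //; move: w_ge a_ge1; lra.
have y1 : forall s : 'I_n, cabs (av w om s + w + mSG G0 s) <= 1 / 64.
 move=> s; have H1 := av_approx gmu wI x_ge cn_le vmax_le kap_le far_diag Im_le Nb lde s.
 have P1 := Phi_small gmu wI x_ge far_diag Im_le x_ge Nb.
 rewrite /= in H1 P1; apply: (leT H1).
 set Phi := sqrt _ in H1 P1 *; have Phi0 : 0 <= Phi by exact: sqrtr_ge0.
 apply: (le_mid (x ^+ 12 * (x * Phi ^+ 2))).
  by apply: leMl; [exact: exprn_ge0 (ltW x0)|apply: leMr; try sgn].
 have -> : x ^+ 12 * (x * Phi ^+ 2) = (x ^+ 9 * Phi) * (x ^+ 9 * Phi) / x ^+ 5 by field; rewrite gt_eqF.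
 rewrite ler_pdivrMr; try sgn.
 have x5 : 64 <= x ^+ 5.
  apply: (le_mid (4 ^+ 5)); first by lra.
  by apply: ler_Xn; rewrite //; move: x_ge; lra.
 have : x ^+ 9 * Phi * (x ^+ 9 * Phi) <= 1.
  by rewrite -[leRHS]mulr1; apply: ler_pM => //; rewrite mulr_ge0 ?exprn_ge0 // ltW.
 move: x5; lra.
have avI s : Im (av w om s)^-1 <= (16/9) / cabs w ^+ 2 * (b + Im (mSG G0 s) + y).
 have num : - Im (av w om s) <= b + Im (mSG G0 s) + y.
  have : - Im (av w om s + w + mSG G0 s) <= y.
  apply: leT (hav s); apply: leT (Im_le_cabs _); by rewrite -normrN ler_norm.
  by rewrite !ImD /=; lra.
 have anum : 0 <= - Im (av w om s) by apply: leT (av_Im om s wI); exact: ltW wI.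
 have den : (3/4) * cabs w <= cabs (av w om s).
  have : cabs w <= cabs (av w om s + w + mSG G0 s) + cabs (mSG G0 s) + cabs (av w om s).
  rewrite {1}(_ : w = (av w om s + w + mSG G0 s) - (mSG G0 s) - av w om s); last by ring.
  by apply: (leT (cabsB _ _)); rewrite lerD2r; exact: cabsB.
  have H1 : s0 * ((4/3) / cabs w) <= cabs w / 24.
  rewrite mulrA ler_pdivrMr //; move: s0_le w_ge a_ge1; nra.
  have := SG_le s G_le; have := y1 s; move: H1 w_ge a_ge1; lra.
 have av0 : 0 < cabs (av w om s) by apply: lt_le_trans den; rewrite mulr_gt0 //; lra.
 rewrite ImV ler_pdivrMr ?exprn_gt0 //; apply: (leT num).
 have q0 : 0 <= b + Im (mSG G0 s) + y by exact: leT num.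
 rewrite mulrAC ler_peMl // mulrAC ler_pdivlMr ?exprn_gt0 // mul1r.
 have : ((3/4) * cabs w) ^+ 2 <= cabs (av w om s) ^+ 2 by leXn.
 by rewrite exprMn; lra.
have sumSG : \sum_s Im (mSG G0 s) <= s0 * \sum_t Im (G0 t t).
 under eq_bigr do rewrite Im_sum.
 rewrite exchange_big /= mulr_sumr; apply: ler_sum => t _.
 apply: (le_mid ((\sum_s mS t s) * Im (G0 t t))); last first.
  by rewrite leMr //; exact: Gm_Im_ge0.
 rewrite mulr_suml; apply: ler_sum => s _; rewrite ImM /= mul0r addr0.
 apply: eq_ler; congr (_ * _).
 by rewrite /mS /mE; apply: eq_EE => om'; rewrite (mh_sym om').1.
have H1 : A <= x * Psi ^+ 2 + n%:R^-1 * \sum_s Im (av w om s)^-1.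
 rewrite -lerBlDr /A -mulrBr -sumrB.
 apply: leT H; apply: leT (Im_le_cabs _); apply: leT (ler_norm _).
 rewrite ImM Im_sum -natC -fmorphV /= mul0r addr0.
 by apply: eq_ler; congr (_ * _); apply: eq_bigr => s _; rewrite ImD ImN.
have H2 : n%:R^-1 * \sum_s Im (av w om s)^-1 <= (16/9) / cabs w ^+ 2 * (b + y + s0 * A).
 rewrite mulrC ler_pdivrMr //.
 apply: (le_mid (\sum_s (16/9) / cabs w ^+ 2 * (b + Im (mSG G0 s) + y))).
  by apply: ler_sum => s _; exact: avI.
 rewrite -mulr_sumr -[leRHS]mulrA; mulL.
 under eq_bigr do rewrite -addrA [_ + y]addrC addrA.
 rewrite big_split /= sumr_const card_ord.
 rewrite [(_ + s0 * A) * _]mulrDl [(_ + y) * _]mulr_natr lerD2l; apply: (leT sumSG).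
 by rewrite /A; apply: eq_ler; field; rewrite gt_eqF.
have H3 : (16/9) / cabs w ^+ 2 * (b + y + s0 * A) <= 2 * (b + y) + 1 / 18 * A.
 rewrite mulrDr; apply: lerD.
  mulR.
  by rewrite ler_pdivrMr ?exprn_gt0 //; lra.
 rewrite mulrA; apply: leMr => //.
 have : a ^+ 2 <= cabs w ^+ 2 by apply: ler_Xn; rewrite ?cabs_ge0 //; move: a_ge1; lra.
 by rewrite mulrAC ler_pdivrMr ?exprn_gt0 //; move: s0_le; lra.
have H4 : x * Psi ^+ 2 + y <= 2 * (x ^+ 27 * Psi ^+ 2).
 have h1 : x <= x ^+ 27 by rewrite -[leLHS]expr1 ler_weXn2l //; move: x_ge; lra.
 have h2 : x ^+ 26 <= x ^+ 27 by rewrite ler_weXn2l //; move: x_ge; lra.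
 by rewrite /y -mulrDl mulrA; apply: leMr => //; lra.
have h6 : 0 <= x * Psi ^+ 2 by sgn.
move: H1 H2 H3 H4 b_gt0 y0 h6; lra.
Qed.

End Weak.
End FarOneStep.

(** * Detection of eigenvalues by the resolvent *)

Lemma sum_CS (R : realType) (I : finType) (a b : I -> R) :
 (\sum_i a i * b i) ^+ 2 <= (\sum_i a i ^+ 2) * (\sum_i b i ^+ 2).
Proof.
have : 0 <= \sum_i \sum_j (a i * b j - a j * b i) ^+ 2.
 by apply: sumr_ge0 => i _; apply: sumr_ge0 => j _; exact: sqr_ge0.
have -> : \sum_i \sum_j (a i * b j - a j * b i) ^+ 2 =
  \sum_i \sum_j (a i ^+ 2 * b j ^+ 2) + \sum_i \sum_j (a j ^+ 2 * b i ^+ 2) - 2 * \sum_i \sum_j (a i * b i) * (a j * b j).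
 rewrite mulr_sumr -big_split -sumrB /=; apply: eq_bigr => i _.
 by rewrite mulr_sumr -big_split -sumrB /=; apply: eq_bigr => j _; ring.
rewrite [X in _ + X - _]exchange_big /=.
have e (c d : I -> R) : \sum_i \sum_j c i * d j = (\sum_i c i) * (\sum_j d j).
 by rewrite mulr_suml; apply: eq_bigr => i _; rewrite mulr_sumr.
rewrite !e expr2; lra.
Qed.

Lemma cabs_sum_CS (R : realType) (I : finType) (a b : I -> R[i]) :
 cabs (\sum_i a i * b i) ^+ 2 <= (\sum_i cabs (a i) ^+ 2) * (\sum_i cabs (b i) ^+ 2).
Proof.
apply: leT (sum_CS _ _); apply: ler_Xn; rewrite ?cabs_ge0 ?sumr_ge0 //.
 by move=> i _; rewrite mulr_ge0 ?cabs_ge0.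
by apply: (leT (cabs_sum _ _ _)); apply: ler_sum => i _; rewrite cabsM.
Qed.

(** An eigenvector satisfies [v = (sg - w) G v]. Cauchy-Schwarz and Ward's identity bound each
    [|v_s|^2 Im w] by [|sg - w|^2 Im G_ss |v|^2]; the norm of [v] cancels after summation over
    [s]. *)
Lemma eigen_Im (R : realType) n (h : 'I_n -> 'I_n -> R) (w : R[i]) (sg : R) (v : 'I_n -> R) :
 hsym h -> 0 < Im w -> (exists s, v s != 0) -> (forall s, \sum_t h s t * v t = sg * v s) ->
 Im w <= cabs (sg%:C - w) ^+ 2 * \sum_s Im (Gm h w fs0 s s).
Proof.
move=> hh w0 [s0 vs0] ev.
set G := Gm h w fs0.
have V0 : 0 < \sum_t cabs (v t)%:C ^+ 2.
 rewrite (bigD1 s0) //= ltr_pwDl ?sumr_ge0 //; last by move=> i _; exact: sqr_ge0.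
 by rewrite exprn_gt0 // cabsR normr_gt0.
have vE s : (v s)%:C = (sg%:C - w) * \sum_t G s t * (v t)%:C.
 pose x : 'cV[R[i]]_n := \col_t (v t)%:C.
 have HX : (Hm h fs0 - w%:M) *m x = (sg%:C - w) *: x.
  rewrite mulmxBl mul_scalar_mx; apply/matrixP => i j; rewrite !mxE mulrBl; congr (_ - _).
  under eq_bigr do rewrite !mxE !inE /= -rmorphM.
  by rewrite -rmorph_sum ev rmorphM.
 have : x = (sg%:C - w) *: (G *m x).
  by rewrite scalemxAr -HX mulmxA mulVmx ?mul1mx //; exact: Hm_unit.
 move=> /matrixP/(_ s ord0); rewrite !mxE => ->; congr (_ * _).
 by apply: eq_bigr => t _; rewrite mxE.
have one s : cabs (v s)%:C ^+ 2 * Im w <= cabs (sg%:C - w) ^+ 2 * Im (G s s) * \sum_t cabs (v t)%:C ^+ 2.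
 rewrite {1}vE cabsM exprMn -[leLHS]mulrA -[leRHS]mulrA; apply: leMl; first exact: sqr_ge0.
 rewrite (Gm_ward hh w0) mulrC -mulrA; mulL.
 exact: cabs_sum_CS.
rewrite -(ler_pM2l V0) [in leRHS]mulr_sumr [leRHS]mulrC mulr_suml [leRHS]mulr_suml.
by apply: ler_sum => s _; exact: one.
Qed.

Lemma near_free_move (R : realType) kap cn vmax (mu : model R) (a b b' x : R) (om : mOm mu) :
 good_model kap cn vmax mu -> 1 <= a -> 0 < b -> 0 < b' -> b <= 2 * a -> b' <= 2 * a -> 4 <= x -> 8 * a <= x -> cn <= x ->
 x ^+ 20 <= (msize mu)%:R * b -> x ^+ 20 <= (msize mu)%:R * b' ->
 `|b - b'| <= (msize mu)%:R ^- 5 ->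
 near_free a b om (1/8) -> near_free a b' om (1/4).
Proof.
move=> gmu a1 b0 b'0 b2 b'2 x4 ax cnx Nb Nb' bb H s.
set N : R := (msize mu)%:R in Nb Nb' bb.
have x0 : 0 < x by apply: lt_le_trans x4.
have N0 : 0 < N.
 have : 0 < N * b by apply: lt_le_trans Nb; rewrite exprn_gt0.
 by rewrite pmulr_lgt0.
have Nx : x ^+ 19 <= N.
 rewrite -(@ler_pM2l _ x) // -exprS; apply: (leT Nb).
 by rewrite mulrC leMr ?(ltW N0) //; move: b2 ax a1; lra.
have hs := mh_sym om.
set w := a +i* b; set w' := a +i* b'.
have wI : 0 < Im w by []. have wI' : 0 < Im w' by [].
have bN c : 0 < c -> x ^+ 20 <= N * c -> c^-1 <= N.
 move=> c0 h; rewrite -[leLHS]mul1r ler_pdivrMr //; apply: leT h.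
 by apply: exprn_ege1; rewrite ?(ltW x0) //; move: x4; lra.
have GG := Gm_diff fs0 s s hs wI wI'.
have dE : cabs (w - w') <= N ^- 5.
 rewrite (_ : w - w' = Complex 0 (b - b')); last by rewrite /w /w'; apply: eqC; rewrite /= ?subrr.
 by rewrite (_ : Complex 0 (b - b') = 'i * (b - b')%:C) ?cabsM ?cabsR; [rewrite (_ : cabs 'i = 1) ?mul1r //; apply/eqP; rewrite -(@eqrXn2 _ 2) ?cabs_ge0 ?ler01 // cabs_sqE /= expr0n add0r|apply: eqC; rewrite /=; ring].
have d1 : cabs (Gm (mh om) w fs0 s s - Gm (mh om) w' fs0 s s) <= x ^- 19.
 apply: (leT GG); apply: (le_mid (N ^- 5 * ((x * N) * (N * N)))).
  lepM.
  lepM.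
  by have [_ h _ _] := gmu; apply: (leT h); rewrite leMr // ltW.
  rewrite invfM; apply: ler_pM; rewrite ?invr_ge0 ?(ltW b0) ?(ltW b'0) //; exact: bN.
 rewrite (_ : N ^- 5 * (x * N * (N * N)) = x / N / N); last by field; rewrite gt_eqF.
 apply: (le_mid (1 / N)).
  rewrite leMr ?invr_ge0 ?(ltW N0) // ler_pdivrMr // mul1r; apply: leT Nx.
  by rewrite -[leLHS]expr1 ler_weXn2l //; move: x4; lra.
 by rewrite mul1r lef_pV2; sgn.
have wle : cabs w <= 3 * a.
 have a0 : 0 <= a by apply: leT a1.
 rewrite -ler_sqr ?nnegrE ?cabs_ge0 ?mulr_ge0 // cabs_sqE /= exprMn.
 move: b2 b0 a1; nra.
have wge : a <= cabs w' by apply: leT (Re_le_cabs _); rewrite /= ler_norm.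
have GVx : cabs (Gm (mh om) w fs0 s s)^-1 <= x.
 rewrite (_ : (Gm _ _ _ _ _)^-1 = ((Gm (mh om) w fs0 s s)^-1 + w) - w); last by ring.
 apply: (leT (cabsB _ _)); have := H s; rewrite -/w; move: wle ax a1; lra.
have xs : 2 * x ^+ 2 / x ^+ 19 <= 1 / 32.
 rewrite (_ : 2 * x ^+ 2 / x ^+ 19 = 2 / x ^+ 17); last by field; rewrite gt_eqF.
 rewrite ler_pdivrMr; try sgn.
 have : 4 ^+ 17 <= x ^+ 17 by leXn.
 by lra.
have xs1 : 2 * x / x ^+ 19 <= 1.
 apply: leT (_ : 1 / 32 <= 1); last by lra.
 apply: leT xs; rewrite leMr ?invr_ge0 ?exprn_ge0 ?(ltW x0) // leMl // -[leLHS]expr1.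
 by rewrite ler_weXn2l //; move: x4; lra.
have G0 := Gm_diag_neq0 hs wI fs0 s.
have x1 : 1 <= x by move: x4; lra.
have H1 := cabs_inv_diff x1 G0 GVx d1 xs1.
rewrite -/w' (_ : _ + w' = ((Gm (mh om) w' fs0 s s)^-1 - (Gm (mh om) w fs0 s s)^-1)
  + ((Gm (mh om) w fs0 s s)^-1 + w) + (w' - w)); last by ring.
apply: (leT (cabsD _ _)); have := cabsD ((Gm (mh om) w' fs0 s s)^-1 - (Gm (mh om) w fs0 s s)^-1) ((Gm (mh om) w fs0 s s)^-1 + w).
have ww : cabs (w' - w) <= 1 / 32.
 rewrite cabs_distC; apply: (leT dE).
 apply: (le_mid (x ^- 19)).
  rewrite lef_pV2 ?posrE ?exprn_gt0 //; apply: (leT Nx).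
  rewrite -[leLHS]expr1 ler_weXn2l //; apply: leT Nx.
  by apply: exprn_ege1; try sgn.
 apply: leT xs; rewrite ler_peMl; try sgn.
 by rewrite expr2; move: x4; nra.
have wlew : cabs w <= cabs w' + cabs (w' - w).
 rewrite {1}(_ : w = w' - (w' - w)); last by ring.
 exact: cabsB.
have := H s; rewrite -/w; move: H1 xs ww wlew wge a1; lra.
Qed.

Section WhpRestrict.
Variables (R : realType) (U : Type) (mu : U -> model R).

Lemma whp_restrict (Q : U -> Prop) (A : forall u, mOm (mu u) -> Prop) : evt mu Q ->
 @whp R {u | Q u} (fun x => mu (sval x)) (fun x om => A (sval x) om) -> whp A.
Proof.
move=> [N0 HQ] H D; have [N1 H1] := H D; exists (maxn N0 N1) => u.
by rewrite geq_max => /andP[/HQ Qu h1]; exact: (H1 (exist _ u Qu)).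
Qed.

Lemma whp_sub (Q : U -> Prop) (A : forall u, mOm (mu u) -> Prop) : whp A ->
 @whp R {u | Q u} (fun x => mu (sval x)) (fun x om => A (sval x) om).
Proof. by move=> H D; have [N0 H0] := H D; exists N0 => -[u Qu] /=; exact: H0. Qed.

End WhpRestrict.

(** * Absence of eigenvalues near a large fixed number *)

Section FarFamily.
Variables (R : realType) (kap : nat -> R) (cn vmax s0 : R) (an : nat) (U : Type) (mu : U -> model R).
Notation Nr u := ((msize (mu u))%:R : R).
Notation a := (an%:R : R).
Hypotheses (gmu : forall u, good_model kap cn vmax (mu u)) (an_gt0 : (0 < an)%N)
 (S_le : forall u (s : 'J_(mu u)), \sum_t mS s t <= s0) (s0_le : 32 * s0 <= a ^+ 2).

Let N_gt0 u : 0 < Nr u.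
Proof. by have [/andP[N0 _] _ _ _] := gmu u; rewrite ltr0n. Qed.
Let N_ge1 u : 1 <= Nr u.
Proof. by have [/andP[N0 _] _ _ _] := gmu u; rewrite ler1n. Qed.
Let a_ge1 : 1 <= a. Proof. by rewrite ler1n. Qed.

(** An eigenvalue within [b] of [a] forces the imaginary part of the trace above [1/(2b)], against
    an upper bound of order [N (b + 1/N + (N b)^-2)] up to powers of [x]. For a contradiction
    [N b^2] and [1/(N b)] must both be small, so the exponent has to lie between [1/2] and 1. *)
Definition farb u : R := Nr u `^ (- (9/16)).
Let bk u (k : nat) : R := farb u + k%:R / Nr u ^+ 5.
Let farb_gt0 u : 0 < farb u. Proof. by rewrite powR_gt0. Qed.
Let farb_le1 u : farb u <= 1.
Proof.
rewrite /farb powRN invf_le1 ?powR_gt0 //; apply: powR_ge1; last by lra.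
by have [/andP[]] := gmu u.
Qed.

Let bk_ge u k : farb u <= bk u k.
Proof. by rewrite lerDl; sgn. Qed.
Let bk_gt0 u k : 0 < bk u k. Proof. exact: lt_le_trans (farb_gt0 u) (bk_ge u k). Qed.
Let bk_le u k : (k <= an * msize (mu u) ^ 5)%N -> bk u k <= 2 * a.
Proof.
move=> kl; rewrite (_ : 2 * a = a + a); last by ring.
rewrite lerD //; first by apply: (leT (farb_le1 u)).
by rewrite ler_pdivrMr ?exprn_gt0 // -natrX -natrM ler_nat.
Qed.

Lemma far_params e : 0 < e -> e <= 1 / 400 -> evt mu (fun u => let x := Nr u `^ e in
 [/\ 4 <= x, 8 * a <= x, cn <= x, vmax <= x & `|kap 1| <= x /\ forall c, farb u <= c -> x ^+ 20 <= Nr u * c]).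
Proof.
move=> e0 e1; apply: evt_mono (evt_and (evt_and (evt_powR mu 4 e0) (evt_powR mu (8 * a) e0))
 (evt_and (evt_powR mu cn e0) (evt_and (evt_powR mu vmax e0) (evt_powR mu `|kap 1| e0)))) => u.
move=> [[h1 h2] [h3 [h4 h5]]]; split=> //; split=> // c cb.
apply: (le_mid (Nr u * farb u)); last by rewrite leMl // ltW.
rewrite powR_exp /farb -{2}(powRr1 (ltW (N_gt0 u))) -powRDp // ler_powR //; lra.
Qed.

(** Continuity in [Im w]: the descent starts at [farb + a], where [near_free_start] applies. Each
    step of [N^-5] weakens [1/8] to at most [1/4], and [near_free_step] restores it. *)
Lemma whp_far e : 0 < e -> e <= 1 / 400 -> whp (fun u (om : mOm (mu u)) =>
 near_free a (farb u) om (1/8) /\ lde_ev (a +i* farb u) (Nr u `^ e) om).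
Proof.
move=> e0 e1.
pose I u := 'I_(an * msize (mu u) ^ 5).+1.
pose U1 := {u : U & I u}.
have L := @lde_whp R kap cn vmax U1 (fun x => mu (projT1 x)) (fun x => a +i* bk (projT1 x) (projT2 x))
  (fun x => gmu (projT1 x)) (fun x => bk_gt0 (projT1 x) (projT2 x)) e e0.
have card u : (#|I u|)%:R <= (a + 1) * Nr u ^+ 5.
 rewrite card_ord -addn1 natrD natrM natrX mulrDl mul1r lerD2l.
 by apply: exprn_ege1; try sgn.
have H := @whp_forall R U mu I 5 (a + 1) (fun u k om => lde_ev (a +i* bk u k) (Nr u `^ e) om) card L.
apply: whp_ev H; have [N0 HN0] := far_params e0 e1.
exists N0 => u /HN0 [x4 ax cnx vx [kx Nb]] om lde.
have gu := gmu u.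
have NF j : (j <= an * msize (mu u) ^ 5)%N -> near_free a (bk u (an * msize (mu u) ^ 5 - j)) om (1/8).
 elim: j => [_|j IH jl].
  rewrite subn0; apply: (near_free_start gu (bk_gt0 u _) a_ge1 (bk_le (leqnn _)) x4 ax cnx vx (Nb _ (bk_ge u _)) _ (@S_le u) s0_le).
  exact: (lde (Ordinal (ltnSn _))).
  by rewrite /bk natrM natrX mulfK ?lerDr ?(ltW (farb_gt0 u)) // expf_neq0 // gt_eqF.
 have {}IH := IH (ltnW jl); set k := (an * msize (mu u) ^ 5 - j.+1)%N.
 have kE : (an * msize (mu u) ^ 5 - j = k.+1)%N by rewrite /k -subSn // subSS.
 rewrite kE in IH.
 have kl : (k <= an * msize (mu u) ^ 5)%N by rewrite leq_subr.
 have kl' : (k.+1 <= an * msize (mu u) ^ 5)%N by rewrite -kE leq_subr.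
 have lk := lde (Ordinal (kl : k < _.+1)%N).
 apply: (near_free_step gu (bk_gt0 u _) a_ge1 (bk_le kl) x4 ax cnx vx kx (Nb _ (bk_ge u _)) lk (@S_le u) s0_le).
 apply: (near_free_move gu a_ge1 (bk_gt0 u k.+1) (bk_gt0 u k) (bk_le kl') (bk_le kl) x4 ax cnx (Nb _ (bk_ge u _)) (Nb _ (bk_ge u _)) _ IH).
 rewrite /bk (_ : _ - _ = (Nr u ^+ 5)^-1); last by rewrite -natr1; ring.
 by rewrite ger0_norm; sgn.
have b0 : bk u 0 = farb u by rewrite /bk mul0r addr0.
split; first by have := NF _ (leqnn _); rewrite subnn b0.
by have := lde ord0; rewrite /= b0.
Qed.

Let Psi u := sqrt ((Nr u)^-1 + (Nr u * farb u) ^- 2).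
Let Psi_sqr u : Psi u ^+ 2 = (Nr u)^-1 + (Nr u * farb u) ^- 2.
Proof. by rewrite sqr_sqrtr; sgn. Qed.
Let Psi_gt0 u : 0 < Psi u.
Proof. by rewrite sqrtr_gt0 ltr_pwDl; sgn. Qed.
Let NfE u : Nr u * farb u = Nr u `^ (7/16).
Proof. by rewrite /farb -{1}(powRr1 (ltW (N_gt0 u))) -powRDp //; congr (_ `^ _); lra. Qed.

Lemma far_noeig : whp (fun u (om : mOm (mu u)) => forall (sg : R) (v : 'J_(mu u) -> R),
 (exists s, v s != 0) -> (forall s, \sum_t mh om s t * v t = sg * v s) -> ~ (`|sg - a| <= farb u)).
Proof.
have c8 : 0 < 1/8 :> R by lra.
(* [Psi^2] is a sum of two terms of size at most [N^(-7/8)]; this condition absorbs the factor 2 in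
   [Psi <= N^(-3/8)]. *)
pose Q u := 2 <= Nr u `^ (1/8).
apply: (@whp_restrict _ _ _ Q); first exact: evt_powR.
pose U1 := {u | Q u}; pose mu1 (x : U1) := mu (sval x).
have bounds e : 0 < e -> whp (fun (x : U1) (om : mOm (mu1 x)) =>
  [/\ forall s t, s != t -> cabs (Gm (mh om) (a +i* farb (sval x)) fs0 s t) <= Nr (sval x) `^ e * Psi (sval x),
  forall s, cabs (Zq (a +i* farb (sval x)) om s) <= Nr (sval x) `^ e * Psi (sval x) &
  forall s, cabs (Gm (mh om) (a +i* farb (sval x)) fs0 s s) <= 4 * a /\
  cabs (Gm (mh om) (a +i* farb (sval x)) fs0 s s)^-1 <= 4 * a]).
 move=> e0; pose e' := Num.min (1/400) (e / 12).
 have e'0 : 0 < e' by rewrite lt_min; apply/andP; split; lra.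
 have e'1 : e' <= 1/400 by rewrite /e' ge_min lexx.
 have e'2 : e' <= e / 12 by rewrite /e' ge_min lexx orbT.
 apply: whp_ev (@whp_sub _ _ mu Q _ (whp_far e'0 e'1)).
 have [N0 HN0] := far_params e'0 e'1.
 exists N0 => -[u Qu] /= /HN0 [x4 ax cnx vx [kx Nb]] om [nf lde].
 have fa : farb u <= 2 * a by apply: (leT (farb_le1 u)); move: a_ge1; lra.
 have nf4 : near_free a (farb u) om (1/4).
  by move=> s; apply: (leT (nf s)); rewrite leMr ?cabs_ge0 //; lra.
 have [h1 h2 _] := far_bounds (gmu u) (farb_gt0 u) a_ge1 fa x4 ax cnx vx kx (Nb _ (lexx _)) lde (@S_le u) s0_le nf4.
 have xe k : (k <= 12)%N -> (Nr u `^ e') ^+ k <= Nr u `^ e.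
  move=> k12; rewrite powR_exp ler_powR ?N_ge1 //.
  have : k%:R <= 12 :> R by rewrite ler_nat.
  move: e'0 e'2; nra.
 split.
 - by move=> s t st; apply: (leT (h1 s t st)); rewrite leMr ?(ltW (Psi_gt0 u)) // xe.
 - by move=> s; apply: (leT (h2 s)); rewrite leMr ?(ltW (Psi_gt0 u)) // xe.
 - move=> s; set w := a +i* farb u; set G := Gm _ _ _ _ _.
  have wle : cabs w <= 2 * a.
  rewrite -ler_sqr ?nnegrE ?cabs_ge0 ?mulr_ge0 // cabs_sqE /= exprMn.
  by have := farb_le1 u; have := farb_gt0 u; move: a_ge1; nra.
  have wge : a <= cabs w by apply: leT (Re_le_cabs _); rewrite /= ler_norm.
  have hG := nf4 s; rewrite -/w -/G in hG.
  have GV : cabs G^-1 <= cabs (G^-1 + w) + cabs w.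
  by rewrite {1}(_ : G^-1 = (G^-1 + w) - w); [exact: cabsB|ring].
  have wGV : cabs w <= cabs (G^-1 + w) + cabs G^-1.
  by rewrite {1}(_ : w = (G^-1 + w) - G^-1); [exact: cabsB|ring].
  have G0 : 0 < cabs G by rewrite cabs_gt0; exact: (Gm_diag_neq0 (mh_sym om) (farb_gt0 u : 0 < Im w)).
  split; last by move: GV hG wle a_ge1; lra.
  have h3 : 1 / 2 <= (cabs G)^-1 by rewrite -cabsV; move: wGV hG wge a_ge1; lra.
  have : 1 / 2 * cabs G <= 1 by rewrite -ler_pdivlMr // [leRHS]mul1r.
  by move: a_ge1; lra.
have FA := @fluctuation_averaging R kap cn vmax U1 mu1 (fun x => a +i* farb (sval x)) (fun x => Psi (sval x)) (3/8) (4 * a)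
 (fun x => gmu (sval x)) (fun x => farb_gt0 (sval x)).
have h400 : 0 < 1/400 :> R by lra.
have {}FA : whp (fun (x : U1) (om : mOm (mu1 x)) =>
 cabs ((mdim (mu1 x))%:R^-1 * \sum_s 1 * (Gm (mh om) (a +i* farb (sval x)) fs0 s s -
  (av (a +i* farb (sval x)) om s)^-1)) <= Nr (sval x) `^ (1/400) * Psi (sval x) ^+ 2).
 apply: FA => //.
 - move=> [u Qu] /=; rewrite /mu1 /farb /= powRN invrK -[leRHS](powRr1 (ltW (N_gt0 u))).
  by rewrite ler_powR ?N_ge1 //; lra.
 - by move: a_ge1; lra.
 - by move=> [u Qu] /=; rewrite Psi_sqr lerDl invr_ge0 exprn_ge0 ?mulr_ge0 // ltW.
 - move=> [u Qu] /=; rewrite -ler_sqr ?nnegrE ?powR_ge0 ?(ltW (Psi_gt0 u)) // Psi_sqr NfE.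
  rewrite -exprVn -powRN !powR_exp -(powR_inv1 (ltW (N_gt0 u))).
  apply: (le_mid (Nr u `^ (- (7/8)) + Nr u `^ (- (7/8)))).
  by apply: lerD; rewrite ler_powR ?N_ge1 //; lra.
  rewrite (_ : - (3 / 8) * 2 = 1/8 + - (7/8)); last by lra.
  rewrite /mu1 /= powRDp; last exact: N_gt0.
  have q0 := powR_ge0 (Nr u) (- (7/8)); move: Qu q0; rewrite /Q; nra.
 - by move=> e e0; apply: whp_mono (bounds e e0) => x om [].
 - by apply: whp_mono (bounds 1 ltr01) => x om [].
 - by move=> e e0; apply: whp_mono (bounds e e0) => x om [].
 - by move=> x s; rewrite cabs1.
apply: whp_ev (whp_and FA (@whp_sub _ _ mu Q _ (@whp_far (1/400) h400 (lexx _)))).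
have [N0 HN0] := far_params h400 (lexx _).
exists N0 => -[u Qu] /= /HN0 [x4 ax cnx vx [kx Nb]] om [FAu [nf lde]] sg v v0 ev sga.
have fa : farb u <= 2 * a by apply: (leT (farb_le1 u)); move: a_ge1; lra.
have nf4 : near_free a (farb u) om (1/4).
 by move=> s; apply: (leT (nf s)); rewrite leMr ?cabs_ge0 //; lra.
set x := Nr u `^ (1/400) in x4 ax cnx vx kx Nb lde FAu.
have FA' : cabs ((mdim (mu u))%:R^-1 * \sum_s (Gm (mh om) (a +i* farb u) fs0 s s - (av (a +i* farb u) om s)^-1))
  <= x * Psi u ^+ 2.
 by move: FAu; under eq_bigr do rewrite mul1r.
have A := far_avg (gmu u) (farb_gt0 u) a_ge1 fa x4 ax cnx vx kx (Nb _ (lexx _)) lde (@S_le u) s0_le nf4 FA'.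
have wI : 0 < Im (a +i* farb u) by exact: farb_gt0.
have E := eigen_Im (mh_sym om) wI v0 ev.
rewrite /= -/(Psi u) Psi_sqr in A.
set T := \sum_s Im _ in A E.
have n0 : 0 < (mdim (mu u))%:R :> R.
 by rewrite ltr0n; have [/andP[h1 h2] _ _ _] := gmu u; exact: leq_trans h2.
have b0 := farb_gt0 u; have N0u := N_gt0 u; have x0 : 0 < x by lra.
set B := farb u in A E sga b0 fa *.
have d2 : cabs (sg%:C - (a +i* B)) ^+ 2 <= 2 * B ^+ 2.
 rewrite cabs_sqE /= sub0r sqrrN.
 have : (sg - a) ^+ 2 <= B ^+ 2 by rewrite -(real_normK (num_real (sg - a))); leXn.
 by lra.
have T0 : 0 <= T by apply: sumr_ge0 => s _; apply: Gm_Im_ge0 => //; exact: mh_sym.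
have nx : (mdim (mu u))%:R <= x * Nr u.
 by have [_ h _ _] := gmu u; apply: (leT h); rewrite leMr // ltW.
have T1 : T <= (x * Nr u) * (8 * (B + x ^+ 27 * ((Nr u)^-1 + (Nr u * B) ^- 2))).
 rewrite ler_pdivrMl // in A; apply: (leT A); apply: leMr => //.
 sgn.
have x1 : 1 <= x by lra.
(* With [x = N^(1/400)], the quantity [N b^2] equals [x^-50], and [b] and [1/(N b)] are below it,
   while only 28 powers of [x] have been lost. *)
have yE : x ^- 50 = Nr u `^ (- (1/8)) by rewrite /x powR_exp -powRN; congr (_ `^ _); lra.
have y0 : 0 < x ^- 50 by sgn.
have B1 : Nr u * B ^+ 2 = x ^- 50.
 rewrite yE /B /farb powR_exp -{1}(powRr1 (ltW N0u)) -powRDp //; congr (_ `^ _); lra.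
have B2 : B <= x ^- 50 by rewrite yE /B /farb ler_powR ?N_ge1 //; lra.
have B3 : (Nr u * B)^-1 <= x ^- 50 by rewrite yE /B NfE -powRN ler_powR ?N_ge1 //; lra.
have E1 : 1 <= 2 * B * T.
 have : B <= 2 * B ^+ 2 * T by apply: (leT E); apply: leMr.
 by rewrite (_ : 2 * B ^+ 2 * T = 2 * B * T * B); [rewrite -ler_pdivrMr // divff ?gt_eqF|ring].
have E2 : 2 * B * T <= 16 * (x * x ^- 50) + 16 * (x ^+ 28 * x ^- 50) + 16 * (x ^+ 28 * x ^- 50).
 have B0 : 0 <= 2 * B by sgn.
 apply: (leT (leMl B0 T1)).
 rewrite (_ : 2 * B * _ = 16 * (x * (Nr u * B ^+ 2)) + 16 * (x ^+ 28 * B) + 16 * (x ^+ 28 * (Nr u * B)^-1)); last first.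
  by field; rewrite !gt_eqF.
 have x28 : 0 <= x ^+ 28 by sgn.
 by rewrite B1 !lerD // leMl // leMl.
have E3 : x * x ^- 50 <= x ^+ 28 * x ^- 50.
 by apply: leMr; [exact: ltW|rewrite -[leLHS]expr1; apply: ler_weXn2l].
have E4 : x ^+ 28 * x ^- 50 <= 1 / 64.
 rewrite (_ : x ^+ 28 * _ = x ^- 22); last by field; rewrite gt_eqF.
 rewrite mul1r lef_pV2 ?posrE ?exprn_gt0 //; apply: (le_mid (4 ^+ 3)); first by lra.
 apply: (le_mid (x ^+ 3)); last by apply: ler_weXn2l.
 by apply: ler_Xn; lra.
by move: E1 E2 E3 E4; lra.
Qed.

End FarFamily.

(** * Upper bound on all eigenvalues *)

Section NormBound.
Variables (R : realType) (kap : nat -> R) (cn vmax s0 : R) (an : nat).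

Program Definition scale_model (r : R) (mu : model R) : model R :=
 @Model R (msize mu) (mdim mu) (mval mu) (mlaw (m:=mu)) (fun k v => r * mxi k v)
  (fun s => r * mvar s) (@mlaw_ge0 _ mu) (@mlaw_sum1 _ mu) _.
Next Obligation.
move=> r mu k /=; under eq_bigr do rewrite mulrCA.
by rewrite -mulr_sumr mxi_mean mulr0.
Qed.

Lemma scale_mh r mu (om : mOm mu) s t : mh (mu := scale_model r mu) om s t = r * mh om s t.
Proof. by rewrite /mh /=; case: eqP; rewrite ?mulr0. Qed.

Lemma scale_good r mu : 0 < r -> r <= 1 -> good_model kap cn vmax mu ->
 good_model kap cn vmax (scale_model r mu).
Proof.
move=> r0 r1 [h1 h2 h3 h4]; split=> //= [s|s t q].
 have /andP[v0 v1] := h3 s; rewrite mulr_gt0 //=; apply: leT v1.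
 by rewrite ler_piMl // ltW.
have := h4 s t q; rewrite -(ler_pM2l (exprn_gt0 (q * 2) r0)) => h.
rewrite (_ : kap q * _ = r ^+ (q * 2) * (kap q * (mvar s * mvar t) ^+ q)); last first.
 rewrite [X in _ = X]mulrCA; congr (_ * _); rewrite mulnC exprM -exprMn; congr (_ ^+ _); ring.
apply: leT h; rewrite /mE -EEZ; apply: eq_ler; apply: eq_EE => om.
rewrite scale_mh mulnC exprM -exprMn; congr (_ ^+ _); ring.
Qed.

Variables (U : Type) (mu : U -> model R).
Notation Nr u := ((msize (mu u))%:R : R).
Notation a := (an%:R : R).
Hypotheses (gmu : forall u, good_model kap cn vmax (mu u)) (an_gt0 : (0 < an)%N)
 (S_le : forall u (s : 'J_(mu u)), \sum_t mS s t <= s0) (s0_le : 32 * s0 <= a ^+ 2).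

Let N_gt0 u : 0 < Nr u.
Proof. by have [/andP[N0 _] _ _ _] := gmu u; rewrite ltr0n. Qed.
Let N_ge1 u : 1 <= Nr u.
Proof. by have [/andP[N0 _] _ _ _] := gmu u; rewrite ler1n. Qed.

(** If [h] had an eigenvalue [sg >= a], some multiple [r h] with [r = K/N^5 <= 1] would have one
    just below [a]. The scaled models are good with the same constants and there are only [N^5] of
    them, so all are excluded at once. *)
Lemma norm_bound : whp (fun u (om : mOm (mu u)) => forall (sg : R) (v : 'J_(mu u) -> R),
 (exists s, v s != 0) -> (forall s, \sum_t mh om s t * v t = sg * v s) -> sg < a).
Proof.
pose I u := 'I_(msize (mu u) ^ 5).
pose U1 := {u : U & I u}.
pose r (x : U1) : R := (projT2 x).+1%:R / Nr (projT1 x) ^+ 5.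
have r0 x : 0 < r x by rewrite divr_gt0 ?exprn_gt0.
have r1 x : r x <= 1.
 by rewrite ler_pdivrMr ?exprn_gt0 // mul1r -natrX ler_nat ltn_ord.
pose mu1 x := scale_model (r x) (mu (projT1 x)).
have gmu1 x : good_model kap cn vmax (mu1 x) by exact: scale_good.
have S_le1 x (s : 'J_(mu1 x)) : \sum_t mS s t <= s0.
 apply: leT (S_le s); apply: ler_sum => t _; apply: le_mE => om.
 rewrite scale_mh exprMn ler_piMl ?sqr_ge0 // -[leRHS](expr1n _ 2).
 by leXn.
have F := far_noeig gmu1 an_gt0 S_le1 s0_le.
have card u : (#|I u|)%:R <= 1 * Nr u ^+ 5 by rewrite card_ord natrX mul1r.
have W := @whp_forall R U mu I 5 1 (fun u k om => forall (sg : R) (v : 'J_(mu u) -> R),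
 (exists s, v s != 0) -> (forall s, \sum_t (r (existT _ u k) * mh om s t) * v t = sg * v s) -> ~ (`|sg - a| <= farb mu u)) card _.
have {}W := W _.
have h0 : 0 < 1/8 :> R by lra.
apply: whp_ev (whp_and (W _) (whp_h gmu h0)).
 have [N0 HN0] := evt_and (evt_powR mu (cn * vmax) h0) (evt_pos mu).
 exists N0 => u /HN0 [cvx N0u] om [H hh] sg v [s0' vs0] ev.
 rewrite ltNge; apply/negP => asg.
 have a1 : 1 <= a by rewrite ler1n.
 have N1 := N_ge1 u; have Np := N_gt0 u.
 have sg0 : 0 < sg by lra.
 (* A priori bound, from the eigenvalue equation at a coordinate where [|v|] is largest. It ensures
    that the grid of ratios is fine enough for every possible [sg]. *)
 have sgN : sg <= Nr u ^+ 3.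
  case: (@arg_maxP _ _ _ s0' xpredT (fun s => `|v s|) isT) => s1 _ s1P.
  have v1 : 0 < `|v s1| by apply: lt_le_trans (s1P s0' isT); rewrite normr_gt0.
  have vle (t : 'J_(mu u)) : 0 < @mvar _ (mu u) t <= vmax by have [_ _ ? _] := gmu u.
  have vm0 : 0 <= vmax by have /andP[h1 h2] := vle s1; exact: leT (ltW h1) h2.
  have hle t : `|mh om s1 t| <= Nr u `^ (1/8) * vmax.
  apply: (leT (hh s1 t)); apply: leMl; first exact: powR_ge0.
  rewrite -[leRHS](ger0_norm vm0) -sqrtr_sqr; apply: ler_wsqrtr.
  have /andP[p1 p2] := vle s1; have /andP[p3 p4] := vle t.
  rewrite ler_pdivrMr //; apply: (le_mid (vmax ^+ 2)).
  by rewrite expr2; apply: ler_pM => //; exact: ltW.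
  by rewrite ler_peMr ?sqr_ge0.
  have : sg * `|v s1| <= (mdim (mu u))%:R * (Nr u `^ (1/8) * vmax) * `|v s1|.
  rewrite -[X in X * _](gtr0_norm sg0) -normrM -ev; apply: (leT (ler_norm_sum _ _ _)).
  apply: (le_mid (\sum_(t < mdim (mu u)) (Nr u `^ (1/8) * vmax) * `|v s1|)).
  apply: ler_sum => t _; rewrite normrM; apply: ler_pM => //; exact: s1P.
  by rewrite sumr_const card_ord -[leLHS]mulr_natl mulrA.
  rewrite ler_pM2r // => /leT; apply.
  have [_ dn _ _] := gmu u.
  have h18 : Nr u `^ (1/8) <= Nr u by rewrite -[leRHS](powRr1 (ltW Np)) ler_powR //; lra.
  apply: (le_mid (cn * Nr u * (Nr u * vmax))).
  apply: ler_pM => //; first sgn.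
  by rewrite leMr.
  rewrite (_ : cn * Nr u * (Nr u * vmax) = cn * vmax * Nr u ^+ 2); last by ring.
  rewrite [leRHS]exprS leMr ?sqr_ge0 //; exact: leT cvx h18.
 (* [K/N^5] is the largest grid ratio that does not push the eigenvalue above [a]. Ratios start at
    [1/N^5], so its index is [K.-1]. *)
 pose K := Num.truncn (a / sg * Nr u ^+ 5).
 have as0 : 0 <= a / sg * Nr u ^+ 5 by sgn.
 have /andP[K1 K2] := truncn_itv as0; rewrite -/K in K1 K2.
 have K0 : (0 < K)%N.
  rewrite truncn_gt0 mulrAC ler_pdivlMr // mul1r; apply: (leT sgN).
  rewrite -[leLHS]mul1r; apply: ler_pM => //; try sgn.
  by rewrite ler_weXn2l.
 have KN : (K.-1 < msize (mu u) ^ 5)%N.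
  rewrite prednK // -(@ler_nat R) natrX; apply: (leT K1).
  by rewrite ler_piMl ?exprn_ge0 ?(ltW Np) // ler_pdivrMr // mul1r.
 apply: (H (Ordinal KN) (r (existT _ u (Ordinal KN)) * sg) v); first by exists s0'.
  move=> s; under eq_bigr do rewrite -mulrA.
  by rewrite -mulr_sumr ev mulrA.
 rewrite /r /= prednK //.
 have N5 : 0 < Nr u ^+ 5 by sgn.
 have E1 : K%:R / Nr u ^+ 5 * sg <= a.
  by rewrite mulrAC ler_pdivrMr // -ler_pdivlMr // mulrAC.
 have E2 : a <= K%:R / Nr u ^+ 5 * sg + sg / Nr u ^+ 5.
  rewrite [K%:R / _ * sg]mulrAC -mulrDl ler_pdivlMr //.
  have : a / sg * Nr u ^+ 5 * sg <= (K%:R + 1) * sg.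
  by rewrite leMr ?(ltW sg0) // natr1 ltW.
  rewrite mulrAC divfK ?gt_eqF //; lra.
 rewrite distrC ger0_norm ?subr_ge0 // lerBlDl; apply: (leT E2); rewrite lerD2l.
 rewrite ler_pdivrMr //; apply: (leT sgN); rewrite mulrC -ler_pdivrMl; try sgn.
 rewrite /farb powRN; apply: (le_mid (Nr u ^- 2)).
  by apply: eq_ler; field; rewrite gt_eqF.
 rewrite lef_pV2 ?posrE ?powR_gt0 ?exprn_gt0 // -powR_mulrn ?(ltW Np) // ler_powR //; lra.
move=> D; have [N0 H] := F D; exists N0 => x hx; apply: leT (H x hx).
apply: mpr_le => om; apply: contra_not => H' sg v v0 ev.
apply: (H' sg v v0) => s; rewrite -ev; apply: eq_bigr => t _.
by rewrite scale_mh.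
Qed.

End NormBound.

Lemma mulKinvM (F : fieldType) (w a y : F) : w != 0 -> w * ((a * w)^-1 * y) = a^-1 * y.
Proof. by move=> w0; rewrite invfM [a^-1 * _]mulrC !mulrA divff // mul1r. Qed.

(** * Self-consistent equations of the bipartite model *)

Section Bipartite.
Variables (R : realType) (mu : model R) (top : pred 'J_mu).
Notation N := (msize mu).
Notation Nr := ((msize mu)%:R : R).
Notation n := (mdim mu).

(* Hermitization of a sample covariance matrix: [top] selects the rows indexed
   by the population, the remaining [N] rows correspond to the samples. *)
Definition bipartite : Prop :=
 [/\ forall s t, mS s t = (if top s (+) top t then mvar s * mvar t / Nr else 0),
  forall s, ~~ top s -> @mvar _ mu s = 1 & #|[pred s | ~~ top s]| = N].

(** The empirical [m_N] at [w^2]; the division by [w] comes from the linearization. *)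
Definition m1 (w : R[i]) (om : mOm mu) : R[i] :=
 (Nr%:C * w)^-1 * \sum_(s | ~~ top s) Gm (mh om) w fs0 s s.
Definition theta (w : R[i]) (om : mOm mu) : R[i] :=
 Nr%:C^-1 * \sum_(s | top s) (mvar s)%:C * Gm (mh om) w fs0 s s.
(** The function [f] of the master equation, with eigenvalues listed by multiplicity and each
    fraction multiplied through by its eigenvalue. *)
Definition fmu (x : R[i]) : R[i] :=
 - x^-1 + Nr%:C^-1 * \sum_(s | top s) (mvar s)%:C / (1 + (mvar s)%:C * x).

Hypotheses (bip : bipartite) (N_gt0 : 0 < Nr).

Let NC0 : Nr%:C != 0.
Proof. by rewrite realC_eq0 gt_eqF. Qed.

Lemma SG_top w om s : w != 0 -> top s ->
 \sum_t (mS s t)%:C * Gm (mh om) w fs0 t t = (mvar s)%:C * (w * m1 w om).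
Proof.
move=> w0 ts; have [hS h1 _] := bip.
rewrite /m1 (bigID top) /= big1 ?add0r; last by move=> t tt; rewrite hS ts tt mul0r.
rewrite mulKinvM // mulrA mulr_sumr; apply: eq_bigr => t tt.
by rewrite hS ts (negbTE tt) /= (h1 t tt) mulr1 rmorphM /= fmorphV.
Qed.

Lemma SG_bot w om s : ~~ top s ->
 \sum_t (mS s t)%:C * Gm (mh om) w fs0 t t = theta w om.
Proof.
move=> ts; have [hS h1 _] := bip.
rewrite /theta (bigID top) /= [X in _ + X]big1 ?addr0; last first.
 by move=> t tt; rewrite hS (negbTE ts) (negbTE tt) mul0r.
rewrite mulr_sumr; apply: eq_bigr => t tt.
by rewrite hS tt (negbTE ts) /= (h1 s ts) mul1r rmorphM /= fmorphV; ring.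
Qed.

(** Sample rows give [1 + w m (w + theta)] close to 0 and population rows express [theta] through
    [m]. Eliminating [theta] between the two leaves [f(m)] close to [w^2]. *)
Lemma fmu_close w om e1 e2 X : w != 0 -> m1 w om != 0 ->
 cabs (1 + w * m1 w om * (w + theta w om)) <= e1 ->
 cabs (theta w om + Nr%:C^-1 * \sum_(s | top s) (mvar s)%:C / (w * (1 + (mvar s)%:C * m1 w om))) <= e2 ->
 cabs w <= X -> (cabs (m1 w om))^-1 <= X ->
 cabs (fmu (m1 w om) - w ^+ 2) <= X * (e1 + e2).
Proof.
move=> w0 mn0; set x := m1 w om in mn0 *; set th := theta w om.
set Q := Nr%:C^-1 * _ => h1 h2 hw hm.
have QE : Nr%:C^-1 * \sum_(s | top s) (mvar s)%:C / (1 + (mvar s)%:C * x) = w * Q.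
 rewrite /Q mulrCA; congr (_ * _); rewrite mulr_sumr; apply: eq_bigr => s _.
 by rewrite invfM (mulrCA w) (mulrA w w^-1) divff // mul1r.
rewrite /fmu QE.
have -> : - x^-1 + w * Q - w ^+ 2 = w * (th + Q) - (1 + w * x * (w + th)) / x by field.
apply: (leT (cabsB _ _)); rewrite (cabsM w) (cabsM (1 + _)) cabsV [X * _]mulrDr [leLHS]addrC; apply: lerD.
 by rewrite mulrC; lepM.
by lepM.
Qed.

End Bipartite.

(** * Error in the master equation at one point *)

Section BipartiteStep.
Variables (R : realType) (kap : nat -> R) (cn vmax : R) (mu : model R) (top : pred 'J_mu).
Variables (w : R[i]) (x g : R) (om : mOm mu).
Notation N := ((msize mu)%:R : R).
Notation n := (mdim mu).
Notation b := (Im w).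
Notation G0 := (Gm (mh om) w fs0).
Notation Phi := (sqrt (g / (N * b))).
Hypotheses (bip : bipartite top) (gmu : good_model kap cn vmax mu) (b_gt0 : 0 < b) (x_ge : 4 <= x)
 (cn_le : cn <= x) (vmax_le : vmax <= x) (kap_le : `|kap 1| <= x) (wV_le : (cabs w)^-1 <= x)
 (w_le : cabs w <= x) (Gd : forall s, cabs (G0 s s) <= x /\ cabs (G0 s s)^-1 <= x)
 (gI : forall s, Im (G0 s s) <= g) (g_le : g <= x) (Nb : x ^+ 20 <= N * b) (lde : lde_ev w x om).

Notation mm := (m1 top w om).
Notation th := (theta top w om).
Notation eps := (x ^+ 6 * Phi).

Let x_gt0 : 0 < x. Proof. exact: lt_le_trans (ltr0Sn _ 3) x_ge. Qed.
Let x_ge0 : 0 <= x. Proof. exact: ltW. Qed.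
Let xp k : 0 <= x ^+ k. Proof. exact: exprn_ge0. Qed.
Let N_ge1 : 1 <= N.
Proof. by have [/andP[N0 _] _ _ _] := gmu; rewrite ler1n. Qed.
Let N_gt0 : 0 < N. Proof. exact: lt_le_trans N_ge1. Qed.
Let v_gt0 (s : 'I_n) : 0 < mvar s.
Proof. by have [_ _ /(_ s)/andP[]] := gmu. Qed.
Let v_le (s : 'I_n) : mvar s <= x.
Proof. by have [_ _ /(_ s)/andP[_ h] _] := gmu; apply: (leT h). Qed.
Let w0 : w != 0.
Proof. by apply: contraTneq b_gt0 => ->; rewrite ltxx. Qed.
Let NC0 : N%:C != 0.
Proof. by rewrite realC_eq0 gt_eqF. Qed.
Let x3 : 2 * x <= x ^+ 3.
Proof.
rewrite (_ : x ^+ 3 = x ^+ 2 * x); last by ring.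
by apply: leMr => //; rewrite expr2; move: x_ge; nra.
Qed.
Let hs := mh_sym om.
Let Phi0 : 0 <= Phi. Proof. exact: sqrtr_ge0. Qed.
Let eps0 : 0 <= eps. Proof. exact: mulr_ge0. Qed.
Let n_le : n%:R <= x * N.
Proof. by have [_ h _ _] := gmu; apply: (leT h); rewrite leMr // ltW. Qed.
Let eps_small : x ^+ 3 * eps <= 1.
Proof.
rewrite mulrA -exprD; exact: (Phi_small gmu b_gt0 x_ge Gd gI g_le Nb).
Qed.

Let diag_err s : cabs ((G0 s s)^-1 + w + mSG G0 s) <= eps.
Proof.
apply: (leT (diagV_approx gmu b_gt0 x_ge cn_le vmax_le kap_le wV_le Gd gI g_le Nb lde s)).
rewrite (_ : eps = x ^+ 5 * (x * Phi)); last by ring.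
by apply: leMl => //; apply: leMr.
Qed.

Lemma top_err s : top s -> cabs ((G0 s s)^-1 + w * (1 + (mvar s)%:C * mm)) <= eps.
Proof.
move=> ts; have := diag_err s; rewrite (SG_top bip om w0 ts).
by rewrite (_ : _ + w + _ = (G0 s s)^-1 + w * (1 + (mvar s)%:C * mm)); [|ring].
Qed.

Lemma bot_err s : ~~ top s -> cabs ((G0 s s)^-1 + (w + th)) <= eps.
Proof. by move=> ts; have := diag_err s; rewrite (SG_bot bip w om ts) addrA. Qed.

Let G_n0 s : G0 s s != 0. Proof. exact: Gm_diag_neq0. Qed.
Let card_bot : #|[pred s | ~~ top s]| = msize mu. Proof. by have [] := bip. Qed.

Lemma avg_bot (F : 'I_n -> R[i]) (K : R) : (forall s, ~~ top s -> cabs (F s) <= K) ->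
 cabs (N%:C^-1 * \sum_(s | ~~ top s) F s) <= K.
Proof.
move=> FK; rewrite cabsM cabsV cabsR ger0_norm ?(ltW N_gt0) // mulrC ler_pdivrMr //.
apply: (leT (cabs_sum _ _ _)); apply: (le_mid (\sum_(s | ~~ top s) K)).
 by apply: ler_sum => s; exact: FK.
by rewrite sumr_const card_bot mulr_natr.
Qed.

Lemma avg_top (F : 'I_n -> R[i]) (K : R) : 0 <= K -> (forall s, top s -> cabs (F s) <= K) ->
 cabs (N%:C^-1 * \sum_(s | top s) (mvar s)%:C * F s) <= x ^+ 2 * K.
Proof.
move=> K0 FK; rewrite cabsM cabsV cabsR ger0_norm ?(ltW N_gt0) // mulrC ler_pdivrMr //.
apply: (leT (cabs_sum _ _ _)); apply: (le_mid (\sum_(s < n) x * K)).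
 rewrite big_mkcond; apply: ler_sum => s _; case: ifP => ts; last exact: mulr_ge0.
 rewrite cabsM cabsR ger0_norm ?(ltW (v_gt0 s)) //; lepM.
 exact: FK.
rewrite sumr_const card_ord -[leLHS]mulr_natl (_ : x ^+ 2 * K * N = (x * N) * (x * K)); last by ring.
by apply: leMr => //; exact: mulr_ge0.
Qed.

Lemma m1E : w * mm = N%:C^-1 * \sum_(s | ~~ top s) G0 s s.
Proof. exact: mulKinvM. Qed.

Lemma inv_ge s (c : R[i]) : cabs ((G0 s s)^-1 + c) <= eps -> (2 * x)^-1 <= cabs c.
Proof.
move=> h; have [h1 _] := Gd s.
have G0p : 0 < cabs (G0 s s) by rewrite cabs_gt0.
have h2 : x^-1 <= cabs (G0 s s)^-1 by rewrite cabsV lef_pV2 ?posrE.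
have h3 : cabs (G0 s s)^-1 <= cabs ((G0 s s)^-1 + c) + cabs c.
 by rewrite {1}(_ : (G0 s s)^-1 = ((G0 s s)^-1 + c) - c); [exact: cabsB|ring].
have h4 : 2 * x * eps <= 1.
 by apply: leT eps_small; apply: leMr.
have h5 : eps <= (2 * x)^-1 by rewrite -[leRHS]mul1r ler_pdivlMr ?mulr_gt0 // mulrC.
have h6 : (2 * x)^-1 = x^-1 / 2 by field; rewrite gt_eqF.
rewrite h6 in h5 *; move: h h2 h3 h5; lra.
Qed.

Lemma bot_exists : exists s, ~~ top s.
Proof.
have /card_gt0P[s ts] : (0 < #|[pred s | ~~ top s]|)%N by rewrite card_bot -(ltr0n R).
by exists s.
Qed.

Lemma e1_le : cabs (1 + w * mm * (w + th)) <= x * eps.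
Proof.
have -> : 1 + w * mm * (w + th) = N%:C^-1 * \sum_(s | ~~ top s) (1 + G0 s s * (w + th)).
 rewrite m1E big_split /= -mulr_suml [RHS]mulrDr [in RHS]mulrA; congr (_ + _).
 by rewrite sumr_const card_bot -natC mulVf.
apply: avg_bot => s ts.
rewrite (_ : 1 + _ = G0 s s * ((G0 s s)^-1 + (w + th))); last by rewrite [RHS]mulrDr divff.
by rewrite cabsM; apply: ler_pM; rewrite ?cabs_ge0 ?bot_err //; have [] := Gd s.
Qed.

Lemma wth_le : cabs (w + th) <= 2 * x.
Proof.
have [s ts] := bot_exists; have := bot_err ts; have [_ h] := Gd s => h1.
have : cabs (w + th) <= cabs ((G0 s s)^-1 + (w + th)) + cabs (G0 s s)^-1.
 by rewrite {1}(_ : w + th = ((G0 s s)^-1 + (w + th)) - (G0 s s)^-1); [exact: cabsB|ring].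
have h3 : 1 * eps <= x ^+ 3 * eps.
 apply: leMr => //; apply: exprn_ege1; rewrite //.
 by move: x_ge; lra.
by move: eps_small x_ge h3 h1; lra.
Qed.

Lemma mV_le : mm != 0 /\ (cabs mm)^-1 <= 4 * x ^+ 2.
Proof.
have h1 : 1 / 2 <= cabs (w * mm * (w + th)).
 have e1 := e1_le; have : cabs 1 <= cabs (1 + w * mm * (w + th)) + cabs (w * mm * (w + th)).
  rewrite {1}(_ : 1 = (1 + w * mm * (w + th)) - w * mm * (w + th)); last by ring.
  exact: cabsB.
 rewrite cabs1; have : x * eps <= 1 / 2.
  have : 2 * (x * eps) <= x ^+ 3 * eps.
  by rewrite mulrA; apply: leMr.
  by move: eps_small; lra.
 by move: e1; lra.
rewrite (cabsM (w * mm)) (cabsM w) in h1; have wt := wth_le.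
have h2 : 1 / 2 <= cabs mm * (2 * x ^+ 2).
 apply: (leT h1); rewrite (_ : cabs mm * (2 * x ^+ 2) = x * cabs mm * (2 * x)); last by ring.
 by apply: ler_pM; rewrite ?mulr_ge0 ?cabs_ge0 //; apply: leMr; try sgn.
have m0 : 0 < cabs mm.
 by rewrite lt_neqAle cabs_ge0 andbT; apply/negP => /eqP h; move: h2; rewrite -h mul0r; lra.
split; first by rewrite -cabs_gt0.
by rewrite -[leLHS]mul1r ler_pdivrMr //; move: h2; lra.
Qed.

Lemma e2_le : cabs (th + N%:C^-1 * \sum_(s | top s) (mvar s)%:C / (w * (1 + (mvar s)%:C * mm))) <= 2 * x ^+ 4 * eps.
Proof.
rewrite /theta -mulrDr -big_split /=.
under eq_bigr do rewrite -mulrDr.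
rewrite (_ : 2 * x ^+ 4 * eps = x ^+ 2 * (2 * x ^+ 2 * eps)); last by ring.
apply: avg_top; first sgn.
move=> s ts; have h := top_err ts; have h1 := inv_ge h.
set c := w * (1 + _) in h h1 *.
have c0 : c != 0 by rewrite -cabs_gt0; apply: lt_le_trans h1; rewrite invr_gt0 mulr_gt0.
have -> : G0 s s + c^-1 = G0 s s * ((G0 s s)^-1 + c) / c by field; rewrite c0 G_n0.
rewrite !cabsM cabsV (_ : 2 * x ^+ 2 * eps = x * eps * (2 * x)); last by ring.
lepM.
 by apply: ler_pM; rewrite ?cabs_ge0 //; have [] := Gd s.
by rewrite -[leRHS]invrK lef_pV2 ?posrE ?cabs_gt0 // invr_gt0 mulr_gt0.
Qed.

Lemma fmu_err1 : cabs (fmu top mm - w ^+ 2) <= x ^+ 14 * Phi.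
Proof.
have [m0 mV] := mV_le.
have wX : cabs w <= 4 * x ^+ 2 by apply: (leT w_le); move: x_ge; nra.
apply: (leT (fmu_close w0 m0 e1_le e2_le wX mV)).
rewrite (_ : x ^+ 14 * Phi = x ^+ 8 * eps); last by rewrite mulrA -exprD.
rewrite [leLHS](_ : _ = 4 * x ^+ 2 * (x + 2 * x ^+ 4) * eps); last by ring.
apply: leMr => //.
have x14 : x <= x ^+ 4 by rewrite -[leLHS]expr1 ler_weXn2l //; move: x_ge; lra.
have x2 : 16 <= x ^+ 2 by rewrite expr2; move: x_ge; nra.
apply: (le_mid (12 * x ^+ 6)).
 rewrite (_ : 12 * x ^+ 6 = 4 * x ^+ 2 * (3 * x ^+ 4)); last by ring.
 by apply: leMl; [rewrite mulr_ge0|lra].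
by rewrite (_ : x ^+ 8 = x ^+ 2 * x ^+ 6); [apply: leMr => //; lra|ring].
Qed.

(* [W_s] runs over the two weights to which fluctuation averaging is applied. *)
Lemma fmu_err2 (e : R) :
 cabs (n%:R^-1 * \sum_s (~~ top s)%:R * (G0 s s - (av w om s)^-1)) <= e ->
 cabs (n%:R^-1 * \sum_s (if top s then (mvar s / (`|vmax| + 1))%:C else 0) * (G0 s s - (av w om s)^-1)) <= e ->
 cabs (fmu top mm - w ^+ 2) <= x ^+ 22 * (e + Phi ^+ 2).
Proof.
move=> hb ht; have [m0 mV] := mV_le.
have n0 : 0 < n%:R :> R.
 by rewrite ltr0n; have [/andP[h1 h2] _ _ _] := gmu; exact: leq_trans h2.
have e0 : 0 <= e := leT (cabs_ge0 _) hb.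
have nC : (n%:R : R[i]) != 0 by rewrite -natC realC_eq0 gt_eqF.
have cN : cabs (n%:R / N%:C) <= x.
 rewrite cabsM cabsV -natC !cabsR !ger0_norm ?ler0n //.
 by rewrite ler_pdivrMr.
pose r := x ^+ 13 * Phi ^+ 2.
have r0 : 0 <= r by rewrite mulr_ge0 ?sqr_ge0.
have avr s : cabs (av w om s + w + mSG G0 s) <= r.
 apply: (leT (av_approx gmu b_gt0 x_ge cn_le vmax_le kap_le Gd gI Nb lde s)).
 rewrite (_ : r = x ^+ 12 * (x * Phi ^+ 2)); last by rewrite /r; ring.
 by apply: leMl => //; apply: leMr; try sgn.
have reps : r * (4 * x) <= 1.
 rewrite /r (_ : x ^+ 13 * Phi ^+ 2 * (4 * x) = 4 / x ^+ 4 * ((x ^+ 3 * eps) * (x ^+ 3 * eps))); last first.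
  by field; rewrite gt_eqF.
 have h4 : 4 / x ^+ 4 <= 1.
  rewrite ler_pdivrMr ?exprn_gt0 // mul1r (_ : x ^+ 4 = x ^+ 3 * x); last by ring.
  by move: x3 x_ge; nra.
 rewrite -[leRHS]mulr1; apply: ler_pM => //; try sgn.
 by rewrite -[leRHS]mulr1; lepM.
have inv s c : cabs ((G0 s s)^-1 + c) <= eps -> cabs (av w om s + c) <= r ->
  cabs ((av w om s)^-1 + c^-1) <= 8 * x ^+ 2 * r.
 move=> h1 h2; have c1 := inv_ge h1.
 have x2 : 0 < 2 * x by sgn.
 have c0 : 0 < cabs c by apply: lt_le_trans c1; rewrite invr_gt0.
 have a1 : (4 * x)^-1 <= cabs (av w om s).
  have : cabs c <= cabs (av w om s + c) + cabs (av w om s).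
  by rewrite {1}(_ : c = (av w om s + c) - av w om s); [exact: cabsB|ring].
  have : r <= (4 * x)^-1 by rewrite -[leRHS]mul1r ler_pdivlMr; sgn.
  have : (2 * x)^-1 = (4 * x)^-1 + (4 * x)^-1 by field; rewrite gt_eqF.
  by move: c1 h2; lra.
 have a0 : 0 < cabs (av w om s) by apply: lt_le_trans a1; rewrite invr_gt0 mulr_gt0.
 have -> : (av w om s)^-1 + c^-1 = (av w om s + c) / (av w om s * c).
  by field; rewrite -!cabs_gt0 a0 c0.
 rewrite cabsM mulrC; lepM.
 rewrite cabsV cabsM invfM (_ : 8 * x ^+ 2 = (4 * x) * (2 * x)); last by ring.
 lepM.
  by rewrite -[leRHS]invrK lef_pV2; sgn.
 by rewrite -[leRHS]invrK lef_pV2; sgn.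
have topc s : top s -> cabs ((av w om s)^-1 + (w * (1 + (mvar s)%:C * mm))^-1) <= 8 * x ^+ 2 * r.
 move=> ts; apply: inv; first exact: top_err.
 have := avr s; rewrite (SG_top bip om w0 ts).
 by rewrite (_ : _ + w + _ = av w om s + w * (1 + (mvar s)%:C * mm)); [|ring].
have botc s : ~~ top s -> cabs ((av w om s)^-1 + (w + th)^-1) <= 8 * x ^+ 2 * r.
 move=> ts; apply: inv; first exact: bot_err.
 by have := avr s; rewrite (SG_bot bip w om ts) addrA.
have wth0 : w + th != 0.
 have [s ts] := bot_exists; have h := inv_ge (bot_err ts); rewrite -cabs_gt0.
 by apply: lt_le_trans h; rewrite invr_gt0 mulr_gt0.
have E1 : cabs (w * mm + (w + th)^-1) <= x * e + 8 * x ^+ 2 * r.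
 rewrite m1E (_ : _ + _ = (n%:R / N%:C) * (n%:R^-1 * \sum_s (~~ top s)%:R * (G0 s s - (av w om s)^-1))
  + N%:C^-1 * \sum_(s | ~~ top s) ((av w om s)^-1 + (w + th)^-1)).
  apply: (leT (cabsD _ _)); apply: lerD; last exact: avg_bot.
  by rewrite cabsM; lepM.
 rewrite big_split /= sumr_const card_bot.
 rewrite (_ : \sum_s (~~ top s)%:R * (G0 s s - (av w om s)^-1) = \sum_(s | ~~ top s) G0 s s - \sum_(s | ~~ top s) (av w om s)^-1).
  rewrite (_ : (w + th)^-1 *+ msize mu = N%:C * (w + th)^-1); last first.
  by rewrite natC mulr_natl.
  by move: (N%:C) NC0 => NN NN0; field; rewrite wth0 NN0 nC.
 rewrite -sumrB [RHS]big_mkcond; apply: eq_bigr => s _.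
 by case: ifP => _; rewrite ?mul1r ?mul0r.
have F1 : cabs (1 + w * mm * (w + th)) <= 2 * x * (x * e + 8 * x ^+ 2 * r).
 rewrite (_ : 1 + _ = (w + th) * (w * mm + (w + th)^-1)); last by rewrite [RHS]mulrDr divff //; ring.
 by rewrite cabsM; apply: ler_pM; rewrite ?cabs_ge0 ?wth_le.
have F2 : cabs (th + N%:C^-1 * \sum_(s | top s) (mvar s)%:C / (w * (1 + (mvar s)%:C * mm)))
  <= x ^+ 3 * e + 8 * x ^+ 4 * r.
 (* Fluctuation averaging needs weights of modulus at most 1; [v1] undoes this normalization. *)
 set v1 := `|vmax| + 1 in ht; have v1p : 0 < v1 by rewrite ltr_wpDl.
 have vx : v1 <= x ^+ 2.
  have vp : 0 <= vmax.
  by have [s _] := bot_exists; have [_ _ /(_ s)/andP[h1 h2] _] := gmu; exact: leT (ltW h1) h2.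
  by rewrite /v1 ger0_norm //; move: x_ge vmax_le; nra.
 rewrite (_ : _ + _ = (n%:R / N%:C) * v1%:C * (n%:R^-1 * \sum_s (if top s then (mvar s / v1)%:C else 0) * (G0 s s - (av w om s)^-1))
  + N%:C^-1 * \sum_(s | top s) (mvar s)%:C * ((av w om s)^-1 + (w * (1 + (mvar s)%:C * mm))^-1)).
  apply: (leT (cabsD _ _)); apply: lerD; last first.
  rewrite (_ : 8 * x ^+ 4 * r = x ^+ 2 * (8 * x ^+ 2 * r)); last by ring.
  by apply: avg_top => //; rewrite !mulr_ge0.
  rewrite cabsM cabsM cabsR gtr0_norm //; lepM.
  by rewrite (_ : x ^+ 3 = x * x ^+ 2); [lepM|ring].
 have v1C : v1%:C != 0 by rewrite realC_eq0 gt_eqF.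
 rewrite (_ : \sum_s (if top s then (mvar s / v1)%:C else 0) * (G0 s s - (av w om s)^-1) =
  v1%:C^-1 * (\sum_(s | top s) (mvar s)%:C * G0 s s - \sum_(s | top s) (mvar s)%:C / av w om s)); last first.
  rewrite -sumrB mulr_sumr [RHS]big_mkcond; apply: eq_bigr => s _.
  by case: ifP => _; rewrite ?mul0r // rmorphM /= fmorphV; ring.
 rewrite (_ : \sum_(s | top s) (mvar s)%:C * ((av w om s)^-1 + (w * (1 + (mvar s)%:C * mm))^-1) =
  \sum_(s | top s) (mvar s)%:C / av w om s + \sum_(s | top s) (mvar s)%:C / (w * (1 + (mvar s)%:C * mm))); last first.
  by rewrite -big_split /=; apply: eq_bigr => s _; rewrite [LHS]mulrDr.
 rewrite /theta; move: (N%:C) NC0 (v1%:C) v1C => NN NN0 vv vv0.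
 by field; rewrite nC NN0 vv0.
have wX : cabs w <= 4 * x ^+ 2 by apply: (leT w_le); move: x_ge; nra.
apply: (leT (fmu_close w0 m0 F1 F2 wX mV)).
rewrite [leLHS](_ : _ = (8 * x ^+ 4 + 4 * x ^+ 5) * e + (64 * x ^+ 18 + 32 * x ^+ 19) * Phi ^+ 2); last first.
 by rewrite /r; ring.
rewrite mulrDr; apply: lerD.
 apply: leMr => //; apply: (le_mid (x ^+ 7)).
  rewrite (_ : x ^+ 7 = x * x ^+ 2 * x ^+ 4); last by ring.
  rewrite (_ : 8 * x ^+ 4 + 4 * x ^+ 5 = (8 + 4 * x) * x ^+ 4); last by ring.
  by apply: leMr => //; move: x_ge; nra.
 by apply: ler_weXn2l => //; move: x_ge; lra.
apply: leMr; first exact: sqr_ge0.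
rewrite (_ : 64 * x ^+ 18 + 32 * x ^+ 19 = (64 + 32 * x) * x ^+ 18); last by ring.
rewrite (_ : x ^+ 22 = (x ^+ 3 * x) * x ^+ 18); last by ring.
apply: leMr => //.
have h1 : 16 * x <= x ^+ 3.
 by rewrite (_ : x ^+ 3 = x ^+ 2 * x); [apply: leMr => //; rewrite expr2; move: x_ge; nra|ring].
have h2 : 16 * x * 4 <= x ^+ 3 * x by apply: ler_pM => //; rewrite mulr_ge0.
by move: h2 x_ge; lra.
Qed.

End BipartiteStep.

(** * Bounds on the solution of the master equation *)

Section MasterSolution.
Variables (R : realType) (mu : model R) (top : pred 'J_mu) (cn vmax tau Z : R) (z m : R[i]).
Notation N := ((msize mu)%:R : R).
Notation n := (mdim mu).
Hypotheses (N_gt0 : 0 < N) (v_bnd : forall s : 'I_n, 0 < mvar s <= vmax) (n_le : n%:R <= cn * N)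
 (vmax_ge0 : 0 <= vmax) (tau_gt0 : 0 < tau) (Imm : 0 < Im m) (mE : fmu top m = z)
 (m_tau : forall s, top s -> tau <= cabs (1 + (mvar s)%:C * m)).

Let m0 : m != 0. Proof. by apply: contraTneq Imm => ->; rewrite ltxx. Qed.
Let NC0 : N%:C != 0.
Proof. by rewrite realC_eq0 gt_eqF. Qed.
Let dm0 s : top s -> 1 + (mvar s)%:C * m != 0.
Proof. by move=> ts; rewrite -cabs_gt0; apply: lt_le_trans (m_tau ts). Qed.
Let avg (F : 'I_n -> R[i]) (K : R) : 0 <= K -> (forall s, top s -> cabs (F s) <= K) ->
 cabs (N%:C^-1 * \sum_(s | top s) F s) <= cn * K.
Proof.
move=> K0 FK; rewrite cabsM cabsV cabsR gtr0_norm // mulrC ler_pdivrMr //.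
apply: (leT (cabs_sum _ _ _)); apply: (le_mid (\sum_(s < n) K)).
 by rewrite big_mkcond; apply: ler_sum => s _; case: ifP => // ts; exact: FK.
rewrite sumr_const card_ord -[leLHS]mulr_natl mulrAC; exact: leMr.
Qed.

(** After multiplication of [z = f(m)] by [m] each summand is [1 - 1/(1 + mvar s m)], which the gap
    hypothesis bounds. *)
Lemma m_le : cabs z * cabs m <= 1 + cn * (1 + tau^-1).
Proof.
have E : z * m = - 1 + N%:C^-1 * \sum_(s | top s) (1 - (1 + (mvar s)%:C * m)^-1).
 rewrite -mE /fmu mulrDl mulNr mulVf //; congr (_ + _); rewrite -mulrA mulr_suml; congr (_ * _).
 by apply: eq_bigr => s ts; field; exact: dm0.
rewrite -cabsM E; apply: (leT (cabsD _ _)); rewrite cabsN cabs1 lerD2l.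
apply: avg; first sgn.
move=> s ts; apply: (leT (cabsB _ _)); rewrite cabs1 lerD2l cabsV.
by rewrite lef_pV2 ?posrE ?m_tau // cabs_gt0 dm0.
Qed.

Lemma mV_le' : (cabs m)^-1 <= cabs z + cn * (vmax / tau).
Proof.
have E : - m^-1 = z - N%:C^-1 * \sum_(s | top s) (mvar s)%:C / (1 + (mvar s)%:C * m).
 by rewrite -mE /fmu; ring.
rewrite -cabsV -cabsN E; apply: (leT (cabsB _ _)); rewrite lerD2l.
apply: avg; first sgn.
move=> s ts; have /andP[h1 h2] := v_bnd s; rewrite cabsM cabsR gtr0_norm // cabsV.
apply: ler_pM => //; try sgn.
by rewrite lef_pV2 ?posrE ?m_tau // cabs_gt0 dm0.
Qed.

(** The sum in [f] has nonpositive imaginary part, so [Im z] is at most that of [-1/m], which is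
    [Im m / |m|^2]. *)
Lemma Imm_ge : Im z * cabs m ^+ 2 <= Im m.
Proof.
have m2 : 0 < cabs m ^+ 2 by rewrite exprn_gt0 // cabs_gt0.
rewrite -ler_pdivlMr // -mE /fmu ImD ImN ImV mulNr opprK gerDl.
rewrite -fmorphV ImM /= mul0r addr0 mulr_ge0_le0; try sgn.
rewrite Im_sum; apply: sumr_le0 => s ts; have /andP[h1 h2] := v_bnd s.
rewrite ImM /= mul0r addr0 mulr_ge0_le0 ?(ltW h1) // ImV mulNr oppr_le0 divr_ge0 ?sqr_ge0 //.
by rewrite ImD ImM /= mul0r addr0 add0r; sgn.
Qed.

End MasterSolution.

(** * Resolvent entries compared with the deterministic limit *)

Section BipartiteLaw.
Variables (R : realType) (kap : nat -> R) (cn vmax : R) (mu : model R) (top : pred 'J_mu).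
Variables (w m : R[i]) (x L tau Lam : R) (om : mOm mu).
Notation N := ((msize mu)%:R : R).
Notation n := (mdim mu).
Notation b := (Im w).
Notation eta := (Im (w ^+ 2)).
Notation G0 := (Gm (mh om) w fs0).
Notation mm := (m1 top w om).
Hypotheses (bip : bipartite top) (gmu : good_model kap cn vmax mu) (b_gt0 : 0 < b) (x_ge : 4 <= x)
 (cn_le : cn <= x) (vmax_le : vmax <= L) (kap_le : `|kap 1| <= x) (L_ge1 : 1 <= L) (L_le : 8 * L ^+ 3 <= x)
 (wV_le : (cabs w)^-1 <= L) (w_le : cabs w <= L) (m_le : cabs m <= L) (mV_le : (cabs m)^-1 <= L)
 (m_neq0 : m != 0) (tau_gt0 : 0 < tau) (tauV_le : tau^-1 <= L)
 (m_tau : forall s, top s -> tau <= cabs (1 + (mvar s)%:C * m)) (Im_m_ge0 : 0 <= Im m) (eta_gt0 : 0 < eta)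
 (Gd : forall s, cabs (G0 s s) <= x /\ cabs (G0 s s)^-1 <= x) (Nb : x ^+ 20 <= N * b) (lde : lde_ev w x om)
 (Lam_le : cabs (mm - m) <= Lam).

Let L0 : 0 < L. Proof. exact: lt_le_trans L_ge1. Qed.
Let L_ge0 : 0 <= L. Proof. exact: ltW. Qed.
Let L23 : L <= L ^+ 2 /\ L ^+ 2 <= L ^+ 3.
Proof. by split; [rewrite -[leLHS]expr1|]; apply: ler_weXn2l. Qed.
Let Lx : L <= x.
Proof. by have [h1 h2] := L23; move: L_ge1 L_le; lra. Qed.
Let x_gt0 : 0 < x. Proof. exact: lt_le_trans (ltr0Sn _ 3) x_ge. Qed.
Let x_ge0 : 0 <= x. Proof. exact: ltW. Qed.
Let xp k : 0 <= x ^+ k. Proof. exact: exprn_ge0. Qed.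
Let vx : vmax <= x. Proof. exact: leT Lx. Qed.
Let wVx : (cabs w)^-1 <= x. Proof. exact: leT Lx. Qed.
Let wx : cabs w <= x. Proof. exact: leT Lx. Qed.
Let w0 : w != 0.
Proof. by apply: contraTneq b_gt0 => ->; rewrite ltxx. Qed.
Let v_gt0 (s : 'I_n) : 0 < mvar s.
Proof. by have [_ _ /(_ s)/andP[]] := gmu. Qed.
Let v_leL (s : 'I_n) : mvar s <= L.
Proof. by have [_ _ /(_ s)/andP[_ h] _] := gmu; apply: (leT h). Qed.
Let Lam0 : 0 <= Lam. Proof. exact: leT (cabs_ge0 _) Lam_le. Qed.
Let N_gt0 : 0 < N.
Proof. by have [/andP[N0 _] _ _ _] := gmu; rewrite ltr0n. Qed.
Let Im_le_x s : Im (G0 s s) <= x.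
Proof. by have [h _] := Gd s; apply: leT h; exact: Im_le. Qed.
Let ab : eta = 2 * Re w * b.
Proof. by rewrite expr2 ImM; ring. Qed.
Let b_ge : eta <= x ^+ 2 * b.
Proof.
rewrite ab; mulR.
have := Re_le_cabs w; have := ler_norm (Re w); move: wx x_ge; nra.
Qed.

Section WithG.
Variable g : R.
Hypotheses (gI : forall s, Im (G0 s s) <= g) (g_le : g <= x).
Notation Phi := (sqrt (g / (N * b))).
Notation eps := (x ^+ 6 * Phi).

Let eps0 : 0 <= eps. Proof. sgn. Qed.
Let eps_small : x ^+ 3 * eps <= 1.
Proof. by rewrite mulrA -exprD; exact: (Phi_small gmu b_gt0 x_ge Gd gI g_le Nb). Qed.
Let terr s : top s -> cabs ((G0 s s)^-1 + w * (1 + (mvar s)%:C * mm)) <= eps :=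
 top_err bip gmu b_gt0 x_ge cn_le vx kap_le wVx Gd gI g_le Nb lde (s := s).
Let berr s : ~~ top s -> cabs ((G0 s s)^-1 + (w + theta top w om)) <= eps :=
 bot_err bip gmu b_gt0 x_ge cn_le vx kap_le wVx Gd gI g_le Nb lde (s := s).

Lemma top_m s : top s -> cabs ((G0 s s)^-1 + w * (1 + (mvar s)%:C * m)) <= eps + L ^+ 2 * Lam.
Proof.
move=> ts; rewrite (_ : _ + _ = ((G0 s s)^-1 + w * (1 + (mvar s)%:C * mm)) - w * (mvar s)%:C * (mm - m)); last by ring.
apply: (leT (cabsB _ _)); apply: lerD; first exact: terr.
rewrite cabsM (cabsM w) cabsR gtr0_norm // expr2; lepM.
by lepM.
Qed.

(** The factor [mvar s] is inherited from the error of [diagV_approx] and from the term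
    [mvar s * w * (mm - m)]. The entrywise law needs it, since it divides by [mvar s]. *)
Lemma top_m2 s : top s -> cabs (G0 s s + (w * (1 + (mvar s)%:C * m))^-1) <= mvar s * (x ^+ 3 * (eps + x * Lam)).
Proof.
move=> ts; set c0 := w * (1 + (mvar s)%:C * m).
have c00 : c0 != 0 by rewrite /c0 mulf_neq0 // -cabs_gt0; exact: lt_le_trans (m_tau ts).
have c0V : (cabs c0)^-1 <= x ^+ 2.
 rewrite /c0 cabsM invfM expr2; lepM.
 apply: (leT _ Lx); apply: leT tauV_le; rewrite lef_pV2 ?posrE ?m_tau //.
 by apply: lt_le_trans (m_tau ts).
have G_n0 : G0 s s != 0 by apply: Gm_diag_neq0 => //; exact: mh_sym.
rewrite (_ : _ + _ = G0 s s * ((G0 s s)^-1 + c0) / c0); last by field; rewrite c00 G_n0.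
rewrite cabsM (cabsM (G0 s s)) cabsV.
have h : cabs ((G0 s s)^-1 + c0) <= mvar s * (eps + x * Lam).
 have := diagV_approx gmu b_gt0 x_ge cn_le vx kap_le wVx Gd gI g_le Nb lde s.
 rewrite (SG_top bip om w0 ts) => d1.
 rewrite (_ : _ + c0 = ((G0 s s)^-1 + w + (mvar s)%:C * (w * mm)) - (mvar s)%:C * (w * (mm - m))); last by rewrite /c0; ring.
 apply: (leT (cabsB _ _)); rewrite [leRHS]mulrDr; apply: lerD.
  apply: (leT d1); rewrite mulrCA; mulL.
  by apply: leMr; [exact: sqrtr_ge0|apply: ler_weXn2l => //; move: x_ge; lra].
 rewrite cabsM cabsR gtr0_norm // (cabsM w); mulL.
 by lepM.
rewrite (_ : mvar s * _ = x * (mvar s * (eps + x * Lam)) * x ^+ 2); last by ring.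
have [h1 _] := Gd s.
lepM.
by lepM.
Qed.

(** The inverses of all sample diagonal entries are close to the same number [-(w + theta)]; hence
    each entry is close to their mean, [w mm]. *)
Lemma bot_m s : ~~ top s -> cabs (G0 s s - w * m) <= 2 * x ^+ 2 * eps + L * Lam.
Proof.
move=> ts; rewrite (_ : _ - _ = (G0 s s - w * mm) + w * (mm - m)); last by ring.
apply: (leT (cabsD _ _)); apply: lerD; last first.
 by rewrite (cabsM w); lepM.
have NC0 : N%:C != 0 by rewrite realC_eq0 gt_eqF.
rewrite (m1E top om b_gt0) (_ : G0 s s - _ = N%:C^-1 * \sum_(t | ~~ top t) (G0 s s - G0 t t)); last first.
 rewrite sumrB mulrBr sumr_const; congr (_ - _); have [_ _ ->] := bip.
 rewrite (_ : G0 s s *+ msize mu = N%:C * G0 s s); first by rewrite mulrA mulVf // mul1r.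
 by rewrite natC mulr_natl.
apply: (avg_bot bip gmu) => t tt.
have G_n0 r : G0 r r != 0 by apply: Gm_diag_neq0 => //; exact: mh_sym.
rewrite (_ : G0 s s - G0 t t = G0 s s * G0 t t * (((G0 t t)^-1 + (w + theta top w om)) - ((G0 s s)^-1 + (w + theta top w om)))).
 rewrite cabsM (cabsM (G0 s s)) (_ : 2 * x ^+ 2 * eps = x * x * (eps + eps)); last by ring.
 have [h1 _] := Gd s; have [h2 _] := Gd t.
 lepM; first by lepM.
 by apply: (leT (cabsB _ _)); apply: lerD; apply: berr.
by field; rewrite !G_n0.
Qed.

Let Imwm : Im (w * m) <= L * (Im m + b).
Proof.
rewrite ImM mulrDr; apply: lerD.
 by apply: leMr => //; apply: leT w_le; apply: leT (Re_le_cabs _); rewrite ler_norm.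
rewrite mulrC; mulR.
by apply: leT m_le; apply: leT (Re_le_cabs _); rewrite ler_norm.
Qed.

(** The limits [w m] and [-1/(w (1 + mvar s m))] both have imaginary part of order [Im w + Im m],
    and the error terms are added. *)
Lemma Im_G_le s : Im (G0 s s) <= x ^+ 7 * (b + Im m) + x ^+ 5 * (eps + Lam).
Proof.
have Y0 : 0 <= b + Im m by sgn.
have x2 : 16 <= x ^+ 2 by rewrite expr2; move: x_ge; nra.
case: (boolP (top s)) => ts; last first.
 have h := bot_m ts.
 have : Im (G0 s s) <= Im (w * m) + cabs (G0 s s - w * m).
  have : Im (G0 s s - w * m) <= cabs (G0 s s - w * m).
  exact: Im_le.
  rewrite ImD ImN; lra.
 move=> /leT; apply; apply: lerD.
  apply: (leT Imwm); rewrite addrC; apply: leMr => //; apply: (leT Lx).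
  by rewrite -[leLHS]expr1; apply: ler_weXn2l => //; move: x_ge; lra.
 apply: (leT h); rewrite mulrDr; apply: lerD; apply: leMr => //.
  by rewrite (_ : x ^+ 5 = x ^+ 3 * x ^+ 2); [apply: leMr => //; have : 2 * x <= x ^+ 3 by rewrite (_ : x ^+ 3 = x ^+ 2 * x); [apply: leMr => //; lra|ring]|ring]; move: x_ge; lra.
 apply: (leT Lx); rewrite -[leLHS]expr1; apply: ler_weXn2l => //; move: x_ge; lra.
have h := top_m ts.
set c0 := w * (1 + (mvar s)%:C * m) in h.
have c0V : (cabs c0)^-1 <= L ^+ 2.
 rewrite /c0 cabsM invfM expr2; lepM.
 apply: leT tauV_le; rewrite lef_pV2 ?posrE ?m_tau //.
 by apply: lt_le_trans (m_tau ts).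
have c00 : c0 != 0.
 rewrite /c0 mulf_neq0 // -cabs_gt0; exact: lt_le_trans (m_tau ts).
have G_n0 : G0 s s != 0 by apply: Gm_diag_neq0 => //; exact: mh_sym.
have GE : cabs (G0 s s + c0^-1) <= x ^+ 3 * (eps + L ^+ 2 * Lam).
 rewrite (_ : _ + _ = G0 s s * ((G0 s s)^-1 + c0) / c0); last by field; rewrite c00 G_n0.
 rewrite cabsM (cabsM (G0 s s)) cabsV (_ : x ^+ 3 * (eps + L ^+ 2 * Lam) = x * (eps + L ^+ 2 * Lam) * x ^+ 2); last by ring.
 lepM.
  by apply: ler_pM; rewrite ?cabs_ge0 //; have [] := Gd s.
 by apply: (leT c0V); apply: ler_Xn.
have : Im (G0 s s) <= - Im c0^-1 + cabs (G0 s s + c0^-1).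
 have : Im (G0 s s + c0^-1) <= cabs (G0 s s + c0^-1).
  exact: Im_le.
 rewrite ImD; lra.
move=> /leT; apply; apply: lerD; last first.
 apply: (leT GE); rewrite (_ : x ^+ 5 * _ = x ^+ 3 * (x ^+ 2 * eps + x ^+ 2 * Lam)); last by ring.
 apply: leMl => //; apply: lerD; last by apply: leMr => //; apply: ler_Xn.
 by rewrite ler_peMl //; lra.
rewrite ImV mulNr opprK.
have Ic : Im c0 <= x ^+ 3 * (b + Im m).
 rewrite /c0 (_ : w * _ = w + (mvar s)%:C * (w * m)); last by ring.
 rewrite ImD (ImM (mvar s)%:C) /= mul0r addr0.
 have : mvar s * Im (w * m) <= L * (L * (b + Im m)).
  apply: (le_mid (mvar s * (L * (Im m + b)))).
  by apply: leMl; [exact: ltW|exact: Imwm].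
  by rewrite [Im m + b]addrC; apply: leMr; try sgn.
 have h1 : L * (L * (b + Im m)) <= x ^+ 2 * (b + Im m).
  by rewrite mulrA -expr2; apply: leMr => //; apply: ler_Xn.
 have h2 : x ^+ 2 * (b + Im m) + (b + Im m) <= x ^+ 3 * (b + Im m).
  rewrite -[X in _ + X <= _]mul1r -mulrDl; apply: leMr => //.
  by rewrite (_ : x ^+ 3 = x ^+ 2 * x); [move: x_ge x2; nra|ring].
 move: h1 h2 b_gt0 Im_m_ge0; lra.
have c02 : 0 < cabs c0 ^+ 2 by rewrite exprn_gt0 // cabs_gt0.
apply: (le_mid (x ^+ 3 * (b + Im m) / cabs c0 ^+ 2)).
 by apply: leMr => //; rewrite invr_ge0 ltW.
rewrite (_ : x ^+ 7 * _ = x ^+ 3 * (b + Im m) * x ^+ 4); last by ring.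
apply: leMl; first exact: mulr_ge0.
rewrite -exprVn (_ : x ^+ 4 = (x ^+ 2) ^+ 2); last by rewrite -exprM.
leXn.
by apply: (leT c0V); apply: ler_Xn.
Qed.

(** Returns from the a priori bound [x], a power of [N], to a constant. This gain closes the
    bootstrap. *)
Lemma diag_K0 : x ^+ 3 * Lam <= 1 ->
 forall s, cabs (G0 s s) <= 4 * L ^+ 3 /\ cabs (G0 s s)^-1 <= 4 * L ^+ 3.
Proof.
move=> Ls s; have [L1 L2] := L23.
have xe : x * (x ^+ 2 * eps) <= 1 by rewrite mulrA -exprS.
have xl : x * (x ^+ 2 * Lam) <= 1 by rewrite mulrA -exprS.
have small y : x * y <= 1 -> y <= 1 / 8 /\ L ^+ 3 * y <= 1/8.
 move=> h; have [y0|y0] := leP 0 y; last by split; [lra|have := exprn_gt0 3 L0; nra].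
 have h2 : 8 * L ^+ 3 * y <= x * y by apply: leMr.
 have : 1 * y <= L ^+ 3 * y by apply: leMr => //; move: L_ge1; lra.
 by split; lra.
have [e1 e2] := small _ xe; have [l1 l2] := small _ xl.
have x2 : 16 <= x ^+ 2 by rewrite expr2; move: x_ge; nra.
have ee : eps <= x ^+ 2 * eps / 16 by have := eps0; nra.
have l2' : L ^+ 2 * Lam <= x ^+ 2 * Lam by apply: leMr => //; apply: ler_Xn.
have l3 : L * Lam <= x ^+ 2 * Lam / 4.
 have : L * 4 <= x ^+ 2 by move: Lx x_ge; nra.
 by have := Lam0; nra.
have G_n0 r : G0 r r != 0 by apply: Gm_diag_neq0 => //; exact: mh_sym.
have L3 : 0 < L ^+ 3 by sgn.
have gp : 0 < cabs (G0 s s) by rewrite cabs_gt0.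
case: (boolP (top s)) => ts.
 have h := top_m ts; set c0 := w * (1 + (mvar s)%:C * m) in h.
 have h1 : cabs c0 <= L * (1 + L * L).
  rewrite /c0 cabsM; apply: ler_pM; rewrite ?cabs_ge0 //; apply: (leT (cabsD _ _)); rewrite cabs1 lerD2l.
  by rewrite (cabsM (mvar s)%:C) cabsR gtr0_norm //; lepM.
 have h2 : 1 <= L ^+ 2 * cabs c0.
  rewrite /c0 cabsM (_ : L ^+ 2 * _ = (L * cabs w) * (L * cabs (1 + (mvar s)%:C * m))); last by ring.
  have wp : 0 < cabs w by rewrite cabs_gt0.
  have a1 : 1 <= L * cabs w by rewrite -ler_pdivrMr // mul1r.
  have a2 : 1 <= L * cabs (1 + (mvar s)%:C * m).
  apply: (le_mid (L * tau)); first by rewrite -ler_pdivrMr // mul1r.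
  by apply: leMl => //; exact: m_tau.
  by rewrite -[leLHS]mulr1; apply: ler_pM.
 have h3 : cabs (G0 s s)^-1 <= cabs ((G0 s s)^-1 + c0) + cabs c0.
  by rewrite {1}(_ : (G0 s s)^-1 = ((G0 s s)^-1 + c0) - c0); [exact: cabsB|ring].
 have h4 : cabs c0 <= cabs ((G0 s s)^-1 + c0) + cabs (G0 s s)^-1.
  by rewrite {1}(_ : c0 = ((G0 s s)^-1 + c0) - (G0 s s)^-1); [exact: cabsB|ring].
 split; last first.
  have : L * (1 + L * L) = L + L ^+ 3 by ring.
  move: h h1 h3 ee e1 l1 l2' L1 L2 L_ge1; lra.
 have h5 : 1 / 2 <= L ^+ 2 * cabs (G0 s s)^-1.
  have a1 : L ^+ 2 * (eps + L ^+ 2 * Lam) <= 1 / 2.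
  have b1 : L ^+ 2 * eps <= L ^+ 3 * (x ^+ 2 * eps) / 16.
  have : L ^+ 2 * eps <= L ^+ 3 * eps by apply: leMr.
  have : L ^+ 3 * eps <= L ^+ 3 * (x ^+ 2 * eps / 16) by apply: leMl => //; exact: ltW.
  lra.
  have b2 : L ^+ 2 * (L ^+ 2 * Lam) <= L ^+ 3 * (x ^+ 2 * Lam) by apply: ler_pM => //; try sgn.
  rewrite mulrDr; move: b1 b2 e2 l2; lra.
  have a2 : L ^+ 2 * cabs c0 <= L ^+ 2 * (eps + L ^+ 2 * Lam + cabs (G0 s s)^-1).
  by apply: leMl; [exact: exprn_ge0|move: h4 h; lra].
  move: a1 a2 h2; rewrite !mulrDr; lra.
 have h6 : cabs (G0 s s) <= 2 * L ^+ 2.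
  move: h5; rewrite cabsV ler_pdivlMr //; lra.
 move: h6 L1 L2; lra.
have h := bot_m ts.
have h1 : cabs (w * m) <= L ^+ 2 by rewrite cabsM expr2; lepM.
have h2 : 1 <= L ^+ 2 * cabs (w * m).
 have m0 : 0 < cabs m.
  by rewrite cabs_gt0.
 rewrite cabsM (_ : L ^+ 2 * _ = (L * cabs w) * (L * cabs m)); last by ring.
 have wp : 0 < cabs w by rewrite cabs_gt0.
 have a1 : 1 <= L * cabs w by rewrite -ler_pdivrMr // mul1r.
 have a2 : 1 <= L * cabs m by rewrite -ler_pdivrMr // mul1r.
 by rewrite -[leLHS]mulr1; apply: ler_pM.
have h3 : cabs (G0 s s) <= cabs (G0 s s - w * m) + cabs (w * m).
 by rewrite {1}(_ : G0 s s = (G0 s s - w * m) + w * m); [exact: cabsD|ring].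
have h4 : cabs (w * m) <= cabs (G0 s s - w * m) + cabs (G0 s s).
 by rewrite {1}(_ : w * m = G0 s s - (G0 s s - w * m)); [apply: (leT (cabsB _ _)); rewrite addrC|ring].
split; first by move: h h1 h3 e1 l1 l3 L1 L2 L_ge1; lra.
have h5 : 1 / 2 <= L ^+ 2 * cabs (G0 s s).
 have a1 : L ^+ 2 * (2 * x ^+ 2 * eps + L * Lam) <= 1 / 2.
  have b1 : L ^+ 2 * (x ^+ 2 * eps) <= L ^+ 3 * (x ^+ 2 * eps) by apply: leMr; try sgn.
  have b2 : L ^+ 2 * (L * Lam) <= L ^+ 3 * (x ^+ 2 * Lam / 4) by apply: ler_pM => //; try sgn.
  move: b1 b2 e2 l2; lra.
 have a2 : L ^+ 2 * cabs (w * m) <= L ^+ 2 * (2 * x ^+ 2 * eps + L * Lam + cabs (G0 s s)).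
  by apply: leMl; [exact: exprn_ge0|move: h4 h; lra].
 move: a1 a2 h2; rewrite !mulrDr; lra.
rewrite cabsV -[leLHS]mul1r ler_pdivrMr //.
have : L ^+ 2 * cabs (G0 s s) <= L ^+ 3 * cabs (G0 s s) by apply: leMr; try sgn.
move: h5; lra.
Qed.

End WithG.

Notation Theta := (N^-1 + (Im m + Lam) / (N * eta) + (N * eta) ^- 2).

(** [Im_G_le] for the maximal entry bounds [g] through [Phi = sqrt (g/(N b))] itself; completing the
    square solves the inequality for [Phi^2]. *)
Lemma law_Phi : exists g, [/\ forall s, Im (G0 s s) <= g, g <= x &
 g / (N * b) <= x ^+ 33 * Theta].
Proof.
have n0 : (0 < n)%N by have [/andP[h1 h2] _ _ _] := gmu; exact: leq_trans h2.
case: (@arg_maxP _ _ _ (Ordinal n0) xpredT (fun s => Im (G0 s s)) isT) => s1 _ s1P.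
have {}s1P s : Im (G0 s s) <= Im (G0 s1 s1) := s1P s isT.
set g := Im (G0 s1 s1) in s1P *.
have gx : g <= x by exact: Im_le_x.
have g0 : 0 <= g by apply: Gm_Im_ge0 => //; exact: mh_sym.
exists g; split=> //.
have H := Im_G_le s1P gx s1; rewrite -/g in H.
have NB0 : 0 < N * b by exact: mulr_gt0.
set Phi := sqrt (g / (N * b)) in H.
have P0 : 0 <= Phi by exact: sqrtr_ge0.
have PE : Phi ^+ 2 = g / (N * b) by rewrite sqr_sqrtr; sgn.
rewrite -PE.
have NE0 : 0 < N * eta by exact: mulr_gt0.
have bV : (N * b)^-1 <= x ^+ 2 / (N * eta).
 rewrite -[leLHS]mul1r ler_pdivrMr // mulrAC ler_pdivlMr // mul1r mulrCA; apply: leMl; [exact: ltW|exact: b_ge].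
set A := Im m + Lam in H *.
have A0 : 0 <= A by exact: addr_ge0.
have PP : Phi ^+ 2 <= x ^+ 7 / N + x ^+ 9 * (A / (N * eta)) + x ^+ 13 * (Phi / (N * eta)).
 rewrite PE; apply: (le_mid (x ^+ 7 / N + (x ^+ 7 * A + x ^+ 11 * Phi) / (N * b))).
  rewrite (_ : x ^+ 7 / N = x ^+ 7 * b / (N * b)); last by field; rewrite !gt_eqF.
  rewrite -mulrDl; mulR.
  apply: (leT H); rewrite /A.
  have x57 : x ^+ 5 <= x ^+ 7 by apply: ler_weXn2l => //; move: x_ge; lra.
  have : x ^+ 5 * Lam <= x ^+ 7 * Lam by apply: leMr.
  rewrite (_ : x ^+ 5 * (x ^+ 6 * Phi + Lam) = x ^+ 11 * Phi + x ^+ 5 * Lam); last by ring.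
  by rewrite !mulrDr; lra.
 have Q0 : 0 <= x ^+ 7 * A + x ^+ 11 * Phi by sgn.
 rewrite -addrA lerD2l; apply: (le_mid ((x ^+ 7 * A + x ^+ 11 * Phi) * (x ^+ 2 / (N * eta)))).
  by apply: leMl.
 by apply: eq_ler; ring.
have PP2 : Phi ^+ 2 <= 2 * x ^+ 9 * (N^-1 + A / (N * eta)) + x ^+ 26 * (N * eta) ^- 2.
 have := sqr_ge0 (Phi - x ^+ 13 / (N * eta)).
 have -> : (Phi - x ^+ 13 / (N * eta)) ^+ 2 = Phi ^+ 2 - 2 * (x ^+ 13 * (Phi / (N * eta))) + x ^+ 26 * (N * eta) ^- 2.
  by have := gt_eqF NE0; move: (N * eta) => ne ne0; field; rewrite ne0.
 have x79 : x ^+ 7 / N <= x ^+ 9 / N by apply: leMr; [rewrite invr_ge0 ltW|apply: ler_weXn2l => //; move: x_ge; lra].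
 by rewrite [2 * x ^+ 9 * (_ + _)]mulrDr; move: PP x79; lra.
apply: (leT PP2); rewrite [x ^+ 33 * _]mulrDr; apply: lerD.
 mulR.
 apply: (le_mid (x * x ^+ 9)); first by apply: leMr => //; move: x_ge; lra.
 by rewrite -exprS; apply: ler_weXn2l => //; move: x_ge; lra.
mulR.
by apply: ler_weXn2l => //; move: x_ge; lra.
Qed.
End BipartiteLaw.

(** * Change of index in uniform events *)

Section WhpReindex.
Variables (R : realType).

Lemma whp_imp (U : Type) (mu : U -> model R) (Q : U -> Prop) (A : forall u, mOm (mu u) -> Prop) :
 @whp R {u | Q u} (fun x => mu (sval x)) (fun x om => A (sval x) om) ->
 whp (fun u om => Q u -> A u om).
Proof.
move=> H D; have [N0 HN] := H D; exists N0 => u hu.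
have [Qu|nQ] := pselect (Q u).
 by apply: leT (HN (exist _ u Qu) hu); apply: mpr_le => om; apply: contra_not.
apply: (le_mid 0); last sgn.
rewrite /mpr /mE -(EEC (mlaw_sum1 (m:=mu u)) 0); apply: eq_ler.
by apply: eq_EE => om; rewrite asboolF // => /(_ (fun q => False_ind _ (nQ q))).
Qed.

Lemma whp_reindex (U U' : Type) (mu : U -> model R) (f : U' -> U) (A : forall u, mOm (mu u) -> Prop) :
 whp A -> @whp R U' (fun x => mu (f x)) (fun x om => A (f x) om).
Proof. by move=> H D; have [N0 HN] := H D; exists N0 => x; exact: HN. Qed.

Lemma evt_reindex (U U' : Type) (mu : U -> model R) (f : U' -> U) (P : U -> Prop) :
 evt mu P -> evt (fun x : U' => mu (f x)) (fun x => P (f x)).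
Proof. by move=> [N0 H]; exists N0 => x; exact: H. Qed.

End WhpReindex.

(** * The square root in the upper half-plane *)

Section SquareRoot.
Variable R : realType.
Implicit Types z : R[i].

Definition wz z : R[i] := let r := sqrtc z in if 0 < Im r then r else - r.

Lemma wz_sqr z : wz z ^+ 2 = z.
Proof. by rewrite /wz; case: ifP => _; rewrite ?sqrrN sqr_sqrtc. Qed.

Lemma wz_Im z : 0 < Im z -> 0 < Im (wz z).
Proof.
move=> z0; rewrite /wz; case: ifP => // /negbT; rewrite -leNgt => h.
rewrite ImN oppr_gt0 lt_neqAle h andbT; apply: contraTneq z0 => r0.
by rewrite -(sqr_sqrtc z) expr2 ImM r0 mulr0 mul0r addr0 ltxx.
Qed.

Lemma cabs_wz z : cabs (wz z) ^+ 2 = cabs z.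
Proof. by rewrite -cabsX wz_sqr. Qed.

Lemma wz_diff z z' : 0 < Im z -> 0 < Im z' ->
 cabs (wz z - wz z') <= cabs (z - z') / Im (wz z).
Proof.
move=> z0 z'0; have b := wz_Im z0; have b' := wz_Im z'0.
have E : z - z' = (wz z - wz z') * (wz z + wz z') by rewrite -{1}(wz_sqr z) -{1}(wz_sqr z'); ring.
rewrite ler_pdivlMr // E cabsM; apply: leMl; first exact: cabs_ge0.
by apply: leT (leT (ler_norm _) (Im_le_cabs _)); rewrite ImD lerDl ltW.
Qed.

End SquareRoot.

(** * Stieltjes transforms of finitely many equal atoms *)

Section Stieltjes.
Variables (R : realType) (n : nat).

Definition stj (lam : 'I_n -> R) (z : R[i]) : R[i] :=
 n%:R^-1 * \sum_i ((lam i)%:C - z)^-1.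

Lemma Im_stj lam z : Im (stj lam z) =
 n%:R^-1 * \sum_i (Im z / cabs ((lam i)%:C - z) ^+ 2).
Proof.
rewrite /stj -natC -fmorphV ImM /= mul0r addr0 Im_sum; congr (_ * _).
by apply: eq_bigr => i _; rewrite ImV ImD ImN /= add0r opprK.
Qed.

(** Each atom contributes [1/|lam - z|^2] to the quotient, which decreases with height. Bounds at
    [z] are carried up the vertical line in this way. *)
Lemma Im_stj_mono lam z z' : 0 < Im z -> Im z <= Im z' ->
 Re z = Re z' ->
 Im (stj lam z') / Im z' <= Im (stj lam z) / Im z.
Proof.
move=> z0 zz' re; rewrite !Im_stj -!mulrA; mulL.
rewrite !mulr_suml; apply: ler_sum => i _.
have z'0 : 0 < Im z' by apply: lt_le_trans zz'.
rewrite mulrAC divff ?gt_eqF // mulrAC divff ?gt_eqF // !mul1r.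
have p y : 0 < Im y -> 0 < cabs ((lam i)%:C - y) ^+ 2.
 move=> y0; rewrite exprn_gt0 // cabs_gt0; apply: contraTneq y0 => /(congr1 (@Im R)).
 by rewrite ImD ImN /= add0r => /eqP; rewrite oppr_eq0 => /eqP ->; rewrite ltxx.
rewrite lef_pV2 ?posrE ?p // !cabs_sqE !ReD !ImD !ReN !ImN /= re !add0r lerD2l !sqrrN.
by leXn.
Qed.

End Stieltjes.

(** * Descent along a vertical grid *)

Section Grid.
Variable R : realType.

Definition zg (N : nat) (z : R[i]) (k : nat) : R[i] := z + Complex 0 (k%:R / N%:R ^+ 5).

Lemma Re_zg N z k : Re (zg N z k) = Re z.
Proof. by rewrite ReD /= addr0. Qed.

Lemma Im_zg N z k : Im (zg N z k) = Im z + k%:R / N%:R ^+ 5.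
Proof. by rewrite ImD. Qed.

Lemma zg0 N z : zg N z 0 = z.
Proof. by apply: eqC; rewrite ?Re_zg // Im_zg mul0r addr0. Qed.

Lemma zgS N z k : zg N z k.+1 = zg N z k + Complex 0 (N%:R ^- 5).
Proof.
apply: eqC; first by rewrite Re_zg ReD Re_zg /= addr0.
by rewrite Im_zg ImD Im_zg /= -natr1; ring.
Qed.

Lemma Im_zg_ge N z k : 0 < Im z -> Im z <= Im (zg N z k).
Proof. by move=> z0; rewrite Im_zg lerDl divr_ge0 // exprn_ge0. Qed.

(** A downward induction: [N^5] steps of length [N^-5] climb by 1, so the top of the grid has height
    at least 1, where stability asks for no previous bound. *)
Lemma grid_ind (N : nat) (z : R[i]) (S : set R[i]) (P : R[i] -> Prop) : (0 < N)%N ->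
 0 < Im z -> S z ->
 (forall y, S y -> Im y < 1 -> S (y + Complex 0 (N%:R ^- 5))) ->
 (forall k, (k <= N ^ 5)%N -> S (zg N z k) -> 1 <= Im (zg N z k) -> P (zg N z k)) ->
 (forall k, (k < N ^ 5)%N -> S (zg N z k) -> Im (zg N z k) < 1 -> S (zg N z k.+1) -> P (zg N z k.+1) -> P (zg N z k)) ->
 P z.
Proof.
move=> N0 z0 Sz up start step.
have Np : 0 < N%:R :> R by sgn.
suff H j : (j <= N ^ 5)%N -> S (zg N z (N ^ 5 - j)) -> P (zg N z (N ^ 5 - j)).
 by have := H _ (leqnn _); rewrite subnn zg0; exact.
elim: j => [_|j IH jl] Sk.
 apply: start => //; rewrite ?leq_subr // Im_zg subn0 natrX divff ?expf_neq0 ?gt_eqF //.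
 by rewrite lerDr ltW.
set k := (N ^ 5 - j.+1)%N in Sk *.
have kE : (N ^ 5 - j = k.+1)%N by rewrite /k -subSn // subSS.
have [h|h] := leP 1 (Im (zg N z k)); first by apply: start => //; rewrite leq_subr.
have Sk1 : S (zg N z k.+1) by rewrite zgS; exact: up.
apply: step => //; first by rewrite -kE leq_subr.
by rewrite -kE; apply: IH; [exact: ltnW|rewrite kE].
Qed.

End Grid.

(** * The bootstrap from height one down to the real axis *)

Section Bootstrap.
Variables (R : realType) (kap : nat -> R) (cn vmax L tau Cs : R) (mu : model R) (top : pred 'J_mu).
Variables (m : R[i] -> R[i]) (S : set R[i]) (om : mOm mu) (lam : 'I_(msize mu) -> R).
Notation N := ((msize mu)%:R : R).
Notation n := (mdim mu).
Notation mm z := (m1 top (wz z) om).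
Notation eta z := (Im z).

Definition stab_bound (d : R) (u : R[i]) (z : R[i]) : Prop :=
 cabs (u - m z) <= Cs * d / (Im (m z) + sqrt d).

Definition mfacts (z : R[i]) : Prop :=
 [/\ cabs (m z) <= L, (cabs (m z))^-1 <= L, 0 < Im (m z),
  eta z <= L ^+ 2 * Im (m z) &
  forall s, top s -> tau <= cabs (1 + (mvar s)%:C * m z)].

Definition zfacts (z : R[i]) : Prop :=
 [/\ 0 < eta z, cabs (wz z) <= L & (cabs (wz z))^-1 <= L].

(** Stability for constant [delta], where the Lipschitz and monotonicity conditions hold trivially,
    and for transforms of [N] equal atoms in [[0, Cs]]. *)
Definition const_stable : Prop := forall (d : R) (l : 'I_(msize mu) -> R),
 N ^- 2 <= d -> d * ln N <= 1 -> (forall i, 0 <= l i <= Cs) ->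
 forall z, S z -> cabs (fmu top (stj l z) - z) <= d ->
  (eta z < 1 -> stab_bound d (stj l (z + Complex 0 (N ^- 5))) (z + Complex 0 (N ^- 5))) ->
  stab_bound d (stj l z) z.

Hypotheses (bip : bipartite top) (gmu : good_model kap cn vmax mu) (vmax_le : vmax <= L) (cn_leL : cn <= L)
 (L_ge1 : 1 <= L) (tau_gt0 : 0 < tau) (tauV_le : tau^-1 <= L) (S_z : forall z, S z -> zfacts z)
 (S_m : forall z, S z -> mfacts z) (S_up : forall z, S z -> eta z < 1 -> S (z + Complex 0 (N ^- 5)))
 (stable : const_stable) (lam_bnd : forall i, 0 <= lam i <= Cs)
 (spec : forall z, 0 < eta z -> mm z = stj lam z) (Cs_gt0 : 0 < Cs).

Let N_gt0 : 0 < N.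
Proof. by have [/andP[N0 _] _ _ _] := gmu; rewrite ltr0n. Qed.
Let Nn0 : (0 < msize mu)%N.
Proof. by have [/andP[N0 _] _ _ _] := gmu. Qed.

(** Once the error in the master equation is below [d] at every grid point above [z], stability
    descends with no further estimate. *)
Lemma bootstrap2 (d : R) (z : R[i]) : N ^- 2 <= d -> d * ln N <= 1 -> S z ->
 (forall k, (k <= msize mu ^ 5)%N -> S (zg (msize mu) z k) ->
  cabs (fmu top (mm (zg (msize mu) z k)) - zg (msize mu) z k) <= d) ->
 cabs (mm z - m z) <= Cs * d / (Im (m z) + sqrt d).
Proof.
move=> d1 d2 Sz H; have [z0 _ _] := S_z Sz.
have zk0 k : 0 < eta (zg (msize mu) z k) := lt_le_trans z0 (Im_zg_ge _ _ z0).
have : stab_bound d (mm z) z.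
 apply: (grid_ind (P := fun y => stab_bound d (mm y) y) Nn0 z0 Sz S_up) => k kl Sk.
  move=> e1; rewrite spec //; apply: stable => //; first by rewrite -spec //; exact: H.
  by rewrite ltNge e1.
 move=> e1 Sk1 Pk1; rewrite spec //; apply: stable => //; first by rewrite -spec //; apply: H => //; exact: ltnW.
 by move=> _; rewrite -zgS -spec.
by [].
Qed.

Variables (x : R) (z0 : R[i]).
Hypotheses (x_ge : 4 <= x) (kap_le : `|kap 1| <= x) (L_le : 8 * L ^+ 3 <= x) (Cs_le : Cs <= x)
 (ln_le : ln N <= x) (Sz0 : S z0) (Neta : x ^+ 100 <= N * eta z0)
 (lde : forall k, (k <= msize mu ^ 5)%N -> lde_ev (wz (zg (msize mu) z0 k)) x om).

Notation zk k := (zg (msize mu) z0 k).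
Notation delta := (x ^+ 17 / sqrt (N * eta z0)).
Notation G z := (Gm (mh om) (wz z) fs0).

Let x_gt0 : 0 < x. Proof. exact: lt_le_trans (ltr0Sn _ 3) x_ge. Qed.
Let x_ge0 : 0 <= x. Proof. exact: ltW. Qed.
Let xp k : 0 <= x ^+ k. Proof. exact: exprn_ge0. Qed.
Let xmono k l : (k <= l)%N -> x ^+ k <= x ^+ l.
Proof. by move=> kl; apply: ler_weXn2l => //; move: x_ge; lra. Qed.
Let L23 : 1 <= L ^+ 3 /\ L <= L ^+ 3.
Proof. by split; [rewrite -[leLHS](expr0 L)|rewrite -[leLHS]expr1]; apply: ler_weXn2l. Qed.
Let Lx : 8 * L <= x.
Proof. have [_ h] := L23; move: L_le; lra. Qed.
Let L_ge0 : 0 <= L. Proof. exact: leT L_ge1. Qed.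
Let cn_le : cn <= x. Proof. move: cn_leL Lx L_ge0; lra. Qed.
Let NE0 : 0 < N * eta z0. Proof. by apply: lt_le_trans Neta; rewrite exprn_gt0. Qed.
Let e0_gt0 : 0 < eta z0. Proof. by move: NE0; rewrite pmulr_rgt0. Qed.
Let zk_ge k : eta z0 <= eta (zk k). Proof. exact: Im_zg_ge. Qed.
Let zk_gt0 k : 0 < eta (zk k). Proof. exact: lt_le_trans e0_gt0 (zk_ge k). Qed.
Let hs := mh_sym om.

Lemma b_ge_eta z : S z -> eta z <= x * Im (wz z).
Proof.
move=> Sz; have [zz w1 _] := S_z Sz; have b := wz_Im zz.
rewrite -{1}(wz_sqr z) expr2 ImM.
have := Re_le_cabs (wz z); have := ler_norm (Re (wz z)); move: Lx w1 b L_ge0; nra.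
Qed.

Let eta_le : eta z0 <= x ^+ 2.
Proof.
have [zz w1 _] := S_z Sz0; apply: (le_mid (cabs z0)).
 exact: Im_le.
by rewrite -cabs_wz; apply: ler_Xn; rewrite ?cabs_ge0 //; move: Lx w1 L_ge0; lra.
Qed.

Let Nx : x ^+ 98 <= N.
Proof.
have x2 : 0 < x ^+ 2 by sgn.
rewrite -(ler_pM2r x2) -exprD; apply: (leT Neta); rewrite leMl; try sgn.
Qed.

Let Nb k : S (zk k) -> x ^+ 99 <= N * Im (wz (zk k)).
Proof.
move=> Sk; rewrite -(ler_pM2l x_gt0) -exprS; apply: (leT Neta); rewrite mulrCA.
mulL.
by apply: leT (b_ge_eta Sk); exact: zk_ge.
Qed.

Let Nb20 k : S (zk k) -> x ^+ 20 <= N * Im (wz (zk k)).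
Proof. by move=> Sk; apply: leT (Nb Sk); exact: xmono. Qed.
Let bV k : S (zk k) -> (Im (wz (zk k)))^-1 <= N.
Proof.
move=> Sk; have b := wz_Im (zk_gt0 k); rewrite -[leLHS]mul1r ler_pdivrMr //.
by apply: leT (Nb Sk); rewrite -[leLHS](expr0 x); exact: xmono.
Qed.

Definition kbound (K : R) z := forall s, cabs (G z s s) <= K /\ cabs (G z s s)^-1 <= K.

Let sq := sqrt (N * eta z0).
Let sq_gt0 : 0 < sq. Proof. by rewrite sqrtr_gt0. Qed.
Let sq_ge : x ^+ 50 <= sq.
Proof.
rewrite -ler_sqr ?nnegrE ?(ltW sq_gt0) // -exprM sqr_sqrtr //; exact: ltW.
Qed.
Let sq_le : sq <= N.
Proof.
rewrite -ler_sqr ?nnegrE ?(ltW sq_gt0) ?(ltW N_gt0) // sqr_sqrtr; try sgn.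
rewrite expr2; mulL.
by apply: (leT eta_le); apply: leT Nx; exact: xmono.
Qed.

Let d_ge : N ^- 2 <= delta.
Proof.
have N1 : 1 <= N by apply: leT Nx; rewrite -[leLHS](expr0 x); exact: xmono.
apply: (le_mid (N^-1)).
 by rewrite lef_pV2 ?posrE ?exprn_gt0 // -[leLHS]expr1; apply: ler_weXn2l.
apply: (le_mid sq^-1); first by rewrite lef_pV2 ?posrE.
by rewrite -[leLHS]mul1r; apply: leMr; [rewrite invr_ge0 ltW|rewrite -[leLHS](expr0 x); exact: xmono].
Qed.

Let d_ln : delta * ln N <= 1.
Proof.
rewrite mulrAC ler_pdivrMr // mul1r; apply: leT sq_ge; apply: (le_mid (x ^+ 17 * x)).
 exact: leMl.
by rewrite -exprSr; exact: xmono.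
Qed.

(** The crude diagonal bound gives an error below [delta], stability turns it into a distance of at
    most [x sqrt delta], and [diag_K0] then yields a constant diagonal bound. As [delta] is
    evaluated at the lowest point [z0], it dominates the errors on the whole vertical line. *)
Lemma boot_step k : (k <= msize mu ^ 5)%N -> S (zk k) -> kbound x (zk k) ->
 (eta (zk k) < 1 -> stab_bound delta (mm (zk k.+1)) (zk k.+1)) ->
 kbound (4 * L ^+ 3) (zk k) /\ stab_bound delta (mm (zk k)) (zk k).
Proof.
move=> kl Sk kb st.
have [zz w1 w2] := S_z Sk; have [m_1 m_2 m_3 m_4 m_5] := S_m Sk.
have b0 := wz_Im zz.
have gI s : Im (G (zk k) s s) <= x.
 by have [h _] := kb s; apply: leT h; exact: Im_le.
have vx : vmax <= x by move: Lx vmax_le L_ge0; lra.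
have wVx : (cabs (wz (zk k)))^-1 <= x by move: Lx w2 L_ge0; lra.
have wx : cabs (wz (zk k)) <= x by move: Lx w1 L_ge0; lra.
have E := fmu_err1 bip gmu b0 x_ge cn_le vx kap_le wVx wx kb gI (lexx x) (Nb20 Sk) (lde kl).
rewrite wz_sqr in E.
have {}E : cabs (fmu top (mm (zk k)) - zk k) <= delta.
 apply: (leT E); rewrite (_ : delta = x ^+ 14 * (x ^+ 3 / sq)); last by rewrite /sq; ring.
 apply: leMl => //; rewrite -ler_sqr; try sgn.
 rewrite sqr_sqrtr; last sgn.
 rewrite expr_div_n sqr_sqrtr ?(ltW NE0) // -exprM ler_pdivrMr; last exact: mulr_gt0.
 rewrite mulrAC ler_pdivlMr // (_ : x ^+ (3 * 2) * _ = x * N * (x ^+ 5 * Im (wz (zk k)))); last by ring.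
 rewrite [leLHS]mulrA; mulL.
 apply: (leT (zk_ge k)); apply: (leT (b_ge_eta Sk)); mulR.
 by rewrite -[leLHS]expr1; exact: xmono.
have SB : stab_bound delta (mm (zk k)) (zk k).
 rewrite spec //; apply: stable => //; first by rewrite -spec.
 by move=> e1; rewrite -zgS -spec //; exact: st.
split=> //.
have d0 : 0 < delta by sgn.
have sd0 : 0 < sqrt delta by sgn.
have LamE : cabs (mm (zk k) - m (zk k)) <= x * sqrt delta.
 apply: (leT SB); rewrite ler_pdivrMr; last sgn.
 rewrite -{1}(sqr_sqrtr (ltW d0)) expr2 mulrA mulrDr -[leLHS]add0r; apply: lerD.
  sgn.
 by rewrite -!mulrA; apply: leMr; try sgn.
have e2 : 0 < Im (wz (zk k) ^+ 2) by rewrite wz_sqr.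
have mn0 : m (zk k) != 0 by apply: contraTneq m_3 => ->; rewrite ltxx.
apply: (@diag_K0 _ kap cn vmax mu top (wz (zk k)) (m (zk k)) x L tau (x * sqrt delta) om bip gmu b0 x_ge cn_le vmax_le kap_le L_ge1 L_le w2 w1 m_1 m_2 mn0 tau_gt0 tauV_le m_5 kb (Nb20 Sk) (lde kl) LamE x gI (lexx x)).
rewrite mulrA -exprSr -ler_sqr; try sgn.
rewrite exprMn sqr_sqrtr ?(ltW d0) // expr1n mulrA ler_pdivrMr // mul1r -exprM -exprD.
by apply: leT sq_ge; exact: xmono.
Qed.

Let v_gt0 (s : 'I_n) : 0 < mvar s.
Proof. by have [_ _ /(_ s)/andP[]] := gmu. Qed.
Let v_leL (s : 'I_n) : mvar s <= L.
Proof. by have [_ _ /(_ s)/andP[_ h] _] := gmu; apply: (leT h). Qed.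
Let n_le : n%:R <= L * N.
Proof. by have [_ h _ _] := gmu; apply: (leT h); rewrite leMr // ltW. Qed.

Lemma mS_sum (s : 'I_n) : \sum_t mS s t <= L ^+ 2.
Proof.
have [hS h1 hN] := bip.
apply: (le_mid (\sum_(t < n) mvar s * mvar t / N * (top s (+) top t)%:R)).
 by apply: ler_sum => t _; rewrite hS; case: ifP => _; rewrite ?mulr1 ?mulr0.
case: (boolP (top s)) => ts /=.
 apply: (le_mid (mvar s)); last first.
  by apply: (leT (v_leL s)); rewrite expr2 ler_peMr.
 rewrite (bigID top) /= big1 ?add0r; last by move=> t ->; rewrite mulr0.
 under eq_bigr => t tt do rewrite (h1 t tt) (negbTE tt) !mulr1.
 by rewrite sumr_const hN -[leLHS]mulr_natr divfK // gt_eqF.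
apply: (le_mid (\sum_(t < n) L / N)).
 apply: ler_sum => t _; rewrite (h1 s ts) mul1r.
 have q0 : 0 <= mvar t / N by sgn.
 have q1 : mvar t / N <= L / N by apply: leMr; try sgn.
 by case: (top t); rewrite /= ?mulr1 ?mulr0 //; exact: leT q1.
rewrite sumr_const card_ord -[leLHS]mulr_natl mulrA ler_pdivrMr //.
by rewrite expr2 mulrC -mulrA; apply: leMl.
Qed.

(** At height at least 1 the resolvent is bounded by a constant, and Schur's formula bounds the
    inverse of its diagonal. *)
Lemma kbound_start k : (k <= msize mu ^ 5)%N -> S (zk k) -> 1 <= eta (zk k) -> kbound x (zk k).
Proof.
move=> kl Sk e1 s; have [zz w1 w2] := S_z Sk; have b0 := wz_Im zz.
set w := wz (zk k) in w1 w2 b0.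
have bV2 : (Im w)^-1 <= 2 * L.
 rewrite -[leLHS]mul1r ler_pdivrMr //; apply: (leT e1).
 rewrite -{1}(wz_sqr (zk k)) -/w expr2 ImM.
 have := Re_le_cabs w; have := ler_norm (Re w); move: w1 b0; nra.
have Gb B t : cabs (Gm (mh om) w B t t) <= 2 * L by apply: (leT (Gm_le hs b0 B t t)).
have [L3 LL] := L23.
split; first by apply: (leT (Gb _ _)); move: Lx L_ge0; lra.
rewrite (Gm_diagV_av om s b0); apply: (leT (cabsB _ _)).
have h1 : cabs (av w om s) <= L + L ^+ 2 * (2 * L).
 rewrite /av; apply: (leT (cabsB _ _)); rewrite cabsN; apply: lerD => //.
 apply: (leT (cabs_sum _ _ _)); apply: (le_mid ((\sum_t mS s t) * (2 * L))); last first.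
  by apply: leMr; [rewrite mulr_ge0|exact: mS_sum].
 rewrite mulr_suml; apply: ler_sum => t _; rewrite cabsM cabsR ger0_norm ?mS_ge0 //.
 by apply: leMl; rewrite ?mS_ge0.
have h2 : cabs (Zq w om s) <= 1.
 have [hz _ _ _] := lde kl; apply: (leT (hz s)).
 apply: (le_mid (x * (x * (x ^+ 2)^-1))); last first.
  by rewrite (_ : x * (x / x ^+ 2) = 1) //; field; rewrite gt_eqF.
 apply: leMl => //; lepM.
  by apply: (leT (v_leL s)); move: Lx L_ge0; lra.
 rewrite -ler_sqr; try sgn.
 have T0 : 0 <= \sum_t Im (Gm (mh om) w [set s]%SET t t).
  by rewrite sumr_ge0 // => t _; exact: Gm_Im_ge0.
 rewrite sqr_sqrtr; last sgn.
 rewrite ler_pdivrMr; last sgn.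
 apply: (le_mid (L * N * x)).
  apply: (le_mid (\sum_(t < n) x)).
  apply: ler_sum => t _; apply: (le_mid (cabs (Gm (mh om) w [set s]%SET t t))).
  exact: Im_le.
  by apply: (leT (Gb _ _)); move: Lx L_ge0; lra.
  by rewrite sumr_const card_ord -[leLHS]mulr_natl; apply: leMr.
 rewrite -/w (_ : x ^- 2 ^+ 2 * (N ^+ 2 * Im w) = N ^+ 2 * Im w / x ^+ 4); last by field; rewrite gt_eqF.
 rewrite ler_pdivlMr; try sgn.
 rewrite (_ : L * N * x * x ^+ 4 = N * (L * x ^+ 5)); last by ring.
 rewrite expr2 -mulrA; mulL.
 apply: (le_mid (x ^+ 99)); last exact: Nb.
 apply: (le_mid (x * x ^+ 5)); last by rewrite -exprS; exact: xmono.
 by apply: leMr => //; move: Lx L_ge0; lra.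
have : L ^+ 2 * (2 * L) = 2 * L ^+ 3 by ring.
move: h1 h2 L3 LL L_le; lra.
Qed.

(** One grid step changes a resolvent entry by at most [x/N], which is negligible against the gap
    between [4 L^3] and [x]. *)
Lemma kbound_move k : S (zk k) -> S (zk k.+1) -> kbound (4 * L ^+ 3) (zk k.+1) -> kbound x (zk k).
Proof.
move=> Sk Sk1 kb s.
set w := wz (zk k); set w' := wz (zk k.+1).
have b : 0 < Im w by exact: wz_Im.
have b' : 0 < Im w' by exact: wz_Im.
have [L3 LL] := L23.
have dz : cabs (zk k.+1 - zk k) = N ^- 5.
 rewrite zgS addrC addKr (_ : Complex 0 (N ^- 5) = 'i * (N ^- 5)%:C); last by apply: eqC; rewrite /=; ring.
 rewrite cabsM cabsR ger0_norm; try sgn.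
 rewrite (_ : cabs 'i = 1) ?mul1r //; apply/eqP; rewrite -(@eqrXn2 _ 2); try sgn.
 by rewrite cabs_sqE /= expr0n add0r.
have dw : cabs (w' - w) <= N ^- 5 * N.
 apply: (leT (wz_diff (zk_gt0 k.+1) (zk_gt0 k))); rewrite dz.
 by apply: leMl; [rewrite invr_ge0 exprn_ge0 // ltW|exact: bV].
have d1 : cabs (Gm (mh om) w' fs0 s s - Gm (mh om) w fs0 s s) <= x / N.
 apply: (leT (Gm_diff fs0 s s hs b' b)).
 apply: (le_mid (N ^- 5 * N * ((x * N) * (N * N)))).
  lepM.
  lepM.
  by apply: (leT n_le); apply: leMr; [exact: ltW|move: Lx L_ge0; lra].
  by rewrite invfM; apply: ler_pM; rewrite ?invr_ge0 ?(ltW b) ?(ltW b') //; exact: bV.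
 by apply: eq_ler; field; rewrite gt_eqF.
have xN : x ^+ 3 / N <= 1.
 by rewrite ler_pdivrMr // mul1r; apply: leT Nx; exact: xmono.
have xN1 : x / N <= 1 / 16.
 have : x / N * 16 <= x ^+ 3 / N.
  rewrite mulrAC; mulR.
  by rewrite (_ : x ^+ 3 = x * (x * x)); [apply: leMl => //; move: x_ge; nra|ring].
 by lra.
set X := 4 * L ^+ 3 in kb.
have X1 : 1 <= X by move: L3; rewrite /X; lra.
have Xx : 2 * X <= x by move: L_le; rewrite /X; lra.
have [g1 g2] := kb s; rewrite -/w' in g1 g2.
have xN2 : 2 * X * (x / N) <= 1 / 4.
 have h1 : 2 * X * (x / N) <= x * (x / N) by apply: leMr => //; rewrite divr_ge0 // ltW.
 have h2 : x * (x / N) * 4 <= x ^+ 3 / N.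
  rewrite (_ : x ^+ 3 / N = x * (x / N) * x); last by ring.
  by apply: leMl; try sgn.
 lra.
have xN3 : 2 * X ^+ 2 * (x / N) <= x / 4.
 rewrite (_ : 2 * X ^+ 2 * (x / N) = X * (2 * X * (x / N))); last by ring.
 have : X * (2 * X * (x / N)) <= X * (1 / 4) by apply: leMl => //; lra.
 lra.
split.
 have : cabs (Gm (mh om) w fs0 s s) <= cabs (Gm (mh om) w' fs0 s s) + cabs (Gm (mh om) w' fs0 s s - Gm (mh om) w fs0 s s).
  rewrite {1}(_ : Gm (mh om) w fs0 s s = Gm (mh om) w' fs0 s s - (Gm (mh om) w' fs0 s s - Gm (mh om) w fs0 s s)); last by ring.
  exact: cabsB.
 move: g1 d1 xN1 Xx X1; lra.
have G0 := Gm_diag_neq0 hs b' fs0 s.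
have H := cabs_inv_diff X1 G0 g2 d1 _.
have {}H : cabs ((Gm (mh om) w fs0 s s)^-1 - (Gm (mh om) w' fs0 s s)^-1) <= 2 * X ^+ 2 * (x / N).
 by apply: H; lra.
have : cabs (Gm (mh om) w fs0 s s)^-1 <= cabs ((Gm (mh om) w fs0 s s)^-1 - (Gm (mh om) w' fs0 s s)^-1) + cabs (Gm (mh om) w' fs0 s s)^-1.
 rewrite {1}(_ : (Gm (mh om) w fs0 s s)^-1 = ((Gm (mh om) w fs0 s s)^-1 - (Gm (mh om) w' fs0 s s)^-1) + (Gm (mh om) w' fs0 s s)^-1); last by ring.
 exact: cabsD.
move: H g2 xN3 Xx X1; lra.
Qed.

(** Where [Im m] may be small, stability only yields the square root of the error; an error of order
    [(N eta)^(-1/2)] thus gives the exponent [1/4]. *)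
Lemma bootstrap1 : kbound (4 * L ^+ 3) z0 /\ cabs (mm z0 - m z0) <= x ^+ 10 / sqrt sq.
Proof.
have [H1 H2] : kbound (4 * L ^+ 3) z0 /\ stab_bound delta (mm z0) z0.
 apply: (grid_ind (P := fun y => kbound (4 * L ^+ 3) y /\ stab_bound delta (mm y) y) Nn0 e0_gt0 Sz0 S_up) => k kl Sk.
  move=> e1; apply: boot_step => //; first exact: kbound_start.
  by rewrite ltNge e1.
 move=> e1 Sk1 [Pk1 Pk2]; apply: boot_step => //; first exact: ltnW.
 exact: kbound_move Pk1.
split=> //.
have d0 : 0 < delta by sgn.
have sd0 : 0 < sqrt delta by sgn.
have [_ _ m_3 _ _] := S_m Sz0.
apply: (le_mid (x * sqrt delta)).
 apply: (leT H2); rewrite ler_pdivrMr; last sgn.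
 rewrite -{1}(sqr_sqrtr (ltW d0)) expr2 mulrA mulrDr -[leLHS]add0r; apply: lerD.
  sgn.
 by rewrite -!mulrA; apply: leMr; try sgn.
have ss0 : 0 < sqrt sq by sgn.
rewrite -ler_sqr; try sgn.
rewrite expr_div_n exprMn !sqr_sqrtr ?(ltW sq_gt0) ?(ltW d0) // mulrA; apply: leMr.
 sgn.
by rewrite -exprD -exprM; exact: xmono.
Qed.

End Bootstrap.

(** * Iterated improvement and the local laws for families *)

Section MainLaw.
Variables (R : realType) (kap : nat -> R) (cn vmax L tau Cs : R) (U : Type) (mu : U -> model R).
Variables (top : forall u, pred 'J_(mu u)) (m : U -> R[i] -> R[i]) (S : U -> set R[i]).
Arguments top : clear implicits.
Notation Nr u := ((msize (mu u))%:R : R).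
Hypotheses (gmu : forall u, good_model kap cn vmax (mu u)) (bip : forall u, bipartite (top u))
 (vmax_le : vmax <= L) (cn_le : cn <= L) (L_ge1 : 1 <= L) (tau_gt0 : 0 < tau) (tau_le1 : tau <= 1)
 (tauV_le : tau^-1 <= L) (Cs_gt0 : 0 < Cs) (S_z : forall u z, S u z -> zfacts L z)
 (S_eta : forall u z, S u z -> Nr u `^ tau <= Nr u * Im z)
 (S_m : forall u z, S u z -> mfacts L tau (top u) (m u) z)
 (S_up : forall u z, S u z -> Im z < 1 -> S u (z + Complex 0 (Nr u ^- 5)))
 (stable : forall u, const_stable Cs (top u) (m u) (S u)).

Definition spectral_rep u (om : mOm (mu u)) : Prop :=
 exists lam : 'I_(msize (mu u)) -> R, (forall i, 0 <= lam i <= Cs) /\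
  forall z, 0 < Im z -> m1 (top u) (wz z) om = stj lam z.

Hypothesis spec : whp spectral_rep.

Let N_gt0 u : 0 < Nr u.
Proof. by have [/andP[N0 _] _ _ _] := gmu u; rewrite ltr0n. Qed.
Let N_ge1 u : 1 <= Nr u.
Proof. by have [/andP[N0 _] _ _ _] := gmu u; rewrite ler1n. Qed.
Let L_ge0 : 0 <= L. Proof. exact: leT L_ge1. Qed.

Definition V := {u : U & {z | S u z}}.
Let uV (v : V) : U := projT1 v.
Let zV (v : V) : R[i] := sval (projT2 v).
Let SV (v : V) : S (uV v) (zV v) := svalP (projT2 v).
Definition muV (v : V) : model R := mu (uV v).
Notation NV v := (Nr (uV v)).
Notation NE v := (NV v * Im (zV v)).
Notation zk v k := (zg (msize (muV v)) (zV v) k).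
Notation mmV v om := (m1 (top (uV v)) (wz (zV v)) om).
Notation mV v := (m (uV v) (zV v)).
Notation GV v om := (Gm (@mh _ (muV v) om) (wz (zV v)) fs0).

Let eta_gt0 v : 0 < Im (zV v).
Proof. by have [] := S_z (SV v). Qed.
Let NE_gt0 v : 0 < NE v. Proof. exact: mulr_gt0. Qed.
Let NE_ge v : NV v `^ tau <= NE v. Proof. exact: S_eta (SV v). Qed.
Let NE_ge1 v : 1 <= NE v.
Proof. by apply: leT (NE_ge v); apply: powR_ge1; [have [/andP[]] := gmu (uV v)|exact: ltW]. Qed.
Let b_gt0 v : 0 < Im (wz (zV v)). Proof. exact: wz_Im. Qed.

Lemma evt_ln e : 0 < e -> evt mu (fun u => ln (Nr u) <= Nr u `^ e).
Proof.
move=> e0; have e20 : 0 < e / 2 by sgn.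
apply: evt_mono (evt_and (evt_pos mu) (evt_powR mu (e / 2)^-1 e20)) => u [N0 h].
have NE : Nr u `^ e = Nr u `^ (e / 2) * Nr u `^ (e / 2) by rewrite -powRDp ?N_gt0 // -splitr.
have h1 := ln_sublinear (powR_gt0 (e / 2) (N_gt0 u)); rewrite ln_powR in h1.
rewrite NE -(ler_pM2l e20); apply: (leT (ltW h1)).
rewrite mulrA ler_peMl ?powR_ge0 // -ler_pdivrMl //; by rewrite mulr1.
Qed.

Lemma evt_x e : 0 < e -> evt mu (fun u => let x := Nr u `^ e in
 [/\ 4 <= x, `|kap 1| <= x, 8 * L ^+ 3 <= x, Cs <= x & ln (Nr u) <= x]).
Proof.
move=> e0; apply: evt_mono (evt_and (evt_and (evt_powR mu 4 e0) (evt_powR mu `|kap 1| e0))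
 (evt_and (evt_and (evt_powR mu (8 * L ^+ 3) e0) (evt_powR mu Cs e0)) (evt_ln e0))) => u.
by move=> [[h1 h2] [[h3 h4] h5]].
Qed.

Let x100 e (v : V) : 0 < e -> e <= tau / 100 -> (NV v `^ e) ^+ 100 <= NE v.
Proof.
move=> e0 e1; apply: leT (NE_ge v); rewrite powR_exp ler_powR ?N_ge1 //; lra.
Qed.

Lemma lde_grid e : 0 < e -> whp (mu := muV) (fun v om => forall k, (k <= msize (muV v) ^ 5)%N ->
 lde_ev (wz (zk v k)) (NV v `^ e) om).
Proof.
move=> e0; pose I (v : V) := 'I_(msize (muV v) ^ 5).+1.
have w0 (x : {v : V & I v}) : 0 < Im (wz (zg (msize (muV (projT1 x))) (zV (projT1 x)) (projT2 x))).
 by apply: wz_Im; apply: lt_le_trans (Im_zg_ge _ _ (eta_gt0 _)).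
have Ld := @lde_whp R kap cn vmax {v : V & I v} (fun x => muV (projT1 x)) _ (fun x => gmu _) w0 e e0.
have card v : (#|I v|)%:R <= 2 * NV v ^+ 5.
 rewrite card_ord -addn1 natrD natrX.
 have : 1 <= NV v ^+ 5 by rewrite -[leLHS](expr0 (NV v)); apply: ler_weXn2l.
 by rewrite /muV; lra.
have H := @whp_forall R V muV I 5 2 (fun v k om => lde_ev (wz (zk v k)) (NV v `^ e) om) card Ld.
by apply: whp_mono H => v om h k kl; exact: (h (Ordinal (kl : k < _.+1)%N)).
Qed.

Definition kb v (om : mOm (muV v)) : Prop := kbound om (4 * L ^+ 3) (zV v).
Definition law (a : R) : Prop := forall e, 0 < e ->
 whp (mu := muV) (fun v om => cabs (mmV v om - mV v) <= NV v `^ e * NE v `^ (- a)).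

Let small (e k : R) : 0 < e -> 0 < k -> exists e', [/\ 0 < e', e' <= tau / 100 & e' <= e / k].
Proof.
move=> e0 k0; exists (Num.min (tau / 100) (e / k)).
have t0 : 0 < tau / 100 by move: tau_gt0; lra.
by rewrite lt_min t0 divr_gt0 // !ge_min !lexx orbT.
Qed.

Let sqrt4 (y : R) : 0 < y -> sqrt (sqrt y) = y `^ (1/4).
Proof.
move=> y0; rewrite -!powR12_sqrt ?powR_ge0 ?(ltW y0) // -powRrM; congr (_ `^ _); lra.
Qed.

Lemma stage1 e : 0 < e -> whp (mu := muV) (fun v om => kb om /\
 cabs (mmV v om - mV v) <= NV v `^ e * NE v `^ (- (1/4))).
Proof.
move=> e0; have k0 : 0 < 10 :> R by lra.
have [e' [e'0 e'1 e'2]] := small e0 k0.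
have spV : whp (mu := muV) (fun v om => spectral_rep om) by exact: whp_reindex spec.
apply: whp_ev (whp_and (lde_grid e'0) spV).
have [N0 HN0] := evt_x e'0; exists N0 => v /HN0 [x4 kx Lx Cx lx] om [lde [lam [lb sp]]].
have [H1 H2] := bootstrap1 (bip (uV v)) (gmu (uV v)) vmax_le cn_le L_ge1 tau_gt0 tauV_le (@S_z (uV v)) (@S_m (uV v)) (@S_up (uV v))
 (@stable (uV v)) lb sp x4 kx Lx Cx lx (SV v) (x100 v e'0 e'1) lde.
split=> //; apply: (leT H2); rewrite sqrt4 // powRN; mulR.
by rewrite powR_exp ler_powR ?N_ge1 //; lra.
Qed.

Lemma whp_kb : whp (mu := muV) kb.
Proof. by apply: whp_mono (stage1 ltr01) => v om []. Qed.

Lemma law14 : law (1/4).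
Proof. by move=> e e0; apply: whp_mono (stage1 e0) => v om []. Qed.

(** The square of the control parameter available under [law a]. The first summand stems from the
    part [Im w] of [Im G]; it also supplies [Psi^2 >= 1/N] for fluctuation averaging. *)
Definition Th (a : R) v : R := (NV v)^-1 + (Im (mV v) + NE v `^ (- a)) / NE v + NE v ^- 2.

Let Imm_gt0 v : 0 < Im (mV v). Proof. by have [] := S_m (SV v). Qed.
Let Th_gt0 a v : 0 < Th a v.
Proof.
rewrite /Th -addrA ltr_pwDl ?invr_gt0 // addr_ge0 ?invr_ge0 ?exprn_ge0 ?(ltW (NE_gt0 v)) //.
sgn.
Qed.

Section Point.
Variables (a e : R) (v : V) (om : mOm (muV v)).
Notation x := (NV v `^ e).
Hypotheses (a_gt0 : 0 < a) (e_gt0 : 0 < e) (e_le : e <= tau / 100) (x_ge : 4 <= x) (kx : `|kap 1| <= x)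
 (Lx : 8 * L ^+ 3 <= x) (kbv : kb om) (lde : lde_ev (wz (zV v)) x om)
 (Lam : cabs (mmV v om - mV v) <= x * NE v `^ (- a)).

Let L3 : L <= L ^+ 3. Proof. by rewrite -[leLHS]expr1; apply: ler_weXn2l. Qed.
Lemma pt_Lx : L <= x. Proof. move: L3 Lx L_ge1; lra. Qed.
Lemma pt_kb : kbound om x (zV v).
Proof. by move=> s; have [h1 h2] := kbv s; split; apply: (leT (_ : _ <= 4 * L ^+ 3)) => //; move: L3 Lx L_ge0; lra. Qed.

Lemma pt_Nb : x ^+ 20 <= NV v * Im (wz (zV v)).
Proof.
have x0 : 0 < x by sgn.
have bb : Im (zV v) <= x * Im (wz (zV v)).
 have Lx' : 8 * L <= x by move: L3 Lx; lra.
 have [_ h _] := S_z (SV v); rewrite -{1}(wz_sqr (zV v)) expr2 ImM.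
 have := Re_le_cabs (wz (zV v)); have := ler_norm (Re (wz (zV v))).
 have := b_gt0 v; move: h Lx' L_ge0; nra.
apply: (le_mid (x ^+ 99)); first by apply: ler_weXn2l => //; move: x_ge; lra.
rewrite -(ler_pM2l x0) -exprS; apply: (leT (x100 v e_gt0 e_le)).
by rewrite mulrCA; apply: leMl; [exact: ltW|exact: bb].
Qed.

Lemma pt_Phi : exists g, [/\ forall s, Im (GV v om s s) <= g, g <= x &
 g / (NV v * Im (wz (zV v))) <= x ^+ 34 * Th a v].
Proof.
have [_ w1 w2] := S_z (SV v); have [m_1 m_2 m_3 m_4 m_5] := S_m (SV v).
have cx : cn <= x by exact: leT pt_Lx.
have mn0 : mV v != 0 by apply: contraTneq m_3 => ->; rewrite ltxx.
have e2 : 0 < Im (wz (zV v) ^+ 2) by rewrite wz_sqr.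
have [g [gI gx gP]] := law_Phi (bip (uV v)) (gmu (uV v)) (b_gt0 v) x_ge cx vmax_le kx L_ge1 Lx w2 w1 m_1 tau_gt0 tauV_le m_5
 (ltW m_3) e2 pt_kb pt_Nb lde Lam.
exists g; split=> //; apply: (leT gP); rewrite wz_sqr.
have x1 : 1 <= x by move: x_ge; lra.
have x0 : 0 <= x by lra.
rewrite (_ : x ^+ 34 * Th a v = x ^+ 33 * (x * Th a v)); last by ring.
apply: leMl; first exact: exprn_ge0.
have p0 : 0 <= NE v `^ (- a) by exact: powR_ge0.
have n0 := NE_gt0 v; have i0 : 0 < (NE v)^-1 by sgn.
rewrite /Th !mulrDr; apply: lerD; last by rewrite ler_peMl; sgn.
apply: lerD; first by rewrite ler_peMl; sgn.
rewrite mulrA; mulR.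
by rewrite mulrDr lerD2r ler_peMl // ltW.
Qed.

Notation Psi := (sqrt (Th a v)).

Lemma pt_bounds : (forall s t, s != t -> cabs (GV v om s t) <= x ^+ 21 * Psi) /\
 (forall s, cabs (Zq (wz (zV v)) om s) <= x ^+ 22 * Psi).
Proof.
have [_ w1 w2] := S_z (SV v).
have cx : cn <= x by exact: leT pt_Lx.
have vx : vmax <= x by exact: leT pt_Lx.
have w2x := leT w2 pt_Lx.
have x0 : 0 < x by sgn.
have [g [gI gx gP]] := pt_Phi.
have T0 := Th_gt0 a v.
have Phile : sqrt (g / (NV v * Im (wz (zV v)))) <= x ^+ 17 * Psi.
 apply: (le_mid (sqrt (x ^+ 34 * Th a v))); first exact: ler_wsqrtr.
 rewrite sqrtrM ?exprn_ge0 ?(ltW x0) // (_ : x ^+ 34 = (x ^+ 17) ^+ 2); last by rewrite -exprM.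
 by rewrite sqrtr_sqr ger0_norm; sgn.
split=> [s t st|s].
 apply: (leT (offdiag_le4 (gmu (uV v)) (b_gt0 v) x_ge vx pt_kb gI pt_Nb lde st)).
 rewrite (_ : x ^+ 21 * Psi = x ^+ 4 * (x ^+ 17 * Psi)); last by rewrite mulrA -exprD.
 by apply: leMl => //; rewrite exprn_ge0 // ltW.
apply: (leT (Zq_le (gmu (uV v)) (b_gt0 v) x_ge cx vx w2x pt_kb gI pt_Nb lde s)).
rewrite (_ : x ^+ 22 * Psi = x ^+ 4 * (x * (x ^+ 17 * Psi))); last by ring.
mulL.
have [_ _ /(_ s)/andP[v1 v2] _] := gmu (uV v).
by apply: ler_pM => //; rewrite ?sqrtr_ge0 ?(ltW v1) //; exact: leT vx.
Qed.

Lemma pt_fmu :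
 cabs ((mdim (muV v))%:R^-1 * \sum_s (~~ top (uV v) s)%:R * (GV v om s s - (av (wz (zV v)) om s)^-1)) <= x * Psi ^+ 2 ->
 cabs ((mdim (muV v))%:R^-1 * \sum_s (if top (uV v) s then (mvar s / (`|vmax| + 1))%:C else 0) *
  (GV v om s s - (av (wz (zV v)) om s)^-1)) <= x * Psi ^+ 2 ->
 cabs (fmu (top (uV v)) (mmV v om) - zV v) <= x ^+ 57 * Th a v.
Proof.
move=> h1 h2.
have [_ w1 w2] := S_z (SV v).
have cx : cn <= x by exact: leT pt_Lx.
have vx : vmax <= x by exact: leT pt_Lx.
have w2x := leT w2 pt_Lx; have w1x := leT w1 pt_Lx.
have x0 : 0 < x by sgn.
have [g [gI gx gP]] := pt_Phi.
have T0 := Th_gt0 a v.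
have := fmu_err2 (bip (uV v)) (gmu (uV v)) (b_gt0 v) x_ge cx vx kx w2x w1x pt_kb gI gx pt_Nb lde h1 h2.
rewrite wz_sqr => /leT; apply.
have g0 : 0 <= g.
 have s0 : 'J_(muV v).
  by have [/andP[i1 i2] _ _ _] := gmu (uV v); exact: Ordinal (leq_trans i1 i2).
 by apply: leT (gI s0); apply: Gm_Im_ge0 => //; exact: mh_sym.
rewrite !sqr_sqrtr ?(ltW T0) //; last sgn.
rewrite (_ : x ^+ 57 * Th a v = x ^+ 22 * (x * (x ^+ 34 * Th a v))); last by ring.
mulL.
have h3 : x * Th a v <= x ^+ 34 * Th a v.
 by apply: leMr; [exact: ltW|rewrite -[leLHS]expr1; apply: ler_weXn2l => //; move: x_ge; lra].
have h4 : 0 <= x ^+ 34 * Th a v by sgn.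
move: gP h3 h4 x_ge; nra.
Qed.

End Point.

Section StageTwo.
Variable a : R.
Hypotheses (a_gt0 : 0 < a) (a_le1 : a <= 1) (law_a : law a).
Let c := tau / 4.
Let Q (v : V) := (L + 3 <= NV v `^ (tau / 2)) /\ 2 * L <= NV v `^ tau.
Let Psi v := sqrt (Th a v).
Let Th_le v : Q v -> Th a v <= NV v `^ (- (tau / 2)).
Proof.
move=> [q1 q2]; set N := NV v in q1 q2 *.
have n0 := NE_gt0 v; have n1 := NE_ge1 v; have N0 : 0 < N by exact: N_gt0.
have i1 : (NE v)^-1 <= N `^ (- tau) by rewrite powRN lef_pV2 ?posrE ?powR_gt0 //; exact: NE_ge.
have i2 : N^-1 <= N `^ (- tau).
 by rewrite powRN lef_pV2 ?posrE ?powR_gt0 // -[leRHS](powRr1 (ltW N0)) ler_powR ?N_ge1.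
have i3 : NE v `^ (- a) <= 1.
 by rewrite powRN invf_le1 ?powR_gt0 // -[leLHS](powRr0 (NE v)) ler_powR // ltW.
have [m_1 _ m_3 _ _] := S_m (SV v).
have i4 : Im (mV v) <= L.
 by apply: leT m_1; exact: Im_le.
have i5 : (Im (mV v) + NE v `^ (- a)) / NE v <= (L + 1) * N `^ (- tau).
 by apply: ler_pM; rewrite ?addr_ge0 ?powR_ge0 ?invr_ge0 ?(ltW n0) ?(ltW m_3) // lerD.
have i6 : NE v ^- 2 <= N `^ (- tau).
 apply: leT i1; rewrite lef_pV2 ?posrE ?exprn_gt0 // -[leLHS]expr1; exact: ler_weXn2l.
rewrite (_ : - (tau / 2) = tau / 2 + - tau); last by lra.
rewrite powRDp //.
apply: (le_mid ((L + 3) * N `^ (- tau))); last by apply: leMr; [exact: powR_ge0|].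
rewrite /Th; move: i2 i5 i6; lra.
Qed.

Let Q_ev : evt muV Q.
Proof.
have t2 : 0 < tau / 2 by move: tau_gt0; lra.
apply: (@evt_reindex _ U V mu uV (fun u => (L + 3 <= Nr u `^ (tau / 2)) /\ 2 * L <= Nr u `^ tau)).
exact: evt_and (evt_powR mu _ t2) (evt_powR mu _ tau_gt0).
Qed.

Let kbnd e : 0 < e -> whp (mu := muV) (fun v om => kb om /\ lde_ev (wz (zV v)) (NV v `^ e) om /\
 cabs (mmV v om - mV v) <= NV v `^ e * NE v `^ (- a)).
Proof.
move=> e0; apply: whp_mono (whp_and whp_kb (whp_and (lde_grid e0) (law_a e0))) => v om [h1 [h2 h3]].
by split=> //; split=> //; have := h2 0%N isT; rewrite zg0.
Qed.

Let bounds e : 0 < e -> whp (mu := muV) (fun v om =>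
 (forall s t, s != t -> cabs (GV v om s t) <= NV v `^ e * Psi v) /\
 (forall s, cabs (Zq (wz (zV v)) om s) <= NV v `^ e * Psi v)).
Proof.
move=> e0; have k0 : 0 < 22 :> R by lra.
have [e' [e'0 e'1 e'2]] := small e0 k0.
apply: whp_ev (kbnd e'0).
have [N0 HN0] := evt_x e'0; exists N0 => v /HN0 [x4 kx Lx Cx lx] om [h1 [h2 h3]].
have [b1 b2] := pt_bounds e'0 e'1 x4 kx Lx h1 h2 h3.
have xe k : (k <= 22)%N -> (NV v `^ e') ^+ k <= NV v `^ e.
 move=> k22; rewrite powR_exp ler_powR ?N_ge1 //.
 have : k%:R <= 22 :> R by rewrite ler_nat.
 move: e'0 e'2; nra.
split=> [s t st|s].
 by apply: (leT (b1 s t st)); apply: leMr; [exact: sqrtr_ge0|exact: xe].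
by apply: (leT (b2 s)); apply: leMr; [exact: sqrtr_ge0|exact: xe].
Qed.

Lemma stage2_FA (W : forall v, 'J_(muV v) -> R[i]) : (forall v s, cabs (W v s) <= 1) ->
 forall e, 0 < e -> whp (mu := muV) (fun v om => cabs ((mdim (muV v))%:R^-1 *
  \sum_s W v s * (GV v om s s - (av (wz (zV v)) om s)^-1)) <= NV v `^ e * Psi v ^+ 2).
Proof.
move=> W1 e e0; apply: (@whp_restrict _ _ muV Q); first exact: Q_ev.
pose V1 := {v | Q v}; pose mu1 (x : V1) := muV (sval x).
have K1 : 1 <= 4 * L ^+ 3.
 have : L <= L ^+ 3 by rewrite -[leLHS]expr1; apply: ler_weXn2l.
 by move: L_ge1; lra.
have c0 : 0 < c by rewrite /c; move: tau_gt0; lra.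
have FA := @fluctuation_averaging R kap cn vmax V1 mu1 (fun x => wz (zV (sval x))) (fun x => Psi (sval x)) c (4 * L ^+ 3)
 (fun x => gmu (uV (sval x))) (fun x => b_gt0 (sval x)) _ c0 K1 (fun x => _) _ _ _ _ _ (fun x => W (sval x)) (fun x => W1 (sval x)) e e0.
apply: FA.
- move=> [v [q1 q2]] /=; have b := b_gt0 v; have [_ w1 _] := S_z (SV v).
 rewrite -[leLHS]mul1r ler_pdivrMr //.
 have h : Im (zV v) <= 2 * L * Im (wz (zV v)).
  rewrite -{1}(wz_sqr (zV v)) expr2 ImM.
  have := Re_le_cabs (wz (zV v)); have := ler_norm (Re (wz (zV v))); move: w1 b; nra.
 have L2 : 0 < 2 * L by move: L_ge1; lra.
 rewrite -(ler_pM2l L2) mulr1; apply: (leT q2); apply: (leT (NE_ge v)).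
 by rewrite mulrCA; apply: leMl; [exact: ltW|exact: h].
- by move=> y; rewrite sqrtr_gt0.
- move=> [v q] /=; rewrite sqr_sqrtr ?(ltW (Th_gt0 a v)) // /Th -addrA lerDl.
 sgn.
- move=> [v q] /=; rewrite -ler_sqr; try sgn.
 rewrite sqr_sqrtr ?(ltW (Th_gt0 a v)) // powR_exp; apply: (leT (Th_le q)).
 by rewrite ler_powR ?N_ge1 // /c; lra.
- by move=> e1 e10; have H := @whp_sub _ _ muV Q _ (bounds e10); apply: whp_mono H => x om [].
- exact: (@whp_sub _ _ muV Q _ whp_kb).
- by move=> e1 e10; have H := @whp_sub _ _ muV Q _ (bounds e10); apply: whp_mono H => x om [].
Qed.

Lemma stage2_fmu e : 0 < e -> whp (mu := muV) (fun v om =>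
 cabs (fmu (top (uV v)) (mmV v om) - zV v) <= NV v `^ e * Th a v).
Proof.
move=> e0; have k0 : 0 < 57 :> R by lra.
have [e' [e'0 e'1 e'2]] := small e0 k0.
pose W1 v (s : 'J_(muV v)) : R[i] := (~~ top (uV v) s)%:R.
pose W2 v (s : 'J_(muV v)) : R[i] := if top (uV v) s then (mvar s / (`|vmax| + 1))%:C else 0.
have W1le v s : cabs (W1 v s) <= 1.
 by rewrite /W1; case: (top _ _); rewrite /= ?cabs0 ?cabs1.
have W2le v s : cabs (W2 v s) <= 1.
 rewrite /W2; case: (top _ _); rewrite ?cabs0 // cabsR.
 have [_ _ /(_ s)/andP[v1 v2] _] := gmu (uV v).
 rewrite ger0_norm; try sgn.
 by rewrite ler_pdivrMr ?ltr_wpDl // mul1r; apply: (leT v2); apply: (leT (ler_norm _)); rewrite lerDl.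
apply: whp_ev (whp_and (kbnd e'0) (whp_and (stage2_FA W1le e'0) (stage2_FA W2le e'0))).
have [N0 HN0] := evt_x e'0; exists N0 => v /HN0 [x4 kx Lx Cx lx] om [[h1 [h2 h3]] [f1 f2]].
apply: (leT (pt_fmu e'0 e'1 x4 kx Lx h1 h2 h3 f1 f2)).
by apply: leMr; [exact: ltW (Th_gt0 a v)|rewrite powR_exp ler_powR ?N_ge1 //; lra].
Qed.

(** Union bound over the points of the vertical grid that belong to the domain; each of them is
    again an index of the family. *)
Lemma whp_grid (A : forall v, mOm (muV v) -> Prop) : whp A -> whp (mu := muV) (fun v om =>
 forall k, (k <= msize (muV v) ^ 5)%N -> forall Sk : S (uV v) (zk v k),
  A (existT _ (uV v) (exist _ (zk v k) Sk)) om).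
Proof.
move=> wA; pose I (v : V) := 'I_(msize (muV v) ^ 5).+1.
have card v : (#|I v|)%:R <= 2 * NV v ^+ 5.
 rewrite card_ord -addn1 natrD natrX.
 have : 1 <= NV v ^+ 5 by rewrite -[leLHS](expr0 (NV v)); apply: ler_weXn2l.
 by rewrite /muV; lra.
pose Q' (y : {v : V & I v}) := S (uV (projT1 y)) (zg (msize (muV (projT1 y))) (zV (projT1 y)) (projT2 y)).
pose f (y : {y | Q' y}) : V := existT (fun u => {z | S u z}) (uV (projT1 (sval y)))
 (exist (S (uV (projT1 (sval y)))) (zg (msize (muV (projT1 (sval y)))) (zV (projT1 (sval y))) (projT2 (sval y))) (svalP y)).
pose B (y : {v : V & I v}) (om : mOm (muV (projT1 y))) : Prop :=
 forall Sk : S (uV (projT1 y)) (zg (msize (muV (projT1 y))) (zV (projT1 y)) (projT2 y)),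
  A (existT _ (uV (projT1 y)) (exist _ (zg (msize (muV (projT1 y))) (zV (projT1 y)) (projT2 y)) Sk)) om.
have H1 : whp (mu := fun y => muV (projT1 (sval y))) (fun (y : {y | Q' y}) om => B (sval y) om).
 have H := whp_reindex f wA; apply: whp_mono H => y om Ay Sk.
 by rewrite (Prop_irrelevance Sk (svalP y)).
have H2 : whp (mu := fun y => muV (projT1 y)) (fun (y : {v : V & I v}) om => B y om).
 by apply: whp_mono (whp_imp H1) => y om h Sk; exact: (h Sk).
have H3 := @whp_forall R V muV I 5 2 (fun v k om => B (existT _ v k) om) card.
have {}H3 := H3 _; apply: whp_mono (H3 _) => [v om h k kl Sk|].
 exact: (h (Ordinal (kl : k < _.+1)%N)).
by apply: whp_mono H2 => -[v k] om.
Qed.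

(** The error at a grid point is governed by [Th] there, whereas stability is used with one constant
    [d]. So [Th] at higher points must be bounded by its value at [z]. For the part [Im m / eta]
    this uses the monotonicity valid for [m_N] and the closeness of [m_N] and [m] at both points. *)
Lemma stage2 : law ((1 + a) / 2).
Proof.
move=> e e0; have k0 : 0 < 5 :> R by lra.
have [e' [e'0 e'1 e'2]] := small e0 k0.
have spV : whp (mu := muV) (fun v om => spectral_rep om) by exact: whp_reindex spec.
apply: whp_ev (whp_and spV (whp_grid (whp_and (stage2_fmu e'0) (law_a e'0)))).
have [N0 HN0] := evt_x e'0; have [N1 HN1] := Q_ev.
exists (maxn N0 N1) => v; rewrite geq_max => /andP[/HN0 [x4 kx Lx Cx lx] /HN1 Qv] om [[lam [lb sp]] H].
have [m_1 m_2 m_3 m_4 m_5] := S_m (SV v).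
set N := NV v in x4 kx Lx Cx lx.
set x := N `^ e' in x4 kx Lx Cx lx.
have N0' : 0 < N by exact: N_gt0.
have x0 : 0 < x by rewrite powR_gt0.
have n0 := NE_gt0 v; have n1 := NE_ge1 v; have et0 := eta_gt0 v.
pose p : R := NE v `^ (- a).
have p0 : 0 < p by rewrite powR_gt0.
have H0 : cabs (mmV v om - mV v) <= x * p.
 have S0 : S (uV v) (zk v 0) by rewrite zg0; exact: SV.
 have [_ h] := H 0%N isT S0; rewrite /= in h.
 by move: S0 h; rewrite zg0 => S0.
pose d : R := 3 * x ^+ 2 * Th a v.
have T0 := Th_gt0 a v.
have d0 : 0 < d by rewrite !mulr_gt0 ?exprn_gt0.
have dge : N ^- 2 <= d.
 apply: (le_mid N^-1).
  by rewrite lef_pV2 ?posrE ?exprn_gt0 // -[leLHS]expr1; apply: ler_weXn2l => //; exact: N_ge1.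
 apply: (le_mid (Th a v)).
  rewrite /Th -addrA lerDl.
  sgn.
 by rewrite /d ler_peMl ?(ltW T0) //; move: x4; nra.
have dln : d * ln N <= 1.
 have lN : 0 <= ln N by rewrite ln_ge0 // N_ge1.
 apply: (le_mid (x ^+ 3 * N `^ (- (tau / 2)) * x)).
  apply: ler_pM => //; first sgn.
  lepM; last exact: Th_le.
  by rewrite (_ : x ^+ 3 = x * x ^+ 2); [apply: leMr; rewrite ?exprn_ge0 ?(ltW x0) //; lra|ring].
 rewrite mulrAC -exprSr /x powR_exp -powRDp // -[leRHS](powRr0 N) ler_powR ?N_ge1 //.
 move: e'1 tau_gt0; lra.
have errk k : (k <= msize (mu (uV v)) ^ 5)%N -> S (uV v) (zk v k) ->
  cabs (fmu (top (uV v)) (m1 (top (uV v)) (wz (zk v k)) om) - zk v k) <= d.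
 move=> kl Sk; have [h1 h2] := H k kl Sk.
 set vk : V := existT _ _ _ in h1 h2.
 have {}h1 : cabs (fmu (top (uV v)) (m1 (top (uV v)) (wz (zk v k)) om) - zk v k) <= x * Th a vk by exact: h1.
 have ek : Im (zV v) <= Im (zV vk) by exact: Im_zg_ge.
 have ek0 : 0 < Im (zV vk) by exact: lt_le_trans ek.
 have nk : NE v <= NE vk by apply: leMl; [exact: ltW|exact: ek].
 have nk0 : 0 < NE vk by exact: lt_le_trans nk.
 have pk : NE vk `^ (- a) <= p.
  by rewrite /p !powRN lef_pV2 ?posrE ?powR_gt0 //; apply: ge0_ler_powR; rewrite ?nnegrE ?(ltW a_gt0) ?(ltW n0) ?(ltW nk0).
 apply: (leT h1); rewrite (_ : d = x * (3 * x * Th a v)); last by rewrite /d; ring.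
 mulL.
 set mk := mV vk; set lk := mmV vk om in h2.
 have lk2 : cabs (lk - mk) <= x * p by apply: (leT h2); apply: leMl => //; exact: ltW.
 (* Monotonicity is applied to the empirical transform; [I1] and [I2] convert between it and [m] at
    the cost of [x p]. *)
 have mono : Im lk / Im (zV vk) <= Im (mmV v om) / Im (zV v).
  by rewrite /lk !sp //; apply: Im_stj_mono => //; rewrite Re_zg.
 have I1 : Im mk <= Im lk + x * p.
  have := leT (leT (ler_norm _) (Im_le_cabs (mk - lk))) (leT (eqbRL (congr1 (fun t => t <= x * p) (cabs_distC mk lk)) lk2) (lexx _)).
  by rewrite ImD ImN; lra.
 have I2 : Im (mmV v om) <= Im (mV v) + x * p.
  have := leT (leT (ler_norm _) (Im_le_cabs (mmV v om - mV v))) H0.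
  by rewrite ImD ImN; lra.
 have i0 : 0 < (Im (zV v))^-1 by sgn.
 have ik0 : 0 < (Im (zV vk))^-1 by sgn.
 have ik : (Im (zV vk))^-1 <= (Im (zV v))^-1 by rewrite lef_pV2 ?posrE.
 have xp0 : 0 <= x * p by sgn.
 have main : (Im mk + NE vk `^ (- a)) / Im (zV vk) <= (Im (mV v) + 3 * (x * p)) / Im (zV v).
  have J1 : Im mk / Im (zV vk) <= Im lk / Im (zV vk) + x * p / Im (zV vk).
  by rewrite -mulrDl; apply: leMr => //; exact: ltW.
  have J2 : Im (mmV v om) / Im (zV v) <= Im (mV v) / Im (zV v) + x * p / Im (zV v).
  by rewrite -mulrDl; apply: leMr => //; exact: ltW.
  have J3 : x * p / Im (zV vk) <= x * p / Im (zV v) by apply: leMl.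
  have J4 : NE vk `^ (- a) / Im (zV vk) <= x * p / Im (zV v).
  apply: ler_pM; rewrite ?powR_ge0 ?(ltW ik0) //; apply: (leT pk).
  by rewrite ler_peMl ?(ltW p0) //; lra.
  rewrite [leLHS]mulrDl [leRHS]mulrDl (_ : 3 * (x * p) / _ = 3 * (x * p / Im (zV v))); last by ring.
  move: J1 mono J2 J3 J4; lra.
 have main2 : (Im mk + NE vk `^ (- a)) / NE vk <= 3 * x * ((Im (mV v) + p) / NE v).
  have e1 : (Im mk + NE vk `^ (- a)) / NE vk = N^-1 * ((Im mk + NE vk `^ (- a)) / Im (zV vk)).
  by rewrite invfM mulrCA.
  have e3 : 3 * x * ((Im (mV v) + p) / NE v) = N^-1 * ((3 * x * (Im (mV v) + p)) / Im (zV v)).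
  by rewrite invfM; ring.
  rewrite e1 e3.
  mulL.
  apply: (leT main); mulR.
  by move: x4 m_3 p0; nra.
 rewrite /Th mulrDr mulrDr; apply: lerD; last first.
  apply: (le_mid (NE v ^- 2)).
  by rewrite lef_pV2 ?posrE ?exprn_gt0 //; leXn.
  by rewrite ler_peMl ?invr_ge0 ?exprn_ge0 ?(ltW n0) //; lra.
 apply: lerD; last exact: main2.
 by rewrite ler_peMl ?invr_ge0 ?(ltW N0') //; lra.
have B := bootstrap2 (gmu (uV v)) (@S_z (uV v)) (@S_up (uV v)) (@stable (uV v)) lb sp dge dln (SV v) errk.
apply: (leT B).
have sd0 : 0 < sqrt d by sgn.
set im := Im (mV v) in m_3 m_4 *.
have D0 : 0 < im + sqrt d by sgn.
set q := NE v `^ (- ((1 + a) / 2)).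
have q0 : 0 < q by rewrite powR_gt0.
have qq : q ^+ 2 = p / NE v.
 rewrite /q powR_exp (_ : - ((1 + a) / 2) * 2 = - a + - 1); last by lra.
 by rewrite powRDp // powR_inv1 // ltW.
have q1 : (NE v)^-1 <= q.
 rewrite -(powR_inv1 (ltW n0)) ler_powR //; move: a_le1; lra.
(* Each summand of [Th] uses the suitable part of the denominator: [Im m] for the term with [Im m],
   and for [1/N] through [eta <= L^2 Im m]; [sqrt d] for the other two. The term [p/(N eta) = q^2]
   is decisive and fixes the new exponent. *)
have part1 : im / NE v / (im + sqrt d) <= q.
 rewrite mulrAC; apply: leT q1; rewrite ler_piMl ?invr_ge0 ?(ltW n0) //.
 by rewrite ler_pdivrMr // mul1r lerDl ltW.
have sq_part y : 0 <= y -> y <= d -> y / (im + sqrt d) <= sqrt y.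
 move=> y0 yd; rewrite ler_pdivrMr // -{1}(sqr_sqrtr y0) expr2; apply: leMl; first exact: sqrtr_ge0.
 by apply: (le_mid (sqrt d)); [exact: ler_wsqrtr|rewrite lerDr ltW].
have Thd y : 0 <= y -> y <= Th a v -> y <= d.
 move=> y0 h; apply: (leT h); rewrite /d ler_peMl ?(ltW T0) //; move: x4; nra.
have part2 : p / NE v / (im + sqrt d) <= q.
 apply: (leT (sq_part _ _ _)); first sgn.
  apply: Thd; first sgn.
  rewrite /Th mulrDl; have := exprn_gt0 2 n0; rewrite -invr_gt0.
  have : 0 <= N^-1 by sgn.
  have : 0 <= im / NE v by sgn.
  rewrite -/p -/im -/N; lra.
 by rewrite -qq sqrtr_sqr ger0_norm // ltW.
have part3 : NE v ^- 2 / (im + sqrt d) <= q.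
 apply: (leT (sq_part _ _ _)); first sgn.
  apply: Thd; first sgn.
  rewrite /Th lerDr addr_ge0 ?invr_ge0 ?(ltW N0') // divr_ge0 ?(ltW n0) //.
  sgn.
 by rewrite -exprVn sqrtr_sqr ger0_norm ?invr_ge0 ?(ltW n0).
have part4 : N^-1 / (im + sqrt d) <= L ^+ 2 * q.
 apply: (le_mid (L ^+ 2 * (NE v)^-1)); last by apply: leMl; try sgn.
 rewrite ler_pdivrMr // mulrAC ler_pdivlMr // mulrA mulVf ?gt_eqF // mul1r.
 by apply: (leT m_4); apply: leMl; rewrite ?sqr_ge0 // lerDl ltW.
have L2 : 1 <= L ^+ 2 by rewrite -[leLHS](expr1n _ 2); apply: ler_Xn.
have total : Th a v / (im + sqrt d) <= 4 * L ^+ 2 * q.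
 have -> : Th a v / (im + sqrt d) = N^-1 / (im + sqrt d) + im / NE v / (im + sqrt d) +
  p / NE v / (im + sqrt d) + NE v ^- 2 / (im + sqrt d).
  by move: (im + _)^-1 => D; rewrite /Th -/p -/im -/N; ring.
 have : q <= L ^+ 2 * q by rewrite ler_peMl // ltW.
 rewrite -/p -/im -/N; move: part1 part2 part3 part4; lra.
rewrite (_ : Cs * d / _ = Cs * (3 * x ^+ 2) * (Th a v / (im + sqrt d))); last by rewrite /d; ring.
apply: (le_mid (x * (3 * x ^+ 2) * (4 * L ^+ 2 * q))).
 lepM.
 by apply: leMr => //; rewrite mulr_ge0 ?exprn_ge0 ?(ltW x0).
rewrite (_ : x * (3 * x ^+ 2) * (4 * L ^+ 2 * q) = 12 * L ^+ 2 * x ^+ 3 * q); last by ring.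
mulR.
have L23 : L ^+ 2 <= L ^+ 3 by apply: ler_weXn2l.
apply: (le_mid (x ^+ 5)); last by rewrite /x powR_exp ler_powR ?N_ge1 //; lra.
rewrite (_ : x ^+ 5 = x * x * x ^+ 3); last by ring.
mulR.
by move: Lx x4 L23; nra.
Qed.

End StageTwo.

(** The map [a -> (1 + a)/2] halves the distance to 1, which is [3/4] at the start. *)
Lemma law_lim k : law (1 - (3 / 4) / 2 ^+ k).
Proof.
elim: k => [|k IH].
 by rewrite expr0 divr1 (_ : 1 - 3 / 4 = 1 / 4); [exact: law14|lra].
have p0 : 0 < (2 ^+ k)^-1 :> R by sgn.
have p1 : (2 ^+ k)^-1 <= 1 :> R.
 by rewrite invf_le1 ?exprn_gt0 // -natrX ler1n expn_gt0.
have h1 : 0 < 1 - 3 / 4 / 2 ^+ k :> R by lra.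
have h2 : 1 - 3 / 4 / 2 ^+ k <= 1 :> R by lra.
rewrite (_ : 1 - 3 / 4 / 2 ^+ k.+1 = (1 + (1 - 3 / 4 / 2 ^+ k)) / 2); first exact: stage2 h1 h2 IH.
by rewrite exprS invfM; lra.
Qed.

Lemma law1 : law 1.
Proof.
move=> e e0; have [K HK] : exists K, 2 * (3 / 4 / 2 ^+ K) <= e / 4.
 (* The missing exponent [r] costs [(N eta)^r <= N^(2 r)], because [N eta <= N^2] for large [N];
    hence [2 r] has to be small against [e]. *)
 exists (Num.Def.archi_bound (8 / e)).
 set K := Num.Def.archi_bound _.
 have h1 : 8 / e < K%:R by apply: archi_boundP; rewrite divr_ge0 // ltW.
 have h2 : K%:R <= 2 ^+ K :> R by rewrite -natrX ler_nat ltnW // ltn_expl.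
 have h3 : 8 / e <= 2 ^+ K by apply: ltW; apply: lt_le_trans h2.
 have p2 : 0 < 2 ^+ K :> R by sgn.
 rewrite ler_pdivrMr // in h3; rewrite mulrA ler_pdivrMr //; lra.
set r := 3 / 4 / 2 ^+ K in HK.
have r0 : 0 <= r by rewrite divr_ge0 ?exprn_ge0.
have e20 : 0 < e / 2 by lra.
apply: whp_ev (law_lim K e20).
have [N0 HN0] := evt_powR mu (L ^+ 2) ltr01.
exists N0 => v /HN0 LN om h; apply: (leT h).
have N0' : 0 < NV v by exact: N_gt0.
have n0 := NE_gt0 v.
rewrite (_ : - (1 - r) = r + - 1); last by lra.
rewrite powRDp // mulrA; apply: leMr; first exact: powR_ge0.
rewrite [e in leRHS]splitr powRDp //; apply: leMl; first exact: powR_ge0.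
apply: (le_mid ((NV v ^+ 2) `^ r)).
 apply: ge0_ler_powR; try sgn.
 rewrite expr2; mulL.
 rewrite powRr1 ?(ltW N0') // in LN; apply: leT LN.
 have [_ w1 _] := S_z (SV v).
 apply: (le_mid (cabs (zV v))); first exact: Im_le.
 by rewrite -cabs_wz; leXn.
rewrite -powR_mulrn ?(ltW N0') // -powRrM ler_powR ?N_ge1 //; lra.
Qed.

Definition PsiV v : R := sqrt (Im (mV v) / NE v) + (NE v)^-1.

Section PointEntry.
Variables (e : R) (v : V) (om : mOm (muV v)).
Notation x := (NV v `^ e).
Hypotheses (e_gt0 : 0 < e) (e_le : e <= tau / 100) (x_ge : 4 <= x) (kx : `|kap 1| <= x) (Lx : 8 * L ^+ 3 <= x)
 (kbv : kb om) (lde : lde_ev (wz (zV v)) x om) (Lam : cabs (mmV v om - mV v) <= x * NE v `^ (- 1)).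

(** The summand [1/N] is absorbed through [eta <= L^2 Im m], after which [Th 1] is comparable to the
    square of the control parameter of the theorem. *)
Lemma Th1_le : Th 1 v <= x * PsiV v ^+ 2.
Proof.
have [m_1 m_2 m_3 m_4 m_5] := S_m (SV v).
have n0 := NE_gt0 v; have N0 : 0 < NV v by exact: N_gt0.
rewrite /Th powR_inv1; try sgn.
set I := Im (mV v) in m_3 m_4 *.
have q0 : 0 <= I / NE v by sgn.
have h1 : (NV v)^-1 <= L ^+ 2 * (I / NE v).
 rewrite mulrA ler_pdivlMr // mulrA mulVf ?gt_eqF // mul1r; exact: m_4.
have h2 : I / NE v + ((NE v)^-1) ^+ 2 <= PsiV v ^+ 2.
 rewrite /PsiV -/I sqrrD sqr_sqrtr // lerD2r lerDl mulrn_wge0 // mulr_ge0; try sgn.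
rewrite exprVn in h2.
have i0 : 0 <= NE v ^- 2 by sgn.
have L2 : 1 + L ^+ 2 <= x.
 have : L ^+ 2 <= L ^+ 3 by apply: ler_weXn2l.
 have : 1 <= L ^+ 2 by apply: exprn_ege1.
 move: Lx; lra.
apply: (le_mid (x * (I / NE v + NE v ^- 2))); last by apply: leMl => //; exact: powR_ge0.
have -> : (I + (NE v)^-1) / NE v = I / NE v + NE v ^- 2 by move: (NE v) => ne; rewrite mulrDl -expr2 exprVn.
rewrite [leRHS]mulrDr.
have : (1 + L ^+ 2) * (I / NE v) <= x * (I / NE v) by apply: leMr.
have : 4 * NE v ^- 2 <= x * NE v ^- 2 by apply: leMr.
move: h1 i0; lra.
Qed.

Lemma pt_entry :
 [/\ forall s t, s != t -> cabs (GV v om s t) <= x ^+ 40 * (sqrt (mvar s * mvar t) * PsiV v),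
  forall s, top (uV v) s -> cabs (GV v om s s + (wz (zV v) * (1 + (mvar s)%:C * mV v))^-1) <= x ^+ 40 * (mvar s * PsiV v) &
  forall s, ~~ top (uV v) s -> cabs (GV v om s s - wz (zV v) * mV v) <= x ^+ 40 * PsiV v].
Proof.
have [_ w1 w2] := S_z (SV v); have [m_1 m_2 m_3 m_4 m_5] := S_m (SV v).
have Lxx := pt_Lx Lx.
have cx : cn <= x by exact: leT Lxx.
have vx : vmax <= x by exact: leT Lxx.
have wVx := leT w2 Lxx.
have x0 : 0 < x by sgn.
have x1 : 1 <= x by move: x_ge; lra.
have xk k l : (k <= l)%N -> x ^+ k <= x ^+ l by move=> kl; apply: ler_weXn2l.
have mn0 : mV v != 0 by apply: contraTneq m_3 => ->; rewrite ltxx.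
have e2 : 0 < Im (wz (zV v) ^+ 2) by rewrite wz_sqr.
have kbx := pt_kb Lx kbv.
have Nb := pt_Nb e_gt0 e_le x_ge Lx.
have [g [gI gx gP]] := pt_Phi e_gt0 e_le x_ge kx Lx kbv lde Lam.
have n0 := NE_gt0 v.
have P0 : 0 <= PsiV v by rewrite addr_ge0 ?sqrtr_ge0 ?invr_ge0 // ltW.
set Phi := sqrt (g / (NV v * Im (wz (zV v)))).
have Phile : Phi <= x ^+ 18 * PsiV v.
 apply: (le_mid (sqrt (x ^+ 36 * PsiV v ^+ 2))).
  apply: ler_wsqrtr; apply: (leT gP).
  apply: (le_mid (x ^+ 34 * (x * PsiV v ^+ 2))).
  by apply: leMl; [rewrite exprn_ge0 // ltW|exact: Th1_le].
  by rewrite mulrA -exprSr; apply: leMr; [exact: sqr_ge0|exact: xk].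
 rewrite sqrtrM ?exprn_ge0 ?(ltW x0) // (_ : x ^+ 36 = (x ^+ 18) ^+ 2); last by rewrite -exprM.
 by rewrite !sqrtr_sqr !ger0_norm; sgn.
have LamP : x * NE v `^ (- 1) <= x * PsiV v.
 by apply: leMl; rewrite ?(ltW x0) // powR_inv1 ?(ltW n0) // /PsiV lerDr sqrtr_ge0.
have v0 (s : 'J_(muV v)) : 0 <= mvar s.
 by have [_ _ /(_ s)/andP[h _] _] := gmu (uV v); exact: ltW.
have epsle : x ^+ 6 * Phi <= x ^+ 24 * PsiV v.
 rewrite (_ : x ^+ 24 * _ = x ^+ 6 * (x ^+ 18 * PsiV v)); last by rewrite mulrA -exprD.
 by apply: leMl; try sgn.
have xP k l : (k <= l)%N -> x ^+ k * PsiV v <= x ^+ l * PsiV v by move=> kl; apply: leMr => //; exact: xk.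
have x24 k : 4 * (x ^+ k * PsiV v) <= x ^+ k.+1 * PsiV v.
 by rewrite exprS -mulrA; apply: leMr => //; rewrite mulr_ge0 // exprn_ge0 // ltW.
split=> [s t st|s ts|s ts].
- apply: (leT (offdiag_le2 (gmu (uV v)) (b_gt0 v) x_ge cx vx wVx kbx gI gx Nb lde st)).
 rewrite -/Phi (_ : x ^+ 40 * _ = x ^+ 8 * (sqrt (mvar s * mvar t) * (x ^+ 32 * PsiV v))); last first.
  by rewrite (_ : 40 = 8 + 32)%N // exprD; ring.
 mulL.
 apply: leMl; first exact: sqrtr_ge0.
 by apply: (leT Phile); exact: xP.
- apply: (leT (top_m2 (bip (uV v)) (gmu (uV v)) (b_gt0 v) x_ge cx vmax_le kx L_ge1 Lx w2 w1 tau_gt0 tauV_le m_5 kbx Nb lde Lam gI gx ts)).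
 rewrite -/Phi mulrCA; rewrite [leRHS](_ : _ = x ^+ 3 * (mvar s * (x ^+ 37 * PsiV v))); last first.
  by rewrite (_ : 40 = 3 + 37)%N // exprD; ring.
 rewrite mulrCA [mvar s * (x ^+ 3 * _)]mulrCA; mulL.
 apply: leMl => //.
 have h1 := xP 2%N 24%N isT; have h2 := x24 24%N; have h3 := xP 25%N 37%N isT.
 have h4 : x * (x * NE v `^ (-1)) <= x ^+ 2 * PsiV v.
  by rewrite expr2 -mulrA; apply: leMl => //; exact: ltW.
 have h5 : 0 <= x ^+ 24 * PsiV v by sgn.
 move: epsle h1 h2 h3 h4 h5; lra.
- apply: (leT (bot_m (bip (uV v)) (gmu (uV v)) (b_gt0 v) x_ge cx vmax_le kx L_ge1 Lx w2 w1 kbx Nb lde Lam gI gx ts)).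
 rewrite -/Phi.
 have h1 : 2 * x ^+ 2 * (x ^+ 6 * Phi) <= 2 * (x ^+ 26 * PsiV v).
  rewrite -mulrA (_ : x ^+ 26 = x ^+ 2 * x ^+ 24); last by rewrite -exprD.
  by apply: leMl => //; rewrite -mulrA; apply: leMl => //; rewrite exprn_ge0 // ltW.
 have h2 : L * (x * NE v `^ (- 1)) <= x ^+ 2 * PsiV v.
  by rewrite expr2 -mulrA; lepM.
 have h3 := xP 2%N 26%N isT; have h4 := x24 26%N; have h5 := xP 27%N 40%N isT.
 have h6 : 0 <= x ^+ 26 * PsiV v by sgn.
 move: h1 h2 h3 h4 h5 h6; lra.
Qed.

End PointEntry.

Lemma law_entry e : 0 < e -> whp (mu := muV) (fun v om => let x := NV v `^ e in
 [/\ forall s t, s != t -> cabs (GV v om s t) <= x * (sqrt (mvar s * mvar t) * PsiV v),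
  forall s, top (uV v) s -> cabs (GV v om s s + (wz (zV v) * (1 + (mvar s)%:C * mV v))^-1) <= x * (mvar s * PsiV v) &
  forall s, ~~ top (uV v) s -> cabs (GV v om s s - wz (zV v) * mV v) <= x * PsiV v]).
Proof.
move=> e0; have k0 : 0 < 40 :> R by lra.
have [e' [e'0 e'1 e'2]] := small e0 k0.
apply: whp_ev (whp_and whp_kb (whp_and (lde_grid e'0) (law1 e'0))).
have [N0 HN0] := evt_x e'0; exists N0 => v /HN0 [x4 kx Lx Cx lx] om [h1 [h2 h3]].
have {}h2 : lde_ev (wz (zV v)) (NV v `^ e') om by have := h2 0%N isT; rewrite zg0.
have [b1 b2 b3] := pt_entry e'0 e'1 x4 kx Lx h1 h2 h3.
have xe : (NV v `^ e') ^+ 40 <= NV v `^ e by rewrite powR_exp ler_powR ?N_ge1 //; lra.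
have n0 := NE_gt0 v.
have P0 : 0 <= PsiV v by rewrite addr_ge0 ?sqrtr_ge0 ?invr_ge0 // ltW.
have v0 (s : 'J_(muV v)) : 0 <= mvar s.
 by have [_ _ /(_ s)/andP[h _] _] := gmu (uV v); exact: ltW.
split=> [s t st|s ts|s ts].
- by apply: (leT (b1 s t st)); apply: leMr => //; rewrite mulr_ge0 ?sqrtr_ge0.
- by apply: (leT (b2 s ts)); apply: leMr => //; rewrite mulr_ge0.
- by apply: (leT (b3 s ts)); apply: leMr.
Qed.

End MainLaw.

(** * Linearization of the sample covariance matrix *)

Lemma ord_sumP M N (s : 'I_(M + N)) :
 (exists i : 'I_M, s = lshift N i) \/ (exists mu : 'I_N, s = rshift M mu).
Proof. by case: (split_ordP s) => j ->; [left|right]; exists j. Qed.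

Lemma invmx_uniq (F : comUnitRingType) n (A B : 'M[F]_n) : A *m B = 1%:M -> invmx A = B.
Proof. by move=> e; have [u _] := mulmx1_unit e; rewrite -[RHS]mul1mx -(mulVmx u) -mulmxA e mulmx1. Qed.

Lemma invmx_factor (F : comUnitRingType) n (K H G A B : 'M[F]_n) :
 B *m K *m A = H -> H *m G = 1%:M -> invmx K = A *m G *m B.
Proof.
move=> <- e; apply: invmx_uniq; rewrite -!mulmxA in e; have := mulmx1C e.
by rewrite -!mulmxA.
Qed.

Section Linearization.
Variables (R : realType) (M N : nat) (d : 'I_M -> R) (X : 'M[R]_(M, N)).
Hypothesis d_gt0 : forall i, 0 < d i.
Variable h : 'I_(M + N) -> 'I_(M + N) -> R.
Hypotheses (h_sym : hsym h) (h_tt : forall i j, h (lshift N i) (lshift N j) = 0)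
 (h_bb : forall i j, h (rshift M i) (rshift M j) = 0)
 (h_tb : forall i j, h (lshift N i) (rshift M j) = sqrt (d i) * X i j).
Let Sg : 'M[R]_M := diag_mx (\row_i d i).
Let h_bt i j : h (rshift M i) (lshift N j) = sqrt (d j) * X j i.
Proof. by rewrite h_sym.1 h_tb. Qed.
Let sd i : R := sqrt (d i).
Let sd_gt0 i : 0 < sd i. Proof. by rewrite sqrtr_gt0. Qed.
Let sd2 i : sd i * sd i = d i. Proof. by rewrite -expr2 sqr_sqrtr // ltW. Qed.
Let neq0C (a : R) : 0 < a -> a%:C != 0.
Proof. by move=> a0; rewrite -cabs_gt0 cabsR gtr0_norm. Qed.

Lemma invSgE : invmx Sg = diag_mx (\row_i (d i)^-1).
Proof.
apply: invmx_uniq; rewrite mulmx_diag; apply/matrixP => i j; rewrite !mxE.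
by case: eqP => // _; rewrite /= mulfV ?gt_eqF.
Qed.

Section AtZ.
Variable z : R[i].
Hypothesis z_gt0 : 0 < Im z.
Notation w := (wz z).
Notation G0 := (Gm h w fs0).
Let w_gt0 : 0 < Im w. Proof. exact: wz_Im. Qed.
Let w0 : w != 0. Proof. by apply: contraTneq w_gt0 => ->; rewrite ltxx. Qed.
Let ww : w * w = z. Proof. by rewrite -expr2 wz_sqr. Qed.

(** Scalings of rows and columns that carry the given block matrix to [h - w]. They are not
    symmetric: the power of [w] is placed on one side, so that no root of [w] is needed. *)
Definition lin_l (s : 'I_(M + N)) : R[i] :=
 match fintype.split s with inl i => w * (sqrt (d i))%:C | inr _ => 1 end.
Definition lin_r (s : 'I_(M + N)) : R[i] :=
 match fintype.split s with inl i => (sqrt (d i))%:C | inr _ => w^-1 end.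

Let ll i : lin_l (lshift N i) = w * (sd i)%:C.
Proof. by rewrite /lin_l; case: split_ordP => j; [move=> /lshift_inj <-|move/eqP; rewrite eq_lrshift]. Qed.
Let lr i : lin_l (rshift M i) = 1.
Proof. by rewrite /lin_l; case: split_ordP => j //; move/eqP; rewrite eq_rlshift. Qed.
Let rl i : lin_r (lshift N i) = (sd i)%:C.
Proof. by rewrite /lin_r; case: split_ordP => j; [move=> /lshift_inj <-|move/eqP; rewrite eq_lrshift]. Qed.
Let rr i : lin_r (rshift M i) = w^-1.
Proof. by rewrite /lin_r; case: split_ordP => j //; move/eqP; rewrite eq_rlshift. Qed.
Let K : 'M[R[i]]_(M + N) := block_mx (- to_mxC (invmx Sg)) (to_mxC X) (to_mxC X^T) (- z%:M).
Let KEs s t : lin_r s * K s t * lin_l t = (Hm h fs0 - w%:M) s t.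
Proof.
have C0 : (0 : R)%:C = 0 :> R[i] by [].
have -> : (Hm h fs0 - w%:M) s t = (h s t)%:C - w *+ (s == t) by rewrite !mxE !inE.
case: (ord_sumP s) => -[i ->]; case: (ord_sumP t) => -[j ->].
- rewrite block_mxEul rl ll h_tt invSgE !mxE (inj_eq (@lshift_inj _ _)) C0 sub0r.
 have [->|_] := eqVneq i j; last by rewrite !mulr0n C0 !oppr0 mulr0 mul0r.
 rewrite !mulr1n (_ : ((d j)^-1)%:C = ((sd j)%:C * (sd j)%:C)^-1); last by rewrite -rmorphM sd2 fmorphV.
 by field; exact: neq0C.
- by rewrite block_mxEur rl lr h_tb !mxE eq_lrshift mulr0n subr0 mulr1 rmorphM.
- rewrite block_mxEdl rr ll h_bt !mxE eq_rlshift mulr0n subr0 (rmorphM (real_complex R)) /= -/(sd j).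
 by field; exact: w0.
- rewrite block_mxEdr rr lr h_bb !mxE (inj_eq (@rshift_inj _ _)) C0 sub0r mulr1.
 move: w0 ww; move: (wz z) => w1 w10 <-; have [_|_] := eqVneq i j; last by rewrite !mulr0n oppr0 mulr0.
 by rewrite !mulr1n; field.
Qed.

Let KE : diag_mx (\row_s lin_r s) *m K *m diag_mx (\row_s lin_l s) = Hm h fs0 - w%:M.
Proof.
apply/matrixP => s t; rewrite -KEs; move: K => K'; by rewrite mul_mx_diag mul_diag_mx !mxE.
Qed.

Lemma G_mxE s t : G_mx Sg X z s t = lin_l s * G0 s t * lin_r t.
Proof.
rewrite /G_mx -/K (invmx_factor KE (mulmxV (Hm_unit _ h_sym w_gt0))).
by rewrite mul_mx_diag mul_diag_mx !mxE.
Qed.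

Let YtY : to_mxC (X^T *m Sg *m X) =
 \matrix_(i, j) \sum_k (h (lshift N k) (rshift M i))%:C * (h (lshift N k) (rshift M j))%:C.
Proof.
rewrite mul_mx_diag; apply/matrixP => i j; rewrite !mxE rmorph_sum; apply: eq_bigr => k _.
rewrite !h_tb -rmorphM mxE (mxE _ _ i k) !mxE; congr (_%:C).
by move: (sd2 k); rewrite /sd; move: (sqrt _) => q <-; ring.
Qed.

(** The resolvent equation of [h] in the population rows is substituted into that of the sample
    rows. *)
Lemma cov_resolventE i j :
 invmx (to_mxC (X^T *m Sg *m X) - z%:M) i j = G0 (rshift M i) (rshift M j) / w.
Proof.
pose R2 : 'M[R[i]]_N := \matrix_(i, j) (G0 (rshift M i) (rshift M j) / w).
suff e : (to_mxC (X^T *m Sg *m X) - z%:M) *m R2 = 1%:M.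
 by rewrite (invmx_uniq e) mxE.
have top k (t : 'I_N) : w * G0 (lshift N k) (rshift M t) = \sum_j (h (lshift N k) (rshift M j))%:C * G0 (rshift M j) (rshift M t).
 have := Gm_eq h_sym w_gt0 fs0 (lshift N k) (rshift M t).
 rewrite eq_lrshift => /eqP; rewrite subr_eq0 => /eqP <-.
 rewrite big_split_ord /= big1 ?add0r; last by move=> l _; rewrite /Hm !mxE !inE /= h_tt mul0r.
 by apply: eq_bigr => l _; rewrite /Hm !mxE !inE.
have bot (r t : 'I_N) : \sum_k (h (lshift N k) (rshift M r))%:C * G0 (lshift N k) (rshift M t)
  = w * G0 (rshift M r) (rshift M t) + (r == t)%:R.
 have := Gm_eq h_sym w_gt0 fs0 (rshift M r) (rshift M t).
 rewrite (inj_eq (@rshift_inj _ _)) => /eqP; rewrite subr_eq addrC => /eqP <-.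
 rewrite big_split_ord /= [X in _ + X]big1 ?addr0; last by move=> l _; rewrite /Hm !mxE !inE /= h_bb mul0r.
 by apply: eq_bigr => l _; rewrite /Hm !mxE !inE /= h_sym.1.
apply/matrixP => i0 t; rewrite mulmxBl mul_scalar_mx YtY !mxE.
under eq_bigr => j0 _ do rewrite !mxE mulr_suml.
rewrite exchange_big /=.
rewrite (eq_bigr (fun k => (h (lshift N k) (rshift M i0))%:C * G0 (lshift N k) (rshift M t))).
 rewrite bot; move: w0 ww; move: (G0 _ _) => g; move: (wz z) => w1 w10 <-; field; exact: w10.
move=> k _; apply: (mulfI w0); rewrite [RHS]mulrCA top !mulr_sumr; apply: eq_bigr => l _; field; exact: w0.
Qed.

Lemma m_empE : m_emp Sg X z = (N%:R%:C * w)^-1 * \sum_i G0 (rshift M i) (rshift M i).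
Proof.
rewrite /m_emp /mxtrace; under eq_bigr => i _ do rewrite cov_resolventE.
by rewrite -mulr_suml invfM natC mulrAC mulrA.
Qed.

End AtZ.
End Linearization.

(** The complex spectral theorem diagonalizes the matrix with real eigenvalues; the trace of the
    resolvent is read off in the eigenbasis. *)
Lemma symmetric_spectrum (R : realType) (n : nat) (A : 'M[R]_n) : A^T = A ->
 exists lam : 'I_n -> R, (forall i, exists2 u : 'rV[R]_n, u != 0 & u *m A = lam i *: u) /\
  forall z : R[i], 0 < Im z -> n%:R^-1 * \tr (invmx (to_mxC A - z%:M)) = stj lam z.
Proof.
move=> As; set AC := to_mxC A.
have realC (a : R) : (a%:C)^*%R = a%:C by rewrite conj_Creal // complex_real.
have herm : AC \is hermsymmx.
 apply/is_hermitianmxP; rewrite expr0 scale1r; apply/matrixP => i j.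
 by rewrite !mxE realC -[in LHS]As mxE.
have AE := orthomx_spectralP (hermitian_normalmx herm).
have U := spectral_unit AC.
have spR := mxOverP (hermitian_spectral_diag_real herm).
set P := spectralmx AC in AE U; set sp := spectral_diag AC in AE spR.
pose lam i := Re (sp 0 i).
have spE i : sp 0 i = (lam i)%:C by rewrite /lam RRe_real.
have PA : P *m AC = diag_mx sp *m P by rewrite AE !mulmxA mulmxV // mul1mx.
exists lam; split=> [i|z z0].
 have rv : row i P *m AC = (lam i)%:C *: row i P.
  rewrite -row_mul PA -spE; apply/rowP => j; rewrite !mxE (bigD1 i) //= big1 ?addr0.
  by rewrite !mxE eqxx mulr1n.
  by move=> k ki; rewrite !mxE eq_sym (negbTE ki) mulr0n mul0r.
 have v0 : row i P != 0.
  apply/eqP => h; have : row i (P *m invmx P) = 0 by rewrite row_mul h mul0mx.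
  by rewrite mulmxV // => /rowP /(_ i); rewrite !mxE eqxx => /eqP; rewrite oner_eq0.
 (* Real and imaginary part of a complex eigenvector both satisfy the real eigenvalue equation, and
    at least one of them is nonzero. *)
 have [r0|r0] := eqVneq (map_mx (@Re R) (row i P)) 0.
  exists (map_mx (@Im R) (row i P)).
  apply: contraNneq v0 => i0; apply/eqP/rowP => j.
  move: r0 i0 => /rowP/(_ j) + /rowP/(_ j); rewrite !mxE => h1 h2.
  by apply: eqC; rewrite /= ?h1 ?h2.
  apply/rowP => j; move: rv => /rowP /(_ j) /(congr1 (@Im R)).
  rewrite !mxE Im_sum ImM /= mul0r addr0 => <-; apply: eq_bigr => k _.
  by rewrite !mxE ImM /= mulr0 add0r.
 exists (map_mx (@Re R) (row i P)) => //.
 apply/rowP => j; move: rv => /rowP /(_ j) /(congr1 (@Re R)).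
 rewrite !mxE Re_sum ReM /= mul0r subr0 => <-; apply: eq_bigr => k _.
 by rewrite !mxE ReM /= mulr0 subr0.
have lz i : (lam i)%:C - z != 0.
 apply/eqP => /(congr1 (@Im R)); rewrite ImD ImN /= add0r => /eqP; rewrite oppr_eq0 => /eqP h.
 by rewrite h ltxx in z0.
pose D : 'M[R[i]]_n := diag_mx (\row_i ((lam i)%:C - z)^-1).
have e : (AC - z%:M) *m (invmx P *m D *m P) = 1%:M.
 have e1 : AC - z%:M = invmx P *m (diag_mx sp - z%:M) *m P.
  by rewrite mulmxBr mulmxBl -AE mul_mx_scalar -scalemxAl mulVmx // scalemx1.
 rewrite e1 -!mulmxA (mulmxA P) mulmxV // mul1mx (mulmxA _ D).
 suff -> : (diag_mx sp - z%:M) *m D = 1%:M by rewrite mul1mx mulVmx.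
 apply/matrixP => i j; rewrite mul_mx_diag !mxE.
 have [->|_] := eqVneq i j; last by rewrite !mulr0n subrr mul0r.
 by rewrite !mulr1n spE mulfV.
rewrite (invmx_uniq e) mxtrace_mulC mulmxA mulmxV // mul1mx mxtrace_diag /stj; congr (_ * _).
by apply: eq_bigr => i _; rewrite mxE.
Qed.

(** * The empirical spectral measure as a probability measure *)

Section EmpiricalMeasure.
Variables (R : realType) (n : nat) (lam : 'I_n -> R).
Hypothesis n_gt0 : (0 < n)%N.
Notation T := (measurableTypeR R).
Let nV : {nonneg R} := NngNum (ltW (eqbRL (invr_gt0 n%:R) (eqbRL (ltr0n R n) n_gt0))).
Let pt (k : nat) : T := if insub k is Some i then lam i else 0.
Let dr (k : nat) : {measure set T -> \bar R} := [the measure _ _ of @dirac _ T (pt k) R].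
Definition emp_measure : set T -> \bar R := mscale nV (msum dr n).

HB.instance Definition _ := Measure.on emp_measure.

Lemma emp_measureE (A : set T) : measurable A -> (forall i, A (lam i)) -> emp_measure A = 1%E.
Proof.
move=> mA AL; rewrite /emp_measure /mscale /= /msum.
rewrite (eq_bigr (fun _ : 'I_n => 1%E)); last first.
 move=> i _; rewrite /dr /= diracE.
 by rewrite /pt valK mem_set.
rewrite sumEFin sumr_const card_ord.
by rewrite -EFinM /= mulVf // pnatr_eq0 -lt0n.
Qed.

HB.instance Definition _ := Measure_isProbability.Build _ _ _ emp_measure (emp_measureE measurableT (fun _ => I)).

Lemma emp_integral (f : R -> R) : measurable_fun setT f ->
 Rintegral emp_measure setT f = n%:R^-1 * \sum_i f (lam i).
Proof.
move=> mf; pose fE : R -> \bar R := EFin \o f.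
have mfE : measurable_fun setT fE by exact/measurable_EFinP.
have ge0 (g : R -> \bar R) : measurable_fun setT g -> (forall x, 0 <= g x)%E ->
  (\int[emp_measure]_x g x = (n%:R^-1)%:E * \sum_(i < n) g (lam i))%E.
 move=> mg g0; rewrite ge0_integral_mscale //; congr (_ * _)%E.
 rewrite ge0_integral_measure_sum //; apply: eq_bigr => i _.
 by rewrite integral_dirac // diracT mul1e /pt valK.
rewrite /Rintegral -/fE integralE ge0 ?ge0 //; last 2 first.
- exact: measurable_funeneg.
- exact: measurable_funepos.
have e1 : (\sum_(i < n) fE^\+ (lam i) = (\sum_(i < n) Num.max (f (lam i)) 0)%:E)%E.
 by rewrite -sumEFin; apply: eq_bigr => i _; rewrite funeposE /= -EFin_max.
have e2 : (\sum_(i < n) fE^\- (lam i) = (\sum_(i < n) Num.max (- f (lam i)) 0)%:E)%E.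
 by rewrite -sumEFin; apply: eq_bigr => i _; rewrite funenegE /= -EFin_max.
move: e1 e2; rewrite /fE /= => e1 e2.
rewrite e1 e2 -!EFinM -EFinB /= -mulrBr -sumrB; congr (_ * _); apply: eq_bigr => i _.
by rewrite !maxEle oppr_le0; have [|] := leP (f (lam i)) 0; case: (leP 0 (f (lam i))); lra.
Qed.

Lemma stieltjes_emp (z : R[i]) : 0 < Im z -> stieltjes_transform emp_measure z = stj lam z.
Proof.
move=> z0; have den (x : R) : 0 < (x - Re z) ^+ 2 + Im z ^+ 2.
 by rewrite ltr_wpDl; sgn.
have dc : continuous (fun x : R => ((x - Re z) ^+ 2 + Im z ^+ 2)^-1 : R).
 move=> x; apply: cvgV; first by rewrite gt_eqF.
 apply: cvgD; last exact: cvg_cst.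
 by under eq_cvg do rewrite expr2; rewrite expr2; apply: cvgM; (apply: cvgB; [exact: cvg_id|exact: cvg_cst]).
have re (x : R) : Re (x%:C - z)^-1 = (x - Re z) / ((x - Re z) ^+ 2 + Im z ^+ 2).
 by case: z z0 den dc => a b /= ? ? ?; rewrite sub0r sqrrN.
have im (x : R) : Im (x%:C - z)^-1 = Im z / ((x - Re z) ^+ 2 + Im z ^+ 2).
 by rewrite ImV ImD ImN /= sub0r opprK cabs_sqE ReD ImD ReN ImN /= sub0r sqrrN.
have mre : measurable_fun setT (fun x : R => Re (x%:C - z)^-1).
 under eq_fun => x do rewrite re.
 apply: continuous_measurable_fun => x; apply: cvgM; last exact: dc.
 by apply: cvgB; [exact: cvg_id|exact: cvg_cst].
have mim : measurable_fun setT (fun x : R => Im (x%:C - z)^-1).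
 under eq_fun => x do rewrite im.
 by apply: continuous_measurable_fun => x; apply: cvgM; [exact: cvg_cst|exact: dc].
rewrite /stieltjes_transform !emp_integral // /stj -natC -fmorphV.
by apply: eqC; rewrite ?ReM ?ImM ?Re_sum ?Im_sum /= !mul0r ?subr0 ?addr0.
Qed.

End EmpiricalMeasure.

(** * The bipartite model with given discrete entries *)

Section CovModel.
Variables (R : realType) (M N K : nat) (d : 'I_M -> R) (q y : 'I_M -> 'I_N -> 'I_K.+1 -> R).
Hypotheses (d_gt0 : forall i, 0 < d i) (q_ge0 : forall i j v, 0 <= q i j v)
 (q_sum1 : forall i j, \sum_v q i j v = 1) (y_mean : forall i j, \sum_v q i j v * y i j v = 0).

Definition pair_coord (c : 'I_M * 'I_N) : {set 'I_(M + N)} := [set lshift N c.1; rshift M c.2]%SET.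
Definition coord_pair (k : {set 'I_(M + N)}) : option ('I_M * 'I_N) := [pick c | pair_coord c == k].

Lemma pair_coord_inj : injective pair_coord.
Proof.
move=> [i j] [i' j'] /finset.setP h.
have := h (lshift N i); rewrite !inE eqxx /= eq_lrshift orbF => /esym/eqP/lshift_inj e1.
have := h (rshift M j); rewrite !inE eqxx orbT /= !eq_rlshift /= => /esym/eqP/rshift_inj e2.
by rewrite e1 e2.
Qed.

Lemma pair_coordK : pcancel pair_coord coord_pair.
Proof.
move=> c; rewrite /coord_pair; case: pickP => [c' /eqP /pair_coord_inj -> //|/(_ c)].
by rewrite eqxx.
Qed.

(** Coordinates that do not join a population index to a sample index carry a point mass, so the
    product law describes the independent matrix entries alone. *)
Definition cov_law k (v : 'I_K.+1) : R :=
 if coord_pair k is Some c then q c.1 c.2 v else (v == ord0)%:R.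
Definition cov_xi k (v : 'I_K.+1) : R :=
 if coord_pair k is Some c then sqrt (d c.1) * y c.1 c.2 v else 0.
Definition cov_var (s : 'I_(M + N)) : R := match fintype.split s with inl i => d i | inr _ => 1 end.
Definition cov_top (s : 'I_(M + N)) : bool := if fintype.split s is inl _ then true else false.

Lemma cov_law_ge0 k v : 0 <= cov_law k v.
Proof. by rewrite /cov_law; case: coord_pair. Qed.

Lemma cov_law_sum1 k : \sum_v cov_law k v = 1.
Proof.
rewrite /cov_law; case: coord_pair => [[i j]|]; first exact: q_sum1.
by rewrite (bigD1 ord0) //= big1 ?addr0 // => v /negbTE ->.
Qed.

Lemma cov_xi_mean k : \sum_v cov_law k v * cov_xi k v = 0.
Proof.
rewrite /cov_law /cov_xi; case: coord_pair => [[i j]|] /=; last by rewrite big1 // => v _; rewrite mulr0.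
rewrite (eq_bigr (fun v => sqrt (d i) * (q i j v * y i j v))); last by move=> v _; ring.
by rewrite -mulr_sumr y_mean mulr0.
Qed.

Definition cov_model : model R := @Model R N (M + N) 'I_K.+1 cov_law cov_xi cov_var
 cov_law_ge0 cov_law_sum1 cov_xi_mean.

Let topl i : cov_top (lshift N i) = true.
Proof. by rewrite /cov_top; case: split_ordP => // j /eqP; rewrite eq_lrshift. Qed.
Let topr j : cov_top (rshift M j) = false.
Proof. by rewrite /cov_top; case: split_ordP => // i /eqP; rewrite eq_rlshift. Qed.
Let varl i : cov_var (lshift N i) = d i.
Proof. by rewrite /cov_var; case: split_ordP => j; [move=> /lshift_inj <-|move/eqP; rewrite eq_lrshift]. Qed.
Let varr j : cov_var (rshift M j) = 1.
Proof. by rewrite /cov_var; case: split_ordP => // i /eqP; rewrite eq_rlshift. Qed.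
Let none_ll i i' : coord_pair [set lshift N i; lshift N i']%SET = None.
Proof.
rewrite /coord_pair; case: pickP => // -[a b] /eqP /finset.setP /(_ (rshift M b)).
by rewrite !inE eqxx !eq_rlshift orbT.
Qed.
Let none_rr j j' : coord_pair [set rshift M j; rshift M j']%SET = None.
Proof.
rewrite /coord_pair; case: pickP => // -[a b] /eqP /finset.setP /(_ (lshift N a)).
by rewrite !inE eqxx !eq_lrshift.
Qed.

Section Entries.
Variable om : mOm cov_model.
Definition cov_sample : 'M[R]_(M, N) := \matrix_(i, j) y i j (om (pair_coord (i, j))).

Lemma cov_h_tt i i' : mh om (lshift N i) (lshift N i') = 0.
Proof. by rewrite /mh /= /cov_xi none_ll; case: ifP. Qed.
Lemma cov_h_bb j j' : mh om (rshift M j) (rshift M j') = 0.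
Proof. by rewrite /mh /= /cov_xi none_rr; case: ifP. Qed.
Lemma cov_h_tb i j : mh om (lshift N i) (rshift M j) = sqrt (d i) * cov_sample i j.
Proof. by rewrite /mh eq_lrshift /= /cov_xi (pair_coordK (i, j)) mxE. Qed.

Lemma cov_m1E z : 0 < Im z -> @m1 R cov_model cov_top (wz z) om = m_emp (diag_mx (\row_i d i)) cov_sample z.
Proof.
move=> z0; rewrite (m_empE d_gt0 (mh_sym om) cov_h_tt cov_h_bb cov_h_tb z0) /m1; congr (_ * _).
rewrite big_split_ord /= big1 ?add0r; last by move=> i; rewrite topl.
by apply: eq_bigl => j; rewrite topr.
Qed.

(** With [Y] the upper right block of [h], an eigenvector [u] of [Y^T Y] for [lam > 0] lifts to the
    eigenvector [(Y u / sqrt lam, u)] of [h] for [sqrt lam]. The bound on eigenvalues of [h] is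
    thereby transferred to the sample covariance spectrum. *)
Lemma cov_spectrum : exists lam : 'I_N -> R,
 (forall z, 0 < Im z -> @m1 R cov_model cov_top (wz z) om = stj lam z) /\
 forall i, 0 <= lam i /\ (0 < lam i -> exists v : 'I_(M + N) -> R,
  (exists s, v s != 0) /\ forall s, \sum_t mh om s t * v t = sqrt (lam i) * v s).
Proof.
pose Sg : 'M[R]_M := diag_mx (\row_i d i); pose A := cov_sample^T *m Sg *m cov_sample.
have As : A^T = A by rewrite /A !trmx_mul trmxK tr_diag_mx mulmxA.
have [lam [lamE lamz]] := symmetric_spectrum As.
exists lam; split=> [z z0|i]; first by rewrite cov_m1E // -lamz.
have [u u0 uA] := lamE i.
pose p k : R := \sum_j mh om (lshift N k) (rshift M j) * u 0 j.
have AE j : \sum_k mh om (lshift N k) (rshift M j) * p k = lam i * u 0 j.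
 have /rowP/(_ j) := uA; rewrite !mxE => <-.
 rewrite /p; under eq_bigr => k _ do rewrite mulr_sumr.
 rewrite exchange_big; apply: eq_bigr => l _; rewrite /A mul_mx_diag mxE mulr_sumr; apply: eq_bigr => k _.
 rewrite !cov_h_tb; set X := cov_sample; rewrite mxE [X^T _ _]mxE [(\row_i0 _) _ _]mxE.
 have := sqr_sqrtr (ltW (d_gt0 k)); move: (sqrt _) => r <-; ring.
have [j0 uj0] : exists j, u 0 j != 0.
 apply/existsP; apply: contraNT u0; rewrite negb_exists => /forallP h.
 by apply/eqP/rowP => j; have := h j; rewrite negbK mxE => /eqP.
have U0 : 0 < \sum_j u 0 j ^+ 2.
 by rewrite (bigD1 j0) //= ltr_pwDl ?sumr_ge0 ?exprn_even_gt0 // => j _; exact: sqr_ge0.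
have lam0 : 0 <= lam i.
 have e : lam i * \sum_j u 0 j ^+ 2 = \sum_k p k ^+ 2.
  rewrite mulr_sumr (eq_bigr (fun j => \sum_k (mh om (lshift N k) (rshift M j) * p k) * u 0 j)); last first.
  by move=> j _; rewrite -mulr_suml AE; ring.
  rewrite exchange_big; apply: eq_bigr => k _; rewrite expr2 [RHS](_ : _ = \sum_j mh om (lshift N k) (rshift M j) * u 0 j * p k).
  by apply: eq_bigr => j _; ring.
  by rewrite {1}/p mulr_suml.
 by rewrite -(pmulr_lge0 _ U0) e sumr_ge0 // => k _; exact: sqr_ge0.
split=> // lp; set sg := sqrt (lam i).
have sg0 : 0 < sg by rewrite sqrtr_gt0.
have sg2 : sg * sg = lam i by rewrite -expr2 sqr_sqrtr.
exists (fun s => match fintype.split s with inl k => p k / sg | inr j => u 0 j end).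
have vl k : match fintype.split (lshift N k) with inl k => p k / sg | inr j => u 0 j end = p k / sg.
 by case: split_ordP => j; [move=> /lshift_inj <-|move/eqP; rewrite eq_lrshift].
have vr j : match fintype.split (rshift M j) with inl k => p k / sg | inr j => u 0 j end = u 0 j.
 by case: split_ordP => k; [move/eqP; rewrite eq_rlshift|move=> /rshift_inj <-].
split; first by exists (rshift M j0); rewrite vr.
move=> s; rewrite big_split_ord /=; case: (ord_sumP s) => -[k ->].
 rewrite big1 ?add0r => [|l _]; last by rewrite cov_h_tt mul0r.
 by rewrite vl mulrC divfK ?gt_eqF //; apply: eq_bigr => j _; rewrite vr.
rewrite [X in _ + X]big1 ?addr0 => [|l _]; last by rewrite cov_h_bb mul0r.
rewrite vr (eq_bigr (fun l => (mh om (lshift N l) (rshift M k) * p l) / sg)); last first.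
 by move=> l _; rewrite vl (mh_sym om).1 mulrA.
rewrite -mulr_suml AE -sg2; field; exact: lt0r_neq0.
Qed.

End Entries.

Lemma cov_mE i j (f : R -> R) : mE (fun om : mOm cov_model => f (mh om (lshift N i) (rshift M j))) =
 \sum_v q i j v * f (sqrt (d i) * y i j v).
Proof.
rewrite /mE (eq_EE _ (G := fun om => f (@mxi _ cov_model (pair_coord (i, j)) (om (pair_coord (i, j)))))); last first.
 by move=> om; rewrite cov_h_tb mxE /= /cov_xi (pair_coordK (i, j)).
rewrite (EE_coord (@mlaw_sum1 _ cov_model) _ (fun v => f (@mxi _ cov_model (pair_coord (i, j)) v))).
by apply: eq_bigr => v _; rewrite /= /cov_law /cov_xi (pair_coordK (i, j)).
Qed.

Variables (kap : nat -> R) (cn vmax : R).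
Hypotheses (N_gt0 : (0 < N)%N) (dim_le : (M + N)%:R <= cn * N%:R) (d_le : forall i, d i <= vmax)
 (vmax_ge1 : 1 <= vmax) (kap0 : forall p, 1 <= kap p)
 (y_mom : forall i j p, \sum_v q i j v * (N%:R * y i j v ^+ 2) ^+ p <= kap p)
 (y_var : forall i j, \sum_v q i j v * y i j v ^+ 2 = N%:R^-1).

Let cov_var_gt0 s : 0 < cov_var s.
Proof. by case: (ord_sumP s) => -[k ->]; rewrite ?varl ?varr. Qed.

Lemma cov_good : good_model kap cn vmax cov_model.
Proof.
split=> //=; first by rewrite N_gt0 leq_addl.
 by move=> s; rewrite cov_var_gt0; case: (ord_sumP s) => -[k ->]; rewrite ?varl ?varr ?d_le.
move=> s t p.
have zero : (forall om : mOm cov_model, mh om s t = 0) ->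
  mE (fun om : mOm cov_model => (N%:R * mh om s t ^+ 2) ^+ p) <= kap p * (cov_var s * cov_var t) ^+ p.
 move=> h0; rewrite /mE (eq_EE _ (G := fun => 0 ^+ p)); last by move=> om; rewrite h0 (expr2 0) !mulr0.
 rewrite (EEC (@mlaw_sum1 _ cov_model)); case: p => [|p].
  by rewrite !expr0 mulr1.
 by rewrite expr0n mulr_ge0 ?exprn_ge0 ?mulr_ge0 ?(ltW (cov_var_gt0 _)) // (leT ler01).
have tb i j : mE (fun om : mOm cov_model => (N%:R * mh om (lshift N i) (rshift M j) ^+ 2) ^+ p) <= kap p * (d i) ^+ p.
 rewrite (cov_mE i j (fun h => (N%:R * h ^+ 2) ^+ p)).
 rewrite (eq_bigr (fun v => (q i j v * (N%:R * y i j v ^+ 2) ^+ p) * d i ^+ p)).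
  by rewrite -mulr_suml; apply: leMr; [rewrite exprn_ge0 // ltW|exact: y_mom].
 move=> v _; rewrite -mulrA -exprMn; congr (_ * _ ^+ _).
 by rewrite (_ : (_ * y i j v) ^+ 2 = sqrt (d i) ^+ 2 * y i j v ^+ 2); [rewrite sqr_sqrtr ?(ltW (d_gt0 i)) //; ring|rewrite exprMn].
case: (ord_sumP s) (zero) => -[i ->]; case: (ord_sumP t) => -[j ->] zero'.
- by apply: zero' => om; exact: cov_h_tt.
- by rewrite varl varr mulr1.
- rewrite varl varr mul1r; apply: leT (tb j i); apply: eq_ler.
 by apply: eq_EE => om; rewrite (mh_sym om).1.
- by apply: zero' => om; exact: cov_h_bb.
Qed.

Lemma cov_mS s t : @mS _ cov_model s t = if cov_top s (+) cov_top t then cov_var s * cov_var t / N%:R else 0.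
Proof.
have tb i j : @mS _ cov_model (lshift N i) (rshift M j) = d i / N%:R.
 rewrite /mS (cov_mE i j (fun h => h ^+ 2)).
 rewrite (eq_bigr (fun v => d i * (q i j v * y i j v ^+ 2))).
  by rewrite -mulr_sumr y_var.
 by move=> v _; rewrite exprMn sqr_sqrtr ?(ltW (d_gt0 i)) //; ring.
have z0 : (forall om : mOm cov_model, mh om s t = 0) -> @mS _ cov_model s t = 0.
 move=> h0; rewrite /mS /mE (eq_EE _ (G := fun => 0)); last by move=> om; rewrite h0 expr0n.
 exact: EEC (@mlaw_sum1 _ cov_model) 0.
case: (ord_sumP s) (z0) => -[i ->]; case: (ord_sumP t) => -[j ->]; rewrite ?topl ?topr /= => z0'.
- by apply: z0' => om; exact: cov_h_tt.
- by rewrite varl varr mulr1.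
- rewrite varl varr mul1r -(tb j i); apply: eq_EE => om; by rewrite (mh_sym om).1.
- by apply: z0' => om; exact: cov_h_bb.
Qed.

Lemma cov_bipartite : @bipartite _ cov_model cov_top.
Proof.
split=> [s t|s|]; first exact: cov_mS.
 by case: (ord_sumP s) => -[k ->]; rewrite ?topl // => _; exact: varr.
rewrite /= -[RHS]card_ord -(card_imset _ (@rshift_inj M N)); apply: eq_card => s; rewrite !inE.
case: (ord_sumP s) => -[k ->]; rewrite ?topl ?topr /=.
 by apply/esym/imsetP => -[j _ /eqP]; rewrite eq_lrshift.
by apply/esym/imsetP; exists k.
Qed.

Lemma cov_row_sum s : \sum_t @mS _ cov_model s t <= cn * vmax.
Proof.
have N0 : 0 < N%:R :> R by sgn.
have vm : 0 <= vmax by exact: leT vmax_ge1.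
have c1 : 1 <= cn.
 rewrite -(ler_pM2r N0) mul1r; apply: leT dim_le; by rewrite ler_nat leq_addl.
have Mle : M%:R <= cn * N%:R by apply: leT dim_le; rewrite ler_nat leq_addr.
rewrite big_split_ord /=; under eq_bigr => i _ do rewrite cov_mS topl.
under [X in _ + X]eq_bigr => i _ do rewrite cov_mS topr.
case: (ord_sumP s) => -[k ->]; rewrite ?topl ?topr /=.
 rewrite big1 // add0r (eq_bigr (fun => d k / N%:R)); last by move=> j _; rewrite varl varr mulr1.
 rewrite sumr_const card_ord -[leLHS]mulr_natl mulrC divfK ?gt_eqF //.
 by apply: (leT (d_le k)); rewrite ler_peMl.
rewrite [X in _ + X]big1 // addr0; apply: (le_mid (\sum_(i < M) vmax / N%:R)).
 by apply: ler_sum => i _; rewrite varl varr mul1r; apply: leMr; try sgn.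
by rewrite sumr_const card_ord -[leLHS]mulr_natl mulrA ler_pdivrMr // mulrAC; apply: leMr.
Qed.

Lemma cov_fmuE x : @fmu _ cov_model cov_top x =
 - x^-1 + N%:R%:C^-1 * \sum_i (d i)%:C / (1 + (d i)%:C * x).
Proof.
rewrite /fmu; congr (_ + _ * _); rewrite big_split_ord /= [X in _ + X]big1 ?addr0; last by move=> j; rewrite topr.
by apply: eq_big => i; [rewrite topl|rewrite varl].
Qed.

End CovModel.

(** * Random variables with finitely many values *)

Section FiniteFibers.
Variables (R : realType) (d : measure_display) (Om : measurableType d) (P : probability Om R).
Variables (F : finType) (g : Om -> F).
Hypothesis mg : forall f, measurable (g @^-1` [set f]).

Definition fib f : R := fine (P (g @^-1` [set f])).

Lemma fibE f : P (g @^-1` [set f]) = (fib f)%:E.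
Proof. by rewrite fineK // fin_num_measure. Qed.

Lemma fib_ge0 f : 0 <= fib f.
Proof. by rewrite fine_ge0. Qed.

Lemma fin_measurable (A : set F) : measurable (g @^-1` A).
Proof.
rewrite (_ : g @^-1` A = \bigcup_(f in A) g @^-1` [set f]).
 by apply: fin_bigcup_measurable => [|f _]; [exact: finite_finset|exact: mg].
by apply/seteqP; split=> [w Aw|w [f Af e]]; [exists (g w)|rewrite /preimage /= e].
Qed.

Lemma fin_integral (h : F -> R) : (\int[P]_w (h (g w))%:E = (\sum_f fib f * h f)%:E)%E.
Proof.
have iI f : P.-integrable setT (fun w => (\1_(g @^-1` [set f]) w)%:E) by exact: integrable_indic.
rewrite (eq_integral (fun w => \sum_f ((h f)%:E * (\1_(g @^-1` [set f]) w)%:E)))%E; last first.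
 move=> w _; rewrite (bigD1 (g w)) //= big1 ?addr0.
  by rewrite indicE mem_set // mule1.
 by move=> f fg; rewrite indicE memNset ?mule0 // => /= e; rewrite e eqxx in fg.
rewrite integral_sum //; last by move=> f; exact: integrableZl.
rewrite -sumEFin; apply: eq_bigr => f _.
by rewrite integralZl // integral_indic // setIT muleC EFinM; congr (_ * _)%E; exact: fibE.
Qed.

Lemma fin_prob (A : set F) : P (g @^-1` A) = (\sum_f fib f * (`[< A f >])%:R)%:E.
Proof.
rewrite -fin_integral -[g @^-1` A]setIT -integral_indic //; last exact: fin_measurable.
Qed.

Lemma fib_sum1 : \sum_f fib f = 1.
Proof.
have := fin_prob setT; rewrite preimage_setT probability_setT => -[->].
by apply: eq_bigr => f _; rewrite asboolT // mulr1.
Qed.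

End FiniteFibers.

(** * Rounding real numbers to a finite grid *)

Section Grid.
Variables (R : realType) (n : nat).
Notation s := (n.+1%:R : R).
(** Cutoff and inverse mesh are both [s = n + 1]: [2 s^2] cells of length [1/s] cover [[-s, s]]. One
    more value, the successor in the type of cells, represents the right end. *)
Definition grid_dim : nat := (2 * n.+1 ^ 2)%N.
Definition grid_clamp (x : R) : R := Num.min (Num.max x (- s)) s.
Definition grid_cell (x : R) : 'I_grid_dim.+1 := inord (Num.truncn (s * (grid_clamp x + s))).
Definition grid_val (v : 'I_grid_dim.+1) : R := v%:R / s - s.

Let s_gt0 : 0 < s. Proof. sgn. Qed.
Let clamp_bnd x : - s <= grid_clamp x <= s.
Proof.
rewrite /grid_clamp; apply/andP; split; last by rewrite ge_min lexx orbT.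
by rewrite le_min le_max lexx orbT /=; move: s_gt0; lra.
Qed.

Let cell_bnd x : (grid_cell x)%:R <= s * (grid_clamp x + s) < (grid_cell x).+1%:R.
Proof.
have /andP[c1 c2] := clamp_bnd x.
have y0 : 0 <= s * (grid_clamp x + s) by apply: mulr_ge0; [exact: ltW|lra].
have := truncn_itv y0; rewrite /grid_cell inordK //.
have /andP[h _] := truncn_itv y0; rewrite ltnS -(ler_nat R); apply: (leT h).
rewrite /grid_dim natrM natrX expr2; move: s_gt0 c2; nra.
Qed.

Lemma grid_val_clamp x : `|grid_val (grid_cell x) - grid_clamp x| <= s^-1 /\ grid_val (grid_cell x) <= grid_clamp x.
Proof.
have /andP[h1 h2] := cell_bnd x; rewrite -natr1 in h2.
have e : grid_val (grid_cell x) - grid_clamp x = ((grid_cell x)%:R - s * (grid_clamp x + s)) / s.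
 by rewrite /grid_val; field; rewrite gt_eqF.
split; last by rewrite -subr_le0 e pmulr_lle0 ?invr_gt0 //; lra.
rewrite e normrM [`|s^-1|]ger0_norm ?invr_ge0 ?(ltW s_gt0) // ler_piMl ?invr_ge0 ?(ltW s_gt0) //.
by rewrite ler_norml; apply/andP; split; lra.
Qed.

Lemma grid_near x : `|x| <= s -> `|grid_val (grid_cell x) - x| <= s^-1.
Proof.
rewrite ler_norml => /andP[x1 x2]; have [h _] := grid_val_clamp x.
suff e : grid_clamp x = x by rewrite e in h.
by rewrite /grid_clamp (max_idPl x1) (min_idPl x2).
Qed.

Lemma grid_abs x : `|grid_val (grid_cell x)| <= `|x| + s^-1.
Proof.
have [h _] := grid_val_clamp x.
have c : `|grid_clamp x| <= `|x|.
 have := normr_ge0 x; have := ler_norm x; have : - x <= `|x| by rewrite -normrN ler_norm.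
 rewrite ler_norml /grid_clamp => h1 h2 h3; apply/andP; split.
  by rewrite le_min le_max; apply/andP; split; [apply/orP; left|move: s_gt0]; lra.
 by rewrite ge_min ge_max; have [xs|xs] := leP `|x| s; apply/orP; [left; apply/andP; split|right]; move: s_gt0; lra.
rewrite -[grid_val _](subrK (grid_clamp x)); apply: (leT (ler_normD _ _)).
by rewrite addrC; apply: lerD.
Qed.

Lemma grid_measurable v : measurable [set x | grid_cell x = v].
Proof.
pose y (x : R) := s * (grid_clamp x + s).
have my : measurable_fun setT y.
 apply: measurable_funM => //; apply: measurable_funD => //.
 by apply: measurable_minr => //; apply: measurable_maxr.
rewrite (_ : [set x | _] = setT `&` y @^-1` [set` `[v%:R, v.+1%:R[]).
 by apply: my => //; exact: measurable_itv.
rewrite setTI; apply/seteqP; split=> [x <- /=|x /=]; rewrite in_itv /=; first exact: cell_bnd.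
move=> /truncn_def h; apply: val_inj; rewrite /grid_cell /= inordK h //.
Qed.

End Grid.

Lemma powD_le (R : realDomainType) (a b : R) k : 0 <= a -> 0 <= b -> (a + b) ^+ k <= 2 ^+ k * (a ^+ k + b ^+ k).
Proof.
move=> a0 b0; wlog ab : a b a0 b0 / a <= b => [H|].
 by have [ab|ba] := leP a b; [exact: H|rewrite addrC [a ^+ k + _]addrC; apply: H => //; exact: ltW].
apply: (le_mid ((2 * b) ^+ k)).
 by apply: ler_Xn; rewrite ?addr_ge0 ?mulr_ge0 //; lra.
by rewrite exprMn leMl ?exprn_ge0 // lerDr exprn_ge0.
Qed.

(** * Discretization with exact mean and variance *)

Section DiscretizedVariable.
Variables (R : realType) (d : measure_display) (Om : measurableType d) (P : probability Om R).
Variables (X : {RV P >-> R}) (N : nat) (C : nat -> R).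
Hypotheses (N_gt0 : (0 < N)%N) (X_mean : ('E_P[X] = 0)%E)
 (X_var : ('E_P[(fun w => `|X w| ^+ 2)%R] = (N%:R^-1)%:E)%E)
 (X_mom : forall p, ('E_P[(fun w => `|sqrt N%:R * X w| ^+ p)%R] <= (C p)%:E)%E).
Let mX : measurable_fun setT X. Proof. exact: measurable_funPT. Qed.
Let Nr0 : 0 < N%:R :> R. Proof. sgn. Qed.

Definition dcell n w := grid_cell n (X w).

Lemma dcell_measurable n v : measurable (dcell n @^-1` [set v]).
Proof.
have := mX measurableT (grid_measurable (v : 'I_(grid_dim n).+1)); rewrite setTI; exact.
Qed.

Definition dlaw n := fib P (dcell n).
Arguments dlaw : clear implicits.
Definition dmean n : R := \sum_v dlaw n v * @grid_val R n v.
Definition dvar n : R := \sum_v dlaw n v * @grid_val R n v ^+ 2 - dmean n ^+ 2.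
(** Rounding disturbs mean and variance slightly, while [bipartite] fixes the variances exactly;
    hence the recentring and rescaling. *)
Definition dval n v : R := (@grid_val R n v - dmean n) / sqrt (N%:R * dvar n).

Let psi n w : R := grid_val R (dcell n w).
Let inv_cvg : (fun n : nat => n.+1%:R^-1 : R) @ \oo --> (0 : R).
Proof. exact: cvg_harmonic. Qed.
Let psi_cvg w : psi n w @[n --> \oo] --> X w.
Proof.
apply/cvgrPdist_le => e e0; near=> n.
have : n.+1%:R^-1 <= e.
 have : `|(n.+1%:R^-1 : R)| <= e by near: n; move/cvgr0_norm_le: inv_cvg => /(_ _ e0).
 by rewrite ger0_norm.
apply: leT; rewrite distrC; apply: grid_near.
have : `|X w| < n%:R by near: n; exact: nbhs_infty_gtr.
by move=> h; rewrite -natr1; lra.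
Unshelve. all: by end_near. Qed.

Let psi_abs n w : `|psi n w| <= `|X w| + n.+1%:R^-1.
Proof. exact: grid_abs. Qed.
Let inv_le1 n : (n.+1%:R^-1 : R) <= 1.
Proof. by rewrite invf_le1 // ler1n. Qed.
Let mgrid n (h : 'I_(grid_dim n).+1 -> R) : measurable_fun setT (fun w => h (dcell n w)).
Proof.
move=> _ Y mY; rewrite setTI (_ : _ @^-1` Y = dcell n @^-1` (h @^-1` Y)) //.
by apply: fin_measurable; exact: dcell_measurable.
Qed.

Let X2_int : P.-integrable setT (fun w => (`|X w| ^+ 2)%:E).
Proof.
apply/integrableP; split.
 by apply/measurable_EFinP; apply: measurable_funX; exact: measurableT_comp.
rewrite (eq_integral (fun w => (`|X w| ^+ 2)%:E)).
 by have := X_var; rewrite unlock => ->; exact: ltry.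
by move=> w _; rewrite gee0_abs // lee_fin sqr_ge0.
Qed.

Let dom_int : P.-integrable setT (fun w => (2 * `|X w| ^+ 2 + 2)%:E).
Proof.
have i2 : P.-integrable setT (fun=> 2%:E : \bar R) by exact: finite_measure_integrable_cst.
have := integrableD measurableT (integrableZl measurableT 2 X2_int) i2.
by apply: eq_integrable => // w _; rewrite /= EFinD EFinM.
Qed.

(** Dominated convergence with a multiple of [X^2 + 1] as majorant; it applies since the rounding
    error is at most 1. *)
Let psi_dct k (f : Om -> R) : (k <= 2)%N -> measurable_fun setT f -> (forall w, f w = X w ^+ k) ->
 \sum_v dlaw n v * @grid_val R n v ^+ k @[n --> \oo] --> fine (\int[P]_w (f w)%:E)%E.
Proof.
move=> k2 mf fE.
have m1 n : measurable_fun setT (fun w => (psi n w ^+ k)%:E).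
 by apply/measurable_EFinP; exact: (mgrid (fun v => grid_val R v ^+ k)).
have m2 : measurable_fun setT (fun w => (f w)%:E) by exact/measurable_EFinP.
have c1 : {ae P, forall w, setT w -> (psi n w ^+ k)%:E @[n --> \oo] --> (f w)%:E}.
 apply: aeW => w _; rewrite fE; apply: cvg_EFin; first exact: nearW.
 by rewrite /comp /=; elim: k {k2 m1 fE} => [|k IH]; [exact: cvg_cst|rewrite exprS; under eq_cvg do rewrite exprS; apply: cvgM].
have b1 : {ae P, forall w n, setT w -> (`|(psi n w ^+ k)%:E| <= (2 * `|X w| ^+ 2 + 2)%:E)%E}.
 apply: aeW => w n _; rewrite lee_fin normrX.
 have ab1 : `|psi n w| <= `|X w| + 1 by apply: (leT (psi_abs n w)); rewrite lerD2l.
 have := normr_ge0 (X w); have := normr_ge0 (psi n w); move: ab1; move: (`|psi n w|) (`|X w|) => a b ab a0 b0.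
 have b1 := sqr_ge0 (b - 1); have b2 := sqr_ge0 b; rewrite sqrrB expr1n mulr1 in b1.
 case: k k2 {fE m1 c1} => [|[|[]]] // _; rewrite ?expr0 ?expr1; [lra|lra|].
 have : a * a <= (b + 1) * (b + 1) by apply: ler_pM.
 by move: b1; rewrite !expr2; lra.
have [i1 _ i3] := dominated_convergence measurableT m1 m2 c1 dom_int b1.
have c2 : (\sum_v dlaw n v * grid_val R v ^+ k)%:E @[n --> \oo] --> (fine (\int[P]_w (f w)%:E)%E)%:E.
 rewrite fineK; last exact: integrable_fin_num.
 apply: cvg_trans i3; apply: near_eq_cvg; apply: nearW => n /=.
 by rewrite (fin_integral P (@dcell_measurable n) (fun v => grid_val R v ^+ k)).
exact: fine_cvg c2.
Qed.

Let X1_eq : (\int[P]_w (X w)%:E = 0)%E.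
Proof. by have := X_mean; rewrite unlock. Qed.
Let mean_cvg : dmean n @[n --> \oo] --> (0 : R).
Proof.
have := @psi_dct 1%N X isT mX (fun w => esym (expr1 _)); rewrite X1_eq /=.
by under eq_cvg do under eq_bigr do rewrite expr1.
Qed.

Let var_cvg : dvar n @[n --> \oo] --> (N%:R^-1 : R).
Proof.
have h2 := @psi_dct 2%N (fun w => X w ^+ 2) isT (measurable_funX _ mX) (fun w => erefl).
rewrite [fine _](_ : _ = N%:R^-1) in h2; last first.
 have := X_var; rewrite unlock => e; rewrite -[RHS]/(fine (N%:R^-1)%:E) -e.
 by congr fine; apply: eq_integral => w _; rewrite real_normK // num_real.
rewrite -[N%:R^-1]subr0 -[X in _ - X](mulr0 0); apply: cvgB => //.
by under eq_cvg do rewrite expr2; apply: cvgM.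
Qed.

Lemma dval_cvg w : dval (dcell n w) @[n --> \oo] --> X w.
Proof.
rewrite (_ : X w = (X w - 0) / sqrt (N%:R * N%:R^-1)); last first.
 by rewrite mulfV ?gt_eqF // sqrtr1 divr1 subr0.
apply: cvgM; first by apply: cvgB; [exact: psi_cvg|exact: mean_cvg].
apply: cvgV; first by rewrite mulfV ?gt_eqF // sqrtr1 oner_neq0.
have h : N%:R * dvar n @[n --> \oo] --> (N%:R * N%:R^-1 : R) by apply: cvgM; [exact: cvg_cst|exact: var_cvg].
exact: (cvg_comp _ _ h (@sqrt_continuous R _)).
Qed.

(** True for all large [n] at fixed [N]. Mesh and mean are small on the scale [N^(-1/2)] of the
    entries and the variance is comparable to [1/N], which makes the moment constants independent of
    [n] and [N]. *)
Definition dgood n : Prop :=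
 [/\ (N <= n)%N, sqrt N%:R * `|dmean n| <= 1 & (4 * N%:R)^-1 <= dvar n].

Lemma dgood_near : \forall n \near \oo, dgood n.
Proof.
have s0 : 0 < (sqrt N%:R)^-1 :> R by sgn.
have v0 : (4 * N%:R)^-1 < N%:R^-1 :> R by rewrite ltf_pV2 ?posrE ?mulr_gt0 //; move: Nr0; lra.
near=> n; split; first by near: n; exact: nbhs_infty_ge.
 rewrite mulrC -ler_pdivlMr ?sqrtr_gt0 // mul1r; near: n.
 by move/cvgr0_norm_le: mean_cvg => /(_ _ s0).
by near: n; move/cvgr_ge: var_cvg; apply.
Unshelve. all: by end_near. Qed.

Section Good.
Variable n : nat.
Hypothesis gn : dgood n.
Let v_gt0 : 0 < dvar n.
Proof. by have [_ _] := gn; apply: lt_le_trans; rewrite invr_gt0 mulr_gt0. Qed.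
Let law1 : \sum_v dlaw n v = 1.
Proof. exact: fib_sum1 (@dcell_measurable n). Qed.
Let Nv : 0 < N%:R * dvar n. Proof. exact: mulr_gt0. Qed.

Lemma dlaw_mean : \sum_v dlaw n v * dval v = 0.
Proof.
rewrite (eq_bigr (fun v => (dlaw n v * grid_val R v - dlaw n v * dmean n) / sqrt (N%:R * dvar n))); last first.
 by move=> v _; rewrite /dval; ring.
by rewrite -mulr_suml sumrB -mulr_suml law1 mul1r subrr mul0r.
Qed.

Lemma dlaw_var : \sum_v dlaw n v * dval v ^+ 2 = N%:R^-1.
Proof.
rewrite (eq_bigr (fun v => (dlaw n v * grid_val R v ^+ 2 - 2 * dmean n * (dlaw n v * grid_val R v) + dmean n ^+ 2 * dlaw n v)
  / (N%:R * dvar n))); last first.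
 by move=> v _; rewrite /dval expr_div_n sqr_sqrtr ?(ltW Nv) //; move: (N%:R * _)^-1 => c; ring.
rewrite -mulr_suml big_split /= sumrB -!mulr_sumr law1 -/(dmean n).
rewrite (_ : _ + _ = dvar n); last by rewrite /dvar; ring.
by rewrite invfM mulrCA mulfV ?mulr1 // gt_eqF.
Qed.

(** On that event of levels [N dval^2 <= 4 (|sqrt N X| + 2)^2]: the 4 is due to the variance, and
    the 2 to mesh and mean with 1 each. *)
Lemma dlaw_moment p : \sum_v dlaw n v * (N%:R * dval v ^+ 2) ^+ p <= 64 ^+ p * (`|C (2 * p)%N| + 1).
Proof.
have [Nn mn vn] := gn; set sN := sqrt N%:R in mn *.
have sN0 : 0 < sN by rewrite sqrtr_gt0.
have sN2 : sN ^+ 2 = N%:R by rewrite sqr_sqrtr // ltW.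
have ptw w : (N%:R * dval (dcell n w) ^+ 2) ^+ p <= 16 ^+ p * `|sN * X w| ^+ (2 * p) + 64 ^+ p.
 have e1 : N%:R * dval (dcell n w) ^+ 2 <= 4 * (sN * `|psi n w - dmean n|) ^+ 2.
  rewrite /dval expr_div_n sqr_sqrtr ?(ltW Nv) // -/(psi n w) exprMn sN2 real_normK ?num_real //.
  set q := (psi n w - dmean n) ^+ 2; have q0 : 0 <= q by exact: sqr_ge0.
  rewrite (_ : N%:R * (q / (N%:R * dvar n)) = (dvar n)^-1 * q); last by field; rewrite !gt_eqF.
  rewrite [leRHS]mulrA; apply: leMr => //.
  by rewrite -[leRHS]invrK lef_pV2; sgn.
 have e2 : sN * `|psi n w - dmean n| <= `|sN * X w| + 2.
  have h1 := ler_normB (psi n w) (dmean n); have h2 := psi_abs n w.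
  have h3 : sN * n.+1%:R^-1 <= 1.
  rewrite ler_pdivrMr // mul1r; apply: (le_mid N%:R); last by rewrite ler_nat ltnW.
  rewrite -sN2 expr2 ler_peMr ?(ltW sN0) // -[leLHS]sqrtr1; apply: ler_wsqrtr; by rewrite ler1n.
  move: h2 h3; move: (n.+1%:R^-1 : R) => ni h2 h3.
  rewrite normrM [`|sN|]ger0_norm ?(ltW sN0) //.
  have : sN * `|psi n w - dmean n| <= sN * (`|X w| + ni + `|dmean n|).
  by apply: leMl; [exact: ltW|lra].
  by rewrite !mulrDr; lra.
 apply: (le_mid ((4 * (sN * `|psi n w - dmean n|) ^+ 2) ^+ p)).
  by apply: lerXn2r => //; rewrite nnegrE mulr_ge0 ?sqr_ge0 ?ler0n.
 apply: (le_mid (4 ^+ p * (`|sN * X w| + 2) ^+ (2 * p))).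
  rewrite exprMn -exprM; apply: leMl; first exact: exprn_ge0.
  by leXn.
 apply: (le_mid (4 ^+ p * (2 ^+ (2 * p) * (`|sN * X w| ^+ (2 * p) + 2 ^+ (2 * p))))).
  by apply: leMl; [exact: exprn_ge0|exact: powD_le].
 rewrite [2 ^+ (2 * p)]exprM (_ : 2 ^+ 2 = 4); last by ring.
 have -> : 16 ^+ p = 4 ^+ p * 4 ^+ p :> R by rewrite -exprMn -natrM.
 have -> : 64 ^+ p = 4 ^+ p * (4 ^+ p * 4 ^+ p) :> R by rewrite -!exprMn -!natrM.
 by apply: eq_ler; ring.
rewrite -lee_fin -(fin_integral P (@dcell_measurable n) (fun v => (N%:R * dval v ^+ 2) ^+ p)).
have m1 : measurable_fun setT (fun w => `|sN * X w| ^+ (2 * p)).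
 by apply: measurable_funX; apply: measurableT_comp => //; apply: measurable_funM.
apply: (le_mid (\int[P]_w ((16 ^+ p)%:E * (`|sN * X w| ^+ (2 * p))%:E + (64 ^+ p)%:E))%E).
 apply: ge0_le_integral => //.
 - by move=> w _; rewrite lee_fin exprn_ge0 // mulr_ge0 ?sqr_ge0 // ltW.
 - by apply/measurable_EFinP; exact: (mgrid (fun v => (N%:R * dval v ^+ 2) ^+ p)).
 - by apply: emeasurable_funD => //; apply: emeasurable_funM => //; exact/measurable_EFinP.
 - by move=> w _; rewrite -EFinM -EFinD lee_fin; exact: ptw.
have p16 : (0 <= (16 ^+ p)%:E :> \bar R)%E by rewrite lee_fin exprn_ge0.
have p64 : (0 <= (64 ^+ p)%:E :> \bar R)%E by rewrite lee_fin exprn_ge0.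
have q0 w : (0 <= (`|sN * X w| ^+ (2 * p))%:E)%E by rewrite lee_fin exprn_ge0.
have m2 : measurable_fun setT (fun w => (`|sN * X w| ^+ (2 * p))%:E) by exact/measurable_EFinP.
have m3 : measurable_fun setT (fun w => ((16 ^+ p)%:E * (`|sN * X w| ^+ (2 * p))%:E)%E) by exact: emeasurable_funM.
rewrite (ge0_integralD P measurableT (fun w _ => mule_ge0 p16 (q0 w)) m3 (fun w _ => p64) (measurable_cst _)).
rewrite (ge0_integralZl_EFin P measurableT (fun w _ => q0 w) m2); last sgn.
rewrite integral_cst //= probability_setT mule1.
have := X_mom (2 * p); rewrite unlock -/sN => h.
apply: (le_mid ((16 ^+ p)%:E * (`|C (2 * p)%N|)%:E + (64 ^+ p)%:E)%E).
 apply: leeD2r; apply: lee_wpmul2l; first by rewrite lee_fin exprn_ge0.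
 by apply: (leT h); rewrite lee_fin ler_norm.
rewrite -EFinM -EFinD lee_fin mulrDr mulr1 lerD2r; apply: leMr => //.
by apply: ler_Xn; rewrite //; lra.
Qed.

End Good.
End DiscretizedVariable.

(** The event [c < f] is the increasing union over [m] of the events that all [f_n] with [n >= m]
    exceed [c + 1/(m+1)]. Each of these lies in a single event of level [n], and continuity from
    below concludes. *)
Lemma limit_prob (R : realType) (d : measure_display) (Om : measurableType d) (P : probability Om R)
  (f_ : nat -> Om -> R) (f : Om -> R) (c r : R) (n0 : nat) :
 (forall n c, measurable [set w | c < f_ n w]) -> (forall w, f_ n w @[n --> \oo] --> f w) ->
 (forall n, (n0 <= n)%N -> (P [set w | (c < f_ n w)%R] <= r%:E)%E) ->
 (P [set w | (c < f w)%R] <= r%:E)%E.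
Proof.
move=> mf cf Pf; pose B m := \bigcap_(n in [set n | (m <= n)%N]) [set w | c + m.+1%:R^-1 < f_ n w].
have i0 m : 0 < (m.+1%:R^-1 : R) by sgn.
have mB m : measurable (B m) by apply: bigcap_measurableType => n _; exact: mf.
have -> : [set w | c < f w] = \bigcup_m B m.
 apply/seteqP; split=> [w /= cw|w [m _ Bw] /=]; last first.
  rewrite ltNge; apply/negP => fc.
  have [n1 _ h1] : \forall n \near \oo, f_ n w < c + m.+1%:R^-1.
  by move/cvgr_lt: (cf w); apply; apply: (le_lt_trans fc); rewrite ltrDl.
  have := lt_trans (h1 (maxn m n1) (leq_maxr _ _)) (Bw (maxn m n1) (leq_maxl _ _)); by rewrite ltxx.
 pose e := (f w - c) / 2; have e0 : 0 < e by rewrite /e; lra.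
 have [n1 _ h1] : \forall n \near \oo, c + e < f_ n w.
  by move/cvgr_gt: (cf w); apply; rewrite /e; lra.
 have [n2 _ h2] : \forall n \near \oo, `|n.+1%:R^-1| <= e.
  by move/cvgr0_norm_le: (@cvg_harmonic R) => /(_ _ e0).
 exists (maxn n1 n2) => // n /= nn; apply: le_lt_trans (h1 n (leq_trans (leq_maxl _ _) nn)).
 by rewrite lerD2l; apply: leT (h2 _ (leq_maxr n1 n2)); exact: ler_norm.
have ndB : nondecreasing_seq B.
 move=> m m' mm; apply/subsetPset => w Bw n /= nn.
 apply: le_lt_trans (Bw n (leq_trans mm nn)).
 by rewrite lerD2l lef_pV2 ?posrE ?ltr0n // ler_nat.
have cvB := @nondecreasing_cvg_mu _ _ _ P B mB (bigcupT_measurable _ mB) ndB.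
rewrite -(cvg_lim _ cvB) //; apply: lime_le; first by apply/cvg_ex; eexists; exact: cvB.
apply: nearW => m /=; apply: leT (Pf (maxn m n0) (leq_maxr _ _)).
apply: le_measure; rewrite ?inE; [exact: mB|exact: mf|].
by move=> w /(_ (maxn m n0) (leq_maxl _ _)) /=; apply: lt_trans; rewrite ltrDl.
Qed.

(** * Passage from discretized to given entries *)

Section Transfer.
Variables (R : realType) (d : measure_display) (Om : measurableType d) (P : probability Om R).
Variables (M N : nat) (X : 'I_M -> 'I_N -> {RV P >-> R}) (dg : 'I_M -> R).
Hypotheses (dg_gt0 : forall i, 0 < dg i) (X_indep : mutually_independent (fun k : 'I_M * 'I_N => X k.1 k.2)).

Let q n i j v : R := @dlaw R d Om P (X i j) n v.
Let y n i j v : R := @dval R d Om P (X i j) N n v.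
Arguments q : clear implicits.
Arguments y : clear implicits.
Let q_ge0 n i j v : 0 <= q n i j v. Proof. exact: fib_ge0. Qed.
Let q_sum1 n i j : \sum_v q n i j v = 1. Proof. exact: fib_sum1 (dcell_measurable (X i j) (n := n)). Qed.
Let y_mean n i j : \sum_v q n i j v * y n i j v = 0. Proof. exact: dlaw_mean. Qed.

Definition disc_model n : model R :=
 @cov_model R M N (grid_dim n) dg (q n) (y n) (@q_ge0 n) (@q_sum1 n) (@y_mean n).

Definition disc_om n (w : Om) : mOm (disc_model n) :=
 [ffun k => if @coord_pair M N k is Some c then dcell (X c.1 c.2) n w else ord0].

Let no_junk n (f : mOm (disc_model n)) := [forall k, (@coord_pair M N k == None) ==> (f k == ord0)].
Let fiberE n (f : mOm (disc_model n)) : disc_om n @^-1` [set f] =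
 if no_junk f then \bigcap_(c in [set` [set: 'I_M * 'I_N]%SET])
  (X c.1 c.2 @^-1` [set x | grid_cell n x = f (pair_coord c)]) else set0.
Proof.
case: ifPn => [/forallP nj|nj]; apply/seteqP; split=> w //=.
- by move=> <- c _ /=; rewrite ffunE pair_coordK.
- move=> h; apply/ffunP => k; rewrite ffunE; case e : (coord_pair k) => [c|].
  have := h c; rewrite /= inE => /(_ isT); rewrite /dcell => ->.
  by move: e; rewrite /coord_pair; case: pickP => // c' /eqP <- [<-].
 by have /implyP/(_ (introT eqP e))/eqP -> := nj k.
- move=> e; case/negP: nj; apply/forallP => k; apply/implyP => /eqP kn.
 by rewrite -e ffunE kn.
Qed.

Let cell_meas n (v : 'I_(grid_dim n).+1) c : measurable (X c.1 c.2 @^-1` [set x | grid_cell n x = v]).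
Proof. exact: dcell_measurable (X c.1 c.2) n v. Qed.

Lemma disc_om_measurable n (f : mOm (disc_model n)) : measurable (disc_om n @^-1` [set f]).
Proof.
rewrite fiberE; case: ifP => // _; apply: fin_bigcap_measurable => [|c _]; [exact: finite_finset|exact: cell_meas].
Qed.

(** Independence of the entries makes the discretized matrix distributed by the product law. A
    configuration that is not at its default off the matrix coordinates has mass zero on both
    sides. *)
Lemma disc_om_fib n (f : mOm (disc_model n)) : P (disc_om n @^-1` [set f]) = (pr (@mlaw _ (disc_model n)) f)%:E.
Proof.
rewrite fiberE; case: ifPn => [/forallP nj|]; last first.
 rewrite negb_forall => /existsP [k]; rewrite negb_imply => /andP[/eqP kn /negbTE fk].
 rewrite measure0 /pr (bigD1 k) //= /cov_law kn fk mul0r //.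
rewrite (X_indep _ (B := fun c => [set x | grid_cell n x = f (pair_coord c)])); last first.
 by move=> c; exact: grid_measurable.
rewrite /pr (bigID (fun k => isSome (@coord_pair M N k))) /= [X in (_ * X)%:E]big1 ?mulr1; last first.
 move=> k; rewrite /cov_law; case e : (coord_pair k) => [//|] _.
 by have /implyP/(_ (introT eqP e)) -> := nj k.
rewrite (reindex_omap (@pair_coord M N) (@coord_pair M N)); last first.
 move=> k; rewrite /coord_pair; by case: pickP => // c /eqP /= ->.
rewrite -prodEFin; apply: eq_big => [c|c _]; first by rewrite inE pair_coordK eqxx.
rewrite /cov_law pair_coordK; exact: (fibE P (@dcell_measurable _ _ _ _ (X c.1 c.2) n) (f (pair_coord c))).
Qed.

Lemma disc_prob n (A : mOm (disc_model n) -> Prop) : P [set w | A (disc_om n w)] = (mpr A)%:E.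
Proof.
have := fin_prob P (@disc_om_measurable n) A; rewrite /preimage => ->; congr (_%:E).
by rewrite /mpr /mE /EE; apply: eq_bigr => f _; rewrite /fib disc_om_fib.
Qed.

Definition entrywise_cts (xi : 'M[R]_(M, N) -> R) : Prop := forall (A_ : nat -> 'M[R]_(M, N)) (A : 'M[R]_(M, N)),
 (forall i j, A_ n i j @[n --> \oo] --> A i j) -> xi (A_ n) @[n --> \oo] --> xi A.

Variable C : nat -> R.
Hypotheses (N_gt0 : (0 < N)%N) (X_mean : forall i j, ('E_P[X i j] = 0)%E)
 (X_var : forall i j, ('E_P[(fun w => `|X i j w| ^+ 2)%R] = (N%:R^-1)%:E)%E)
 (X_mom : forall p i j, ('E_P[(fun w => `|sqrt N%:R * X i j w| ^+ p)%R] <= (C p)%:E)%E).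

Definition disc_good n : Prop := forall i j, dgood (X i j) N n.
Definition disc_kap p : R := 64 ^+ p * (`|C (2 * p)%N| + 1).
Definition disc_sample n (om : mOm (disc_model n)) : 'M[R]_(M, N) := cov_sample (y := y n) om.

Lemma disc_good_near : \forall n \near \oo, disc_good n.
Proof.
apply: filter_forall => i; apply: filter_forall => j.
exact: dgood_near (X_mean i j) (X_var i j).
Qed.

Section GoodLevel.
Variables (n : nat) (cn vmax : R).
Hypotheses (gn : disc_good n) (dim_le : (M + N)%:R <= cn * N%:R) (dg_le : forall i, dg i <= vmax)
 (vmax_ge1 : 1 <= vmax).
Let kap1 p : 1 <= disc_kap p.
Proof.
have : 1 <= 64 ^+ p :> R by rewrite exprn_ege1 // ler1n.
have := normr_ge0 (C (2 * p)%N); rewrite /disc_kap; nra.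
Qed.
Let mom i j p : \sum_v q n i j v * (N%:R * y n i j v ^+ 2) ^+ p <= disc_kap p.
Proof. exact: (@dlaw_moment R d Om P (X i j) N C N_gt0 (fun p => X_mom p i j) n (gn i j) p). Qed.
Let vr i j : \sum_v q n i j v * y n i j v ^+ 2 = N%:R^-1.
Proof. exact: (@dlaw_var R d Om P (X i j) N N_gt0 n (gn i j)). Qed.

Lemma disc_good_model : good_model disc_kap cn vmax (disc_model n).
Proof. by apply: cov_good => // *; (exact: mom || exact: vr || exact: kap1). Qed.
Lemma disc_bipartite : @bipartite _ (disc_model n) (@cov_top M N).
Proof. by apply: cov_bipartite => // *; (exact: mom || exact: vr || exact: kap1). Qed.
Lemma disc_row_sum s : \sum_t @mS _ (disc_model n) s t <= cn * vmax.
Proof. by apply: cov_row_sum => // *; (exact: mom || exact: vr || exact: kap1). Qed.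
End GoodLevel.

(** Pointwise convergence of the entries and continuity of [xi] let a tail bound that holds at every
    good level pass to the limit for fixed [N]. *)
Lemma transfer_prob (xi : 'M[R]_(M, N) -> R) (c r : R) : entrywise_cts xi ->
 (forall n, disc_good n -> mpr (fun om : mOm (disc_model n) => c < xi (disc_sample om)) <= r) ->
 (P [set w | (c < xi (\matrix_(i, j) X i j w))%R] <= r%:E)%E.
Proof.
move=> xc H; have [n0 _ Hn0] := disc_good_near.
apply: (@limit_prob _ _ _ P (fun n w => xi (disc_sample (disc_om n w))) _ c r n0) => [n c'|w|n nn].
- exact: fin_measurable (@disc_om_measurable n) [set om | c' < xi (disc_sample om)].
- apply: xc => i j; rewrite mxE; under eq_cvg do rewrite mxE ffunE pair_coordK.
 exact: dval_cvg.
- by rewrite (disc_prob (fun om => c < xi (disc_sample om))) lee_fin; apply: H; exact: Hn0.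
Qed.

End Transfer.

(** * The population spectrum and the master equation *)

Lemma positive_definite_cov_gt0 (R : realType) M (T : 'M[R]_M) i : positive_definite T -> 0 < population_cov T i i.
Proof.
move=> [_ /(_ (delta_mx 0 i))]; have d0 : (delta_mx 0 i : 'rV[R]_M) != 0.
 by apply/eqP => /rowP/(_ i); rewrite !mxE !eqxx => /eqP; rewrite oner_eq0.
move=> /(_ d0); rewrite -rowE trmx_delta -colE !mxE => Tii.
rewrite (bigD1 i) //= ltr_pwDl ?mxE; try sgn.
by apply: sumr_ge0 => j _; rewrite mxE -expr2 sqr_ge0.
Qed.

Lemma diag_mx_diagonal (R : realType) M (A : 'M[R]_M) : is_diag_mx A -> A = diag_mx (\row_i A i i).
Proof.
move=> /is_diag_mxP h; apply/matrixP => i j; rewrite !mxE; have [->|ij] := eqVneq i j; first by rewrite mulr1n.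
by rewrite mulr0n h.
Qed.

Section Spectrum.
Variables (R : realType) (M N : nat) (Sg : 'M[R]_M) (sigma : M.-tuple R).
Hypotheses (Sdiag : is_diag_mx Sg) (Sgt0 : forall i, 0 < Sg i i) (eig : eigenvalues_of Sg sigma).

Lemma eigenvalues_diag : perm_eq sigma [seq Sg i i | i <- enum 'I_M].
Proof.
have [_ h] := eig; apply: (@prod_XsubC_eq R); rewrite -h char_poly_trig ?big_map ?big_enum //.
apply/is_trig_mxP => i j ij; have /is_diag_mxP := Sdiag; apply; by rewrite neq_ltn ij.
Qed.

Lemma diag_eigenvalue i : exists j, Sg i i = tnth sigma j.
Proof.
have : Sg i i \in sigma by rewrite (perm_mem eigenvalues_diag); apply/map_f; rewrite mem_enum.
by move=> /tnthP [j ->]; exists j.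
Qed.

Lemma sum_eigenvalues (V : nmodType) (F : R -> V) : \sum_i F (tnth sigma i) = \sum_i F (Sg i i).
Proof.
by rewrite -(big_tuple _ _ sigma predT F) (perm_big _ eigenvalues_diag) big_map big_enum.
Qed.

(** The weight of a distinct eigenvalue counts its multiplicity, so the sum over distinct values
    becomes one over the diagonal; positivity makes the filter on nonzero values void. *)
Lemma sum_esd (g : R -> R[i]) :
 \sum_(s <- undup [seq t <- sigma | t != 0]) (esd sigma [set s])%:C * g s = M%:R%:C^-1 * \sum_i g (Sg i i).
Proof.
rewrite -sum_eigenvalues /esd.
under eq_bigr => s _ do rewrite rmorphM /= fmorphV /= rmorph_sum -mulrA /=.
rewrite -mulr_sumr; congr (_ * _).
under eq_bigr => s _ do rewrite mulr_suml.
rewrite exchange_big /=; apply: eq_bigr => i _.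
have sn0 : tnth sigma i != 0.
 have : tnth sigma i \in sigma by exact: mem_tnth.
 by rewrite (perm_mem eigenvalues_diag) => /mapP [j _ ->]; rewrite gt_eqF.
rewrite (bigD1_seq (tnth sigma i)) ?undup_uniq //=; last by rewrite mem_undup mem_filter sn0 mem_tnth.
rewrite indicE mem_set // mul1r big1 ?addr0 // => s si.
by rewrite indicE memNset ?mul0r // => /= e; rewrite e eqxx in si.
Qed.

Lemma master_fE x : master_f N sigma x =
 - x^-1 + N%:R%:C^-1 * \sum_i (Sg i i)%:C / (1 + (Sg i i)%:C * x).
Proof.
(* For [M = 0] the factor [1/M] does not cancel, and both sums vanish. *)
have [M0|M0] := posnP M.
 rewrite /master_f; congr (_ + _).
 have z (F : 'I_M -> R[i]) : \sum_i F i = 0 by apply: big1 => i _; have := ltn_ord i; rewrite {2}M0.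
 by rewrite z mulr0 (_ : Defs.ratio R M N = 0) ?mul0r // /Defs.ratio M0 mul0r.
rewrite /master_f sum_esd mulrA /ratio rmorphM fmorphV /= [_ / _]mulrC -mulrA mulrA.
have MC : M%:R%:C != 0 :> R[i].
 by rewrite realC_eq0 pnatr_eq0 -lt0n.
rewrite mulKf //; congr (_ + _ * _); apply: eq_bigr => i _.
have dn0 : (Sg i i)%:C != 0 :> R[i].
 by rewrite realC_eq0 gt_eqF.
rewrite (_ : 1 + (Sg i i)%:C * x = (Sg i i)%:C * (x + ((Sg i i)^-1)%:C)).
 by rewrite invfM mulrA mulfV // mul1r.
by rewrite fmorphV /= mulrDr mulfV // addrC.
Qed.

End Spectrum.

(** * Continuity and normalization of the matrix entries *)

Section Entries.
Variables (R : realType) (M N : nat) (d : 'I_M -> R).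
Hypothesis d_gt0 : forall i, 0 < d i.
Let Sg : 'M[R]_M := diag_mx (\row_i d i).
Notation var := (@cov_var R M N d).

Definition lin_h (X : 'M[R]_(M, N)) (s t : 'I_(M + N)) : R :=
 match fintype.split s, fintype.split t with
 | inl i, inr j => sqrt (d i) * X i j
 | inr j, inl i => sqrt (d i) * X i j
 | _, _ => 0
 end.

Let spl i : fintype.split (lshift N i : 'I_(M + N)) = inl i.
Proof. by case: split_ordP => j; [move=> /lshift_inj <-|move/eqP; rewrite eq_lrshift]. Qed.
Let spr j : fintype.split (rshift M j : 'I_(M + N)) = inr j.
Proof. by case: split_ordP => k; [move/eqP; rewrite eq_rlshift|move=> /rshift_inj <-]. Qed.

Lemma lin_h_sym X : hsym (lin_h X).
Proof.
split=> [s t|s]; rewrite /lin_h; first by case: (fintype.split s) => ?; case: (fintype.split t).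
by case: (fintype.split s).
Qed.

Lemma lin_h_uniq (h : 'I_(M + N) -> 'I_(M + N) -> R) (X : 'M[R]_(M, N)) : hsym h ->
 (forall i j, h (lshift N i) (lshift N j) = 0) -> (forall i j, h (rshift M i) (rshift M j) = 0) ->
 (forall i j, h (lshift N i) (rshift M j) = sqrt (d i) * X i j) -> lin_h X = h.
Proof.
move=> hs tt bb tb; apply/funext => s; apply/funext => t.
case: (ord_sumP s) => -[i ->]; case: (ord_sumP t) => -[j ->]; rewrite /lin_h ?spl ?spr ?tt ?bb ?tb //.
by rewrite hs.1 tb.
Qed.

Lemma lin_G_mxE X z s t : 0 < Im z ->
 G_mx Sg X z s t = lin_l d z s * Gm (lin_h X) (wz z) fs0 s t * lin_r d z t.
Proof.
by move=> z0; apply: (G_mxE d_gt0 (lin_h_sym X)) => // i j; rewrite /lin_h ?spl ?spr.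
Qed.

Lemma lin_m_empE X z : 0 < Im z ->
 m_emp Sg X z = (N%:R%:C * wz z)^-1 * \sum_i Gm (lin_h X) (wz z) fs0 (rshift M i) (rshift M i).
Proof.
by move=> z0; apply: (m_empE d_gt0 (lin_h_sym X)) => // i j; rewrite /lin_h ?spl ?spr.
Qed.

Lemma lipschitz_cts (xi : 'M[R]_(M, N) -> R) (K : R) : 0 <= K ->
 (forall A A' e, (forall s t, `|lin_h A s t - lin_h A' s t| <= e) -> `|xi A - xi A'| <= K * e) ->
 entrywise_cts xi.
Proof.
move=> K0 xiK A_ A cA; apply/cvgrPdist_le => e e0.
have K1 : 0 < K + 1 by rewrite ltr_wpDl.
have e'0 : 0 < e / (K + 1) by sgn.
have ch s t : lin_h (A_ n) s t @[n --> \oo] --> lin_h A s t.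
 rewrite /lin_h; case: (fintype.split s) => [i|j]; case: (fintype.split t) => [i'|j'];
  (exact: cvg_cst || (apply: cvgM; [exact: cvg_cst|exact: cA])).
have near_h : \forall n \near \oo, forall s t, `|lin_h A s t - lin_h (A_ n) s t| <= e / (K + 1).
 apply: filter_forall => s; apply: filter_forall => t.
 by have /cvgrPdist_le := ch s t; apply.
apply: filterS near_h => n hn; apply: (leT (xiK _ _ _ hn)).
by rewrite mulrA ler_pdivrMr // mulrC; apply: leMl; [exact: ltW|rewrite lerDl].
Qed.

Lemma ler_dist_cabs (a b : R[i]) : `|cabs a - cabs b| <= cabs (a - b).
Proof.
rewrite ler_norml; apply/andP; split.
 by have := cabsD (b - a) a; rewrite subrK cabs_distC; lra.
by have := cabsD (a - b) b; rewrite subrK; lra.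
Qed.

Lemma m_emp_cts z c : 0 < Im z -> entrywise_cts (fun X : 'M[R]_(M, N) => cabs (m_emp Sg X z - c)).
Proof.
move=> z0; have w0 := wz_Im z0; set D := (M + N)%:R ^+ 2 / Im (wz z) ^+ 2 : R.
have D0 : 0 <= D by rewrite divr_ge0 ?sqr_ge0.
apply: (@lipschitz_cts _ (cabs (N%:R%:C * wz z)^-1 * (N%:R * D))).
 sgn.
move=> A A' e h; apply: (leT (ler_dist_cabs _ _)); rewrite opprB addrA subrK !lin_m_empE // -mulrBr -sumrB.
rewrite cabsM -mulrA; apply: leMl; first exact: cabs_ge0.
apply: (leT (cabs_sum _ _ _)); apply: (le_mid (\sum_(i < N) D * e)).
 apply: ler_sum => i _; apply: (leT (Gm_diff_h fs0 _ _ (lin_h_sym A) (lin_h_sym A') w0 h)).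
 by apply: eq_ler; rewrite /D; ring.
by rewrite sumr_const card_ord -[leLHS]mulr_natl mulrA.
Qed.

Lemma under_SigmaE : under_Sigma N Sg = diag_mx (\row_s (var s)%:C).
Proof.
apply/matrixP => s t; rewrite /under_Sigma !mxE /cov_var.
case: split_ordP => i ->; rewrite mxE; case: split_ordP => j ->; rewrite ?mxE.
- rewrite (inj_eq (@lshift_inj _ _)); by case: (i == j).
- by rewrite eq_lrshift.
- by rewrite eq_rlshift.
- by rewrite (inj_eq (@rshift_inj _ _)).
Qed.

Let var_gt0 s : 0 < var s.
Proof. by rewrite /cov_var; case: (fintype.split s). Qed.
Let varC0 s : (var s)%:C != 0.
Proof. by rewrite -cabs_gt0 cabsR gtr0_norm. Qed.

Definition Pi_diag (mz : R[i]) (s : 'I_(M + N)) : R[i] :=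
 match fintype.split s with inl i => - ((d i)%:C / (1 + mz * (d i)%:C)) | inr _ => mz end.

Lemma Pi_mxE mz s t : (forall i, 1 + mz * (d i)%:C != 0) -> Pi_mx N Sg mz s t = Pi_diag mz s *+ (s == t).
Proof.
move=> h; have e : invmx (1%:M + mz *: to_mxC Sg) = diag_mx (\row_i (1 + mz * (d i)%:C)^-1).
 apply: invmx_uniq; apply/matrixP => i j; rewrite mul_mx_diag !mxE.
 have [->|_] := eqVneq i j; last by rewrite !mulr0n rmorph0 mulr0 addr0 mul0r.
 by rewrite !mulr1n mulfV.
rewrite /Pi_mx e !mxE /Pi_diag.
case: (split_ordP s) => i ->; rewrite mxE; case: (split_ordP t) => j ->.
- rewrite mxE mul_mx_diag !mxE (inj_eq (@lshift_inj _ _)).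
 by have [->|_] := eqVneq i j; rewrite ?mulr1n // !mulr0n rmorph0 mul0r oppr0.
- by rewrite mxE eq_lrshift.
- by rewrite mxE eq_rlshift.
- by rewrite mxE (inj_eq (@rshift_inj _ _)).
Qed.

Lemma normalized_entryE X z mz s t : 0 < Im z -> (forall i, 1 + mz * (d i)%:C != 0) ->
 (invmx (under_Sigma N Sg) *m (G_mx Sg X z - Pi_mx N Sg mz) *m invmx (under_Sigma N Sg)) s t =
 (var s)%:C^-1 * (lin_l d z s * Gm (lin_h X) (wz z) fs0 s t * lin_r d z t - Pi_diag mz s *+ (s == t)) * (var t)%:C^-1.
Proof.
move=> z0 h; have e : invmx (under_Sigma N Sg) = diag_mx (\row_s (var s)%:C^-1).
 rewrite under_SigmaE; apply: invmx_uniq; apply/matrixP => i j; rewrite mul_mx_diag !mxE.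
 by have [->|_] := eqVneq i j; rewrite ?mulr1n ?mulr0n ?mul0r // mulfV.
rewrite e mul_mx_diag mul_diag_mx [in LHS]mxE [X in X * _]mxE [(\row_s0 _) _ _]mxE [(\row_s0 _) 0 t]mxE.
have sub (A B : 'M[R[i]]_(M + N)) : (A - B) s t = A s t - B s t by rewrite !mxE.
by rewrite sub lin_G_mxE // Pi_mxE.
Qed.

Lemma normalized_entry_cts z mz s t : 0 < Im z -> (forall i, 1 + mz * (d i)%:C != 0) ->
 entrywise_cts (fun X : 'M[R]_(M, N) =>
  cabs ((invmx (under_Sigma N Sg) *m (G_mx Sg X z - Pi_mx N Sg mz) *m invmx (under_Sigma N Sg)) s t)).
Proof.
move=> z0 h; have w0 := wz_Im z0; set D := (M + N)%:R ^+ 2 / Im (wz z) ^+ 2 : R.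
have D0 : 0 <= D by rewrite divr_ge0 ?sqr_ge0.
set a := (var s)%:C^-1 * lin_l d z s * (lin_r d z t * (var t)%:C^-1).
apply: (@lipschitz_cts _ (cabs a * D)); first sgn.
move=> A A' e hA; apply: (leT (ler_dist_cabs _ _)); rewrite !normalized_entryE //.
rewrite [X in cabs X](_ : _ = a * (Gm (lin_h A) (wz z) fs0 s t - Gm (lin_h A') (wz z) fs0 s t)); last first.
 by rewrite /a; ring.
rewrite cabsM -mulrA; apply: leMl; first exact: cabs_ge0.
apply: (leT (Gm_diff_h fs0 _ _ (lin_h_sym A) (lin_h_sym A') w0 hA)).
by apply: eq_ler; rewrite /D; ring.
Qed.

Lemma lin_lr_le z s L : 0 < Im z -> 1 <= L -> cabs (wz z) <= L -> (cabs (wz z))^-1 <= L ->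
 cabs (lin_l d z s) <= L * sqrt (var s) /\ cabs (lin_r d z s) <= L * sqrt (var s).
Proof.
move=> z0 L1 w1 w2; rewrite /lin_l /lin_r /cov_var; case: (fintype.split s) => i.
 rewrite cabsM cabsR ger0_norm; try sgn.
 by split; [apply: leMr; try sgn|rewrite ler_peMl ?sqrtr_ge0].
by rewrite sqrtr1 mulr1 cabs1 cabsV.
Qed.

(** The scalings [lin_l] and [lin_r] contribute [sqrt (var s)] and [sqrt (var t)]; with the same two
    factors in the resolvent bound they cancel the division by [Sigma] on both sides. *)
Lemma normalized_entry_le X z mz s t (L q : R) : 0 < Im z -> (forall i, 1 + mz * (d i)%:C != 0) ->
 1 <= L -> cabs (wz z) <= L -> (cabs (wz z))^-1 <= L ->
 (forall s t, s != t -> cabs (Gm (lin_h X) (wz z) fs0 s t) <= sqrt (var s * var t) * q) ->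
 (forall s, @cov_top M N s -> cabs (Gm (lin_h X) (wz z) fs0 s s + (wz z * (1 + (var s)%:C * mz))^-1) <= var s * q) ->
 (forall s, ~~ @cov_top M N s -> cabs (Gm (lin_h X) (wz z) fs0 s s - wz z * mz) <= q) ->
 cabs ((invmx (under_Sigma N Sg) *m (G_mx Sg X z - Pi_mx N Sg mz) *m invmx (under_Sigma N Sg)) s t) <= L ^+ 2 * q.
Proof.
move=> z0 h L1 w1 w2 h1 h2 h3; rewrite normalized_entryE //.
have w0 : wz z != 0 by apply: contraTneq (wz_Im z0) => ->; rewrite ltxx.
have LL : L <= L ^+ 2 by rewrite expr2 ler_peMr // (leT ler01).
have L0 : 0 <= L by exact: leT L1.
have [<-|st] := eqVneq s t; last first.
 have s0 : 0 < sqrt (var s) by sgn.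
 have t0 : 0 < sqrt (var t) by sgn.
 have [l1 _] := lin_lr_le s z0 L1 w1 w2; have [_ l2] := lin_lr_le t z0 L1 w1 w2.
 rewrite mulr0n subr0 !cabsM !cabsV !cabsR !gtr0_norm //.
 have hst := h1 _ _ st; rewrite sqrtrM ?(ltW (var_gt0 s)) // in hst.
 have := sqr_sqrtr (ltW (var_gt0 s)); have := sqr_sqrtr (ltW (var_gt0 t)).
 move: (sqrt (var s)) (sqrt (var t)) s0 t0 l1 l2 hst => a b a0 b0 l1 l2 hst <- <-.
 rewrite ler_pdivrMr ?exprn_gt0 // [_ ^- 2 * _]mulrC ler_pdivrMr; try sgn.
 apply: (le_mid (L * a * (a * b * q) * (L * b))).
  by apply: ler_pM; rewrite ?mulr_ge0 ?cabs_ge0 //; lepM.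
 by apply: eq_ler; ring.
rewrite mulr1n; case: (boolP (@cov_top M N s)) => ts.
 have := h2 s ts; have v0 := var_gt0 s; move: ts v0.
 rewrite /cov_top /cov_var /lin_l /lin_r /Pi_diag; case: (fintype.split s) => // i _ v0.
 move: (Gm _ _ _ _ _) => g hg; have hi := h i.
 have sdE : (sqrt (d i))%:C * (sqrt (d i))%:C = (d i)%:C :> R[i].
  by rewrite -rmorphM -expr2 sqr_sqrtr // ltW.
 have dC : (d i)%:C != 0 :> R[i] by rewrite -cabs_gt0 cabsR gtr0_norm.
 have hi' : 1 + (d i)%:C * mz != 0 by rewrite mulrC.
 rewrite (_ : _ * _ * _ = (d i)%:C^-1 * (wz z * (g + (wz z * (1 + (d i)%:C * mz))^-1))); last first.
  rewrite (_ : wz z * (sqrt (d i))%:C * g * (sqrt (d i))%:C = wz z * g * (d i)%:C); last by rewrite -sdE; ring.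
  by rewrite [mz * _]mulrC; field; rewrite ?dC ?w0 ?hi'.
 rewrite cabsM cabsM cabsV cabsR gtr0_norm // mulrC ler_pdivrMr // -mulrA [q * _]mulrC.
 by apply: ler_pM; rewrite ?cabs_ge0 //; apply: (leT w1).
have := h3 s ts; move: ts; rewrite /cov_top /cov_var /lin_l /lin_r /Pi_diag; case: (fintype.split s) => // j _.
move: (Gm _ _ _ _ _) => g hg.
rewrite (_ : _ * _ * _ = (wz z)^-1 * (g - wz z * mz)); last first.
 by rewrite (_ : (1 : R)%:C = 1) //; field.
by rewrite cabsM cabsV; apply: ler_pM; rewrite ?invr_ge0 ?cabs_ge0 //; apply: (leT w2).
Qed.

End Entries.

(** * Verification of the hypotheses and conclusion *)

Section Assembly.
Variables (R : realType) (tau : R) (Cp : nat -> R) (an : nat).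
Hypothesis tau_gt0 : 0 < tau.
Notation t := (tau^-1 : R).
Notation cn := (1 + t).
Notation L := (5 * t ^+ 3).
Hypotheses (an_gt0 : (0 < an)%N) (an_ge : 32 * (cn * t) <= an%:R ^+ 2).
Variables (M : nat -> nat) (T : forall N, 'M[R]_(M N, M N)) (sigma : forall N, (M N).-tuple R).
Variables (d : nat -> measure_display) (Omega : forall N, measurableType (d N)).
Variables (P : forall N, probability (Omega N) R) (X : forall N, 'I_(M N) -> 'I_N -> {RV (P N) >-> R}).
Arguments X : clear implicits.
Variables (m : nat -> R[i] -> R[i]) (S : nat -> set R[i]) (C : R).
Hypotheses (basic : forall N, (0 < N)%N -> basic_assumption tau Cp (T N) (sigma N) (X N))
 (Tdiag : forall N, (0 < N)%N -> is_diag_mx (population_cov (T N)))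
 (Tpos : forall N, (0 < N)%N -> positive_definite (T N))
 (msol : forall N, (0 < N)%N -> solves_master N (sigma N) (m N))
 (Sdom : forall N, (0 < N)%N -> spectral_domain tau N (S N)).
Hypothesis mgap : forall N, (0 < N)%N -> forall z, S N z -> forall i,
 tau <= cabs (1 + m N z * (tnth (sigma N) i)%:C).
Hypotheses (C_ge : an%:R ^+ 2 <= C) (stab : forall N, (0 < N)%N -> stable_on N (sigma N) (m N) (S N) C).

Let dg N i : R := population_cov (T N) i i.

(** Otherwise no ratio [M/N] could lie between [tau] and its inverse. *)
Lemma tau_le1 : tau <= 1.
Proof.
have [[/andP[h1 h2] _] _ _ _ _] := basic (ltn0Sn 0); have {h1 h2} h := leT h1 h2.
rewrite leNgt; apply/negP => t1; have : t < 1 by rewrite invf_lt1.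
by move: h t1; lra.
Qed.
Let t_ge1 : 1 <= t. Proof. by rewrite invf_ge1 // tau_le1. Qed.
Let t_le3 : t <= t ^+ 3. Proof. by rewrite -[leLHS]expr1; apply: ler_weXn2l. Qed.
Let L_ge1 : 1 <= L. Proof. by move: t_le3 t_ge1; lra. Qed.
Let cn_le : cn <= L. Proof. by move: t_le3 t_ge1; lra. Qed.
Let C_gt0 : 0 < C.
Proof. by apply: lt_le_trans C_ge; rewrite exprn_gt0 // ltr0n. Qed.

Section FixedN.
Variable N : nat.
Hypothesis N_gt0 : (0 < N)%N.
Let Nr0 : 0 < N%:R :> R. Proof. sgn. Qed.
Let eig : eigenvalues_of (population_cov (T N)) (sigma N).
Proof. by have [_ _ _ _ []] := basic N_gt0. Qed.

Lemma dg_gt0 i : 0 < @dg N i.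
Proof. exact: positive_definite_cov_gt0 (Tpos N_gt0). Qed.

Lemma dg_le i : @dg N i <= t.
Proof.
have [_ _ _ _ [_ h _]] := basic N_gt0.
by have [j] := diag_eigenvalue (Tdiag N_gt0) eig i; rewrite /dg => ->.
Qed.

Lemma cov_diag : population_cov (T N) = diag_mx (\row_i @dg N i).
Proof. exact: diag_mx_diagonal (Tdiag N_gt0). Qed.

Lemma dim_le : (M N + N)%:R <= cn * N%:R.
Proof.
have [[/andP[_ h] _] _ _ _ _] := basic N_gt0.
by move: h; rewrite /Defs.ratio ler_pdivrMr // natrD mulrDl mul1r => h; lra.
Qed.

Lemma S_Ddomain z : S N z -> Ddomain tau N z.
Proof. by have [h _] := Sdom N_gt0; exact: h. Qed.

Lemma dg_gap z i : S N z -> tau <= cabs (1 + (@dg N i)%:C * m N z).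
Proof.
move=> Sz; have [j] := diag_eigenvalue (Tdiag N_gt0) eig i; rewrite /dg => ->.
by rewrite [_%:C * _]mulrC; exact: mgap.
Qed.

Lemma dg_gap0 z i : S N z -> 1 + m N z * (@dg N i)%:C != 0.
Proof.
by move=> Sz; rewrite -cabs_gt0 [m N z * _]mulrC; apply: lt_le_trans (dg_gap i Sz).
Qed.

Lemma S_cabs_le z : S N z -> cabs z <= 2 * t.
Proof.
move=> /S_Ddomain[z1 _ z3 /andP[_ z4]]; have : cabs z <= `|Re z| + `|Im z|.
 rewrite -ler_sqr ?nnegrE ?cabs_ge0 ?addr_ge0 // cabs_sqE sqrrD !real_normK ?num_real //.
 by rewrite lerD2r lerDl mulrn_wge0; sgn.
by rewrite (ger0_norm (ltW z1)); move: z3 z4; lra.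
Qed.

Lemma S_zfacts z : S N z -> zfacts L z.
Proof.
move=> Sz; have [z1 z2 _ _] := S_Ddomain Sz.
have w0 : 0 < cabs (wz z).
 by rewrite cabs_gt0; apply: contraTneq (wz_Im z1) => ->; rewrite ltxx.
have w2 := cabs_wz z.
have zle := S_cabs_le Sz.
have t0 : 0 < t by sgn.
have sq5 : (L : R) ^+ 2 = 25 * (t ^+ 3) ^+ 2 by ring.
have t33 : t <= (t ^+ 3) ^+ 2 by rewrite -exprM -[leLHS]expr1; apply: ler_weXn2l.
split=> //.
 rewrite -ler_sqr ?nnegrE ?cabs_ge0 ?(leT ler01 L_ge1) // w2 sq5; move: zle t33; lra.
rewrite -ler_sqr ?nnegrE ?invr_ge0 ?cabs_ge0 ?(leT ler01 L_ge1) // exprVn w2 sq5.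
have : (cabs z)^-1 <= t by rewrite lef_pV2 ?posrE // (lt_le_trans tau_gt0).
by move: t33 t0; lra.
Qed.

Lemma S_eta z : S N z -> N%:R `^ tau <= N%:R * Im z.
Proof.
move=> Sz; have [z1 _ _ /andP[z4 _]] := S_Ddomain Sz.
rewrite -ler_pdivrMl //; apply: leT z4; rewrite powRDp // powR_inv1; try sgn.
Qed.

Section Level.
Variable n : nat.
Hypothesis gn : disc_good (X N) n.
Notation mu := (disc_model (X N) (@dg N) n).

Let mom : forall p i j, ('E_(P N)[(fun w => `|sqrt N%:R * X N i j w| ^+ p)%R] <= (Cp p)%:E)%E.
Proof. by have [] := basic N_gt0. Qed.

Lemma level_good : good_model (disc_kap Cp) cn t mu.
Proof. exact: (disc_good_model dg_gt0 N_gt0 mom gn dim_le dg_le t_ge1). Qed.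

Lemma level_bip : @bipartite _ mu (@cov_top (M N) N).
Proof. exact: (disc_bipartite dg_gt0 N_gt0 gn). Qed.

Lemma level_row s : \sum_s' @mS _ mu s s' <= cn * t.
Proof. exact: (disc_row_sum dg_gt0 N_gt0 gn dim_le dg_le t_ge1 s). Qed.

Lemma level_fmu x : @fmu _ mu (@cov_top (M N) N) x = master_f N (sigma N) x.
Proof. by rewrite (master_fE N (Tdiag N_gt0) dg_gt0 eig) cov_fmuE. Qed.

Lemma level_mfacts z : S N z -> mfacts L tau (@cov_top (M N) N : pred 'J_mu) (m N) z.
Proof.
move=> Sz; have [z1 z2 z3 /andP[z4 z5]] := S_Ddomain Sz.
have [Imm mE] := msol N_gt0 z1; rewrite -level_fmu in mE.
have gmu := level_good; have [_ dl vb _] := gmu.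
have gap (s : 'I_(M N + N)) : @cov_top (M N) N s -> tau <= cabs (1 + (@mvar _ mu s)%:C * m N z).
 by rewrite /= /cov_top /cov_var; case: (fintype.split s) => // i _; exact: dg_gap.
have t0 : 0 < t by sgn.
have H1 := @m_le _ mu _ cn tau z (m N z) Nr0 dl tau_gt0 Imm mE gap.
have H2 := @mV_le' _ mu _ cn t tau z (m N z) Nr0 vb dl (ltW t0) tau_gt0 mE gap.
have H3 := @Imm_ge _ mu _ t z (m N z) vb Imm mE.
have t2 : 1 <= t ^+ 2 by apply: exprn_ege1; try sgn.
have t23 : t ^+ 2 <= t ^+ 3 by apply: ler_weXn2l.
have [_ w1 w2] := S_zfacts Sz.
have zle := S_cabs_le Sz.
have mle : cabs (m N z) <= L.
 have : tau * cabs (m N z) <= 1 + cn * cn.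
  by apply: leT H1; apply: leMr; try sgn.
 rewrite -ler_pdivlMl //; move=> /leT; apply.
 (* This sum [2 t + 2 t^2 + t^3] is where the constant 5 in [L] comes from. *)
 by rewrite (_ : t * (1 + cn * cn) = 2 * t + 2 * t ^+ 2 + t ^+ 3); [move: t_le3 t23; lra|ring].
have mVle : (cabs (m N z))^-1 <= L.
 apply: (leT H2); rewrite (_ : cn * (t / tau) = t ^+ 2 + t ^+ 3); last by ring.
 by move: zle t_le3 t23; lra.
split=> //.
have m0 : 0 < cabs (m N z) by rewrite cabs_gt0; apply: contraTneq Imm => ->; rewrite ltxx.
have e : Im z = Im z * cabs (m N z) ^+ 2 * (cabs (m N z))^-1 ^+ 2.
 by rewrite -mulrA -exprMn mulfV ?gt_eqF // expr1n mulr1.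
rewrite [in leLHS]e [leRHS]mulrC.
apply: ler_pM => //; [sgn|exact: sqr_ge0|].
by apply: ler_Xn; rewrite ?invr_ge0 ?cabs_ge0 ?(leT ler01 L_ge1).
Qed.

(** [1 < N] makes [ln N] positive, so that [d ln N <= 1] can be read as [d <= 1/ln N]. The measure
    required by stability is the empirical one of the atoms. *)
Lemma level_stable : (1 < N)%N -> const_stable C (@cov_top (M N) N : pred 'J_mu) (m N) (S N).
Proof.
move=> N1 dl l d1 d2 lb z Sz err prev.
have lnN : 0 < ln (N%:R : R) by rewrite ln_gt0 // ltr1n.
have d3 : N%:R ^- 2 <= dl <= (ln N%:R)^-1.
 by rewrite d1 /= -[leRHS]mul1r ler_pdivlMr.
have up1 : 0 < Im (z + Complex 0 (N%:R ^- 5)).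
 have [z1 _ _ _] := S_Ddomain Sz.
 by rewrite ImD /=; sgn.
apply: (stab N_gt0 (delta := fun=> dl) (u := stj l)) => //.
- by move=> z1 z2 _ _; rewrite subrr normr0 mulr_ge0 ?cabs_ge0 ?exprn_ge0.
- exists (emp_measure l N_gt0); split.
  by apply: emp_measureE => [|i]; [exact: measurable_itv|rewrite /= in_itv /= lb].
 by move=> z1 /S_Ddomain [z10 _ _ _]; rewrite stieltjes_emp.
- by rewrite -level_fmu.
Qed.

(** Positive covariance eigenvalues are squares of eigenvalues of [h], which lie below [an]; they
    are thus at most [an^2 <= C]. *)
Lemma level_spectral (om : mOm mu) :
 (forall (sg : R) (v : 'I_(M N + N) -> R), (exists s, v s != 0) ->
  (forall s, \sum_s' mh om s s' * v s' = sg * v s) -> sg < an%:R) ->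
 exists lam : 'I_N -> R, (forall i, 0 <= lam i <= C) /\
  forall z, 0 < Im z -> m1 (mu := mu) (@cov_top (M N) N) (wz z) om = stj lam z.
Proof.
move=> nb; have [lam [l1 l2]] := cov_spectrum dg_gt0 om.
exists lam; split=> // i; have [li0 h] := l2 i; rewrite li0 /=; apply: leT C_ge.
have [li|lp] := leP (lam i) 0; first by apply: (leT li); rewrite exprn_ge0.
have [v [v0 vE]] := h lp; have := nb _ v v0 vE => sl.
by rewrite -(sqr_sqrtr li0); apply: ler_Xn; rewrite ?sqrtr_ge0 //; exact: ltW.
Qed.

End Level.

(** For [tau < 1] the condition on [N] leaves room between 1 and the upper edge [1/tau] of the
    domain. For [tau = 1] every point of the domain has height at least 1, so no such [z] exists. *)
Lemma S_step z : (tau < 1 -> N%:R ^- 5 <= t - 1) -> S N z -> Im z < 1 -> S N (z + Complex 0 (N%:R ^- 5)).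
Proof.
move=> Nbig Sz Iz; have [_ up] := Sdom N_gt0; have [z1 z2 z3 /andP[z4 z5]] := S_Ddomain Sz.
have p0 : 0 < (N%:R ^- 5 : R) by sgn.
have tl1 : tau < 1.
 rewrite lt_neqAle tau_le1 andbT; apply: contraTneq Iz => t1.
 by rewrite -leNgt; apply: leT z4; rewrite t1 addNr powRr0.
have Re : Re (z + Complex 0 (N%:R ^- 5)) = Re z by rewrite ReD /= addr0.
have Im : Im (z + Complex 0 (N%:R ^- 5)) = Im z + N%:R ^- 5 by rewrite ImD.
apply: (up z Sz); split=> //; last by rewrite Im lerDl ltW.
split; rewrite ?Re ?Im //; first sgn.
 apply: (leT z2); rewrite -ler_sqr ?nnegrE ?cabs_ge0 // !cabs_sqE Re Im lerD2l.
 by apply: ler_Xn; rewrite ?addr_ge0 ?(ltW z1) ?(ltW p0) // lerDl ltW.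
apply/andP; split; first by apply: (leT z4); rewrite lerDl ltW.
by have := Nbig tl1; lra.
Qed.

End FixedN.

Variable N0 : nat.
Hypotheses (N0_gt1 : (1 < N0)%N) (N0_big : forall N, (N0 <= N)%N -> tau < 1 -> (N%:R ^- 5 : R) <= t - 1).

(** The mesh is part of the index, so the threshold found for the family does not depend on it and
    the mesh can be sent to 0 for each fixed [N]. *)
Let U := {x : nat * nat | (N0 <= x.1)%N /\ disc_good (X x.1) x.2}.
Let NU (u : U) : nat := (sval u).1.
Let muU (u : U) : model R := disc_model (X (NU u)) (@dg (NU u)) (sval u).2.
Let topU (u : U) : pred 'J_(muU u) := @cov_top (M (NU u)) (NU u).
Arguments topU : clear implicits.
Let NU_ge (u : U) : (N0 <= NU u)%N. Proof. by have [] := svalP u. Qed.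
Let NU_gt1 (u : U) : (1 < NU u)%N. Proof. exact: leq_trans N0_gt1 (NU_ge u). Qed.
Let NU_gt0 (u : U) : (0 < NU u)%N. Proof. exact: ltnW (NU_gt1 u). Qed.
Let NU_good (u : U) : disc_good (X (NU u)) (sval u).2. Proof. by have [] := svalP u. Qed.
Let goodU u : good_model (disc_kap Cp) cn t (muU u).
Proof. exact (level_good (NU_gt0 u) (@NU_good u)). Qed.
Let bipU u : bipartite (topU u).
Proof. exact (level_bip (NU_gt0 u) (@NU_good u)). Qed.
Let specU : whp (@spectral_rep R C U muU topU).
Proof.
have NB := @norm_bound R (disc_kap Cp) cn t (cn * t) an U muU goodU an_gt0
 (fun u => level_row (NU_gt0 u) (@NU_good u)) an_ge.
apply: whp_mono NB => u om nb; exact: (level_spectral (NU_gt0 u) nb).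
Qed.
Let tL : t <= L. Proof. by move: t_le3 t_ge1; lra. Qed.
Let lawU := @law1 R (disc_kap Cp) cn t L tau C U muU topU (fun u => m (NU u)) (fun u => S (NU u))
 goodU bipU tL cn_le L_ge1 tau_gt0 tau_le1 tL C_gt0 (fun u => @S_zfacts _ (NU_gt0 u)) (fun u => @S_eta _ (NU_gt0 u))
 (fun u => @level_mfacts _ (NU_gt0 u) _ (@NU_good u)) (fun u z => @S_step _ (NU_gt0 u) z (N0_big (NU_ge u)))
 (fun u => @level_stable _ (NU_gt0 u) _ (NU_gt1 u)) specU.
Let entryU := @law_entry R (disc_kap Cp) cn t L tau C U muU topU (fun u => m (NU u)) (fun u => S (NU u))
 goodU bipU tL cn_le L_ge1 tau_gt0 tau_le1 tL C_gt0 (fun u => @S_zfacts _ (NU_gt0 u)) (fun u => @S_eta _ (NU_gt0 u))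
 (fun u => @level_mfacts _ (NU_gt0 u) _ (@NU_good u)) (fun u z => @S_step _ (NU_gt0 u) z (N0_big (NU_ge u)))
 (fun u => @level_stable _ (NU_gt0 u) _ (NU_gt1 u)) specU.

Let transfer N (N_gt0 : (0 < N)%N) (xi : 'M[R]_(M N, N) -> R) (c : R) (D : nat) (D' : R) : D' <= D%:R ->
 entrywise_cts xi ->
 (forall n, disc_good (X N) n -> mpr (fun om : mOm (disc_model (X N) (@dg N) n) => c < xi (disc_sample om)) <= N%:R ^- D) ->
 (P N [set w | (c < xi (sample_mx (X N) w))%R] <= (N%:R `^ (- D'))%:E)%E.
Proof.
move=> DD xc H; have [_ ind mv _ _] := basic N_gt0.
have Nr1 : 1 <= N%:R :> R by rewrite ler1n.
apply: (le_mid (N%:R ^- D)%:E); last first.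
 by rewrite lee_fin -powR_mulrn ?ler0n // -powRN ler_powR // lerN2.
exact: (transfer_prob ind N_gt0 (fun i j => (mv i j).1) (fun i j => (mv i j).2) xc H).
Qed.

Lemma averaged_law : averaged_local_law (fun N => population_cov (T N)) X m S.
Proof.
move=> eps D eps0 D0; pose D' := (Num.truncn D).+1.
have DD : D <= D'%:R by apply: ltW; have /andP[_ h] := truncn_itv (ltW D0); exact: h.
have [N1 HN1] := lawU eps0 D'.
exists (maxn N0 N1) => N; rewrite geq_max => /andP[NN0 NN1].
have N_gt0 : (0 < N)%N by apply: leq_trans NN0; exact: ltnW.
apply: ub_ereal_sup => _ [z Sz <-]; have [z0 _ _ _] := S_Ddomain N_gt0 Sz.
rewrite (cov_diag N_gt0).
apply: (transfer N_gt0 (xi := fun A => cabs (m_emp _ A z - m N z)) DD).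
 exact: (m_emp_cts (dg_gt0 N_gt0)).
move=> n gn; pose u : U := exist _ (N, n) (conj NN0 gn).
have h := HN1 (existT (fun u : U => {z | S (NU u) z}) u (exist (S N) z Sz)) NN1.
apply: leT h; apply: mpr_le => om lt1 h; move: lt1; apply/negP; rewrite -leNgt.
have ne0 : 0 < N%:R * Im z by sgn.
rewrite /= -(cov_m1E (dg_gt0 N_gt0) om z0); apply: leT h _.
by rewrite powR_inv1 // ltW.
Qed.

Lemma entrywise_law : entrywise_local_law (fun N => population_cov (T N)) X m S.
Proof.
move=> eps D eps0 D0; pose D' := (Num.truncn D).+1.
have DD : D <= D'%:R by apply: ltW; have /andP[_ h] := truncn_itv (ltW D0); exact: h.
have e20 : 0 < eps / 2 by sgn.
have [N1 HN1] := entryU e20 D'; have [N2 HN2] := powR_ge_ev (L ^+ 2) e20.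
exists (maxn N0 (maxn N1 N2)) => N; rewrite !geq_max => /and3P[NN0 NN1 NN2].
have N_gt0 : (0 < N)%N by apply: leq_trans NN0; exact: ltnW.
have Nr0 : 0 < N%:R :> R by sgn.
apply: ub_ereal_sup => _ [[[z s] s'] /= Sz <-]; have [z0 _ _ _] := S_Ddomain N_gt0 Sz.
rewrite (cov_diag N_gt0).
have gap i := dg_gap0 N_gt0 i Sz.
apply: (transfer N_gt0 (xi := fun A => cabs ((invmx (under_Sigma N _) *m (G_mx _ A z - Pi_mx N _ (m N z)) *m
 invmx (under_Sigma N _)) s s')) DD).
 exact: (@normalized_entry_cts R (M N) N (@dg N) (dg_gt0 N_gt0) z (m N z) s s' z0 gap).
move=> n gn; pose u : U := exist _ (N, n) (conj NN0 gn).
have h := HN1 (existT (fun u : U => {z | S (NU u) z}) u (exist (S N) z Sz)) NN1.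
apply: leT h; apply: mpr_le => om lt1 [h1 h2 h3]; move: lt1; apply/negP; rewrite -leNgt.
have [_ w1 w2] := S_zfacts N_gt0 Sz.
have lh : lin_h (@dg N) (disc_sample om) = mh om.
 exact (lin_h_uniq (mh_sym om) (fun i j => cov_h_tt om i j) (fun i j => cov_h_bb om i j) (fun i j => cov_h_tb om i j)).
apply: (leT (normalized_entry_le (dg_gt0 N_gt0) s s' z0 gap L_ge1 w1 w2
 (q := N%:R `^ (eps / 2) * Psi N (m N) z) _ _ _)).
- by move=> a b ab; rewrite lh mulrCA; exact: h1.
- by move=> a ta; rewrite lh mulrCA; exact: h2.
- by move=> a ta; rewrite lh; exact: h3.
have P0 : 0 <= Psi N (m N) z by rewrite addr_ge0 ?sqrtr_ge0 // invr_ge0 mulr_ge0 ?ler0n // ltW.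
rewrite mulrA [eps in leRHS]splitr powRDp //; apply: leMr => //; apply: leMr; first exact: powR_ge0.
exact: HN2.
Qed.

End Assembly.

(* [C0] makes precise the "large enough constant" of the definition of
   stability: it depends only on [tau] and on the moment bounds [Cp]. *)
Theorem theorem3p22 (R : realType) (tau : R) (Cp : nat -> R) (tau_gt0 : 0 < tau) :
  exists C0 : R, 0 < C0 /\
  forall (M : nat -> nat)
    (T : forall N, 'M[R]_(M N, M N))
    (sigma : forall N, (M N).-tuple R)
    (d : nat -> measure_display) (Omega : forall N, measurableType (d N))
    (P : forall N, probability (Omega N) R)
    (X : forall N, 'I_(M N) -> 'I_N -> {RV (P N) >-> R})
    (m : forall N : nat, R[i] -> R[i])
    (S : forall N : nat, set R[i])
    (C : R),
  (forall N, (0 < N)%N -> basic_assumption tau Cp (T N) (sigma N) (X N)) ->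
  (forall N, (0 < N)%N -> is_diag_mx (population_cov (T N))) ->
  (forall N, (0 < N)%N -> positive_definite (T N)) ->
  (forall N, (0 < N)%N -> solves_master N (sigma N) (m N)) ->
  (forall N, (0 < N)%N -> spectral_domain tau N (S N)) ->
  (forall N, (0 < N)%N -> forall z, S N z -> forall i,
     tau <= cabs (1 + m N z * (tnth (sigma N) i)%:C)) ->
  C0 <= C ->
  (forall N, (0 < N)%N -> stable_on N (sigma N) (m N) (S N) C) ->
  entrywise_local_law (fun N => population_cov (T N)) X m S /\
  averaged_local_law (fun N => population_cov (T N)) X m S.
Proof.
(* Row sums of variances are at most [(1 + 1/tau)/tau]; the factor 32 is the margin asked by the
   estimates at real part [a]. *)
set s0 : R := 32 * ((1 + tau^-1) * tau^-1).
have s00 : 0 <= s0 by rewrite !mulr_ge0 ?addr_ge0 ?invr_ge0 // ltW.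
(* A natural number, because the descent in [Im w] counts [an * N^5] steps. Being at least 1 and at
   least [s0], its square dominates [s0]. *)
pose an := (Num.truncn s0).+1.
have /andP[_ an1] := truncn_itv s00.
have an2 : s0 <= an%:R ^+ 2.
 by apply: (leT (ltW an1)); rewrite expr2 ler_peMr // ler1n.
exists (an%:R ^+ 2); split; first sgn.
move=> M T sigma d Omega P X m S C H1 H2 H3 H4 H5 H6 H7 H8.
(* From this size on, a point of height below 1 stays below [1/tau] after moving up by [N^-5]. *)
have [N0 N01 N0b] : exists2 N0 : nat, (1 < N0)%N & forall N, (N0 <= N)%N -> tau < 1 -> (N%:R ^- 5 : R) <= tau^-1 - 1.
 have [t1|t1] := ltP tau 1; last by exists 2%N => // N _; rewrite ltNge t1.
 have p0 : 0 < tau^-1 - 1 by rewrite subr_gt0 invf_gt1.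
 have [N1 HN1] := @natr_pow_ge R (tau^-1 - 1)^-1 5 isT.
 exists (maxn 2 N1) => [|N]; first by rewrite leq_max.
 rewrite geq_max => /andP[N2 NN] _; have := HN1 N NN.
 by rewrite -[leRHS]invrK lef_pV2 ?posrE ?invr_gt0 // exprn_gt0 // ltr0n ltnW.
split.
 exact: (entrywise_law tau_gt0 (ltn0Sn _) an2 H1 H2 H3 H4 H5 H6 H7 H8 N01 N0b).
exact: (averaged_law tau_gt0 (ltn0Sn _) an2 H1 H2 H3 H4 H5 H6 H7 H8 N01 N0b).
Qed.
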